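(* Let $p$ be an odd prime, $E$ a finite unramified extension of $\mathbb{Q}_p$, $n\ge 1$ an integer, and $F=E(\zeta_{p^n})$ with $\zeta_{p^n}$ a primitive $p^n$th root of unity. Let $r$ be an integer with $r\not\equiv 0,1 \pmod{p-1}$, and let $t$ be the smallest positive integer with $t\equiv 2-r \pmod{p-1}$. Let $x\in F^r$ with $x\notin F^{\times p}$. Then $f_i(x)=p^{i-1}t$ for every integer $i$ with $1\le i\le n$.
   Context: Let $U_0$ be the unit group of $F$ and $U_j=1+\mathfrak{m}_F^j$ ($j\ge 1$) its higher unit groups. Let $G_E$ be the absolute Galois group of $E$ and $\chi:G_E\to(\mathbb{Z}/p^n\mathbb{Z})^\times$ the cyclotomic character, $\sigma(\zeta_{p^n})=\zeta_{p^n}^{\chi(\sigma)}$. For $r\in\mathbb{Z}$, $F^r=\{x\in F^\times:\ \sigma(x)x^{-\chi(\sigma)^r}\in F^{\times p^n}\text{ for all }\sigma\in G_E\}$. For $1\le m\le n$ let $(\cdot,\cdot)_{m,F}$ be the $p^m$th Hilbert norm residue symbol of $F$; for $a\in F^\times$, $f_m(a)$ denotes the conductor of $F(a^{1/p^m})/F$, i.e. the smallest integer $f\ge 0$ such that $(a,u)_{m,F}=1$ for all $u\in U_f$. *)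

(* Defs.v *)
From HB Require Import structures.
From mathcomp Require Export all_boot all_order all_algebra.
From mathcomp Require Export classical_sets.

Set Implicit Arguments.
Unset Strict Implicit.
Unset Printing Implicit Defensive.

Export Order.TTheory GRing.Theory Num.Theory.
Global Open Scope classical_set_scope.
Global Open Scope ring_scope.

Definition rat_padic_abs (p : nat) (q : rat) : rat :=
  if q == 0 then 0
  else p%:R ^ ((logn p `|denq q|%N)%:Z - (logn p `|numq q|%N)%:Z).

(* A completion of the rationals for the p-adic absolute value; this determines
   the field Q_p up to a unique isometric isomorphism.  The absolute value of
   Q_p takes its values in {0} and the integral powers of p, so it can be taken
   to be rat-valued. *)
Record padicField (p : nat) : Type := PadicField {
  padic_sort :> fieldType;
  padic_abs : padic_sort -> rat;
  padic_abs_ge0 : forall x, 0 <= padic_abs x;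
  padic_abs_eq0 : forall x, padic_abs x = 0 <-> x = 0;
  padic_absM : forall x y, padic_abs (x * y) = padic_abs x * padic_abs y;
  padic_absD : forall x y,
    padic_abs (x + y) <= Num.max (padic_abs x) (padic_abs y);
  padic_abs_rat : forall q : rat, padic_abs (ratr q) = rat_padic_abs p q;
  padic_dense : forall x (eps : rat), 0 < eps ->
    exists q : rat, padic_abs (x - ratr q) < eps;
  padic_complete : forall u : nat -> padic_sort,
    (forall eps : rat, 0 < eps -> exists N : nat, forall i j : nat,
       (N <= i)%N -> (N <= j)%N -> padic_abs (u i - u j) < eps) ->
    exists l : padic_sort, forall eps : rat, 0 < eps ->
      exists N : nat, forall i : nat, (N <= i)%N -> padic_abs (u i - l) < eps
}.

Section LocalFields.

(* C is meant to be an algebraic closure of Q_p, through iota; all fields below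
   are subfields of C containing Q_p, given by their sets of elements. *)
Variables (p : nat) (Qp : padicField p) (C : closedFieldType).
Variable iota : {rmorphism Qp -> C}.

Implicit Types (K L : set C) (x y a b z pi : C) (g h : {rmorphism C -> C}).

Definition Zp : {pred Qp} := [pred c | padic_abs c <= 1].

Definition integral x : Prop :=
  exists f : {poly Qp},
    [/\ f \is monic, f \is a polyOver Zp & root (map_poly iota f) x].

Definition subfield K : Prop :=
  [/\ range iota `<=` K,
      forall x y, K x -> K y -> K (x - y),
      forall x y, K x -> K y -> K (x * y)
    & forall x, K x -> K x^-1].

Definition adjoin K x : set C :=
  [set y | forall M : set C, subfield M -> K `<=` M -> M x -> M y].

Definition is_basis K L (d : nat) (e : 'rV[C]_d) : Prop :=
  (forall i, L (e 0 i)) /\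
  (forall y, L y -> exists! c : 'cV[C]_d,
     (forall i, K (c i 0)) /\ (e *m c) 0 0 = y).

Definition finite_extension K L : Prop :=
  [/\ subfield K, subfield L, K `<=` L
    & exists (d : nat) (e : 'rV[C]_d), is_basis K L e].

(* z = N_{L/K}(y), the determinant of multiplication by y on L over K *)
Definition is_norm K L y z : Prop :=
  exists (d : nat) (e : 'rV[C]_d) (M : 'M[C]_d),
    [/\ is_basis K L e, forall i j, K (M i j), e *m M = y *: e & z = \det M].

Definition integers K : set C := [set x | K x /\ integral x].

Definition units K : set C :=
  [set x | integers K x /\ exists2 y, integers K y & x * y = 1].

Definition max_ideal K : set C := [set x | integers K x /\ ~ units K x].

Fixpoint max_ideal_power K (j : nat) : set C :=
  if j is j'.+1 then
    [set x | exists2 s : seq (C * C),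
       forall ab, ab \in s -> max_ideal K ab.1 /\ max_ideal_power K j' ab.2
       & x = \sum_(ab <- s) ab.1 * ab.2]
  else integers K.

Definition higher_units K (j : nat) : set C :=
  if j is 0 then units K else [set u | max_ideal_power K j (u - 1)].

Definition prime_element K pi : Prop :=
  max_ideal K pi /\
  forall x, max_ideal K x -> exists2 y, integers K y & x = pi * y.

(* Ramification index 1; the residue fields considered are finite, so that the
   residue extension is automatically separable. *)
Definition unramified K L : Prop :=
  finite_extension K L /\ exists2 pi, prime_element K pi & prime_element L pi.

Definition max_unramified K : set C :=
  [set x | exists2 M : set C, unramified K M & M x].

Definition residue_field_card K (q : nat) : Prop :=
  exists2 s : q.-tuple C,
    forall i, integers K (tnth s i)
    & forall x, integers K x -> exists! i : 'I_q, max_ideal K (x - tnth s i).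

(* g belongs to the absolute Galois group of K *)
Definition in_galois K g : Prop :=
  bijective g /\ forall x, K x -> g x = x.

(* On the maximal unramified extension of K, g is the d-th power of the
   (arithmetic) Frobenius automorphism over K. *)
Definition frobenius_degree K (d : nat) g : Prop :=
  exists2 q : nat, residue_field_card K q
    & forall x, integers (max_unramified K) x ->
        max_ideal (max_unramified K) (g x - x ^+ (q ^ d)%N).

(* (b, L/K) = g|_L, for L/K finite abelian: the local norm residue symbol, in
   the form of Neukirch's construction of the reciprocity map.  A lift h of
   g|_L to the maximal unramified extension L~ of L is chosen whose degree over
   K is a positive integer; S is its fixed field in L~, a finite extension
   of K, and the reciprocity map sends g|_L to the class modulo N_{L/K}(L^* ) of
   N_{S/K}(pi), with pi a prime element of S.  The automorphism h of L~ is
   represented by one of its extensions to C. *)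
Definition norm_residue_symbol K L b g : Prop :=
  exists (h : {rmorphism C -> C}) (d : nat),
    [/\ in_galois K h, forall y, L y -> h y = g y,
        (0 < d)%N, frobenius_degree K d h
      & let S := [set y | max_unramified L y /\ h y = y] in
        exists pi y Npi Ny : C,
          [/\ prime_element S pi, is_norm K S pi Npi,
              L y /\ y != 0, is_norm K L y Ny
            & b = Npi * Ny]].

(* (a, b)_{m,K} = z: the p^m-th Hilbert symbol of a field K containing the p^m-th
   roots of unity, z = (b, K(alpha)/K)(alpha) / alpha with alpha^(p^m) = a. *)
Definition hilbert_symbol (m : nat) K a b z : Prop :=
  exists alpha (g : {rmorphism C -> C}),
    [/\ alpha ^+ (p ^ m)%N = a, in_galois K g,
        norm_residue_symbol K (adjoin K alpha) b g
      & g alpha = z * alpha].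

(* f_m(a) = f *)
Definition is_conductor (m : nat) K a (f : nat) : Prop :=
  (forall u, higher_units K f u -> hilbert_symbol m K a u 1) /\
  (forall f' : nat,
     (forall u, higher_units K f' u -> hilbert_symbol m K a u 1) ->
     (f <= f')%N).

(* K^{* N}, the N-th powers of nonzero elements of K *)
Definition unit_powers K (N : nat) : set C :=
  [set z | exists2 y, K y /\ y != 0 & z = y ^+ N].

(* chi(g), the unique u with g zeta = zeta ^+ u when zeta is a primitive p^n-th
   root of unity; n is positive wherever this is used, so that 'Z_(p ^ n) is
   the ring of integers modulo p^n. *)
Definition cyclotomic_character (n : nat) (zeta : C) g : 'Z_(p ^ n) :=
  odflt 1 [pick u : 'Z_(p ^ n) | g zeta == zeta ^+ (u : nat)].

(* F^r; here chi(g) ^ r is an integral power in 'Z_(p ^ n), of which the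
   standard representative is used as exponent of x. *)
Definition twisted_eigenspace (n : nat) (zeta : C) (E F : set C) (r : int) :
    set C :=
  [set x | [/\ F x, x != 0
    & forall g, in_galois E g ->
        unit_powers F (p ^ n)
          (g x * x ^- (cyclotomic_character n zeta g ^ r)%R)]].

End LocalFields.

(* Main.v *)
From HB Require Import structures.
Require Import Defs.
From mathcomp Require Import boolp separable cyclic cyclotomic finfield.
From mathcomp Require Import zify ring lra.

Set Implicit Arguments.
Unset Strict Implicit.
Unset Printing Implicit Defensive.

(** Let [alpha^(p^i) = x], [L = F(alpha)] and [q = p^i].  The eigenspace condition
and [r <> 1] mod [p - 1] make [L/F] totally ramified of degree [q], with generator
[tau].  Choosing the Frobenius [phi] over [L] as the lift in Neukirch's definition
shows that the symbol of [u] is trivial iff [u] is a norm from [L].  For a unit [u]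
of [F] one solves [N w = u] in [L^ur] and [phi w / w = tau y / y] (Hilbert 90); the
valuation of [y] modulo [q] is a homomorphism [X] on the units of [F], surjective
modulo [p], whose kernel consists of the norms, and [X (sigma u) = c X u] where
[c chi(sigma)^r = chi(sigma)].

It remains to find the exact level of the unit filtration [U_j] at which [X] modulo
[p^k] dies.  By induction on [k], this level is [p^(k-1) t].  On [U_j / U_(j+1)] the
Galois group acts through [chi^j], so [X] can only change at [j = t - 1] mod
[p - 1].  If [sigma = gamma] has [chi = 1 + p], then [c = 1] mod [p], hence
[gamma w / w] and [w^p] have [X] divisible by [p^k] as soon as [X w] is divisible
by [p^(k-1)]; such quotients fill every level [j <> -1] mod [p], and for
[j = p i0 + p - 1] one uses [gamma w / (w v^p)] with [w = 1 + b^p l^s],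
[v = 1 + b l^i0], [s = p i0 - (p - 1)] and [l] the logarithm of [zeta] truncated at
degree [p - 1].  In the other direction, a [p]-th power of a unit on which [X]
modulo [p^(k-1)] does not vanish would be killed if the level were smaller. *)

(** * The p-adic numbers and Weierstrass preparation *)

(** [C] is not complete, and no limit is taken in it. Completeness of [Qp] enters once, through
    Weierstrass preparation, to make the integral elements of [C] a valuation ring; valuations are
    then replaced by divisibility. What would need a limit is proved up to a high power of a
    uniformizer and made exact afterwards: either because a unit very close to [1] is a [p^i]-th
    power, hence the norm of an element of the base, or because an element congruent to its
    conjugates to every order is fixed.

    The number [t] comes from [c = chi(sigma)^(1 - r)] modulo [p]: this agrees with [chi(sigma)^j]
    when [j = 1 - r = t - 1] modulo [p - 1], and excluding [r = 0, 1] gives [t > 2]. The obstacle at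
    [j = -1] mod [p] is that the leading coefficient of [gamma w / w], for [w] of level
    [m = j - (p - 1)], acquires the factor [m], which [p] then divides. The remedy starts another
    [p - 1] levels lower and lets a [p]-th power cancel the first term of [gamma w / w]. The
    logarithm serves because [gamma] moves it only by [pi^p - pi^(2p-1)], up to order [2p]. *)

Section PadicNumbers.
Variables (p : nat) (Qp : padicField p).
Hypothesis p_prime : prime p.
Local Notation abs := (@padic_abs p Qp).

Let pr_gt0 : 0 < (p%:R : rat).
Proof. by rewrite ltr0n prime_gt0. Qed.

Let pr_gt1 : 1 < (p%:R : rat).
Proof. by rewrite ltr1n prime_gt1. Qed.

Lemma padic_abs0 : abs 0 = 0.
Proof. by apply/padic_abs_eq0. Qed.

Lemma padic_abs_neq0 x : x != 0 -> abs x != 0.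
Proof. by move=> nx; apply/eqP=> /padic_abs_eq0 e; rewrite e eqxx in nx. Qed.

Lemma padic_abs1 : abs 1 = 1.
Proof.
have n1 := padic_abs_neq0 (oner_neq0 Qp).
by apply: (mulfI n1); rewrite -padic_absM !mulr1.
Qed.

Lemma padic_absN x : abs (- x) = abs x.
Proof.
have e : abs (-1) = 1.
  apply: (@pexpIrn _ 2) => //; rewrite ?nnegrE ?padic_abs_ge0 ?ler01 //.
  by rewrite expr2 -padic_absM mulrNN mulr1 padic_abs1 expr1n.
by rewrite -mulN1r padic_absM e mul1r.
Qed.

Lemma padic_absV x : abs x^-1 = (abs x)^-1.
Proof.
have [->|nx] := eqVneq x 0; first by rewrite invr0 padic_abs0 invr0.
apply: (mulfI (padic_abs_neq0 nx)).
by rewrite -padic_absM mulfV // padic_abs1 mulfV // padic_abs_neq0.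
Qed.

Lemma padic_absX x n : abs (x ^+ n) = abs x ^+ n.
Proof.
by elim: n => [|n IH]; rewrite ?expr0 ?padic_abs1 // !exprS padic_absM IH.
Qed.

Lemma padic_absD_le x y e : abs x <= e -> abs y <= e -> abs (x + y) <= e.
Proof.
by move=> hx hy; apply: le_trans (padic_absD x y) _; rewrite ge_max hx.
Qed.

Lemma padic_absD_lt x y e : abs x < e -> abs y < e -> abs (x + y) < e.
Proof.
by move=> hx hy; apply: le_lt_trans (padic_absD x y) _; rewrite gt_max hx.
Qed.

Lemma padic_abs_eq x y : abs (x - y) < abs x -> abs y = abs x.
Proof.
move=> h; apply/eqP; rewrite eq_le; apply/andP; split.
  have {1}-> : y = x + - (x - y) by ring.
  by apply: padic_absD_le => //; rewrite padic_absN ltW.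
rewrite leNgt; apply/negP => hy.
have : abs x < abs x.
  rewrite {1}(_ : x = (x - y) + y); last by ring.
  exact: padic_absD_lt.
by rewrite ltxx.
Qed.

Lemma padic_abs_nat n : abs n%:R = if n == 0%N then 0 else p%:R ^- logn p n.
Proof.
rewrite -(ratr_nat Qp n) padic_abs_rat /rat_padic_abs pnatr_eq0; case: eqP => // _.
rewrite (_ : (n%:R : rat) = (n%:Z)%:~R) // numq_int denq_int /=.
by rewrite logn1 sub0r -invr_expz.
Qed.

Lemma padic_absp : abs p%:R = p%:R^-1.
Proof.
rewrite padic_abs_nat logn_prime // eqxx expr1.
by case: eqP p_prime => // ->.
Qed.

Lemma padic_nat_neq0 n : (0 < n)%N -> (n%:R : Qp) != 0.
Proof.
move=> n0; apply/eqP => e; have := padic_abs_nat n.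
rewrite e padic_abs0 -[n == 0%N]negbK -lt0n n0 /= => /esym/eqP.
by rewrite invr_eq0 expf_eq0 (gt_eqF pr_gt0) andbF.
Qed.

(** A rational number closer to [x] than [abs x] has the same absolute value, and on rationals the
    value group is explicit. *)
Lemma padic_abs_exprz x : x != 0 -> exists k : int, abs x = p%:R ^ k.
Proof.
move=> nx; have hx : 0 < abs x by rewrite lt_def padic_abs_neq0 // padic_abs_ge0.
have [q hq] := padic_dense x hx.
have := padic_abs_eq hq; rewrite padic_abs_rat /rat_padic_abs.
case: eqP => [_ e|_ <-]; last by eexists.
by rewrite -e ltxx in hx.
Qed.

Definition padic_le (k : nat) (x : Qp) := abs x <= p%:R ^- k.

Lemma padic_lt1 x : abs x < 1 -> padic_le 1 x.
Proof.
rewrite /padic_le expr1.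
have [->|nx] := eqVneq x 0; first by rewrite padic_abs0 invr_ge0 ltW.
have [k ->] := padic_abs_exprz nx; move=> h.
have : k < 0.
  by rewrite -(ltr_eXz2l pr_gt1) expr0z.
by move=> k0; rewrite -exprN1 ler_eXz2l //; lia.
Qed.

Lemma padic_leD k x y : padic_le k x -> padic_le k y -> padic_le k (x + y).
Proof. exact: padic_absD_le. Qed.

Lemma padic_leN k x : padic_le k x -> padic_le k (- x).
Proof. by rewrite /padic_le padic_absN. Qed.

Lemma padic_leB k x y : padic_le k x -> padic_le k y -> padic_le k (x - y).
Proof. by move=> hx hy; apply: padic_leD (padic_leN _). Qed.

Lemma padic_le_0 k : padic_le k 0.
Proof. by rewrite /padic_le padic_abs0 invr_ge0 exprn_ge0 // ltW. Qed.

Lemma padic_leM k l x y : padic_le k x -> padic_le l y -> padic_le (k + l) (x * y).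
Proof.
move=> hx hy; rewrite /padic_le padic_absM exprD invfM.
by apply: ler_pM; rewrite ?padic_abs_ge0.
Qed.

Lemma padic_leW k l x : (l <= k)%N -> padic_le k x -> padic_le l x.
Proof.
move=> lk h; apply: le_trans h _; rewrite lef_pV2 ?posrE ?exprn_gt0 //.
by rewrite ler_weXn2l // ltW.
Qed.

Lemma padic_le_eq0 x : (forall k, padic_le k x) -> x = 0.
Proof.
move=> h; apply/eqP/negPn/negP => nx.
have [z hz] := padic_abs_exprz nx.
have := h (`|z|.+1)%N; rewrite /padic_le hz exprnN ler_eXz2l //; lia.
Qed.

Lemma padic_le_sum (I : Type) (r : seq I) (P : pred I) (F : I -> Qp) k :
  (forall i, P i -> padic_le k (F i)) -> padic_le k (\sum_(i <- r | P i) F i).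
Proof.
move=> h; apply: (big_ind (padic_le k)) => //; first exact: padic_le_0.
exact: padic_leD.
Qed.

Lemma padic_abs_int_dvd (z : int) : (p %| z)%Z -> abs z%:~R < 1.
Proof.
move=> /dvdzP[w ->]; rewrite rmorphM padic_absM.
rewrite /= -pmulrn padic_absp.
have h : abs w%:~R <= 1.
  have hn (m : nat) : abs m%:R <= 1.
    rewrite padic_abs_nat; case: eqP => // _.
    by rewrite invf_le1 ?exprn_gt0 // exprn_ege1 // ltW.
  by case: w => m; rewrite ?NegzE ?rmorphN ?padic_absN; apply: hn.
have := invf_lt1 pr_gt0; rewrite pr_gt1 => h1.
by apply: le_lt_trans h1; rewrite ler_piMl // invr_ge0 ltW.
Qed.

(** By density [x] may be replaced by a rational of absolute value at most [1]; its denominator is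
    then prime to [p], and a Bezout relation inverts it modulo [p]. *)
Lemma padic_residue x : x \in @Zp p Qp -> exists k : nat, abs (x - k%:R) < 1.
Proof.
rewrite inE => hx; have [q hq] := padic_dense x ltr01.
set y := ratr q : Qp in hq *.
have hy : abs y <= 1.
  rewrite (_ : y = x + - (x - y)); last by ring.
  by apply: padic_absD_le => //; rewrite padic_absN ltW.
suff [k hk] : exists k : nat, abs (y - k%:R) < 1.
  by exists k; rewrite (_ : x - k%:R = (x - y) + (y - k%:R)); [apply: padic_absD_lt|ring].
have [q0|q0] := eqVneq q 0.
  by exists 0%N; rewrite /y q0 (ratr_nat Qp 0) subrr padic_abs0.
have pd : ~~ (p %| `|denq q|)%N.
  apply/negP => pd; move: hy; rewrite /y padic_abs_rat /rat_padic_abs (negPf q0).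
  have pn : ~~ (p %| `|numq q|)%N.
    apply/negP => pn; have := coprime_num_den q; rewrite /coprime => /eqP e.
    by have := dvdn_gcd p `|numq q| `|denq q|; rewrite pd pn e dvdn1 gtn_eqF // prime_gt1.
  have l0 : logn p `|numq q|%N = 0%N.
    by apply/eqP; rewrite -leqn0 leqNgt logn_gt0 mem_primes (negPf pn) !andbF.
  have l1 : (0 < logn p `|denq q|)%N.
    by rewrite logn_gt0 mem_primes p_prime pd absz_gt0 denq_neq0.
  rewrite l0 subr0 -(expr0z (p%:R : rat)) ler_eXz2l //; lia.
have absd : abs (denq q)%:~R = 1.
  rewrite -[denq q]gez0_abs ?denq_ge0 // -pmulrn padic_abs_nat.
  by rewrite absz_eq0 (negPf (denq_neq0 q)) lognE (negPf pd) !andbF expr0 invr1.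
have eqy : y * (denq q)%:~R = (numq q)%:~R.
  rewrite /y /ratr divfK //.
  by apply/eqP => e; move: absd; rewrite e padic_abs0.
have [u [v e]] := Bezoutz p (denq q).
have e1 : gcdz p (denq q) = 1.
  by rewrite /gcdz; congr Posz; apply/eqP; rewrite -/(coprime _ _) prime_coprime.
rewrite e1 in e.
exists `|((v * numq q) %% p)%Z|%N.
suff h : abs ((y - (`|((v * numq q) %% p)%Z|%N)%:R) * (denq q)%:~R) < 1.
  by move: h; rewrite padic_absM absd mulr1.
rewrite mulrBl eqy pmulrn gez0_abs; last first.
  by apply: modz_ge0; have := prime_gt0 p_prime; lia.
rewrite -rmorphM -rmorphB /=; apply: padic_abs_int_dvd.
rewrite -eqz_mod_dvd -modzMml modz_mod modzMml eqz_mod_dvd.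
apply/dvdzP; exists (u * numq q).
by rewrite -[X in X - _ = _]mul1r -e; ring.
Qed.

Lemma padic_fermat x : x \in @Zp p Qp -> abs (x ^+ p - x) < 1.
Proof.
move=> hx; have [k hk] := padic_residue hx; move: hx; rewrite inE => hx.
have hkk : abs (k%:R ^+ p - k%:R) < 1.
  have -> : k%:R ^+ p - k%:R = ((k ^ p)%N%:Z - k%:Z)%:~R :> Qp.
    by rewrite rmorphB /= -!pmulrn natrX.
  apply: padic_abs_int_dvd; rewrite -eqz_mod_dvd; apply/eqP.
  by rewrite !modz_nat fermat_little.
have hy : abs k%:R <= 1.
  rewrite (_ : k%:R = x + - (x - k%:R)); last by ring.
  by apply: padic_absD_le => //; rewrite padic_absN ltW.
rewrite (_ : x ^+ p - x = (x ^+ p - k%:R ^+ p) + (k%:R ^+ p - k%:R) - (x - k%:R)); last by ring.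
apply: padic_absD_lt; last by rewrite padic_absN.
apply: padic_absD_lt => //; rewrite subrXX padic_absM.
apply: le_lt_trans hk; rewrite ler_piMr ?padic_abs_ge0 //.
apply: (big_ind (fun z => abs z <= 1)); rewrite ?padic_abs0 ?ler01 //.
  by move=> *; apply: padic_absD_le.
move=> i _; rewrite padic_absM !padic_absX.
by rewrite mulr_ile1 ?exprn_ge0 ?padic_abs_ge0 ?exprn_ile1 ?padic_abs_ge0.
Qed.

Definition pol_le k (f : {poly Qp}) := forall i, padic_le k f`_i.

Lemma pol_leD k f g : pol_le k f -> pol_le k g -> pol_le k (f + g).
Proof. by move=> hf hg i; rewrite coefD; apply: padic_leD. Qed.

Lemma pol_leN k f : pol_le k f -> pol_le k (- f).
Proof. by move=> hf i; rewrite coefN; apply: padic_leN. Qed.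

Lemma pol_leB k f g : pol_le k f -> pol_le k g -> pol_le k (f - g).
Proof. by move=> hf hg; apply: pol_leD => //; apply: pol_leN. Qed.

Lemma pol_leM k l f g : pol_le k f -> pol_le l g -> pol_le (k + l) (f * g).
Proof.
by move=> hf hg i; rewrite coefM; apply: padic_le_sum => j _; apply: padic_leM.
Qed.

Lemma pol_leC k c : padic_le k c -> pol_le k c%:P.
Proof. by move=> hc i; rewrite coefC; case: eqP => // _; apply: padic_le_0. Qed.

Lemma pol_leW k l f : (l <= k)%N -> pol_le k f -> pol_le l f.
Proof. by move=> h hf i; apply: padic_leW (hf i). Qed.

(** Euclidean division by a monic polynomial divides no coefficient, so it preserves a common bound
    on the coefficients. *)
Lemma pol_le_edivp k f g : g \is monic -> pol_le 0 g -> pol_le k f ->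
  pol_le k (f %/ g) /\ pol_le k (f %% g).
Proof.
move=> mg hg hf.
suff [q [r [e sr hq hr]]] : exists q r, [/\ f = q * g + r, (size r < size g)%N,
    pol_le k q & pol_le k r].
  by rewrite -(divpP e sr) -(modpP e sr).
have g0 := monic_neq0 mg.
have [m hm] := ubnP (size f); elim: m => // m IH in f hf hm *.
have [sf|sf] := ltnP (size f) (size g).
  exists 0, f; split=> //; first by rewrite mul0r add0r.
  by move=> i; rewrite coef0; apply: padic_le_0.
have f0 : f != 0.
  by apply/eqP => f0; rewrite f0 size_poly0 leqn0 size_poly_eq0 (negPf g0) in sf.
pose s := (lead_coef f)%:P * 'X^(size f - size g).
have hs : pol_le k s.
  move=> i; rewrite coefCM coefXn; case: eqP => _; rewrite ?mulr1 ?mulr0.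
    exact: hf.
  exact: padic_le_0.
have [||q [r [e sr hq hr]]] := IH (f - s * g).
- by apply: pol_leB => //; rewrite -[k]addn0; apply: pol_leM.
- rewrite -ltnS; apply: leq_trans hm; rewrite ltnS.
  have szf : size (s * g) = size f.
    have s0 : s != 0 by rewrite mulf_neq0 ?polyC_eq0 ?lead_coef_eq0 // monic_neq0 // monicXn.
    rewrite size_Mmonic // /s.
    rewrite size_Cmul ?lead_coef_eq0 // size_polyXn.
    by have := size_poly_gt0 g; rewrite g0 => g1; lia.
  have lt : size (f - s * g) != size f.
    apply/eqP => e.
    have : lead_coef (f - s * g) = 0.
      rewrite lead_coefE e coefB -lead_coefE -[in X in _ - X]szf -lead_coefE lead_coefM.
      rewrite (monicP mg) mulr1 /s lead_coefM lead_coefC lead_coefXn mulr1.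
      by rewrite subrr.
    by move/eqP; rewrite lead_coef_eq0 -size_poly_eq0 e size_poly_eq0 (negPf f0).
  by rewrite ltn_neqAle lt (leq_trans (size_polyD _ _)) // size_polyN szf maxnn.
exists (q + s), r; split=> //; last exact: pol_leD.
by rewrite mulrDl addrAC -e subrK.
Qed.

Lemma padic_cvg (u : nat -> Qp) : (forall k, padic_le k (u k.+1 - u k)) ->
  exists l, forall k, padic_le k (l - u k).
Proof.
move=> hu.
have hd k j : padic_le k (u (k + j)%N - u k).
  elim: j => [|j IH]; first by rewrite addn0 subrr; apply: padic_le_0.
  rewrite addnS (_ : u (k + j).+1 - u k = (u (k + j).+1 - u (k + j)%N) + (u (k + j)%N - u k)); last by ring.
  by apply: padic_leD => //; apply: padic_leW (hu _); apply: leq_addr.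
have sm (eps : rat) : 0 < eps -> exists k, p%:R ^- k < eps.
  move=> e0; exists (Num.bound eps^-1)%N.
  rewrite -[X in _ < X]invrK ltf_pV2 ?posrE ?invr_gt0 ?exprn_gt0 //.
  have ab := archi_boundP (ltW (_ : 0 < eps^-1)); rewrite invr_gt0 in ab.
  apply: lt_le_trans (ab e0) _.
  rewrite -natrX ler_nat; by apply: ltnW; rewrite ltn_expl // prime_gt1.
have [|l hl] := @padic_complete p Qp u.
  move=> eps /sm [k hk]; exists k => i j ki kj.
  apply: le_lt_trans hk; rewrite -[abs _ <= _]/(padic_le k _).
  rewrite -(subnKC ki) -(subnKC kj).
  rewrite (_ : _ - _ = (u (k + (i - k))%N - u k) - (u (k + (j - k))%N - u k)); last by ring.
  exact: padic_leB.
exists l => k.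
have [|N hN] := hl (p%:R ^- k); first by rewrite invr_gt0 exprn_gt0.
rewrite (_ : l - u k = (u (k + N)%N - u k) - (u (k + N)%N - l)); last by ring.
by apply: padic_leB => //; apply: ltW; apply: hN; apply: leq_addl.
Qed.

(* Weierstrass preparation: Newton's iteration [g := g + (f mod g) / f_m]
   improves the divisibility of [f mod g] by a factor [p] at each step. *)
Lemma weierstrass_factor (f : {poly Qp}) m :
  pol_le 0 f -> abs f`_m = 1 -> (forall i, (m < i)%N -> padic_le 1 f`_i) ->
  exists g, [/\ g \is monic, size g = m.+1 & g %| f].
Proof.
move=> hf fm hi.
have fm0 : f`_m != 0 by apply/eqP => e; rewrite e padic_abs0 in fm.
have hm : padic_le 0 f`_m by apply: hf.
have hmV : padic_le 0 (f`_m)^-1 by rewrite /padic_le padic_absV fm expr0 invr1.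
pose good k (g : {poly Qp}) := [/\ g \is monic, size g = m.+1, pol_le 0 g,
  pol_le 1 (f - f`_m *: g) & pol_le k.+1 (f %% g)].
pose next (g : {poly Qp}) := g + (f`_m)^-1%:P * (f %% g).
pose g0 := (f`_m)^-1 *: \poly_(i < m.+1) f`_i.
have sg0 : size (\poly_(i < m.+1) f`_i) = m.+1 by apply: size_poly_eq.
have good0 : good 0%N g0.
  have mo : g0 \is monic.
    by rewrite monicE /g0 lead_coefZ lead_coefE sg0 coef_poly ltnSn mulVf.
  have h0 : pol_le 0 g0.
    move=> i; rewrite coefZ coef_poly; case: ifP => _; rewrite ?mulr0; last exact: padic_le_0.
    by rewrite -[0%N]addn0; apply: padic_leM.
  have h1 : pol_le 1 (f - f`_m *: g0).
    move=> i; rewrite /g0 scalerA divff // scale1r coefB coef_poly.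
    case: ltnP => him; first by rewrite subrr; apply: padic_le_0.
    by rewrite subr0; apply: hi.
  split=> //; first by rewrite size_scale ?invr_eq0.
  have -> : f %% g0 = (f - f`_m *: g0) %% g0.
    by rewrite modpD modpN modpZl modpp scaler0 subr0.
  by have [] := pol_le_edivp mo h0 h1.
have step k g : good k g -> good k.+1 (next g) /\ pol_le k.+1 (next g - g).
  case=> mo sg h0 h1 hr.
  have sr : (size ((f`_m)^-1%:P * (f %% g) : {poly Qp})%R < size g)%N.
    by rewrite size_Cmul ?invr_eq0 // ltn_modp monic_neq0.
  have hd : pol_le k.+1 ((f`_m)^-1%:P * (f %% g)).
    by rewrite -[k.+1]add0n; apply: pol_leM => //; apply: pol_leC.
  split; last by rewrite /next addrC addKr.
  have mo' : next g \is monic by rewrite monicE /next lead_coefDl // -monicE.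
  have h0' : pol_le 0 (next g) by apply: pol_leD => //; apply: pol_leW hd.
  have h1' : pol_le 1 (f - f`_m *: next g).
    rewrite /next scalerDr opprD addrA; apply: pol_leD => //; apply: pol_leN.
    rewrite -mul_polyC -[1%N]add0n; apply: pol_leM; first exact: pol_leC.
    by apply: pol_leW hd.
  split=> //; first by rewrite /next size_polyDl.
  pose q := f %/ g.
  (* The quotient reduces to the constant [f_m] modulo [p]; the difference multiplies the old
     remainder, already divisible by [p^(k+1)], by one more factor [p]. *)
  have hq : pol_le 1 ((f`_m)%:P - q).
    have -> : (f`_m)%:P - q = - ((f - f`_m *: g) %/ g).
      rewrite divpD divpN divpZl divpp ?monic_neq0 //.
      by rewrite opprD opprK addrC -alg_polyC.
    by apply: pol_leN; have [] := pol_le_edivp mo h0 h1.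
  have -> : f %% next g = (((f`_m)%:P - q) * ((f`_m)^-1%:P * (f %% g))) %% next g.
    have ef : f = q * next g + ((f`_m)%:P - q) * ((f`_m)^-1%:P * (f %% g)).
      rewrite {1}(divp_eq f g) /next -/q.
      have e1 : (f`_m)%:P * (f`_m)^-1%:P = 1 :> {poly Qp} by rewrite -polyCM divff.
      rewrite mulrBl (mulrA (f`_m)%:P) e1; ring.
    by rewrite {1}ef modpD modp_mull add0r.
  have hh : pol_le k.+2 (((f`_m)%:P - q) * ((f`_m)^-1%:P * (f %% g))).
    by rewrite -[k.+2]add1n; apply: pol_leM.
  by have [] := pol_le_edivp mo' h0' hh.
pose g_ k := iter k next g0.
have hg k : good k (g_ k) by elim: k => [|k IH] //=; have [] := step _ _ IH.
have hgd k : pol_le k.+1 (g_ k.+1 - g_ k) by have [] := step _ _ (hg k).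
have hlim i : exists l, forall k, padic_le k (l - (g_ k)`_i).
  apply: padic_cvg => k; rewrite -coefB; apply: padic_leW (hgd k i) => //.
have /choice[l hl] := hlim.
pose g := \poly_(i < m.+1) l i.
have hgg k : pol_le k (g - g_ k).
  move=> i; rewrite coefB coef_poly; case: ltnP => him; first exact: hl.
  rewrite nth_default ?subrr; first exact: padic_le_0.
  by have [_ -> _ _ _] := hg k.
have lm : l m = 1.
  apply/eqP; rewrite -subr_eq0; apply/eqP; apply: padic_le_eq0 => k.
  have := hl m k; have [/monicP mo sg _ _ _] := hg k.
  by rewrite lead_coefE sg /= in mo; rewrite mo.
have sg : size g = m.+1 by apply: size_poly_eq; rewrite lm oner_neq0.
have mg : g \is monic by rewrite monicE lead_coefE sg /= coef_poly ltnSn lm.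
have hg0 : pol_le 0 g.
  rewrite -(subrK (g_ 0%N) g); apply: pol_leD; first exact: hgg.
  by have [] := hg 0%N.
exists g; split=> //; apply/eqP; apply/polyP => i; rewrite coef0.
apply: padic_le_eq0 => k.
pose q := f %/ g_ k.
have [mo' _ hk' _ hr] := hg k.
have hq : pol_le 0 q by have [] := pol_le_edivp mo' hk' hf.
have ef : f = q * g + (f %% g_ k - q * (g - g_ k)).
  rewrite {1}(divp_eq f (g_ k)) -/q; ring.
have -> : f %% g = (f %% g_ k - q * (g - g_ k)) %% g.
  by rewrite {1}ef modpD modp_mull add0r.
have hh : pol_le k (f %% g_ k - q * (g - g_ k)).
  apply: pol_leB; first by apply: pol_leW hr.
  by rewrite -[k]add0n; apply: pol_leM.
by have [_] := pol_le_edivp mg hg0 hh; apply.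
Qed.

End PadicNumbers.

(** * Subfields and automorphisms of the algebraic closure *)

Fact Zp_subring_closed (p : nat) (Qp : padicField p) : subring_closed (@Zp p Qp).
Proof.
split; rewrite ?inE ?padic_abs1 // => x y; rewrite !inE => hx hy.
  by apply: padic_absD_le; rewrite ?padic_absN.
by rewrite padic_absM mulr_ile1 ?padic_abs_ge0.
Qed.

HB.instance Definition _ (p : nat) (Qp : padicField p) :=
  GRing.isSubringClosed.Build Qp (@Zp p Qp) (Zp_subring_closed Qp).

(** The valuation ring of [Qp] as a ring in its own right, so that the closure properties of
    elements integral over a ring apply. *)
Definition padic_integers (p : nat) (Qp : padicField p) :=
  {x : Qp | x \in @Zp p Qp}.
HB.instance Definition _ (p : nat) (Qp : padicField p) :=
  SubChoice.on (padic_integers Qp).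
HB.instance Definition _ (p : nat) (Qp : padicField p) :=
  [SubChoice_isSubComNzRing of padic_integers Qp by <:].

Lemma mk_rmorphism (R S : nzRingType) (f : R -> S) :
  {morph f : x y / x - y} -> {morph f : x y / x * y} -> f 1 = 1 ->
  exists g : {rmorphism R -> S}, forall x, g x = f x.
Proof.
move=> fB fM f1.
pose ga := GRing.isZmodMorphism.Build R S f fB.
pose gm := GRing.isMonoidMorphism.Build R S f (conj f1 fM).
by exists (HB.pack f ga gm : {rmorphism R -> S}).
Qed.

Section Fields.
Variables (p : nat) (Qp : padicField p) (C : closedFieldType).
Variable iota : {rmorphism Qp -> C}.
Implicit Types (K : set C) (x y z : C).

Record sfield := Sfield {sf_set : set C; sf_P : subfield iota sf_set}.
Definition sf_pred (K : sfield) : {pred C} := [pred x | x \in sf_set K].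

Lemma subfield1 K : subfield iota K -> K 1.
Proof. by case=> + _ _ _; apply; exists 1; rewrite ?rmorph1. Qed.

Lemma subfield_iota K c : subfield iota K -> K (iota c).
Proof. by case=> + _ _ _; apply; exists c. Qed.

Fact sf_pred_divring_closed (K : sfield) : divring_closed (sf_pred K).
Proof.
case: K => K sK; split; rewrite ?inE /=.
- exact: (subfield1 sK).
- move=> x y; rewrite !inE => hx hy.
  by have [_ hB _ _] := sK; apply: hB.
- move=> x y; rewrite !inE => hx hy.
  by have [_ _ hM hV] := sK; apply: hM => //; apply: hV.
Qed.

HB.instance Definition _ (K : sfield) :=
  GRing.isDivringClosed.Build C (sf_pred K) (sf_pred_divring_closed K).

Definition sf_type (K : sfield) := {x : C | x \in sf_pred K}.
HB.instance Definition _ (K : sfield) := SubChoice.on (sf_type K).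
HB.instance Definition _ (K : sfield) :=
  [SubChoice_isSubIntegralDomain of sf_type K by <:].
HB.instance Definition _ (K : sfield) :=
  [SubIntegralDomain_isSubField of sf_type K by <:].

(** Linear algebra and polynomial division need a field type, whereas subfields of [C] are sets;
    each is replaced by an abstract field with an embedding. *)
Lemma subfield_fieldType K : subfield iota K ->
  exists (k : fieldType) (j : {rmorphism k -> C}), forall x, K x <-> exists a, x = j a.
Proof.
move=> sK; pose KK := Sfield sK.
exists (sf_type KK), (val : sf_type KK -> C) => x; split.
  move=> Kx; have h : x \in sf_pred KK by rewrite !inE.
  by exists (exist _ x h).
by case=> -[a ha] /= ->; move: ha; rewrite !inE.
Qed.

Lemma subfield0 K : subfield iota K -> K 0.
Proof. by move=> sK; rewrite -(rmorph0 iota); apply: subfield_iota. Qed.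

Lemma subfieldB K x y : subfield iota K -> K x -> K y -> K (x - y).
Proof. by case=> _ h _ _; apply: h. Qed.

Lemma subfieldN K x : subfield iota K -> K x -> K (- x).
Proof. by move=> sK Kx; rewrite -sub0r; apply: subfieldB => //; apply: subfield0. Qed.

Lemma subfieldD K x y : subfield iota K -> K x -> K y -> K (x + y).
Proof. by move=> sK Kx Ky; rewrite -[y]opprK; apply: subfieldB => //; apply: subfieldN. Qed.

Lemma subfieldM K x y : subfield iota K -> K x -> K y -> K (x * y).
Proof. by case=> _ _ h _; apply: h. Qed.

Lemma subfieldV K x : subfield iota K -> K x -> K x^-1.
Proof. by case=> _ _ _ h; apply: h. Qed.

Lemma subfield_div K x y : subfield iota K -> K x -> K y -> K (x / y).
Proof. by move=> sK Kx Ky; apply: subfieldM => //; apply: subfieldV. Qed.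

Lemma subfieldX K x n : subfield iota K -> K x -> K (x ^+ n).
Proof.
move=> sK Kx; elim: n => [|n IH]; rewrite ?expr0 ?exprS; first exact: subfield1.
exact: subfieldM.
Qed.

Lemma subfield_nat K n : subfield iota K -> K n%:R.
Proof. by move=> sK; rewrite -(rmorph_nat iota); apply: subfield_iota. Qed.

Lemma subfield_sum K (I : Type) (r : seq I) (P : pred I) (F : I -> C) :
  subfield iota K -> (forall i, P i -> K (F i)) -> K (\sum_(i <- r | P i) F i).
Proof.
move=> sK h; apply: (big_ind K) => //; first exact: subfield0.
by move=> *; apply: subfieldD.
Qed.

Lemma subfield_prod K (I : Type) (r : seq I) (P : pred I) (F : I -> C) :
  subfield iota K -> (forall i, P i -> K (F i)) -> K (\prod_(i <- r | P i) F i).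
Proof.
move=> sK h; apply: (big_ind K) => //; first exact: subfield1.
by move=> *; apply: subfieldM.
Qed.

Lemma subfield_iotaR : subfield iota (range iota).
Proof.
split=> //.
- by move=> _ _ [a _ <-] [b _ <-]; exists (a - b); rewrite ?rmorphB.
- by move=> _ _ [a _ <-] [b _ <-]; exists (a * b); rewrite ?rmorphM.
- by move=> _ [a _ <-]; exists a^-1; rewrite ?fmorphV.
Qed.

Lemma adjoin_subfield K z : subfield iota K -> subfield iota (adjoin iota K z).
Proof.
move=> sK; split.
- by move=> _ [c _ <-] M sM _ _; apply: subfield_iota.
- by move=> x y hx hy M sM KM Mz; apply: subfieldB; [|apply: hx|apply: hy].
- by move=> x y hx hy M sM KM Mz; apply: subfieldM; [|apply: hx|apply: hy].
- by move=> x hx M sM KM Mz; apply: subfieldV; [|apply: hx].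
Qed.

Lemma adjoin_base K z x : K x -> adjoin iota K z x.
Proof. by move=> Kx M _ KM _; apply: KM. Qed.

Lemma adjoin_gen K z : adjoin iota K z z.
Proof. by move=> M _ _. Qed.

Lemma adjoin_min K z M : subfield iota M -> (forall x, K x -> M x) -> M z ->
  forall x, adjoin iota K z x -> M x.
Proof. by move=> sM KM Mz x; apply. Qed.

Lemma agree_subfield (g h : {rmorphism C -> C}) :
  (forall c, g (iota c) = h (iota c)) -> subfield iota [set x | g x = h x].
Proof.
move=> e; split=> [_ [c _ <-]|x y /= hx hy|x y /= hx hy|x /= hx] //=.
- by rewrite !rmorphB hx hy.
- by rewrite !rmorphM hx hy.
- by rewrite !fmorphV hx.
Qed.

Hypothesis alg : forall y : C, algebraicOver iota y.

Lemma charC n : (0 < n)%N -> prime p -> (n%:R : C) != 0.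
Proof.
by move=> n0 pp; rewrite -(rmorph_nat iota) fmorph_eq0 padic_nat_neq0.
Qed.

Lemma min_poly (k : fieldType) (j : {rmorphism k -> C}) y : algebraicOver j y ->
  exists P : {poly k}, [/\ P != 0, root (map_poly j P) y &
    forall R, root (map_poly j R) y -> P %| R].
Proof.
move=> [f f0 fy].
have ex : exists n, `[< exists f : {poly k}, [/\ f != 0, root (map_poly j f) y & size f = n] >].
  by exists (size f); apply/asboolP; exists f.
case: (ex_minnP ex) => n /asboolP[P [P0 Py Pn]] nmin.
exists P; split=> // R Ry; apply/negPn/negP => /negP nd.
have r0 : R %% P != 0 by apply/negP => /eqP e; apply: nd; rewrite /dvdp e.
have := nmin (size (R %% P)).
have -> : `[< exists f : {poly k}, [/\ f != 0, root (map_poly j f) y & size f = size (R %% P)] >].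
  apply/asboolP; exists (R %% P); split=> //.
  move: Ry; rewrite {1}(divp_eq R P) rmorphD rmorphM /= rootE hornerD hornerM.
  by rewrite (rootP Py) mulr0 add0r.
by move=> /(_ isT); rewrite -Pn leqNgt ltn_modp P0.
Qed.

(** The minimal polynomial of [y != 0] has a nonzero constant term; solving for that term expresses
    [y^-1]. *)
Lemma inv_poly y : y != 0 -> exists g : {poly Qp}, y^-1 = (map_poly iota g).[y].
Proof.
move=> y0; have [P [P0 Py Pmin]] := min_poly (alg y).
have eP : P = (P %/ 'X) * 'X + (P.[0])%:P.
  rewrite {1}(divp_eq P 'X); congr (_ + _).
  by rewrite -[X in _ %% X]subr0 -polyC0 modp_XsubC.
have c0 : P.[0] != 0.
  apply/eqP => e; rewrite e addr0 in eP.
  have : root (map_poly iota (P %/ 'X)) y.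
    move: Py; rewrite {1}eP rmorphM /= map_polyX rootE hornerM hornerX mulf_eq0 (negPf y0) orbF.
    by [].
  move=> /Pmin; rewrite {1}eP => h.
  have q0 : P %/ 'X != 0 by apply/eqP => e0; move: P0; rewrite eP e0 mul0r eqxx.
  have := dvdp_leq q0 h; rewrite size_mulX //; by rewrite ltnn.
exists (- (P.[0])^-1 *: (P %/ 'X)).
move: Py; rewrite {1}eP rmorphD rmorphM /= map_polyX map_polyC rootE hornerD hornerM hornerX hornerC.
rewrite addr_eq0 => /eqP e.
apply: (mulIf y0); rewrite mulVf // map_polyZ hornerZ -mulrA e /= rmorphN fmorphV.
by rewrite mulrN mulNr opprK mulVf // fmorph_eq0.
Qed.

(** Everything is algebraic over [Qp], so inverses are polynomials in the element and come for
    free. *)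
Lemma subring_subfield K : (forall c, K (iota c)) ->
  (forall x y, K x -> K y -> K (x - y)) -> (forall x y, K x -> K y -> K (x * y)) ->
  subfield iota K.
Proof.
move=> Ki KB KM; split=> //; first by move=> _ [c _ <-].
move=> x Kx; have [->|x0] := eqVneq x 0; first by rewrite invr0 -(rmorph0 iota).
have [g ->] := inv_poly x0.
have K0 : K 0 by rewrite -(rmorph0 iota).
have K1 : K 1 by rewrite -(rmorph1 iota).
have KD a b : K a -> K b -> K (a + b).
  by move=> Ka Kb; rewrite -[b]opprK; apply: (KB) => //; rewrite -sub0r; apply: KB.
rewrite horner_coef; apply: (big_ind K) => // i _; rewrite coef_map; apply: (KM); first exact: Ki.
by elim: (nat_of_ord i) => [|n IH]; rewrite ?expr0 ?exprS //; apply: KM.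
Qed.

Lemma alg_over (k : fieldType) (j : {rmorphism k -> C}) y :
  (forall c, exists a, iota c = j a) -> algebraicOver j y.
Proof.
move=> /choice[l hl]; have [f f0 fy] := alg y.
pose g := \poly_(i < size f) l f`_i.
have eg : map_poly j g = map_poly iota f.
  apply/polyP => i; rewrite !coef_map coef_poly; case: ltnP => h /=; first by rewrite hl.
  by rewrite rmorph0 nth_default ?rmorph0.
exists g; last by rewrite eg.
by rewrite -(map_poly_eq0 j) eg map_poly_eq0.
Qed.

Lemma adjoin_poly (k : fieldType) (j : {rmorphism k -> C}) K z y :
  subfield iota K -> (forall x, K x <-> exists a, x = j a) ->
  adjoin iota K z y -> exists P : {poly k}, y = (map_poly j P).[z].
Proof.
move=> sK hK; move/(_ [set y | exists P : {poly k}, y = (map_poly j P).[z]]).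
apply.
- apply: subring_subfield => /=.
  + move=> c; have /hK[a ->] := subfield_iota c sK; exists a%:P.
    by rewrite map_polyC hornerC.
  + by move=> _ _ [P ->] [P' ->]; exists (P - P'); rewrite rmorphB hornerD hornerN.
  + by move=> _ _ [P ->] [P' ->]; exists (P * P'); rewrite rmorphM hornerM.
- by move=> x /hK[a ->]; exists a%:P; rewrite map_polyC hornerC.
- by exists 'X; rewrite map_polyX hornerX.
Qed.

(** The graph of a morphism over [Qp] defined on an intermediate ring. The last clause is
    single-valuedness, given closure under differences. *)
Definition hom_graph (G : set (C * C)) :=
  [/\ forall c, G (iota c, iota c),
      forall a b, G a -> G b -> G (a.1 - b.1, a.2 - b.2),
      forall a b, G a -> G b -> G (a.1 * b.1, a.2 * b.2)
    & forall y, G (0, y) -> y = 0].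

(** A maximal graph containing [G0] has a subfield as its domain. For any [y], the minimal
    polynomial transported by the partial morphism has a root in the algebraically closed [C], so
    the morphism extends to [y] and maximality puts [y] in the domain. *)
Lemma hom_graph_extend (G0 : set (C * C)) : hom_graph G0 ->
  exists h : {rmorphism C -> C}, forall a, G0 a -> h a.1 = a.2.
Proof.
move=> hG0.
(* Zorn's lemma is applied to the sets [A] joined to [G0], not to supersets of [G0], so that the
   empty chain needs no separate treatment. *)
pose P := [set A : set (C * C) | hom_graph (G0 `|` A)].
have [|A [PA maxA]] := @Zorn_bigcup _ P.
  move=> F FP Ftot; rewrite /P /=.
  have dir a b : (G0 `|` \bigcup_(X in F) X) a -> (G0 `|` \bigcup_(X in F) X) b ->
      exists Y, [/\ hom_graph (G0 `|` Y), G0 `|` Y `<=` G0 `|` \bigcup_(X in F) X,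
        (G0 `|` Y) a & (G0 `|` Y) b].
    have sub X : F X -> G0 `|` X `<=` G0 `|` \bigcup_(X in F) X.
      by move=> FX x [?|Xx]; [left|right; exists X].
    move=> [Ga|[X FX Xa]] [Gb|[Y FY Yb]].
    - exists set0; rewrite setU0; split=> //; exact: subsetUl.
    - by exists Y; split; [apply: FP|apply: sub|left|right].
    - by exists X; split; [apply: FP|apply: sub|right|left].
    - case: (Ftot X Y FX FY) => XY.
        by exists Y; split; [apply: FP|apply: sub|right; apply: XY|right].
      by exists X; split; [apply: FP|apply: sub|right|right; apply: XY].
  split.
  - by move=> c; left; case: hG0.
  - move=> a b ha hb; have [Y [[_ h _ _] s Ya Yb]] := dir _ _ ha hb.
    by apply: s; apply: h.
  - move=> a b ha hb; have [Y [[_ _ h _] s Ya Yb]] := dir _ _ ha hb.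
    by apply: s; apply: h.
  - move=> y hy; have [Y [[_ _ _ h] s Ya Yb]] := dir _ _ hy hy.
    exact: h.
set M := G0 `|` A in PA maxA *.
have hM : hom_graph M by [].
have maxM B : hom_graph B -> M `<=` B -> B `<=` M.
  move=> hB MB; apply: contrapT => nBM.
  apply: (maxA B).
    split; first by move=> x Ax; apply: MB; right.
    by move=> BA; apply: nBM => x /BA; right.
  rewrite /P /= (_ : G0 `|` B = B) //; apply/seteqP; split=> x; last by right.
  by case=> // Gx; apply: MB; left.
have [Mi MB MM MK] := hM.
pose K := [set x | exists y, M (x, y)].
have sK : subfield iota K.
  apply: subring_subfield.
  - by move=> c; exists (iota c).
  - by move=> x y [x' hx] [y' hy]; exists (x' - y'); have := MB _ _ hx hy.
  - by move=> x y [x' hx] [y' hy]; exists (x' * y'); have := MM _ _ hx hy.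
have Mfun x y y' : M (x, y) -> M (x, y') -> y = y'.
  by move=> h h'; have := MB _ _ h h'; rewrite /= subrr => /MK/eqP; rewrite subr_eq0 => /eqP.
have [k [j hj]] := subfield_fieldType sK.
have Kj a : K (j a) by apply/hj; exists a.
have /choice[s0 hs0] : forall a, exists y, M (j a, y) by exact: Kj.
have [|||s hs] := @mk_rmorphism k C s0.
- move=> a b; apply: (Mfun (j (a - b))) => //.
  by have := MB _ _ (hs0 a) (hs0 b); rewrite /= -rmorphB.
- move=> a b; apply: (Mfun (j (a * b))) => //.
  by have := MM _ _ (hs0 a) (hs0 b); rewrite /= -rmorphM.
- by apply: (Mfun 1); [rewrite -(rmorph1 j)|rewrite -(rmorph1 iota)].
have ji c : exists a, iota c = j a by apply/hj; apply: subfield_iota.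
have full y : K y.
  have [Pm [Pm0 Py Pmin]] := min_poly (alg_over y ji).
  have sP : size (map_poly s Pm) != 1%N.
    rewrite size_map_poly; apply: contraTneq Py => /eqP/size_poly1P[c c0 ->].
    by rewrite map_polyC rootC fmorph_eq0.
  have [y' y'r] := closed_rootP _ sP.
  pose B := [set a | exists R : {poly k}, a = ((map_poly j R).[y], (map_poly s R).[y'])].
  have jiota c a : iota c = j a -> s a = iota c.
    by move=> e; rewrite hs; apply: (Mfun (j a)) => //; rewrite -e.
  have hB : hom_graph B.
    split.
    - move=> c; have [a e] := ji c; exists a%:P.
      by rewrite !map_polyC !hornerC /= -e (jiota _ _ e).
    - move=> _ _ [R ->] [R' ->] /=; exists (R - R').
      by rewrite !rmorphB /= !hornerD !hornerN.
    - move=> _ _ [R ->] [R' ->] /=; exists (R * R').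
      by rewrite !rmorphM /= !hornerM.
    - move=> z [R [/esym e ->]]; have : Pm %| R by apply: Pmin; apply/rootP.
      move=> /dvdpP[R' ->]; rewrite rmorphM hornerM /=.
      by rewrite (rootP y'r) mulr0.
  exists y'; apply: (maxM B) => //.
    move=> [a b] hab; have /hj[a' ea] : K a by exists b.
    exists a'%:P; rewrite !map_polyC !hornerC /= -ea hs; congr (_, _).
    by apply: (Mfun a) => //; rewrite ea.
  by exists 'X; rewrite !map_polyX !hornerX.
have /choice[h0 hh0] : forall y, exists z, M (y, z) by exact: full.
have [|||h hh] := @mk_rmorphism C C h0.
- by move=> a b; apply: (Mfun (a - b)) => //; have := MB _ _ (hh0 a) (hh0 b).
- by move=> a b; apply: (Mfun (a * b)) => //; have := MM _ _ (hh0 a) (hh0 b).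
- by apply: (Mfun 1) => //; rewrite -(rmorph1 iota).
by exists h => -[a b] Gab; rewrite hh /=; apply: (Mfun a) => //; left.
Qed.

Definition fixes K (h : {rmorphism C -> C}) := forall x, K x -> h x = x.

Lemma fixes_iota K h : subfield iota K -> fixes K h -> forall c, h (iota c) = iota c.
Proof. by move=> sK hK c; apply: hK; apply: subfield_iota. Qed.

(** An endomorphism over [Qp] maps the finite root set of a polynomial injectively into itself,
    hence onto it. *)
Lemma endo_surj (h : {rmorphism C -> C}) : (forall c, h (iota c) = iota c) ->
  forall y, exists x, h x = y.
Proof.
move=> hi y; have [f f0 fy] := alg y.
have [r er] := closed_field_poly_normal (map_poly iota f).
have l0 : lead_coef (map_poly iota f) != 0 by rewrite lead_coef_eq0 map_poly_eq0.
have rr z : root (map_poly iota f) z = (z \in undup r).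
  by rewrite er rootZ // root_prod_XsubC mem_undup.
have hr z : z \in undup r -> h z \in undup r.
  rewrite -!rr => /rootP e; apply/rootP.
  have -> : map_poly iota f = map_poly h (map_poly iota f).
    by apply/polyP => i; rewrite !coef_map /= hi.
  by rewrite horner_map e rmorph0.
have inj := fmorph_inj h.
have um : uniq (map h (undup r)) by rewrite map_inj_uniq ?undup_uniq.
have sub : {subset map h (undup r) <= undup r} by move=> _ /mapP[z zr ->]; apply: hr.
have [_ e] := uniq_min_size um sub (eq_leq (esym (size_map h (undup r)))).
have : y \in map h (undup r) by rewrite e -rr.
by move=> /mapP[x _ ->]; exists x.
Qed.

Lemma endo_bij (h : {rmorphism C -> C}) : (forall c, h (iota c) = iota c) -> bijective h.
Proof.
move=> hi; have /choice[g hg] := endo_surj hi.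
by exists g => // x; apply: (fmorph_inj h); rewrite hg.
Qed.

Lemma in_galoisP K h : subfield iota K -> in_galois K h <-> fixes K h.
Proof.
move=> sK; split=> [[]//|hK]; split=> //.
by apply: endo_bij; apply: fixes_iota hK.
Qed.

Lemma aut_inverse (h : {rmorphism C -> C}) : (forall c, h (iota c) = iota c) ->
  exists g : {rmorphism C -> C}, cancel h g /\ cancel g h.
Proof.
move=> hi; have [|g hg] := @hom_graph_extend [set a | a.1 = h a.2].
  split=> /=.
  - by move=> c; rewrite hi.
  - by move=> a b -> ->; rewrite rmorphB.
  - by move=> a b -> ->; rewrite rmorphM.
  - by move=> y /esym/eqP; rewrite fmorph_eq0 => /eqP.
have gh : cancel h g by move=> x; have := hg (h x, x) erefl.
exists g; split=> // y; have [x <-] := endo_surj hi y.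
by rewrite gh.
Qed.

Hypothesis p_prime : prime p.

(* An element all of whose conjugates coincide with it is a multiple root of its
   minimal polynomial unless that polynomial is linear. *)
Lemma fixed_mem K y : subfield iota K -> (forall h, fixes K h -> h y = y) -> K y.
Proof.
move=> sK hy; have [k [j hj]] := subfield_fieldType sK.
have ji c : exists a, iota c = j a by apply/hj; apply: subfield_iota.
have [P [P0 Py Pmin]] := min_poly (alg_over y ji).
have conj z : root (map_poly j P) z -> z = y.
  move=> Pz.
  have [|h hh] := @hom_graph_extend [set a | exists R : {poly k},
      a = ((map_poly j R).[y], (map_poly j R).[z])].
    split.
    - by move=> c; have [a e] := ji c; exists a%:P; rewrite !map_polyC !hornerC /= -e.
    - move=> _ _ [R ->] [R' ->] /=; exists (R - R').
      by rewrite !rmorphB /= !hornerD !hornerN.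
    - move=> _ _ [R ->] [R' ->] /=; exists (R * R').
      by rewrite !rmorphM /= !hornerM.
    - move=> x [R [/esym e ->]]; have : P %| R by apply: Pmin; apply/rootP.
      by move=> /dvdpP[R' ->]; rewrite rmorphM hornerM /= (rootP Pz) mulr0.
  have <- : h y = z.
    have := hh (y, z); apply; exists 'X; by rewrite !map_polyX !hornerX.
  apply: hy => x /hj[a ->].
  have := hh (j a, j a); apply; exists a%:P; by rewrite !map_polyC !hornerC.
have [r er] := closed_field_poly_normal (map_poly j P).
have l0 : lead_coef (map_poly j P) != 0 by rewrite lead_coef_eq0 map_poly_eq0.
have rr z : z \in r -> z = y.
  by move=> zr; apply: conj; rewrite er rootZ // root_prod_XsubC.
have rs : size P = (size r).+1.
  by rewrite -(size_map_poly j) er size_scale // size_prod_XsubC.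
have P'0 : P^`() != 0.
  have n1 : (0 < size r)%N.
    rewrite lt0n; apply/eqP => e; move: Py; rewrite er rootZ // root_prod_XsubC.
    by rewrite (size0nil e) in_nil.
  apply/eqP => e.
  have : P^`()`_(size r).-1 = 0 by rewrite e coef0.
  rewrite coef_deriv prednK // => /(congr1 j)/eqP.
  rewrite rmorphMn rmorph0 /= -mulr_natr mulf_eq0 (negPf (charC _ _)) // orbF fmorph_eq0.
  have -> : P`_(size r) = lead_coef P by rewrite lead_coefE rs.
  by rewrite lead_coef_eq0 (negPf P0).
have nr : ~~ root (map_poly j P^`()) y.
  by apply/negP => /Pmin /(dvdp_leq P'0); rewrite leqNgt lt_size_deriv.
have sr : size r = 1%N.
  case: r er rr rs => [|a [|b r]] er rr rs //=.
    by move: Py; rewrite er big_nil rootZ // (negPf (root1 _)).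
  have ea : a = y by apply: rr; rewrite inE eqxx.
  have eb : b = y by apply: rr; rewrite !inE eqxx orbT.
  exfalso; move/negP: nr; apply; rewrite -deriv_map er derivZ !big_cons ea eb.
  rewrite rootZ // !derivM !derivXsubC rootE !hornerE subrr.
  by rewrite !(mul0r, mulr0, addr0, mul1r) eqxx.
case: r er sr {rs rr} => [|a [|b r]] // er _.
have ea : a = y by apply: conj; rewrite er rootZ // big_seq1 root_XsubC.
apply/hj; exists (- P`_0 / P`_1).
have e i : j P`_i = lead_coef (map_poly j P) * ('X - y%:P)`_i.
  by rewrite -coef_map {1}er big_seq1 ea coefZ.
rewrite fmorph_div rmorphN /= !e !coefB !coefX !coefC /=.
by rewrite ?mulr0n ?mulr1n; field.
Qed.

End Fields.

(** * The valuation ring of the algebraic closure *)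

Class padic_closure (p : nat) (Qp : padicField p) (C : closedFieldType)
    (iota : {rmorphism Qp -> C}) : Prop := PadicClosure {
  pc_prime : prime p;
  pc_alg : forall y : C, algebraicOver iota y }.

Section Valuation.
Variables (p : nat) (Qp : padicField p) (C : closedFieldType).
Variable iota : {rmorphism Qp -> C}.
Context {HC : padic_closure iota}.
Let p_prime : prime p := pc_prime.
Let alg : forall y : C, algebraicOver iota y := pc_alg.
Implicit Types (K : set C) (x y z : C).
Local Notation O := (integral iota).
Local Notation zp_inj := (iota \o (val : padic_integers Qp -> Qp)).

Lemma integralP x : O x <-> integralOver zp_inj x.
Proof.
split=> [[f [mf /polyOverP hf fx]]|[f mf fx]].
  have h i : exists a : padic_integers Qp, val a = f`_i by exists (exist (fun c : Qp => c \in @Zp p Qp) _ (hf i)).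
  have /choice[l hl] := h.
  pose g := \poly_(i < size f) l i.
  have eg : map_poly val g = f.
    apply/polyP => i; rewrite coef_map coef_poly; case: ltnP => hi; first by rewrite /= hl.
    by rewrite nth_default.
  have inj : injective (val : padic_integers Qp -> Qp) by apply: val_inj.
  exists g; last by rewrite map_poly_comp eg.
  rewrite monicE; apply/eqP/val_inj; move: mf; rewrite -eg monicE lead_coef_map_inj //.
  by move/eqP.
exists (map_poly val f); split.
- by rewrite monic_map.
- by apply/polyOverP => i; rewrite coef_map; apply: valP.
- by rewrite -map_poly_comp.
Qed.

Lemma O0 : O 0. Proof. by apply/integralP; apply: integral0. Qed.
Lemma O1 : O 1. Proof. by apply/integralP; apply: integral1. Qed.
Lemma OnatR n : O n%:R. Proof. by apply/integralP; apply: integral_nat. Qed.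
Lemma ON x : O x -> O (- x).
Proof. by move=> /integralP h; apply/integralP; apply: integral_opp. Qed.
Lemma OD x y : O x -> O y -> O (x + y).
Proof. by move=> /integralP hx /integralP hy; apply/integralP; apply: integral_add. Qed.
Lemma OB x y : O x -> O y -> O (x - y).
Proof. by move=> hx hy; apply: OD (ON _). Qed.
Lemma OM x y : O x -> O y -> O (x * y).
Proof. by move=> /integralP hx /integralP hy; apply/integralP; apply: integral_mul. Qed.
Lemma OX x n : O x -> O (x ^+ n).
Proof. by move=> hx; elim: n => [|n IH]; rewrite ?expr0 ?exprS; [apply: O1|apply: OM]. Qed.
Lemma Osum (I : Type) (r : seq I) (P : pred I) (F : I -> C) :
  (forall i, P i -> O (F i)) -> O (\sum_(i <- r | P i) F i).
Proof. by move=> h; apply: (big_ind O) => //; [apply: O0|apply: OD]. Qed.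
Lemma Oprod (I : Type) (r : seq I) (P : pred I) (F : I -> C) :
  (forall i, P i -> O (F i)) -> O (\prod_(i <- r | P i) F i).
Proof. by move=> h; apply: (big_ind O) => //; [apply: O1|apply: OM]. Qed.
Lemma Ohorner (f : {poly C}) x : (forall i, O f`_i) -> O x -> O f.[x].
Proof.
by move=> hf hx; rewrite horner_coef; apply: Osum => i _; apply: OM (OX _ _).
Qed.

Lemma O_root (f : {poly C}) x : f \is monic -> (forall i, O f`_i) -> root f x -> O x.
Proof.
move=> mf hf fx; apply/integralP; apply: (integral_root_monic mf fx).
by move=> c /(nthP 0)[i _ <-]; apply/integralP; apply: hf.
Qed.

Lemma O_iotaW c : c \in @Zp p Qp -> O (iota c).
Proof.
move=> hc; exists ('X - c%:P); split; first exact: monicXsubC.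
  by rewrite polyOverXsubC.
by rewrite rmorphB /= map_polyX map_polyC root_XsubC.
Qed.

(** If [abs c > 1], the leading term of a monic equation over [Zp] strictly dominates all the
    others. *)
Lemma O_iota c : O (iota c) -> c \in @Zp p Qp.
Proof.
move=> [f [mf /polyOverP hf fx]]; rewrite inE leNgt; apply/negP => hc.
have c0 : c != 0 by apply/eqP => e; move: hc; rewrite e padic_abs0; lra.
have := rootP fx; rewrite horner_map => /eqP; rewrite fmorph_eq0 => /eqP.
have fs : (0 < size f)%N by rewrite size_poly_gt0 monic_neq0.
rewrite horner_coef -(prednK fs) big_ord_recr /= -lead_coefE (monicP mf) mul1r.
set n := (size f).-1.
move=> /eqP; rewrite addrC addr_eq0 => /eqP e.
have : padic_abs (c ^+ n) < padic_abs (c ^+ n).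
  rewrite {1}e padic_absN.
  apply: (big_ind (fun z : Qp => padic_abs z < padic_abs (c ^+ n))).
  - by rewrite padic_abs0 padic_absX exprn_gt0 //; lra.
  - by move=> *; apply: padic_absD_lt.
  - move=> i _; rewrite padic_absM !padic_absX.
    apply: (@le_lt_trans _ _ (padic_abs c ^+ i)).
      rewrite ler_piMl ?exprn_ge0 ?padic_abs_ge0 //.
      by have := hf i; rewrite inE.
    by rewrite ltr_eXn2l.
by rewrite ltxx.
Qed.

(** The integral elements form a valuation ring. Scale the minimal polynomial of [x] so that its
    largest coefficient has absolute value [1], and let [m] be the last index where this is
    attained. At the top degree the polynomial shows [x] integral; at [m = 0] its reversal shows
    [x^-1] integral; in between, Weierstrass preparation gives a proper factor of degree [m],
    against minimality. *)
Lemma O_total x : O x \/ O x^-1.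
Proof.
have [->|x0] := eqVneq x 0; first by left; apply: O0.
have [P0 [P00 Px0 Pmin0]] := min_poly (alg x).
pose s := size P0.
have s0 : (0 < s)%N by rewrite size_poly_gt0.
pose i0 := Ordinal s0.
case: (@Order.TotalTheory.arg_maxP _ _ 'I_s i0 predT (fun i : 'I_s => padic_abs P0`_i) isT) => im _ imP.

pose a := P0`_im.
have a0 : a != 0.
  apply/eqP => ea; have ls : (s.-1 < s)%N by rewrite ltn_predL.
  have := imP (Ordinal ls) isT; rewrite /= -/a ea padic_abs0 -lead_coefE.
  have := padic_abs_neq0 (_ : lead_coef P0 != 0); rewrite lead_coef_eq0 => /(_ P00).
  by have := padic_abs_ge0 (lead_coef P0); lra.
pose f := a^-1 *: P0.
have sf : size f = s by rewrite size_scale ?invr_eq0.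
have fx : root (map_poly iota f) x by rewrite map_polyZ rootZ // fmorph_eq0 invr_eq0.
have f1 i : padic_abs f`_i <= 1.
  rewrite coefZ padic_absM padic_absV mulrC ler_pdivrMr ?mul1r; last first.
    by rewrite lt_def padic_abs_neq0 ?padic_abs_ge0.
  have [ilt|ige] := ltnP i s; first by have := imP (Ordinal ilt) isT.
  by rewrite nth_default // padic_abs0 padic_abs_ge0.
have fim : padic_abs f`_im == 1 by rewrite coefZ mulVf // padic_abs1.
case: (@arg_maxnP _ im (fun i : 'I_s => padic_abs f`_i == 1) (fun i => i : nat) fim) => m /eqP m1 mmax.
have mhi i : (m < i)%N -> padic_le 1 f`_i.
  move=> mi; apply: (padic_lt1 p_prime); rewrite lt_neqAle f1 andbT.
  have [ilt|ige] := ltnP i s; last by rewrite nth_default ?sf // padic_abs0 eq_sym oner_neq0.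
  by apply/negP => h; have := mmax (Ordinal ilt) h; rewrite /= leqNgt mi.
have hf : pol_le 0 f by move=> i; rewrite /padic_le expr0 invr1.
have fm0 : f`_m != 0 by apply/eqP => e; move: m1; rewrite e padic_abs0 => /esym/eqP; rewrite oner_eq0.
have [em|nm] := eqVneq (m : nat) s.-1.
  left; exists ((lead_coef f)^-1 *: f); have ef : lead_coef f = f`_m by rewrite em lead_coefE sf.
  split.
  - by rewrite monicE lead_coefZ mulVf // ef.
  - apply/polyOverP => i; rewrite inE coefZ padic_absM padic_absV ef m1 invr1 mul1r; exact: f1.
  - by rewrite map_polyZ rootZ // fmorph_eq0 invr_eq0 ef.
have ms : (m.+1 < s)%N by rewrite -[s in (_ < s)%N]prednK // ltnS ltn_neqAle nm -ltnS prednK //=.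
have [m0|m0] := eqVneq (m : nat) 0%N.
  right; exists (\poly_(i < s) ((f`_m)^-1 * f`_(s.-1 - i))).
  have sg : size (\poly_(i < s) ((f`_m)^-1 * f`_(s.-1 - i))) = s.
    by apply: size_poly_eq; rewrite subnn -m0 mulVf ?oner_neq0.
  split.
  - by rewrite monicE lead_coefE sg coef_poly ltn_predL s0 subnn -m0 mulVf.
  - apply/polyOverP => i; rewrite inE coef_poly; case: ifP => _; last by rewrite padic_abs0 ler01.
    by rewrite padic_absM padic_absV m1 invr1 mul1r; apply: f1.
  - apply/rootP; rewrite horner_coef size_map_poly sg.
    have := rootP fx; rewrite horner_coef size_map_poly sf => e.
    rewrite (reindex_inj rev_ord_inj) /=.
    apply: (mulIf (expf_neq0 s.-1 x0)); rewrite mul0r mulr_suml.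
    rewrite -[RHS](mulr0 (iota (f`_m)^-1)) -[X in _ = _ * X]e mulr_sumr; apply: eq_bigr => i _.
    rewrite !coef_map /= coef_poly (_ : (s - i.+1 < s)%N); last by have := ltn_ord i; lia.
    rewrite (_ : (s.-1 - (s - i.+1) = i)%N); last by have := ltn_ord i; lia.
    rewrite rmorphM -!mulrA; congr (_ * (_ * _)).
    rewrite (_ : s.-1 = (s - i.+1) + i)%N; last by have := ltn_ord i; lia.
    by rewrite exprD mulrA -exprMn mulVf // expr1n mul1r.
have [g [mg sg gf]] := weierstrass_factor p_prime hf m1 mhi.
exfalso; have /dvdpP[q eq] := gf.
have g0 := monic_neq0 mg.
have f0 : f != 0 by rewrite -size_poly_eq0 sf -lt0n.
have q0 : q != 0 by apply/eqP => e; move: f0; rewrite eq e mul0r eqxx.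
have sq : (size q < s)%N.
  have := size_mul q0 g0; rewrite -eq sf sg addnS /= => ->.
  by rewrite -[X in (X < _)%N]addn0 ltn_add2l lt0n.
move: fx; rewrite eq rmorphM rootM => /orP[] /Pmin0 /dvdp_leq.
  by move=> /(_ q0); rewrite -/s leqNgt sq.
by move=> /(_ g0); rewrite -/s sg leqNgt ms.
Qed.

Lemma O_aut (h : {rmorphism C -> C}) x : (forall c, h (iota c) = iota c) ->
  O x -> O (h x).
Proof.
move=> hi [f [mf of_ fx]]; exists f; split=> //; apply/rootP.
have -> : map_poly iota f = map_poly h (map_poly iota f).
  by apply/polyP => i; rewrite !coef_map /= hi.
by rewrite horner_map (rootP fx) rmorph0.
Qed.

(** The maximal ideal of the valuation ring; [0] needs its own clause because [0^-1 = 0] is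
    integral. *)
Definition nonunit x := x = 0 \/ ~ O x^-1.
Local Notation M := nonunit.
Definition isunit x := O x /\ ~ M x.
Local Notation U := isunit.

Lemma M0 : M 0. Proof. by left. Qed.
Lemma M_O x : M x -> O x.
Proof. by case=> [->|h]; [apply: O0|case: (O_total x)]. Qed.
Lemma unitP x : U x <-> [/\ x != 0, O x & O x^-1].
Proof.
split=> [[Ox nM]|[x0 Ox Ox']].
  have x0 : x != 0 by apply/eqP => e; apply: nM; left.
  by split=> //; apply: contrapT => n; apply: nM; right.
by split=> // -[e|//]; rewrite e eqxx in x0.
Qed.
Lemma U_neq0 x : U x -> x != 0. Proof. by move=> /unitP[]. Qed.
Lemma U_O x : U x -> O x. Proof. by case. Qed.
Lemma UV x : U x -> U x^-1.
Proof. by move=> /unitP[x0 h h']; apply/unitP; rewrite invr_eq0 invrK. Qed.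
Lemma U_OV x : U x -> O x^-1. Proof. by move/UV/U_O. Qed.
Lemma U1 : U 1. Proof. by apply/unitP; rewrite invr1 oner_neq0; split=> //; apply: O1. Qed.
Lemma UM x y : U x -> U y -> U (x * y).
Proof.
move=> /unitP[x0 h h'] /unitP[y0 g g']; apply/unitP.
by rewrite mulf_neq0 // invfM; split=> //; apply: OM.
Qed.
Lemma UX x n : U x -> U (x ^+ n).
Proof. by move=> hx; elim: n => [|n IH]; rewrite ?expr0 ?exprS; [apply: U1|apply: UM]. Qed.
Lemma UN x : U x -> U (- x).
Proof.
by move=> /unitP[x0 h h']; apply/unitP; rewrite oppr_eq0 invrN; split=> //; apply: ON.
Qed.
Lemma Uprod (I : Type) (r : seq I) (P : pred I) (F : I -> C) :
  (forall i, P i -> U (F i)) -> U (\prod_(i <- r | P i) F i).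
Proof. by move=> h; apply: (big_ind U) => //; [apply: U1|apply: UM]. Qed.
Lemma U_notM x : U x -> ~ M x. Proof. by case. Qed.
Lemma O_case x : O x -> M x \/ U x.
Proof. by move=> h; have [|] := EM (M x); [left|right]. Qed.
Lemma MM x y : O x -> M y -> M (x * y).
Proof.
move=> Ox My; have [|U_] := O_case (OM Ox (M_O My)) => //.
exfalso; have xy0 := U_neq0 U_.
have x0 : x != 0 by apply: contraNneq xy0 => ->; rewrite mul0r.
have y0 : y != 0 by apply: contraNneq xy0 => ->; rewrite mulr0.
case: My => [e|]; first by rewrite e eqxx in y0.
apply; rewrite (_ : y^-1 = x * (x * y)^-1); last by field; rewrite x0 y0.
exact: OM (U_OV U_).
Qed.
Lemma MMr x y : M x -> O y -> M (x * y).
Proof. by move=> *; rewrite mulrC; apply: MM. Qed.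
(** One of [x / y] and [y / x] is integral, so the sum is an integral multiple of one summand. *)
Lemma MD x y : M x -> M y -> M (x + y).
Proof.
move=> Mx My.
have [->|x0] := eqVneq x 0; first by rewrite add0r.
have [->|y0] := eqVneq y 0; first by rewrite addr0.
case: (O_total (x / y)) => h.
  have -> : x + y = (x / y + 1) * y by field.
  by apply: MM => //; apply: OD => //; apply: O1.
have -> : x + y = ((x / y)^-1 + 1) * x by field; rewrite x0 y0.
by apply: MM => //; apply: OD => //; apply: O1.
Qed.
Lemma MN x : M x -> M (- x).
Proof. by move=> h; rewrite -mulN1r; apply: MM => //; apply: ON; apply: O1. Qed.
Lemma MB x y : M x -> M y -> M (x - y).
Proof. by move=> hx hy; apply: MD (MN _). Qed.
Lemma M1 : ~ M 1. Proof. by have [] := U1. Qed.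
Lemma M_mul x y : O x -> O y -> M (x * y) -> M x \/ M y.
Proof.
move=> /O_case[|Ux]; first by left.
move=> /O_case[|Uy]; first by right.
by have [_ h] := UM Ux Uy.
Qed.
Lemma M_exp x n : O x -> M (x ^+ n) -> M x.
Proof.
move=> Ox; elim: n => [|n IH]; first by rewrite expr0 => /M1.
by rewrite exprS => /(M_mul Ox (OX _ Ox))[].
Qed.
Lemma MX x n : (0 < n)%N -> M x -> M (x ^+ n).
Proof. by case: n => // n _ h; rewrite exprS; apply: MMr => //; apply: OX; apply: M_O. Qed.
Lemma M_prod (I : eqType) (r : seq I) (F : I -> C) :
  (forall i, i \in r -> O (F i)) -> M (\prod_(i <- r) F i) -> exists2 i, i \in r & M (F i).
Proof.
elim: r => [|a r IH] h; first by rewrite big_nil => /M1.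
rewrite big_cons => /M_mul[||h1|h1].
- by apply: h; rewrite inE eqxx.
- by rewrite big_seq; apply: Oprod => i ir; apply: h; rewrite inE ir orbT.
- by exists a => //; rewrite inE eqxx.
- have [i ir Mi] := IH (fun i ir => h i (@mem_behead _ (a :: r) i ir)) h1.
  by exists i => //; rewrite inE ir orbT.
Qed.
Lemma U_D x y : U x -> M y -> U (x + y).
Proof.
move=> Ux My; split; first by apply: OD (U_O Ux) (M_O My).
move=> h; apply: (U_notM Ux); rewrite (_ : x = x + y - y); first exact: MB.
by ring.
Qed.
Lemma U_root x n : (0 < n)%N -> U (x ^+ n) -> U x.
Proof.
move=> n0 Ux; have x0 : x != 0 by apply: contraNneq (U_neq0 Ux) => ->; rewrite expr0n gtn_eqF.
have rt y : O (y ^+ n) -> O y.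
  move=> h; apply: (@O_root ('X^n - (y ^+ n)%:P)).
  - by rewrite monicXnsubC.
  - move=> i; rewrite coefB coefXn coefC.
    by apply: OB; case: (i == _); rewrite ?mulr1n ?mulr0n; [apply: O1|apply: O0|apply: h|apply: O0].
  - by rewrite rootE !hornerE subrr.
by apply/unitP; split=> //; apply: rt; [apply: U_O|rewrite exprVn; apply: U_OV].
Qed.

Lemma aut_inv_iota (h g : {rmorphism C -> C}) : cancel h g ->
  (forall c, h (iota c) = iota c) -> forall c, g (iota c) = iota c.
Proof. by move=> hg hi c; rewrite -{1}(hi c) hg. Qed.

Lemma M_aut (h : {rmorphism C -> C}) x : (forall c, h (iota c) = iota c) ->
  M x -> M (h x).
Proof.
move=> hi [->|n]; first by left; rewrite rmorph0.
right; rewrite -fmorphV => h1; apply: n.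
have [g [hg gh]] := aut_inverse alg hi.
by rewrite -(hg x^-1); apply: O_aut h1 => //; apply: aut_inv_iota hg hi.
Qed.

Lemma U_aut (h : {rmorphism C -> C}) x : (forall c, h (iota c) = iota c) ->
  U x -> U (h x).
Proof.
by move=> hi /unitP[x0 ? ?]; apply/unitP; rewrite fmorph_eq0 -fmorphV; split=> //; apply: O_aut.
Qed.

Lemma M_iota c : padic_abs c < 1 -> M (iota c).
Proof.
move=> hc; have [->|c0] := eqVneq c 0; first by rewrite rmorph0; left.
right; rewrite -fmorphV => /O_iota; rewrite inE padic_absV => h.
have := padic_abs_neq0 c0; have := padic_abs_ge0 c => h1 h2.
have h3 : 0 < padic_abs c by rewrite lt_def h2.
by move: h; rewrite invf_le1 // leNgt hc.
Qed.

Lemma Mp : M p%:R.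
Proof.
rewrite -(rmorph_nat iota); apply: M_iota; rewrite padic_absp //.
by rewrite invf_lt1 ?ltr1n ?ltr0n ?prime_gt1 ?prime_gt0.
Qed.

Lemma U_coprime n : coprime p n -> U n%:R.
Proof.
move=> cpn; split; first exact: OnatR.
move=> h; apply: M1.
have n0 : (0 < n)%N.
  by rewrite lt0n; apply: contraTneq cpn => ->; rewrite /coprime gcdn0 gtn_eqF // prime_gt1.
have [[u v] e] : exists uv : nat * nat, (uv.1 * n = uv.2 * p + 1)%N.
  have [u v e _] := egcdnP p n0; exists (u, v) => /=.
  by rewrite e; move: cpn; rewrite coprime_sym /coprime => /eqP ->.
have : 1 = u%:R * n%:R - v%:R * p%:R :> C.
  by rewrite -!natrM /= e natrD addrC addKr.
move=> ->; apply: MB; apply: MM => //; try exact: OnatR.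
exact: Mp.
Qed.

Lemma charC0 n : (0 < n)%N -> (n%:R : C) != 0.
Proof. by move=> n0; apply: (charC iota). Qed.

(** Submodules of [C] over its ring of integers: one congruence calculus serves the maximal ideal
    and all the principal ideals [multiple z]. *)
Definition Oideal (I : C -> Prop) :=
  [/\ I 0, forall x y, I x -> I y -> I (x - y) & forall x y, O x -> I y -> I (x * y)].

Section Congruence.
Variable I : C -> Prop.
Hypothesis hI : Oideal I.

Lemma idl0 : I 0. Proof. by case: hI. Qed.
Lemma idlB x y : I x -> I y -> I (x - y). Proof. by case: hI => _ h _; apply: h. Qed.
Lemma idlM x y : O x -> I y -> I (x * y). Proof. by case: hI => _ _ h; apply: h. Qed.
Lemma idlMr x y : I x -> O y -> I (x * y). Proof. by rewrite mulrC => *; apply: idlM. Qed.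
Lemma idlN x : I x -> I (- x). Proof. by move=> h; rewrite -sub0r; apply: idlB => //; apply: idl0. Qed.
Lemma idlD x y : I x -> I y -> I (x + y).
Proof. by move=> *; rewrite -[y]opprK; apply: idlB => //; apply: idlN. Qed.
Lemma idl_sum (J : Type) (r : seq J) (P : pred J) (F : J -> C) :
  (forall i, P i -> I (F i)) -> I (\sum_(i <- r | P i) F i).
Proof. by move=> h; apply: (big_ind I) => //; [apply: idl0|apply: idlD]. Qed.

Definition eqm x y := I (x - y).
Lemma eqm_refl x : eqm x x. Proof. by rewrite /eqm subrr; apply: idl0. Qed.
Lemma eqm_sym x y : eqm x y -> eqm y x.
Proof. by rewrite /eqm => /idlN; rewrite opprB. Qed.
Lemma eqm_trans y x z : eqm x y -> eqm y z -> eqm x z.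
Proof. by move=> h h'; have := idlD h h'; rewrite addrA subrK. Qed.
Lemma eqmD x y x' y' : eqm x x' -> eqm y y' -> eqm (x + y) (x' + y').
Proof. by move=> h h'; have := idlD h h'; rewrite addrACA -opprD. Qed.
Lemma eqmN x x' : eqm x x' -> eqm (- x) (- x').
Proof. by move=> /idlN; rewrite opprD. Qed.
Lemma eqmB x y x' y' : eqm x x' -> eqm y y' -> eqm (x - y) (x' - y').
Proof. by move=> h h'; apply: eqmD => //; apply: eqmN. Qed.
Lemma eqmM x y x' y' : O x -> O y' -> eqm x x' -> eqm y y' -> eqm (x * y) (x' * y').
Proof.
move=> Ox Oy' h h'; rewrite /eqm (_ : _ - _ = x * (y - y') + (x - x') * y'); last by ring.
by apply: idlD; [apply: idlM|apply: idlMr].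
Qed.
Lemma eqmX x x' n : O x -> O x' -> eqm x x' -> eqm (x ^+ n) (x' ^+ n).
Proof.
move=> Ox Ox' h; elim: n => [|n IH]; first by rewrite !expr0; apply: eqm_refl.
by rewrite !exprS; apply: eqmM => //; apply: OX.
Qed.
Lemma eqm_sum (J : Type) (r : seq J) (P : pred J) (F G : J -> C) :
  (forall i, P i -> eqm (F i) (G i)) -> eqm (\sum_(i <- r | P i) F i) (\sum_(i <- r | P i) G i).
Proof. by move=> h; rewrite /eqm -sumrB; apply: idl_sum. Qed.
Lemma eqm_prod (J : Type) (r : seq J) (P : pred J) (F G : J -> C) :
  (forall i, P i -> O (F i)) -> (forall i, P i -> O (G i)) ->
  (forall i, P i -> eqm (F i) (G i)) -> eqm (\prod_(i <- r | P i) F i) (\prod_(i <- r | P i) G i).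
Proof.
move=> hF hG h; elim: r => [|a r IH]; first by rewrite !big_nil; apply: eqm_refl.
rewrite !big_cons; case: ifP => // Pa; apply: eqmM => //; try exact: hF; try exact: h.
exact: Oprod.
Qed.
End Congruence.

Lemma M_ideal : Oideal M.
Proof. by split; [apply: M0|apply: MB|apply: MM]. Qed.

(** For [z != 0] this is membership in [z O], the substitute for [v(x) >= v(z)]. For [z = 0] it
    holds of every [x], whence the conditions [z != 0] below. *)
Definition multiple z x := O (x / z).

Lemma multiple_ideal z : Oideal (multiple z).
Proof.
split; rewrite /multiple; first by rewrite mul0r; apply: O0.
  by move=> x y hx hy; rewrite mulrBl; apply: OB.
by move=> x y hx hy; rewrite -mulrA; apply: OM.
Qed.

Lemma multiple_M z x : z != 0 -> M z -> multiple z x -> M x.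
Proof. by move=> z0 Mz h; rewrite -(divfK z0 x); apply: MM. Qed.
Lemma multiple_O z x : z != 0 -> O z -> multiple z x -> O x.
Proof. by move=> z0 Oz h; rewrite -(divfK z0 x); apply: OM. Qed.
Lemma multiple_mul z w x y : multiple z x -> multiple w y -> multiple (z * w) (x * y).
Proof.
move=> h h'; rewrite /multiple (_ : _ / _ = (x / z) * (y / w)); first exact: OM.
by rewrite invfM mulrACA.
Qed.
Lemma multiple_exp z x n : multiple z x -> multiple (z ^+ n) (x ^+ n).
Proof. by move=> h; rewrite /multiple -exprVn -exprMn; apply: OX. Qed.
Lemma multiple_trans z w x : w != 0 -> multiple z w -> multiple w x -> multiple z x.
Proof.
move=> w0 h h'; rewrite /multiple (_ : _ / _ = (x / w) * (w / z)); first exact: OM.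
by rewrite mulrA divfK.
Qed.
Lemma multiple_self z : z != 0 -> multiple z z.
Proof. by move=> z0; rewrite /multiple divff //; apply: O1. Qed.
Lemma multiple_powW z m l x : z != 0 -> O z -> (l <= m)%N -> multiple (z ^+ m) x -> multiple (z ^+ l) x.
Proof.
move=> z0 Oz lm; apply: multiple_trans; first exact: expf_neq0.
rewrite /multiple -(subnK lm) exprD mulfK ?expf_neq0 //; exact: OX.
Qed.
Lemma multiple_mull z w x : multiple z x -> O w -> multiple z (w * x).
Proof. by move=> h Ow; rewrite /multiple -mulrA; apply: OM. Qed.
Lemma multiple_mulr z w x : multiple z x -> O w -> multiple z (x * w).
Proof. by rewrite mulrC => *; apply: multiple_mull. Qed.
Lemma multiple_unit z u x : U u -> multiple z x <-> multiple (z * u) x.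
Proof.
move=> Uu; rewrite /multiple invfM mulrA; split=> h; first by apply: OM => //; apply: U_OV.
by rewrite -[X in O X](mulfVK (U_neq0 Uu)); apply: OM => //; apply: U_O.
Qed.
Lemma multiple_aut (h : {rmorphism C -> C}) z x : (forall c, h (iota c) = iota c) ->
  multiple z x -> multiple (h z) (h x).
Proof. by move=> hi; rewrite /multiple -fmorph_div; apply: O_aut. Qed.

Lemma padic_denominator (g : {poly Qp}) :
  exists N, forall i, p%:R ^+ N * g`_i \in @Zp p Qp.
Proof.
suff h n : exists N, forall i, (i < n)%N -> p%:R ^+ N * g`_i \in @Zp p Qp.
  have [N hN] := h (size g); exists N => i; have [|ige] := ltnP i (size g); first exact: hN.
  by rewrite nth_default // mulr0 inE padic_abs0 ler01.
elim: n => [|n [N IH]]; first by exists 0%N.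
have p0 : (p%:R : rat) != 0 by rewrite pnatr_eq0 -lt0n prime_gt0.
have p1 : 1 <= (p%:R : rat) by rewrite ler1n prime_gt0.
have Zm (a b : Qp) : a \in @Zp p Qp -> b \in @Zp p Qp -> a * b \in @Zp p Qp.
  by rewrite !inE => ha hb; rewrite padic_absM mulr_ile1 ?padic_abs_ge0.
have pX m : padic_abs (p%:R ^+ m : Qp) = p%:R ^- m.
  by rewrite padic_absX padic_absp // exprVn.
have [m hm] : exists m, p%:R ^+ m * g`_n \in @Zp p Qp.
  have [->|gn0] := eqVneq g`_n 0; first by exists 0%N; rewrite mulr0 inE padic_abs0.
  have [k ek] := padic_abs_exprz gn0; exists `|k|%N; rewrite inE padic_absM pX ek.
  rewrite exprnN -expfzDr // -(expr0z (p%:R : rat)) ler_weXz2l //; lia.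
exists (N + m)%N => i; rewrite ltnS leq_eqVlt => /orP[/eqP ->|/IH h].
  rewrite exprD -mulrA; apply: Zm => //.
  by rewrite inE pX invf_le1 ?exprn_ege1 // exprn_gt0 // (lt_le_trans ltr01).
rewrite exprD (mulrC (p%:R ^+ N)) -mulrA; apply: Zm => //.
by rewrite inE pX invf_le1 ?exprn_ege1 // exprn_gt0 // (lt_le_trans ltr01).
Qed.

(** For integral [x != 0], [x^-1] is a polynomial in [x] over [Qp], and a power of [p] clears its
    denominators. *)
Lemma multiple_ppow x : x != 0 -> exists N, multiple x (p%:R ^+ N).
Proof.
move=> x0; case: (O_total x) => [Ox|h]; last by exists 0%N; rewrite expr0 /multiple mul1r.
have [g eg] := inv_poly alg x0; have [N hN] := padic_denominator g.
exists N; rewrite /multiple eg -(rmorph_nat iota) -rmorphXn -hornerZ -map_polyZ /=.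
by apply: Ohorner => // i; rewrite coef_map coefZ; apply: O_iotaW.
Qed.

(** In a monic integral equation of [z], let [j] be the least index of a unit coefficient: the terms
    from [j] on add up to [z^j] times a unit, and the earlier ones are divisible by [p]. *)
Lemma M_pow_multiple_p z : M z -> exists k, multiple p%:R (z ^+ k).
Proof.
move=> Mz; have Oz := M_O Mz; have [f [mf /polyOverP hf fz]] := Oz.
have ex : exists i, padic_abs f`_i == 1.
  exists (size f).-1; rewrite -lead_coefE (monicP mf) padic_abs1 //.
case: (ex_minnP ex) => j /eqP j1 jmin.
have p0 : (p%:R : C) != 0 by apply: charC0; apply: prime_gt0.
have := rootP fz; rewrite -(poly_take_drop j f) rmorphD rmorphM /= map_polyXn hornerD hornerM hornerXn.
set a := (map_poly iota (drop_poly j f)).[z]; set b := _.[z] => e.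
have Ua : U a.
  have -> : a = iota f`_j + (a - iota f`_j) by ring.
  apply: U_D.
    apply/unitP; rewrite fmorph_eq0; split; last first.
    - by rewrite -fmorphV; apply: O_iotaW; rewrite inE padic_absV j1 invr1.
    - exact: O_iotaW.
    - by apply/eqP => e0; move: j1; rewrite e0 padic_abs0 => /esym/eqP; rewrite oner_eq0.
  have [s0|s0] := posnP (size (drop_poly j f)).
    move: s0 => /eqP; rewrite size_poly_eq0 => /eqP d0.
    have : (drop_poly j f)`_0 = 0 by rewrite d0 coef0.
    by rewrite coef_drop_poly add0n /a d0 rmorph0 horner0 => ->; rewrite rmorph0 subrr; apply: M0.
  rewrite /a horner_coef size_map_poly -(prednK s0) big_ord_recl coef_map coef_drop_poly add0n expr0 mulr1.
  rewrite addrAC subrr add0r; apply: (idl_sum M_ideal) => i _; rewrite /= exprS mulrA mulrAC.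
  apply: MM => //; apply: OM; last exact: OX.
  by rewrite coef_map coef_drop_poly; apply: O_iotaW.
exists j; move: e => /eqP; rewrite addr_eq0 => /eqP e.
have -> : z ^+ j = - b / a by rewrite e opprK mulrAC divff ?mul1r // U_neq0.
rewrite /multiple mulrAC; apply: OM (U_OV Ua); rewrite mulNr; apply: ON.
rewrite -/(multiple _ _) /b horner_coef; apply: (idl_sum (multiple_ideal _)) => i _.
apply: multiple_mulr; last exact: OX.
rewrite coef_map /= coef_take_poly; case: ltnP => hij; last by rewrite rmorph0 /multiple mul0r; apply: O0.
rewrite /multiple -(rmorph_nat iota) -fmorph_div; apply: O_iotaW; rewrite inE.
have : padic_le 1 f`_i.
  apply: padic_lt1 => //; rewrite lt_neqAle; apply/andP; split; last by have := hf i; rewrite inE.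
  by apply/negP => /jmin; rewrite leqNgt hij.
rewrite /padic_le expr1 padic_absM padic_absV padic_absp // invrK => h.
by rewrite -ler_pdivlMr ?ltr0n ?prime_gt0 // mul1r.
Qed.

(** The valuation has rank one: some power of [z] is divisible by [p], and some power of [p] by
    [x]. *)
Lemma archimedean z x : M z -> x != 0 -> exists k, multiple x (z ^+ k).
Proof.
move=> Mz x0; have [N hN] := multiple_ppow x0; have [k hk] := M_pow_multiple_p Mz.
exists (k * N)%N; rewrite exprM; apply: multiple_trans hN _.
  by rewrite expf_neq0 // charC0 // prime_gt0.
exact: multiple_exp.
Qed.

(** Separatedness of the [z]-adic topology; equalities that one would obtain by passing to a limit
    are proved through it. *)
Lemma multiple_pow_eq0 z x : M z -> z != 0 -> (forall k, multiple (z ^+ k) x) -> x = 0.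
Proof.
move=> Mz z0 h; apply/eqP/negPn/negP => x0.
have [k hk] := archimedean Mz x0.
case: Mz => [e|]; first by rewrite e eqxx in z0.
apply; have := OM hk (h k.+1).
by rewrite exprS (_ : _ * _ = z^-1) //; field; rewrite x0 z0 expf_neq0.
Qed.

End Valuation.

Arguments O0 {p Qp C iota}.
Arguments O1 {p Qp C iota}.
Arguments M0 {p Qp C iota}.
Arguments M1 {p Qp C iota}.
Arguments U1 {p Qp C iota}.
Arguments Mp {p Qp C iota HC}.
Arguments M_ideal {p Qp C iota HC}.
Arguments charC0 {p Qp C iota HC} [n].

(** * Roots of unity of order prime to p *)

Section RootsOfUnity.
Variables (p : nat) (Qp : padicField p) (C : closedFieldType).
Variable iota : {rmorphism Qp -> C}.
Context {HC : padic_closure iota}.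
Let p_prime : prime p := pc_prime.
Let alg : forall y : C, algebraicOver iota y := pc_alg.
Implicit Types (K : set C) (x y z : C).
Local Notation O := (integral iota).
Local Notation M := (nonunit iota).
Local Notation U := (isunit iota).
Local Notation eqM := (eqm M).
Let MI : Oideal iota M := M_ideal.

Lemma coprime_gt0 N : coprime p N -> (0 < N)%N.
Proof.
by rewrite lt0n; apply: contraTneq => ->; rewrite /coprime gcdn0 gtn_eqF // prime_gt1.
Qed.

(** Together with [0] these are the Teichmuller representatives of the residue field of [C]. *)
Definition ru z := exists2 N, coprime p N & z ^+ N = 1.

Lemma ru1 : ru 1. Proof. by exists 1%N; rewrite ?coprimen1 ?expr1n. Qed.
Lemma ruM a b : ru a -> ru b -> ru (a * b).
Proof.
move=> [m cm am] [n cn bn]; exists (m * n)%N; first by rewrite coprimeMr cm.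
by rewrite exprMn exprM am expr1n mul1r mulnC exprM bn expr1n.
Qed.
Lemma ruX a n : ru a -> ru (a ^+ n).
Proof. by move=> h; elim: n => [|n IH]; rewrite ?expr0 ?exprS; [apply: ru1|apply: ruM]. Qed.
Lemma ruV a : ru a -> ru a^-1.
Proof. by move=> [m cm am]; exists m => //; rewrite exprVn am invr1. Qed.
Lemma ru_U a : ru a -> U a.
Proof. by move=> [m cm am]; apply: (U_root (coprime_gt0 cm)); rewrite am; apply: U1. Qed.
Lemma ru_aut (h : {rmorphism C -> C}) a : ru a -> ru (h a).
Proof. by move=> [m cm am]; exists m => //; rewrite -rmorphXn am rmorph1. Qed.

(** If [c = a / b] is congruent to [1] but different from it, the geometric sum of its powers is
    zero and yet congruent to the unit [N]. *)
Lemma ru_inj a b : ru a -> ru b -> M (a - b) -> a = b.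
Proof.
move=> ra rb h; have Ub := ru_U rb; have b0 := U_neq0 Ub.
have [N cN cc] := ruM ra (ruV rb); set c := a / b in cc.
have Mc : M (c - 1).
  have -> : c - 1 = (a - b) / b by rewrite /c; field.
  by apply: MMr => //; apply: U_OV.
have [/eqP|c1] := boolP (c - 1 == 0).
  by move/eqP; rewrite subr_eq0 => /eqP e; rewrite -(divfK b0 a) -/c e mul1r.
have Oc : O c by rewrite -(subrK 1 c); apply: OD (M_O Mc) O1.
exfalso; apply: (U_notM (U_coprime cN)).
have : 0 = (c - 1) * \sum_(i < N) c ^+ i by rewrite -subrX1 cc subrr.
move=> /esym/eqP; rewrite mulf_eq0 (negPf c1) /= => /eqP s0.
rewrite (_ : N%:R = - (\sum_(i < N) (c ^+ i - 1))).
  apply: MN; apply: (idl_sum MI) => i _; rewrite subrX1; apply: MMr => //.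
  by apply: Osum => j _; apply: OX.
by rewrite sumrB s0 sub0r opprK sumr_const card_ord.
Qed.

Lemma exists_prim_root N : (0 < N)%N -> exists z : C, N.-primitive_root z.
Proof.
move=> N0; have [r er] := closed_field_poly_normal ('X^N - 1 : {poly C}).
have l1 : lead_coef ('X^N - 1 : {poly C}) = 1.
  by apply/eqP; rewrite -monicE -(polyC1 C) monicXnsubC.
rewrite l1 scale1r in er.
have ur : uniq r.
  by rewrite -separable_prod_XsubC -er separable_Xn_sub_1 // (charC0 (iota := iota)).
have sr : size r = N.
  by have := size_XnsubC (1 : C) N0; rewrite polyC1 er size_prod_XsubC => -[].
have ar : all N.-unity_root r.
  by apply/allP => z zr; rewrite /root_of_unity er root_prod_XsubC.
have := has_prim_root N0 ar ur; rewrite sr leqnn => /(_ isT) /hasP[z _ pz].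
by exists z.
Qed.

Lemma prim_ru N z : coprime p N -> N.-primitive_root z -> ru z.
Proof. by move=> c pz; exists N => //; apply: prim_expr_order. Qed.

Lemma ru_common a b : ru a -> ru b -> exists c, [/\ ru c,
  exists m, a = c ^+ m & exists m, b = c ^+ m].
Proof.
move=> [m cm am] [n cn bn].
have cmn : coprime p (m * n) by rewrite coprimeMr cm.
have [c pc] := exists_prim_root (coprime_gt0 cmn).
exists c; split; first exact: prim_ru pc.
  have : a ^+ (m * n) = 1 by rewrite exprM am expr1n.
  by move=> /(prim_rootP pc)[i ->]; exists i.
have : b ^+ (m * n) = 1 by rewrite mulnC exprM bn expr1n.
by move=> /(prim_rootP pc)[i ->]; exists i.
Qed.

Lemma frobD x y : O x -> O y -> eqM ((x + y) ^+ p) (x ^+ p + y ^+ p).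
Proof.
move=> Ox Oy; have pp : p = p.-1.+1 by rewrite prednK // prime_gt0.
have aux n : (x + y) ^+ n.+1 = x ^+ n.+1 + y ^+ n.+1 +
    \sum_(i < n) x ^+ (n - i)%N * y ^+ i.+1 *+ 'C(n.+1, i.+1).
  rewrite exprDn big_ord_recl big_ord_recr /= subn0 bin0 expr0 mulr1 mulr1n.
  by rewrite /bump /= add1n binn subnn expr0 mul1r mulr1n addrA addrAC.
rewrite /eqm; have := aux p.-1; rewrite -pp => ->.
rewrite addrAC subrr add0r; apply: (idl_sum MI) => i _.
rewrite -mulr_natr; apply: MM; first by apply: OM; apply: OX.
have /dvdnP[k ->] : (p %| 'C(p, i.+1))%N.
  by apply: prime_dvd_bin => //; have := ltn_ord i; lia.
by rewrite natrM; apply: MM; [apply: OnatR|apply: Mp].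
Qed.

Lemma frobq_D f x y : O x -> O y ->
  eqM ((x + y) ^+ (p ^ f)%N) (x ^+ (p ^ f)%N + y ^+ (p ^ f)%N).
Proof.
move=> Ox Oy; elim: f => [|f IH]; first by rewrite expn0 !expr1; apply: (eqm_refl MI).
rewrite expnSr !exprM; apply: (eqm_trans MI) (frobD (OX _ Ox) (OX _ Oy)).
by apply: (eqmX MI) => //; try apply: OD; apply: OX; try apply: OD.
Qed.

Lemma frobq_inj f x y : O x -> O y -> eqM (x ^+ (p ^ f)%N) (y ^+ (p ^ f)%N) -> eqM x y.
Proof.
move=> Ox Oy h; have Oxy : O (x - y) by apply: OB.
apply: (M_exp Oxy (n := (p ^ f)%N)).
have := frobq_D f Oxy Oy; rewrite subrK => h1.
have := eqm_trans MI (eqm_sym MI h1) h; rewrite /eqm.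
by rewrite addrK.
Qed.

Lemma frobq_sum f (I : Type) (r : seq I) (F : I -> C) : (forall i, O (F i)) ->
  eqM ((\sum_(i <- r) F i) ^+ (p ^ f)%N) (\sum_(i <- r) F i ^+ (p ^ f)%N).
Proof.
move=> h; elim: r => [|a r IH].
  by rewrite !big_nil expr0n expn_eq0 (gtn_eqF (prime_gt0 p_prime)) /=; apply: (eqm_refl MI).
rewrite !big_cons; apply: (eqm_trans MI (frobq_D f (h a) (Osum _ _))) => [i _|]; first exact: h.
by apply: (eqmD MI) => //; apply: (eqm_refl MI).
Qed.

Lemma frobq_horner f (P : {poly C}) x : O x -> (forall i, O P`_i) ->
  (forall i, eqM (P`_i ^+ (p ^ f)%N) P`_i) ->
  eqM (P.[x] ^+ (p ^ f)%N) P.[x ^+ (p ^ f)%N].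
Proof.
move=> Ox OP hP; rewrite !horner_coef.
apply: (eqm_trans MI (frobq_sum _ _ _)) => [i|]; first by apply: OM => //; apply: OX.
apply: (eqm_sum MI) => i _; rewrite exprMn -!exprM [(i * _)%N]mulnC.
by apply: (eqmM MI) => //; [apply: OX|apply: OX|apply: (eqm_refl MI)].
Qed.

(** The product of [x - z] over the roots [z] of [X^k - 1] lies in the maximal ideal, which is
    prime. *)
Lemma teichmuller x k : O x -> coprime p k -> eqM (x ^+ k) 1 ->
  exists2 z, z ^+ k = 1 & eqM x z.
Proof.
move=> Ox cpk h; have k0 := coprime_gt0 cpk.
have [r er] := closed_field_poly_normal ('X^k - 1 : {poly C}).
have l1 : lead_coef ('X^k - 1 : {poly C}) = 1.
  by apply/eqP; rewrite -monicE -(polyC1 C) monicXnsubC.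
rewrite l1 scale1r in er.
have rt z : z \in r -> z ^+ k = 1.
  rewrite -root_prod_XsubC -er rootE !hornerE subr_eq0; by move/eqP.
have : M (\prod_(z <- r) (x - z)).
  have -> : \prod_(z <- r) (x - z) = ('X^k - 1).[x].
    by rewrite er horner_prod; apply: eq_bigr => z _; rewrite !hornerE.
  by rewrite !hornerE.
move=> /M_prod[z zr|z zr Mz]; last by exists z => //; apply: rt.
by apply: OB => //; apply: U_O; apply: ru_U; exists k => //; apply: rt.
Qed.

Lemma teich_q f x : O x -> eqM (x ^+ (p ^ f)%N) x -> (0 < f)%N ->
  exists2 z, z ^+ (p ^ f)%N = z & eqM x z.
Proof.
move=> Ox h f0; have [Mx|Ux] := O_case Ox.
  exists 0; first by rewrite expr0n expn_eq0 (gtn_eqF (prime_gt0 p_prime)).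
  by rewrite /eqm subr0.
have q1 : (1 < p ^ f)%N by rewrite -(exp1n f) ltn_exp2r // prime_gt1.
have eq : (p ^ f = (p ^ f).-1.+1)%N by rewrite prednK // ltnW.
have cq : coprime p (p ^ f).-1.
  have : coprime (p ^ f) (p ^ f).-1 by rewrite {1}eq coprimeSn.
  by rewrite coprime_pexpl.
have h1 : eqM (x ^+ (p ^ f).-1) 1.
  rewrite /eqm (_ : _ - _ = (x ^+ (p ^ f)%N - x) / x); first by apply: MMr h (U_OV Ux).
  by have x0 := U_neq0 Ux; rewrite {2}eq exprS; field.
have [z zk xz] := teichmuller Ox cq h1.
by exists z => //; rewrite eq exprS zk mulr1.
Qed.

Lemma ru_q f z : (0 < f)%N -> z != 0 -> z ^+ (p ^ f)%N = z -> ru z.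
Proof.
move=> f0 z0 h.
have q1 : (1 < p ^ f)%N by rewrite -(exp1n f) ltn_exp2r // prime_gt1.
have eq : (p ^ f = (p ^ f).-1.+1)%N by rewrite prednK // ltnW.
exists (p ^ f).-1.
  have : coprime (p ^ f) (p ^ f).-1 by rewrite {1}eq coprimeSn.
  by rewrite coprime_pexpl.
by apply: (mulfI z0); rewrite mulr1 -exprS -eq.
Qed.

(** Interpolation: after division by [X - a], the values at the other nodes only get divided by
    differences of nodes, which are units. It converts information on the values at conjugates into
    information on coefficients. *)
Lemma ideal_coef (I : C -> Prop) (Y : seq C) (R : {poly C}) : Oideal iota I ->
  uniq Y -> (forall a, a \in Y -> O a) ->
  (forall a b, a \in Y -> b \in Y -> a != b -> U (a - b)) ->
  (size R <= size Y)%N -> (forall w, w \in Y -> I R.[w]) -> forall i, I R`_i.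
Proof.
move=> hI; elim: Y R => [|a Y IH] R uY OY dY sR hR i.
  by move: sR; rewrite /= leqn0 size_poly_eq0 => /eqP ->; rewrite coef0; apply: (idl0 hI).
have eR : R = (R %/ ('X - a%:P)) * ('X - a%:P) + (R.[a])%:P.
  by rewrite {1}(divp_eq R ('X - a%:P)) modp_XsubC.
set R' := R %/ _ in eR.
have sR' : (size R' <= size Y)%N.
  by rewrite /R' size_divp ?polyXsubC_eq0 // size_XsubC subn1 -ltnS; case: (size R) sR.
move: uY => /= /andP[aY uY].
have aa : a \in a :: Y by rewrite inE eqxx.
have hR' j : I R'`_j.
  apply: IH => //.
  - by move=> b bY; apply: OY; rewrite inE bY orbT.
  - by move=> b c bY cY; apply: dY; rewrite inE ?bY ?cY orbT.
  - move=> w wY; have wa : w != a by apply: contraNneq aY => <-.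
    have Uw : U (w - a) by apply: dY => //; rewrite inE wY orbT.
    have wa0 : w - a != 0 by rewrite subr_eq0.
    have -> : R'.[w] = (w - a)^-1 * (R.[w] - R.[a]).
      rewrite {1}eR hornerD hornerM !hornerE addrK mulrC mulfK //.
    apply: (idlM hI); first exact: U_OV.
    by apply: (idlB hI); apply: hR; rewrite // inE wY orbT.
rewrite eR mulrBr coefD coefB coefMX coefMC coefC.
apply: (idlD hI).
  apply: (idlB hI); last by apply: (idlMr hI) => //; apply: OY.
  by case: (i == 0)%N => //; apply: (idl0 hI).
by case: (i == 0)%N; [apply: hR|apply: (idl0 hI)].
Qed.

Lemma horner_eqM (P R : {poly C}) x : O x -> (forall i, eqM P`_i R`_i) -> eqM P.[x] R.[x].
Proof.
move=> Ox h; rewrite /eqm -hornerN -hornerD horner_coef; apply: (idl_sum MI) => i _.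
by apply: MMr; [rewrite coefB; apply: h|apply: OX].
Qed.

(** Cut [P] after its last unit coefficient. Nothing changes modulo the maximal ideal, and the
    truncation has integral roots in [C]; a zero of [P] modulo the maximal ideal is congruent to one
    of them. *)
Lemma residue_roots (P : {poly C}) : (forall i, O P`_i) -> (exists i, ~ M P`_i) ->
  exists r : seq C, (size r < size P)%N /\
    forall z, O z -> M P.[z] -> exists2 w, w \in r & eqM z w.
Proof.
move=> OP [i0 hi0].
have ub i : `[< ~ M P`_i >] -> (i <= size P)%N.
  move=> /asboolP h; rewrite leqNgt; apply/negP => hi; apply: h.
  by rewrite nth_default; [apply: M0|apply: ltnW].
have ex : exists i, `[< ~ M P`_i >] by exists i0; apply/asboolP.
case: (ex_maxnP ex ub) => m /asboolP mP mmax.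
have ms : (m < size P)%N.
  by rewrite ltnNge; apply/negP => h; apply: mP; rewrite nth_default //; apply: M0.
have Um : U P`_m by split.
pose P1 := \poly_(i < m.+1) P`_i.
have s1 : size P1 = m.+1 by apply: size_poly_eq; apply: U_neq0.
have l1 : lead_coef P1 = P`_m by rewrite lead_coefE s1 coef_poly ltnSn.
have [r er] := closed_field_poly_normal P1.
have Or w : w \in r -> O w.
  move=> wr; apply: (@O_root _ _ _ _ ((P`_m)^-1 *: P1)).
  - by rewrite monicE lead_coefZ l1 mulVf // (U_neq0 Um).
  - move=> i; rewrite coefZ coef_poly; case: ifP => _; last by rewrite mulr0; apply: O0.
    by apply: OM => //; apply: U_OV.
  - by rewrite rootZ ?invr_eq0 ?(U_neq0 Um) // er rootZ ?root_prod_XsubC // l1 (U_neq0 Um).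
exists r; split.
  have := congr1 (fun P : {poly C} => size P) er.
  by rewrite size_scale ?l1 ?(U_neq0 Um) // size_prod_XsubC s1 => -[<-].
move=> z Oz Mz.
have : M P1.[z].
  rewrite -(subrK P.[z] P1.[z]); apply: MD => //; apply: horner_eqM => // i.
  rewrite coef_poly; case: ltnP => hi; first exact: (eqm_refl MI).
  rewrite /eqm sub0r; apply: MN; apply: contrapT => h.
  by have := mmax i (asboolT h); rewrite leqNgt hi.
rewrite er hornerZ l1 horner_prod => /M_mul[||/(U_notM Um)//|].
- exact: OP.
- rewrite big_seq; apply: Oprod => w wr; rewrite !hornerE; apply: OB => //.
  exact: Or.
- move=> /M_prod[w wr|w wr Mw]; first by rewrite !hornerE; apply: OB => //; apply: Or.
  by exists w => //; move: Mw; rewrite !hornerE.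
Qed.

(** The powers [x^(q^i)] remain residual roots of [P], of which there are fewer than [size P]; two
    of them agree by the pigeonhole principle, and Frobenius is injective on residues. *)
Lemma residue_period f (P : {poly C}) x : (forall i, O P`_i) ->
  (forall i, eqM (P`_i ^+ (p ^ f)%N) P`_i) -> (exists i, ~ M P`_i) -> O x -> M P.[x] ->
  exists b, (0 < b <= size P)%N /\ eqM (x ^+ ((p ^ f) ^ b)%N) x.
Proof.
move=> OP hP nP Ox Px; have [r [sr hr]] := residue_roots OP nP.
pose q := (p ^ f)%N.
have xq i : M P.[x ^+ (q ^ i)%N].
  elim: i => [|i IH]; first by rewrite expn0 expr1.
  rewrite expnSr exprM.
  have h := frobq_horner (OX (q ^ i)%N Ox) OP hP.
  rewrite -(subKr (P.[x ^+ (q ^ i)%N] ^+ (p ^ f)%N) P.[_ ^+ q]).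
  by apply: MB => //; apply: MX => //; rewrite expn_gt0 prime_gt0.
have /choice[w hw] : forall i : 'I_(size P), exists w, w \in r /\ eqM (x ^+ (q ^ i)%N) w.
  by move=> i; have [w wr h] := hr _ (OX (q ^ i)%N Ox) (xq i); exists w.
have ninj : ~~ injectiveb w.
  apply/negP => /injectiveP inj.
  have uc : uniq (map w (enum 'I_(size P))) by rewrite map_inj_uniq ?enum_uniq.
  have := uniq_leq_size uc (_ : {subset _ <= r}); rewrite size_map size_enum_ord leqNgt sr.
  suff h : {subset map w (enum 'I_(size P)) <= r} by move=> /(_ h).
  by move=> _ /mapP[i _ ->]; have [] := hw i.
move/injectivePn: ninj => [i [j nij ewij]].
wlog lij : i j nij ewij / (i < j)%N.
  move=> H; have [/H h|h] := boolP (i < j)%N; first exact: h.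
  apply: (H j i) => //; first by rewrite eq_sym.
  by rewrite ltn_neqAle leqNgt h andbT eq_sym; apply: contraNneq nij => e; apply/eqP/val_inj.
exists (j - i)%N; split; first by rewrite subn_gt0 lij /= (leq_trans (leq_subr _ _)) // ltnW.
apply: (@frobq_inj (f * i)) => //; first exact: OX.
rewrite -exprM expnM -expnD subnK; last exact: ltnW.
apply: (eqm_trans MI (hw j).2); rewrite -ewij; apply: (eqm_sym MI); exact: (hw i).2.
Qed.

Lemma period_mul q b c x : O x -> eqM (x ^+ (q ^ b)%N) x -> (b %| c)%N -> eqM (x ^+ (q ^ c)%N) x.
Proof.
move=> Ox h /dvdnP[k ->]; elim: k => [|k IH].
  by rewrite mul0n expn0 expr1; apply: (eqm_refl MI).
rewrite mulSn expnD exprM; apply: (eqm_trans MI _ IH).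
by apply: (eqmX MI) => //; apply: OX.
Qed.

(** For [q] a power of [p]: the residue field of [K] is contained in the field with [q] elements.
    The reverse inclusion is [full_resid]. *)
Definition resid K q := forall x, K x -> O x -> eqM (x ^+ q) x.

Lemma resid_iota : resid (range iota) p.
Proof.
move=> _ [c _ <-] /O_iota hc; rewrite /eqm -rmorphXn -rmorphB; apply: M_iota.
exact: padic_fermat.
Qed.

Lemma dominant_coef (P : {poly C}) : P != 0 ->
  exists i0, P`_i0 != 0 /\ forall i, O (P`_i / P`_i0).
Proof.
move=> P0.
suff h n : (exists i, (i < n)%N && (P`_i != 0)) ->
    exists i0, P`_i0 != 0 /\ forall i, (i < n)%N -> O (P`_i / P`_i0).
  have [|i0 [h0 hi]] := h (size P).
    exists (size P).-1; rewrite -lead_coefE lead_coef_eq0 P0 andbT ltn_predL.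
    by rewrite size_poly_gt0.
  exists i0; split=> // i; have [/hi//|hi'] := ltnP i (size P).
  by rewrite nth_default // mul0r; apply: O0.
elim: n => [|n IH] [i /andP[lin i0]] //.
have [e|ne] := eqVneq P`_n 0.
  have [|i1 [h1 hi]] := IH.
    exists i; rewrite i0 andbT ltn_neqAle -ltnS lin andbT.
    by apply: contraNneq i0 => ->; rewrite e.
  exists i1; split=> // k; rewrite ltnS leq_eqVlt => /orP[/eqP ->|/hi//].
  by rewrite e mul0r; apply: O0.
have [ex|nex] := EM (exists i, (i < n)%N && (P`_i != 0)); last first.
  exists n; split=> // k; rewrite ltnS leq_eqVlt => /orP[/eqP ->|lk].
    by rewrite divff //; apply: O1.
  have -> : P`_k = 0.
    by apply/eqP/negPn/negP => h; apply: nex; exists k; rewrite lk.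
  by rewrite mul0r; apply: O0.
have [i1 [h1 hi]] := IH ex.
have [h|h] := O_total (P`_n / P`_i1).
  exists i1; split=> // k; rewrite ltnS leq_eqVlt => /orP[/eqP ->//|/hi//].
exists n; split=> // k; rewrite ltnS leq_eqVlt => /orP[/eqP ->|lk].
  by rewrite divff //; apply: O1.
rewrite (_ : _ / _ = (P`_k / P`_i1) * (P`_n / P`_i1)^-1); first by apply: OM => //; apply: hi.
by field; rewrite h1.
Qed.

Lemma finite_dependence K L d (e : 'rV[C]_d) x : subfield iota K -> subfield iota L ->
  is_basis K L e -> L x ->
  exists P : {poly C}, [/\ P != 0, forall i, K P`_i, (size P <= d.+1)%N & P.[x] = 0].
Proof.
move=> sK sL [Le be] Lx; have [k [j hj]] := subfield_fieldType sK.
have /choice[c hc] : forall i : 'I_d.+1, exists c : 'cV[C]_d, (forall l, K (c l 0)) /\ (e *m c) 0 0 = x ^+ i.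
  by move=> i; have [c [h _]] := be _ (subfieldX i sL Lx); exists c.
have /choice[a ha] : forall il : 'I_d.+1 * 'I_d, exists a, c il.1 il.2 0 = j a.
  by move=> il; apply/hj; have [h _] := hc il.1; apply: h.
pose A := \matrix_(i < d.+1, l < d) a (i, l).
have nA : kermx A != 0.
  rewrite kermx_eq0 /row_free; apply/eqP => rA.
  by have := rank_leq_col A; rewrite rA ltnn.
pose v := nz_row (kermx A).
have v0 : v != 0 by rewrite nz_row_eq0.
have vA : v *m A = 0 by apply/sub_kermxP; apply: nz_row_sub.
exists (\poly_(i < d.+1) (if insub i is Some i' then j (v 0 i') else 0)); split.
- apply: contra_neq v0 => P0; apply/rowP => i; rewrite mxE; apply: (fmorph_inj j).
  have := congr1 (fun P : {poly C} => P`_i) P0; rewrite coef_poly ltn_ord coef0 valK rmorph0.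
  by [].
- move=> i; rewrite coef_poly; case: ifP => _; last exact: subfield0 sK.
  by case: insubP => [i' _ _|_]; [apply/hj; eexists|apply: subfield0 sK].
- exact: size_poly.
- rewrite horner_poly; transitivity (\sum_(i < d.+1) j (v 0 i) * (e *m c i) 0 0).
    by apply: eq_bigr => i _; rewrite valK (hc i).2.
  rewrite (eq_bigr (fun i => \sum_l e 0 l * j (v 0 i * A i l))); last first.
    move=> i _; rewrite mxE mulr_sumr; apply: eq_bigr => l _.
    by rewrite rmorphM mxE -(ha (i, l)) /=; ring.
  rewrite exchange_big big1 // => l _; rewrite -mulr_sumr -rmorph_sum /=.
  have := congr1 (fun B : 'rV[k]_d => B 0 l) vA; rewrite !mxE => ->.
  by rewrite rmorph0 mulr0.
Qed.

(** An integer of [L] is a residual root of a polynomial of degree at most [d] over [K]; its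
    Frobenius period is thus at most [d + 1], and [(d + 1)!] is a common multiple of all such
    periods. *)
Lemma resid_finite K L d (e : 'rV[C]_d) f : subfield iota K -> subfield iota L ->
  is_basis K L e -> resid K (p ^ f) -> resid L ((p ^ f) ^ (d.+1)`!)%N.
Proof.
move=> sK sL be rK x Lx Ox.
have [P [P0 KP sP Px]] := finite_dependence sK sL be Lx.
have [i0 [h0 hi]] := dominant_coef P0.
pose P' := (P`_i0)^-1 *: P.
have c' i : P'`_i = P`_i / P`_i0 by rewrite coefZ mulrC.
have [|||||b [b0 hb]] := @residue_period f P' x.
- by move=> i; rewrite c'.
- by move=> i; rewrite c'; apply: rK => //; apply: (subfield_div sK).
- by exists i0; rewrite c' divff //; apply: M1.
- exact: Ox.
- by rewrite hornerZ Px mulr0; apply: M0.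
apply: period_mul hb _ => //; apply: dvdn_fact.
by move: b0; rewrite size_scale ?invr_eq0 // => /andP[-> h]; apply: leq_trans sP.
Qed.

End RootsOfUnity.

(** * Unramified extensions *)

Section Unramified.
Variables (p : nat) (Qp : padicField p) (C : closedFieldType).
Variable iota : {rmorphism Qp -> C}.
Context {HC : padic_closure iota}.
Let p_prime : prime p := pc_prime.
Let alg : forall y : C, algebraicOver iota y := pc_alg.
Implicit Types (K L : set C) (x y z pi : C) (g h : {rmorphism C -> C}).
Local Notation O := (integral iota).
Local Notation M := (nonunit iota).
Local Notation U := (isunit iota).
Local Notation eqM := (eqm M).
Local Notation adj := (adjoin iota).
Let MI : Oideal iota M := M_ideal.

Lemma unitsP K x : subfield iota K -> units iota K x <-> K x /\ U x.
Proof.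
move=> sK; split=> [[[Kx Ox] [y [Ky Oy] e]]|[Kx Ux]].
  have x0 : x != 0 by apply: contra_eq_neq e => ->; rewrite mul0r eq_sym oner_neq0.
  split=> //; apply/unitP; split=> //.
  by rewrite (_ : x^-1 = y) //; apply: (mulfI x0); rewrite divff.
split; first by split=> //; apply: U_O.
exists x^-1; last by rewrite divff // (U_neq0 Ux).
by split; [apply: (subfieldV sK)|apply: U_OV].
Qed.

Lemma max_idealP K x : subfield iota K -> max_ideal iota K x <-> K x /\ M x.
Proof.
move=> sK; split=> [[[Kx Ox] nu]|[Kx Mx]].
  split=> //; have [//|Ux] := O_case Ox.
  by exfalso; apply: nu; apply/unitsP.
split; first by split=> //; apply: M_O.
by move=> /unitsP[//|_ /U_notM].
Qed.

Definition unif K pi :=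
  [/\ K pi, pi != 0, M pi & forall x, K x -> M x -> multiple iota pi x].

Lemma p_neq0 : (p%:R : C) != 0.
Proof. by apply: (charC0 (iota := iota)); apply: prime_gt0. Qed.

Lemma prime_elementP K pi : subfield iota K -> prime_element iota K pi <-> unif K pi.
Proof.
move=> sK; split.
  move=> [/max_idealP[//|Kpi Mpi] h].
  have pi0 : pi != 0.
    apply/eqP => e; have [|y _] := h p%:R.
      by apply/max_idealP => //; split; [apply: subfield_nat sK|apply: Mp].
    by rewrite e mul0r => e0; have := p_neq0; rewrite e0 eqxx.
  split=> // x Kx Mx; have [|y [_ Oy] ->] := h x; first by apply/max_idealP.
  by rewrite /multiple mulrAC divff ?mul1r.
move=> [Kpi pi0 Mpi h]; split; first by apply/max_idealP.
move=> x /max_idealP[//|Kx Mx]; exists (x / pi); last by rewrite mulrC divfK.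
by split; [apply: subfield_div sK _ _|apply: h].
Qed.

Lemma unif_decomp K pi x : subfield iota K -> unif K pi -> K x -> O x -> x != 0 ->
  exists a : nat, U (x / pi ^+ a).
Proof.
move=> sK [Kpi pi0 Mpi hpi] Kx Ox x0.
have [N hN] := archimedean Mpi x0.
elim: N x Kx Ox x0 hN => [|N IH] x Kx Ox x0 hN.
  by exists 0%N; rewrite expr0 divr1; apply/unitP; split=> //; move: hN; rewrite /multiple expr0 mul1r.
have [Mx|Ux] := O_case Ox; last by exists 0%N; rewrite expr0 divr1.
have [||||a ha] := IH (x / pi).
- exact: subfield_div sK _ _.
- exact: hpi.
- by rewrite mulf_neq0 ?invr_eq0.
- move: hN; rewrite /multiple exprS invfM invrK.
  by rewrite (_ : pi * pi ^+ N / x = pi ^+ N * (x^-1 * pi)) //; ring.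
by exists a.+1; rewrite exprS invfM mulrA.
Qed.

Lemma unif_decompz K pi x : subfield iota K -> unif K pi -> K x -> x != 0 ->
  exists a : int, U (x / pi ^ a).
Proof.
move=> sK hpi Kx x0; have [Ox|Ox] := O_total x.
  by have [a ha] := unif_decomp sK hpi Kx Ox x0; exists a%:Z; rewrite -exprnP.
have [|a ha] := unif_decomp sK hpi (subfieldV sK Kx) Ox; first by rewrite invr_eq0.
exists (- a%:Z); rewrite -exprnN invrK.
by rewrite -[x]invrK -[pi ^+ a]invrK -invfM; apply: UV.
Qed.

Lemma fixes_adjoin K z g h : subfield iota K -> fixes K g -> fixes K h -> g z = h z ->
  forall y, (adj K z) y -> g y = h y.
Proof.
move=> sK hg hh e; apply: adjoin_min => //.
  by apply: agree_subfield => c; rewrite (fixes_iota sK hg) (fixes_iota sK hh).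
by move=> x Kx /=; rewrite hg ?hh.
Qed.

(** [Y] is the orbit of [xi] under the automorphisms over [K]. Its elements differ by units, which
    makes it a set of nodes for [ideal_coef]. *)
Lemma ru_conj K xi : subfield iota K -> ru p xi ->
  exists Y : seq C, [/\ uniq Y, xi \in Y,
    forall w, w \in Y -> ru p w /\ exists2 h, fixes K h & h xi = w,
    forall i, K (\prod_(w <- Y) ('X - w%:P))`_i &
    forall y, (adj K xi) y -> exists P : {poly C}, [/\ forall i, K P`_i, (size P <= size Y)%N & y = P.[xi]]].
Proof.
move=> sK [N cN xiN].
have [r er] := closed_field_poly_normal ('X^N - 1 : {poly C}).
have l1 : lead_coef ('X^N - 1 : {poly C}) = 1.
  by apply/eqP; rewrite -monicE -(polyC1 C) monicXnsubC // (coprime_gt0 cN).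
rewrite l1 scale1r in er.
have rt z : (z \in r) = (z ^+ N == 1).
  by rewrite -root_prod_XsubC -er rootE !hornerE subr_eq0.
pose Y := [seq w <- undup r | `[< exists2 h, fixes K h & h xi = w >]].
have YP w : w \in Y <-> exists2 h, fixes K h & h xi = w.
  rewrite mem_filter mem_undup; split; first by case/andP => /asboolP.
  move=> [h hK <-]; apply/andP; split; first by apply/asboolP; exists h.
  by rewrite rt -rmorphXn xiN rmorph1.
have uY : uniq Y by rewrite filter_uniq // undup_uniq.
have xiY : xi \in Y by apply/YP; exists idfun.
have KG i : K (\prod_(w <- Y) ('X - w%:P))`_i.
  apply: (fixed_mem alg p_prime sK) => h hK.
  rewrite -coef_map rmorph_prod /=; congr (_`_i).
  rewrite (eq_bigr (fun w => 'X - (h w)%:P)); last by move=> w _; rewrite rmorphB /= map_polyX map_polyC.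
  rewrite -(big_map h xpredT (fun w => 'X - w%:P)).
  first [rewrite (perm_big Y)|apply: (@perm_big {poly C} 1 *%R)|apply/perm_big|exact: perm_big].
    by [].
  have um : uniq (map h Y) by rewrite map_inj_uniq //; apply: fmorph_inj.
  have sub : {subset map h Y <= Y}.
    move=> _ /mapP[w /YP[h' h'K <-] ->]; apply/YP; exists (h \o h') => //.
    by move=> x Kx /=; rewrite h'K // hK.
  apply: uniq_perm => //.
  by have [_ e] := uniq_min_size um sub (eq_leq (esym (size_map h Y))).
exists Y; split=> //.
  move=> w wY; split; last exact/YP.
  by have /YP[h hK <-] := wY; apply: ru_aut; exists N.
have [k [j hj]] := subfield_fieldType sK.
have /choice[l hl] : forall i, exists a, (\prod_(w <- Y) ('X - w%:P))`_i = j a by move=> i; apply/hj.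
set G := \prod_(w <- Y) _ in KG hl.
pose g := \poly_(i < size G) l i.
have eg : map_poly j g = G.
  apply/polyP => i; rewrite coef_map coef_poly; case: ltnP => h /=; first by rewrite -hl.
  by rewrite rmorph0 nth_default.
have G0 : G != 0 by rewrite monic_neq0 // monic_prod_XsubC.
have g0 : g != 0 by rewrite -(map_poly_eq0 j) eg.
move=> y /(adjoin_poly alg sK hj)[P ->].
exists (map_poly j (P %% g)); split.
- by move=> i; rewrite coef_map; apply/hj; eexists.
- by rewrite size_map_poly -ltnS -(size_prod_XsubC Y (fun w => w)) -/G -eg size_map_poly ltn_modp.
- rewrite {1}(divp_eq P g) rmorphD rmorphM /= hornerD hornerM eg.
  suff -> : G.[xi] = 0 by rewrite mulr0 add0r.
  by apply/rootP; rewrite root_prod_XsubC.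
Qed.

Lemma ru_diff a b : ru p a -> ru p b -> a != b -> U (a - b).
Proof.
move=> ra rb nab; split; first by apply: OB; apply: U_O; apply: ru_U.
by move=> h; move/eqP: nab; apply; apply: ru_inj h.
Qed.

Lemma horner_fixes K h (P : {poly C}) x : fixes K h -> (forall i, K P`_i) -> h P.[x] = P.[h x].
Proof.
move=> hK KP; rewrite -horner_map; congr (_.[_]).
by apply/polyP => i; rewrite coef_map /= hK.
Qed.

(** The values of [P] on the orbit of [xi] are conjugates of [y], which lie in the stable ideal [I];
    interpolation gives the coefficients. With [I] the integers this says that [xi] generates the
    integers of [K(xi)] over those of [K]; with [I] the maximal ideal, that a uniformizer of [K]
    remains one. *)
Lemma adjoin_ru_ideal K xi (I : C -> Prop) y : subfield iota K -> ru p xi ->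
  Oideal iota I -> (forall h, fixes K h -> forall x, I x -> I (h x)) ->
  (adj K xi) y -> I y ->
  exists P : {poly C}, (forall i, K P`_i /\ I P`_i) /\ y = P.[xi].
Proof.
move=> sK rxi hI Ih Ky Iy; have [Y [uY xiY hY _ hP]] := ru_conj sK rxi.
have [P [KP sP eP]] := hP _ Ky.
exists P; split=> // i; split=> //.
apply: (ideal_coef hI uY _ _ sP).
- by move=> a /hY[ra _]; apply: U_O; apply: ru_U.
- by move=> a b /hY[ra _] /hY[rb _]; apply: ru_diff.
- move=> w /hY[_ [h hK <-]]; rewrite -(horner_fixes _ hK KP) -eP.
  exact: Ih.
Qed.

Lemma adjoin_ru_unif K xi pi : subfield iota K -> ru p xi -> unif K pi -> unif ((adj K xi)) pi.
Proof.
move=> sK rxi [Kpi pi0 Mpi hpi]; split=> //; first exact: adjoin_base.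
move=> x Kx Mx.
have [|P [hP ->]] := adjoin_ru_ideal sK rxi MI _ Kx Mx.
  by move=> h hK z; apply: M_aut; apply: fixes_iota hK.
rewrite horner_coef; apply: (idl_sum (multiple_ideal iota _)) => i _.
apply: multiple_mulr; last by apply: OX; apply: U_O; apply: ru_U.
by apply: hpi; have [] := hP i.
Qed.

Lemma adjoin_ru_int K xi y : subfield iota K -> ru p xi -> (adj K xi) y -> O y ->
  exists P : {poly C}, (forall i, K P`_i /\ O P`_i) /\ y = P.[xi].
Proof.
move=> sK rxi Ky Oy; apply: (adjoin_ru_ideal sK rxi) => //.
  by split; [apply: O0|apply: OB|apply: OM].
by move=> h hK z; apply: O_aut; apply: fixes_iota hK.
Qed.

Lemma power_basis K L z m : subfield iota K -> (forall i, L (z ^+ i)) ->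
  (forall y, L y -> exists P : {poly C}, [/\ forall i, K P`_i, (size P <= m)%N & y = P.[z]]) ->
  (forall P : {poly C}, (forall i, K P`_i) -> (size P <= m)%N -> P.[z] = 0 -> P = 0) ->
  is_basis K L (\row_(i < m) z ^+ i).
Proof.
move=> sK Lz sp fr; split=> [i|y Ly]; first by rewrite mxE.
have [P [KP sP eP]] := sp _ Ly.
have ev (c : 'cV[C]_m) : (\row_(i < m) z ^+ i *m c) 0 0 = (\sum_(i < m) c i 0 *: 'X^i).[z].
  by rewrite mxE horner_sum; apply: eq_bigr => i _; rewrite mxE !hornerE mulrC.
have co (c : 'cV[C]_m) (i : 'I_m) : (\sum_(l < m) c l 0 *: 'X^l)`_i = c i 0.
  rewrite coef_sum (bigD1 i) //= big1 => [|l li]; first by rewrite coefZ coefXn eqxx mulr1 addr0.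
  by rewrite coefZ coefXn eq_sym; case: eqP => [e|]; rewrite ?mulr0 //; case/eqP: li; apply: val_inj.
have sc (c : 'cV[C]_m) : (size (\sum_(l < m) c l 0 *: 'X^l : {poly C})%R <= m)%N.
  apply: (leq_trans (size_sum _ _ _)); apply/bigmax_leqP => l _.
  by rewrite (leq_trans (size_scale_leq _ _)) // size_polyXn.
have Kc (c : 'cV[C]_m) : (forall i, K (c i 0)) -> forall i, K (\sum_(l < m) c l 0 *: 'X^l)`_i.
  move=> h i; rewrite coef_sum. apply: (subfield_sum _ sK) => l _; rewrite coefZ coefXn.
  by apply: (subfieldM sK) => //; apply: subfield_nat sK.
exists (\col_i P`_i); split.
  split=> [i|]; first by rewrite mxE.
  rewrite ev eP horner_sum (horner_coef_wide _ sP); apply: eq_bigr => i _.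
  by rewrite mxE !hornerE.
move=> c' [Kc' ec']; apply/colP => i; rewrite mxE -co.
have : P - \sum_(l < m) c' l 0 *: 'X^l = 0.
  apply: fr.
  - by move=> l; rewrite coefB; apply: (subfieldB sK) => //; apply: Kc.
  - by rewrite (leq_trans (size_polyD _ _)) // geq_max sP size_polyN sc.
  - by rewrite hornerD hornerN -ev ec' eP subrr.
by move/eqP; rewrite subr_eq0 => /eqP ->.
Qed.

Lemma adjoin_ru_finite K xi : subfield iota K -> ru p xi ->
  finite_extension iota K ((adj K xi)).
Proof.
move=> sK rxi; have [Y [uY xiY hY _ hP]] := ru_conj sK rxi.
split=> //; first exact: adjoin_subfield.
  by move=> x; apply: adjoin_base.
exists (size Y), (\row_i xi ^+ i); apply: power_basis => //.
  by move=> i; apply: (subfieldX i (adjoin_subfield xi sK)); apply: adjoin_gen.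
move=> P KP sP Pxi; apply/eqP/negPn/negP => P0.
have := max_poly_roots P0 (_ : all (root P) Y) uY; rewrite ltnNge sP => H.
suff: false by []; apply: H; apply/allP => w /hY[_ [h hK <-]].
by apply/rootP; rewrite -(horner_fixes _ hK KP) Pxi rmorph0.
Qed.

(** The explicit form of the maximal unramified extension, identified with [max_unramified] in
    [max_unramifiedE]. *)
Definition ur K : set C := [set y | exists2 xi, ru p xi & (adj K xi) y].

Lemma adjoin_pow K xi m y : subfield iota K -> (adj K (xi ^+ m)) y -> (adj K xi) y.
Proof.
move=> sK; have sKx := adjoin_subfield xi sK.
apply: adjoin_min => //; first by move=> x; apply: adjoin_base.
by apply: (subfieldX m sKx); apply: adjoin_gen.
Qed.

Lemma ur_subfield K : subfield iota K -> subfield iota (ur K).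
Proof.
move=> sK.
have dir x y : ur K x -> ur K y -> exists2 xi, ru p xi & (adj K xi) x /\ (adj K xi) y.
  move=> [a ra ax] [b rb bY]; have [c [rc [m em] [n en]]] := ru_common (HC := HC) ra rb.
  by exists c => //; split; [apply: (@adjoin_pow _ _ m)|apply: (@adjoin_pow _ _ n)]; rewrite // -?em -?en.
split.
- move=> _ [c _ <-]; exists 1; first exact: ru1.
  by apply: adjoin_base; apply: subfield_iota.
- move=> x y hx hy; have [xi rxi [ux uy]] := dir _ _ hx hy; exists xi => //.
  exact: (subfieldB (adjoin_subfield xi sK)).
- move=> x y hx hy; have [xi rxi [ux uy]] := dir _ _ hx hy; exists xi => //.
  exact: (subfieldM (adjoin_subfield xi sK)).
- by move=> x [xi rxi ux]; exists xi => //; apply: (subfieldV (adjoin_subfield xi sK)).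
Qed.

Lemma ur_base K x : K x -> ur K x.
Proof. by move=> Kx; exists 1; [apply: ru1|apply: adjoin_base]. Qed.

Lemma ur_ru K z : ru p z -> ur K z.
Proof. by move=> rz; exists z => //; apply: adjoin_gen. Qed.

Lemma ur_unif K pi : subfield iota K -> unif K pi -> unif (ur K) pi.
Proof.
move=> sK upi; have [Kpi pi0 Mpi hpi] := upi; split=> //; first exact: ur_base.
move=> x [xi rxi ux]; have [_ _ _] := adjoin_ru_unif sK rxi upi.
by apply.
Qed.

Lemma ur_agree K g h : subfield iota K -> (forall x, K x -> g x = h x) ->
  (forall z, ru p z -> g z = h z) -> forall y, ur K y -> g y = h y.
Proof.
move=> sK e1 e2 y [xi rxi]; move: y; apply: adjoin_min => //; last exact: e2.
by apply: agree_subfield => c; apply: e1; apply: subfield_iota.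
Qed.

Lemma adjoin_image K L z h : subfield iota K -> subfield iota L ->
  (forall c, h (iota c) = iota c) -> (forall x, K x -> L (h x)) ->
  forall y, (adj K z) y -> (adj L (h z)) (h y).
Proof.
move=> sK sL hi hK; apply: adjoin_min.
- have sLz := adjoin_subfield (h z) sL; split=> /=.
  + by move=> _ [c _ <-] /=; rewrite hi; apply: subfield_iota.
  + by move=> x y hx hy; rewrite rmorphB; apply: (subfieldB sLz).
  + by move=> x y hx hy; rewrite rmorphM; apply: (subfieldM sLz).
  + by move=> x hx; rewrite fmorphV; apply: (subfieldV sLz).
- by move=> x Kx; apply: adjoin_base; apply: hK.
- exact: adjoin_gen.
Qed.

Lemma ur_image K L h : subfield iota K -> subfield iota L ->
  (forall c, h (iota c) = iota c) -> (forall x, K x -> L (h x)) ->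
  forall y, ur K y -> ur L (h y).
Proof.
move=> sK sL hi hK y [xi rxi ux]; exists (h xi); first exact: ru_aut.
exact: adjoin_image ux.
Qed.

Lemma ur_mono K L : subfield iota L -> (forall x, K x -> L x) -> forall y, ur K y -> ur L y.
Proof.
move=> sL KL y [xi rxi ux]; exists xi => //; move: ux; apply: adjoin_min.
- exact: adjoin_subfield.
- by move=> x /KL; apply: adjoin_base.
- exact: adjoin_gen.
Qed.

(** Adjoin a root of unity [xi] of order [p^g - 1], with [g] large enough to represent the residues
    of [L]. As [pi] is a uniformizer of both fields, integers of [L(xi)] have expansions in [pi]
    with digits in [K(xi)]; an automorphism over [K(xi)] then moves them by multiples of every power
    of [pi], hence not at all. *)
Lemma unramified_ur K L : subfield iota K ->
  (exists2 f, (0 < f)%N & resid iota K (p ^ f)) -> unramified iota K L ->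
  forall y, L y -> ur K y.
Proof.
move=> sK [f f0 rK] [[_ sL KL [d [e be]]] [pi /(prime_elementP _ sK) hK /(prime_elementP _ sL) hL]].
have [Kpi pi0 Mpi _] := hK.
have rL := resid_finite sK sL be rK.
set g := (f * (d.+1)`!)%N.
have eR : ((p ^ f) ^ (d.+1)`! = p ^ g)%N by rewrite -expnM.
rewrite eR in rL.
have g0 : (0 < g)%N by rewrite muln_gt0 f0 fact_gt0.
have q1 : (1 < p ^ g)%N by rewrite -(exp1n g) ltn_exp2r // prime_gt1.
have cq : coprime p (p ^ g).-1.
  have : coprime (p ^ g) (p ^ g).-1 by rewrite -{1}(prednK (ltnW q1)) coprimeSn.
  by rewrite coprime_pexpl.
have [xi pxi] := exists_prim_root (iota := iota) (coprime_gt0 cq).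
have rxi : ru p xi := prim_ru cq pxi.
have xiq : xi ^+ (p ^ g)%N = xi.
  by rewrite -(prednK (ltnW q1)) exprS (prim_expr_order pxi) mulr1.
have sL' := adjoin_subfield xi sL.
have rL' : resid iota ((adj L xi)) (p ^ g).
  move=> x Lx Ox; have [P [hP ->]] := adjoin_ru_int sL rxi Lx Ox.
  have Oxi : O xi by apply: U_O; apply: ru_U.
  apply: (eqm_trans MI); first apply: (@frobq_horner _ _ _ _ _ g P xi) => //.
  - by move=> i; have [] := hP i.
  - by move=> i; have [h1 h2] := hP i; apply: rL.
  - by rewrite xiq; apply: (eqm_refl MI).
have [_ _ _ hL'] := adjoin_ru_unif sL rxi hL.
have sK' := adjoin_subfield xi sK.
have KxL : forall x, (adj K xi) x -> (adj L xi) x.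
  apply: (@adjoin_min _ _ _ _ K xi (adj L xi) sL') => [z /KL|]; [exact: adjoin_base|exact: adjoin_gen].
have ap k : forall y, (adj L xi) y -> O y -> exists2 l, (adj K xi) l & multiple iota (pi ^+ k) (y - l).
  elim: k => [|k IH] y Ly Oy.
    exists 0; first exact: subfield0 sK'.
    by rewrite /multiple subr0 expr0 divr1.
  have [z zq yz] := teich_q Oy (rL' _ Ly Oy) g0.
  have Kz : (adj K xi) z.
    have [->|z0] := eqVneq z 0; first exact: subfield0 sK'.
    have : z ^+ (p ^ g).-1 = 1.
      by apply: (mulfI z0); rewrite mulr1 -exprS prednK ?zq // ltnW.
    move=> /(prim_rootP pxi)[i ->]; apply: (subfieldX i sK'); exact: adjoin_gen.
  have Lw : (adj L xi) ((y - z) / pi).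
    apply: (subfield_div sL'); last by apply: adjoin_base; apply: KL.
    by apply: (subfieldB sL') => //; apply: KxL.
  have Ow : O ((y - z) / pi) by apply: hL' => //; apply: (subfieldB sL') => //; apply: KxL.
  have [l Kl hl] := IH _ Lw Ow.
  exists (z + pi * l).
    apply: (subfieldD sK') => //; apply: (subfieldM sK') => //; exact: adjoin_base.
  move: hl; rewrite /multiple exprS invfM.
  have pk : pi ^+ k != 0 by rewrite expf_neq0.
  rewrite (_ : (y - (z + pi * l)) * (pi^-1 * pi ^- k) = ((y - z) / pi - l) / pi ^+ k) //.
  by field; rewrite pi0 pk.
have intL y : (adj L xi) y -> O y -> (adj K xi) y.
  move=> Ly Oy; apply: (fixed_mem alg p_prime sK') => h hK'.
  apply/eqP; rewrite -subr_eq0; apply/eqP; apply: (multiple_pow_eq0 Mpi pi0) => k.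
  have [l Kl hl] := ap k _ Ly Oy.
  rewrite (_ : h y - y = (h y - l) - (y - l)); last by ring.
  apply: (idlB (multiple_ideal iota _)) => //.
  have := multiple_aut (fixes_iota sK' hK') hl.
  by rewrite rmorphXn rmorphB (hK' l) // (hK' pi) //; apply: adjoin_base.
move=> y Ly; exists xi => //; have Ly' := adjoin_base (z := xi) Ly.
have [Oy|Oy] := O_total y; first exact: intL.
by rewrite -[y]invrK; apply: (subfieldV sK'); apply: intL => //; apply: (subfieldV sL').
Qed.

Lemma max_unramifiedE K pi : subfield iota K -> unif K pi ->
  (exists2 f, (0 < f)%N & resid iota K (p ^ f)) -> max_unramified iota K = ur K.
Proof.
move=> sK upi rK; apply/seteqP; split=> y.
  by move=> [L uL Ly]; apply: unramified_ur uL _ Ly.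
move=> [xi rxi ux]; exists ((adj K xi)) => //; split; first exact: adjoin_ru_finite.
exists pi; first exact/prime_elementP.
by apply/prime_elementP; [apply: adjoin_subfield|apply: adjoin_ru_unif].
Qed.

(** The morphism sends [P.[xi]] to [P.[xi^q]] with [q = p^f], and the point is single-valuedness.
    The orbit polynomial [G] of [xi] has coefficients fixed by Frobenius on residues, so [G.[xi^q]]
    is congruent to [G.[xi]^q = 0]; hence [xi^q] is congruent, and therefore equal, to a conjugate
    of [xi]. *)
Lemma frobenius_exists K f : subfield iota K -> resid iota K (p ^ f) ->
  exists2 h, fixes K h & forall z, ru p z -> h z = z ^+ (p ^ f)%N.
Proof.
move=> sK rK.
have key xi (P : {poly C}) : ru p xi -> (forall i, K P`_i) -> P.[xi] = 0 -> P.[xi ^+ (p ^ f)%N] = 0.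
  move=> rxi KP Pxi; have [Y [uY xiY hY KG _]] := ru_conj sK rxi.
  set G := \prod_(w <- Y) _ in KG.
  have Oxi : O xi by apply: U_O; apply: ru_U.
  have OG i : O G`_i.
    (* [G] has degree [size Y], so one node more than the orbit is needed; [0] also differs from
       roots of unity by units. *)
    apply: (@ideal_coef _ _ _ iota O (0 :: Y)) => //; rewrite /G ?size_prod_XsubC //=.
    - by split; [apply: O0|apply: OB|apply: OM].
    - rewrite uY andbT; apply/negP => /hY[/(ru_U (iota := iota))/U_neq0]; by rewrite eqxx.
    - move=> a; rewrite inE => /orP[/eqP ->|/hY[/(ru_U (iota := iota))/U_O]//]; exact: O0.
    - move=> a b; rewrite !inE => /orP[/eqP ->|/hY[ra _]] /orP[/eqP ->|/hY[rb _]]; rewrite ?eqxx //.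
      + by move=> _; rewrite sub0r; apply: UN; apply: ru_U.
      + by move=> _; rewrite subr0; apply: ru_U.
      + exact: ru_diff.
    - move=> w; rewrite inE => /orP[/eqP ->|wY].
        rewrite horner_prod big_seq; apply: Oprod => z /hY[rz _]; rewrite hornerXsubC sub0r.
        by apply: ON; apply: U_O; apply: ru_U.
      by rewrite (rootP (_ : root _ w)) ?root_prod_XsubC //; apply: O0.
  have := frobq_horner (HC := HC) Oxi OG (fun i => rK _ (KG i) (OG i)).
  have -> : G.[xi] = 0 by apply/rootP; rewrite root_prod_XsubC.
  have qn : (p ^ f)%N != 0%N by rewrite -lt0n expn_gt0 prime_gt0.
  rewrite expr0n (negPf qn) /= /eqm sub0r => /MN; rewrite opprK horner_prod.
  move=> /M_prod[w wY|w wY].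
    by rewrite !hornerE; apply: OB; [apply: OX|apply: U_O; apply: ru_U; have [] := hY _ wY].
  rewrite !hornerE => h; have [rw [s sK' es]] := hY _ wY.
  rewrite (ru_inj (ruX _ rxi) rw h) -es -(horner_fixes _ sK' KP) Pxi.
  by rewrite rmorph0.
have KP0 (P R : {poly C}) m n : (forall i, K P`_i) -> (forall i, K R`_i) ->
    forall i, K ((P \Po 'X^m) - (R \Po 'X^n))`_i.
  move=> KP KR i; rewrite coefB; apply: (subfieldB sK).
    rewrite comp_polyE coef_sum; apply: (subfield_sum _ sK) => l _.
    by rewrite coefZ -exprM coefXn; apply: (subfieldM sK) => //; apply: subfield_nat sK.
  rewrite comp_polyE coef_sum; apply: (subfield_sum _ sK) => l _.
  by rewrite coefZ -exprM coefXn; apply: (subfieldM sK) => //; apply: subfield_nat sK.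
pose G0 : set (C * C) := [set a | exists xi (P : {poly C}),
  [/\ ru p xi, forall i, K P`_i & a = (P.[xi], P.[xi ^+ (p ^ f)%N])]].
have com a b : G0 a -> G0 b -> exists xi (P R : {poly C}), [/\ ru p xi, forall i, K P`_i,
    forall i, K R`_i, a = (P.[xi], P.[xi ^+ (p ^ f)%N]) & b = (R.[xi], R.[xi ^+ (p ^ f)%N])].
  move=> [x1 [P1 [r1 K1 ->]]] [x2 [P2 [r2 K2 ->]]].
  have [c [rc [m em] [n en]]] := ru_common (HC := HC) r1 r2.
  have Kc (P : {poly C}) m' : (forall i, K P`_i) -> forall i, K (P \Po 'X^m')`_i.
    move=> KP i; have := KP0 P 0 m' 0%N KP; rewrite comp_poly0 subr0; apply.
    by move=> l; rewrite coef0; apply: subfield0 sK.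
  exists c, (P1 \Po 'X^m), (P2 \Po 'X^n); split=> //; try exact: Kc.
    by rewrite !horner_comp !hornerXn em -!exprM mulnC.
  by rewrite !horner_comp !hornerXn en -!exprM mulnC.
have [|h hh] := @hom_graph_extend _ _ _ iota alg G0.
  split.
  - move=> c; exists 1, (iota c)%:P; split; first exact: ru1.
      by move=> i; rewrite coefC; case: eqP => _; [apply: subfield_iota|apply: subfield0 sK].
    by rewrite !hornerC.
  - move=> a b ha hb; have [xi [P [R [rxi KP KR -> ->]]]] := com _ _ ha hb.
    exists xi, (P - R); split=> //; last by rewrite /= !hornerD !hornerN.
    by move=> i; rewrite coefB; apply: (subfieldB sK).
  - move=> a b ha hb; have [xi [P [R [rxi KP KR -> ->]]]] := com _ _ ha hb.
    exists xi, (P * R); split=> //; last by rewrite /= !hornerM.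
    by move=> i; rewrite coefM; apply: (subfield_sum _ sK) => l _; apply: (subfieldM sK).
  - move=> y [xi [P [rxi KP [e ->]]]]; apply: key => //.
exists h.
  move=> x Kx; have := hh (x, x); apply; exists 1, x%:P; split; rewrite ?hornerC //; first exact: ru1.
  by move=> i; rewrite coefC; case: eqP => _ //; apply: subfield0 sK.
move=> z rz; have := hh (z, z ^+ (p ^ f)%N); apply; exists z, 'X; split; rewrite ?hornerX //.
by move=> i; rewrite coefX; apply: subfield_nat sK.
Qed.

End Unramified.

(** * Residue fields, Eisenstein extensions and p-th roots of units *)

Lemma posint_succ (z : int) : 0 <= z -> z != 0 -> exists k : nat, z = k.+1%:Z.
Proof. by case: z => [[|k]|k] // _ _; exists k. Qed.

(** Write [Q = m * p^a] with [m] prime to [p]. Modulo [p] the binomial coefficient of index [p^a] is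
    [m], so the hypothesis forces that index to be [Q] itself. *)
Lemma prime_power_binomial p Q : prime p -> (1 < Q)%N ->
  (forall k, (0 < k < Q)%N -> (p %| 'C(Q, k))%N) -> exists2 f, (0 < f)%N & Q = (p ^ f)%N.
Proof.
move=> p_prime Q1 h.
have Q0 : (0 < Q)%N by apply: ltnW.
pose a := logn p Q; pose m := (Q %/ p ^ a)%N.
have eQ : Q = (m * p ^ a)%N by rewrite /m divnK // pfactor_dvdnn.
have pm : ~~ (p %| m)%N.
  apply/negP => /dvdnP[k ek]; have : (p ^ a.+1 %| Q)%N by rewrite eQ ek -mulnA -expnS dvdn_mull.
  by rewrite pfactor_dvdn // ltnn.
have m0 : (0 < m)%N by rewrite lt0n; apply: contraTneq pm => ->; rewrite dvdn0.
have [m1|m1] := eqVneq m 1%N.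
  exists a; last by rewrite eQ m1 mul1n.
  by rewrite lt0n; apply: contraTneq Q1 => a0; rewrite eQ m1 a0.
have m2 : (1 < m)%N by rewrite ltn_neqAle eq_sym m1.
have pa0 : (0 < p ^ a)%N by rewrite expn_gt0 prime_gt0.
have : (p %| 'C(Q, p ^ a))%N by apply: h; rewrite pa0 eQ -{1}[(p ^ a)%N]mul1n ltn_pmul2r.
have chp : p \in [pchar {poly 'F_p}] by rewrite pchar_poly pchar_Fp.
have e1 : ('X + 1 : {poly 'F_p}) ^+ Q = ('X^(p ^ a) + 1) ^+ m.
  by rewrite eQ mulnC exprM exprDn_pchar ?pnatX ?pnatE ?chp // expr1n.
have c1 : (('X + 1 : {poly 'F_p}) ^+ Q)`_(p ^ a) = 'C(Q, p ^ a)%:R.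
  have lt : (p ^ a < Q.+1)%N by rewrite ltnS eQ leq_pmull.
  rewrite addrC exprDn coef_sum (bigD1 (Ordinal lt)) //= big1 ?addr0 => [|i ni].
    by rewrite expr1n mul1r coefMn coefXn eqxx.
  rewrite expr1n mul1r coefMn coefXn; case: eqP => [e|]; rewrite ?mul0rn //.
  by case/eqP: ni; apply: val_inj.
have c2 : (('X^(p ^ a) + 1 : {poly 'F_p}) ^+ m)`_(p ^ a) = m%:R.
  have lt : (1 < m.+1)%N by rewrite ltnS.
  rewrite addrC exprDn coef_sum (bigD1 (Ordinal lt)) //= big1 ?addr0 => [|i ni].
    by rewrite expr1n mul1r coefMn expr1 coefXn eqxx bin1.
  rewrite expr1n mul1r coefMn -exprM coefXn; case: eqP => [e|]; rewrite ?mul0rn //.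
  case/eqP: ni; apply: val_inj => /=; apply/eqP.
  by rewrite -(eqn_pmul2l pa0) muln1 -e.
move=> /dvdnP[k ek]; move: c1; rewrite e1 c2 ek natrM pchar_Fp_0 // mulr0 => e.
by move: pm; rewrite (dvdn_pcharf (pchar_Fp p_prime)) e eqxx.
Qed.

Section Residues.
Variables (p : nat) (Qp : padicField p) (C : closedFieldType).
Variable iota : {rmorphism Qp -> C}.
Context {HC : padic_closure iota}.
Let p_prime : prime p := pc_prime.
Let alg : forall y : C, algebraicOver iota y := pc_alg.
Implicit Types (K L : set C) (x y z pi : C) (g h : {rmorphism C -> C}).
Local Notation O := (integral iota).
Local Notation M := (nonunit iota).
Local Notation U := (isunit iota).
Local Notation eqM := (eqm M).
Local Notation adj := (adjoin iota).
Local Notation mult := (multiple iota).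
Let MI : Oideal iota M := M_ideal.

Lemma teich_seq f : (0 < f)%N -> exists T : seq C, [/\ uniq T, size T = (p ^ f)%N,
  forall z, (z \in T) = (z ^+ (p ^ f)%N == z), 0 \in T & forall a, a \in T -> a = 0 \/ ru p a].
Proof.
move=> f0.
have q1 : (1 < p ^ f)%N by rewrite -(exp1n f) ltn_exp2r // prime_gt1.
have q2 : (0 < (p ^ f).-1)%N by rewrite -subn1 subn_gt0.
have [r er] := closed_field_poly_normal ('X^((p ^ f).-1) - 1 : {poly C}).
have l1 : lead_coef ('X^((p ^ f).-1) - 1 : {poly C}) = 1.
  by apply/eqP; rewrite -monicE -(polyC1 C) monicXnsubC.
rewrite l1 scale1r in er.
have rt z : (z \in r) = (z ^+ (p ^ f).-1 == 1).
  by rewrite -root_prod_XsubC -er rootE !hornerE subr_eq0.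
have rt0 z : (z \in 0 :: r) = (z ^+ (p ^ f)%N == z).
  rewrite inE rt; have [->|z0] /= := eqVneq z 0.
    by rewrite expr0n (gtn_eqF (ltnW q1)) eqxx.
  apply/eqP/eqP => h; first by rewrite -(prednK (ltnW q1)) exprS h mulr1.
  by apply: (mulfI z0); rewrite -exprS prednK ?mulr1 // ltnW.
exists (0 :: r); split=> //.
- rewrite /= rt expr0n (gtn_eqF q2) /= eq_sym oner_eq0 /=.
  by rewrite -separable_prod_XsubC -er separable_Xn_sub_1 // (charC0 (iota := iota)).
- have := size_XnsubC (1 : C) q2; rewrite polyC1 er size_prod_XsubC => -[/= ->].
  by rewrite prednK // ltnW.
- by rewrite inE eqxx.
- move=> a; rewrite rt0 => /eqP h; have [->|a0] := eqVneq a 0; first by left.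
  by right; apply: (ru_q (iota := iota) f0).
Qed.

Lemma teich_diff a b : (a = 0 \/ ru p a) -> (b = 0 \/ ru p b) -> a != b -> U (a - b).
Proof.
move=> [->|ra] [->|rb]; rewrite ?eqxx //.
- by rewrite sub0r => _; apply: UN; apply: ru_U.
- by rewrite subr0 => _; apply: ru_U.
- exact: ru_diff.
Qed.

Lemma teich_O a : (a = 0 \/ ru p a) -> O a.
Proof. by move=> [->|ra]; [apply: O0|apply: U_O; apply: ru_U]. Qed.

Lemma teich_eq a b : (a = 0 \/ ru p a) -> (b = 0 \/ ru p b) -> eqM a b -> a = b.
Proof. by move=> ha hb h; apply/eqP/negPn/negP => /(teich_diff ha hb)/U_notM. Qed.

(** The residue field of [K] contains the field with [q] elements, expressed through Teichmuller
    representatives taken in [C]. *)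
Definition full_resid K q := forall z, z ^+ q = z -> exists c, [/\ K c, O c & eqM z c].

(** Let [s] list the Teichmuller representatives that are residues of [K], and [Q] be its length.
    Fermat's product argument gives [c^Q = c] on residues; then [(X + 1)^Q - X^Q - 1] vanishes
    residually at [Q] nodes while of degree below [Q], so [p] divides the inner binomial
    coefficients and [Q] is a power of [p]. In the same way [X^Q - X] is residually the product of
    the [X - w], so that no root is missing from [s]. *)
Lemma residue_full K f0 : subfield iota K -> (0 < f0)%N -> resid iota K (p ^ f0) ->
  exists f, [/\ (0 < f)%N, resid iota K (p ^ f) & full_resid K (p ^ f)].
Proof.
move=> sK f00 rK; have [T [uT sT memT T0 hT]] := teich_seq f00.
pose s := [seq z <- T | `[< exists c, [/\ K c, O c & eqM z c] >]].
have us : uniq s by rewrite filter_uniq.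
have sT' z : z \in s -> z = 0 \/ ru p z by rewrite mem_filter => /andP[_ /hT].
have sP z : z \in s -> exists c, [/\ K c, O c & eqM z c] by rewrite mem_filter => /andP[/asboolP].
have s0 : 0 \in s.
  rewrite mem_filter T0 andbT; apply/asboolP; exists 0; split; first exact: subfield0 sK.
    exact: O0.
  exact: (eqm_refl MI).
have cs c : K c -> O c -> exists2 z, z \in s & eqM c z.
  move=> Kc Oc; have [z zq cz] := teich_q Oc (rK _ Kc Oc) f00.
  exists z => //; rewrite mem_filter memT zq eqxx andbT; apply/asboolP; exists c.
  by split=> //; apply: (eqm_sym MI).
have Os z : z \in s -> O z by move=> /sT'; apply: teich_O.
pose s' := [seq z <- s | z != 0].
have us' : uniq s' by rewrite filter_uniq.
have es : size s = (size s').+1.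
  by rewrite (perm_size (perm_to_rem s0)) /= (rem_filter _ us).
have s1 : 1 \in s'.
  rewrite mem_filter oner_neq0 mem_filter memT expr1n eqxx andbT; apply/asboolP; exists 1.
  split; [exact: subfield1 sK|exact: O1|exact: (eqm_refl MI)].
have s's z : z \in s' -> z \in s by rewrite mem_filter => /andP[].
have s'U z : z \in s' -> U z.
  by rewrite mem_filter => /andP[z0 /sT'[e|]]; [rewrite e eqxx in z0|apply: ru_U].
pose Q := size s.
have Q1 : (1 < Q)%N by rewrite /Q es ltnS lt0n; apply: contraTneq s1 => /size0nil ->.
have Q0 : (0 < Q)%N by apply: ltnW.
have rQ : resid iota K Q.
  move=> c Kc Oc; have [Mc|Uc] := O_case Oc.
    by apply: (idlB MI) => //; apply: MX.
  have /choice[w hw] : forall z, exists w, z \in s' -> w \in s' /\ eqM (c * z) w.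
    move=> z; have [zs|] := boolP (z \in s'); last by exists 0.
    have [d [Kd Od zd]] := sP _ (s's _ zs).
    have [w ws cw] := cs (c * d) (subfieldM sK Kc Kd) (OM Oc Od).
    have czw : eqM (c * z) w.
      apply: (eqm_trans MI _ cw); apply: (eqmM MI) => //; exact: (eqm_refl MI).
    exists w => _; split=> //; rewrite mem_filter ws andbT.
    apply/eqP => w0; move: czw; rewrite w0 /eqm subr0.
    exact: (U_notM (UM Uc (s'U _ zs))).
  have injw : {in s' &, injective w}.
    move=> a b sa sb ew; have [_ ha] := hw _ sa; have [_ hb] := hw _ sb.
    apply: teich_eq; [exact: sT' (s's _ sa)|exact: sT' (s's _ sb)|].
    have : eqM (c * a) (c * b) by apply: (eqm_trans MI ha); rewrite ew; apply: (eqm_sym MI).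
    rewrite /eqm -mulrBr => h; rewrite -[a - b](mulKf (U_neq0 Uc)).
    by apply: MM => //; apply: U_OV.
  have pw : perm_eq (map w s') s'.
    have um : uniq (map w s') by rewrite map_inj_in_uniq.
    have sub : {subset map w s' <= s'} by move=> _ /mapP[z zs ->]; have [] := hw _ zs.
    apply: uniq_perm => //.
    by have [_ e] := uniq_min_size um sub (eq_leq (esym (size_map w s'))).
  have h : eqM (\prod_(z <- s') (c * z)) (\prod_(z <- s') z).
    rewrite -[X in eqM _ X](perm_big _ pw) big_map /= !(big_seq _ _ s') /=.
    apply: (eqm_prod MI) => z zs; have [h1 h2] := hw _ zs => //.
      by apply: OM => //; apply: Os; apply: s's.
    by apply: Os; apply: s's.
  set pr := \prod_(z <- s') z in h.
  have Upr : U pr by rewrite /pr big_seq; apply: Uprod => z; apply: s'U.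
  rewrite big_split /= big_const_seq count_predT iter_mulr_1 -/pr in h.
  have h1 : eqM (c ^+ size s') 1.
    rewrite /eqm (_ : _ - _ = (c ^+ size s' * pr - pr) / pr); first by apply: MMr (U_OV Upr).
    by rewrite mulrBl mulfK ?divff // (U_neq0 Upr).
  rewrite /Q es exprS /eqm (_ : _ - _ = c * (c ^+ size s' - 1)); last by ring.
  exact: MM.
have zQ z : z \in s -> eqM (z ^+ Q) z.
  move=> zs; have [c [Kc Oc zc]] := sP _ zs.
  apply: (eqm_trans MI); first by apply: (eqmX MI) zc => //; apply: Os.
  apply: (eqm_trans MI (rQ _ Kc Oc)); exact: (eqm_sym MI).
have z1Q z : z \in s -> eqM ((z + 1) ^+ Q) (z + 1).
  move=> zs; have [c [Kc Oc zc]] := sP _ zs; have Oz := Os _ zs.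
  have zc1 : eqM (z + 1) (c + 1) by apply: (eqmD MI) => //; apply: (eqm_refl MI).
  apply: (eqm_trans MI); first by apply: (eqmX MI _ _ _ zc1); apply: OD => //; apply: O1.
  apply: (eqm_trans MI); last exact: (eqm_sym MI zc1).
  by apply: rQ; [apply: (subfieldD sK) => //; apply: subfield1 sK|apply: OD => //; apply: O1].
have idc := @ideal_coef _ _ _ iota M s _ MI us Os (fun a b sa sb => teich_diff (sT' _ sa) (sT' _ sb)).
have [|f f1 ef] := @prime_power_binomial p Q p_prime Q1.
  move=> k kQ; apply/negPn/negP => npk.
  pose R := ('X + 1 : {poly C}) ^+ Q - 'X^Q - 1.
  have eR i : R`_i = ('C(Q, i))%:R - (i == Q)%:R - (i == 0)%N%:R.
    rewrite /R !coefB coefXn coef1; congr (_ - _ - _).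
    rewrite addrC exprDn coef_sum.
    have [iQ|iQ] := ltnP i Q.+1.
      rewrite (bigD1 (Ordinal iQ)) //= big1 ?addr0 => [|l nl].
        by rewrite expr1n mul1r coefMn coefXn eqxx.
      rewrite expr1n mul1r coefMn coefXn; case: eqP => [e|]; rewrite ?mul0rn //.
      by case/eqP: nl; apply: val_inj.
    rewrite bin_small // big1 // => l _; rewrite expr1n mul1r coefMn coefXn.
    by case: eqP => [e|]; rewrite ?mul0rn //; have := ltn_ord l; rewrite -e; lia.
  have sR : (size R <= size s)%N.
    apply/leq_sizeP => i; rewrite -/Q leq_eqVlt => /orP[/eqP <-|lt]; rewrite eR.
      by rewrite binn eqxx (gtn_eqF Q0) subrr subr0.
    by rewrite bin_small // (gtn_eqF lt) (gtn_eqF (leq_trans Q0 (ltnW lt))) !subr0.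
  have /(_ k) : forall i, M R`_i.
    apply: idc => // z zs; rewrite /R !hornerE.
    rewrite (_ : (z + 1) ^+ Q - z ^+ Q - 1 = ((z + 1) ^+ Q - (z + 1)) - (z ^+ Q - z)); last by ring.
    by apply: MB; [apply: z1Q|apply: zQ].
  have [k0 k1] := andP kQ.
  rewrite eR (ltn_eqF k1) (gtn_eqF k0) !subr0.
  by apply: U_notM; apply: U_coprime; rewrite prime_coprime.
exists f; split=> //; rewrite -ef //.
move=> z zq.
pose R := 'X^Q - 'X - \prod_(w <- s) ('X - w%:P) : {poly C}.
have sR : (size R <= size s)%N.
  have mo1 : ('X^Q - 'X : {poly C}) \is monic.
    rewrite monicE lead_coefDl ?lead_coefXn // size_polyN size_polyX size_polyXn.
    by rewrite ltnS.
  have sz1 : size ('X^Q - 'X : {poly C}) = Q.+1.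
    by rewrite size_polyDl size_polyXn // size_polyN size_polyX ltnS.
  have mo2 : \prod_(w <- s) ('X - w%:P) \is monic := monic_prod_XsubC _ _ _.
  have sz2 : size (\prod_(w <- s) ('X - w%:P)) = Q.+1 by rewrite size_prod_XsubC.
  apply/leq_sizeP => i; rewrite -/Q leq_eqVlt => /orP[/eqP <-|lt].
    rewrite /R coefB.
    move: mo1 mo2; rewrite !monicE !lead_coefE sz1 sz2 /= => /eqP -> /eqP ->.
    exact: subrr.
  by rewrite /R coefB !nth_default ?subrr ?sz1 ?sz2.
have hR : forall i, M R`_i.
  apply: idc => // w ws; rewrite /R !hornerE (rootP (_ : root _ w)) ?root_prod_XsubC //.
  by rewrite subr0; apply: zQ.
have f0' : z = 0 \/ ru p z.
  have [->|z0] := eqVneq z 0; first by left.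
  by right; apply: (ru_q (iota := iota) f1 z0); rewrite -ef.
have Oz : O z := teich_O f0'.
have : M R.[z].
  by rewrite horner_coef; apply: (idl_sum MI) => i _; apply: MMr => //; apply: OX.
rewrite /R !hornerE zq subrr sub0r => /MN; rewrite opprK horner_prod => /M_prod[w ws|w ws].
  by rewrite !hornerE; apply: OB => //; apply: Os.
rewrite !hornerE => zw; have [c [Kc Oc wc]] := sP _ ws.
by exists c; split=> //; apply: (eqm_trans MI zw).
Qed.

Lemma residue_card K f : subfield iota K -> (0 < f)%N -> resid iota K (p ^ f) ->
  full_resid K (p ^ f) -> forall q, residue_field_card iota K q <-> q = (p ^ f)%N.
Proof.
move=> sK f0 rK fK; have [T [uT sT memT T0 hT]] := teich_seq f0.
have cT c : K c -> O c -> exists2 z, z \in T & eqM c z.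
  move=> Kc Oc; have [z zq cz] := teich_q Oc (rK _ Kc Oc) f0.
  by exists z => //; rewrite memT zq.
have /choice[c hc] : forall z, exists c, z \in T -> [/\ K c, O c & eqM z c].
  move=> z; have [zT|] := boolP (z \in T); last by exists 0.
  by have [c hc] := fK z (eqP (etrans (esym (memT z)) zT)); exists c.
move=> q; split=> [[s hs us]|->].
  have /choice[w hw] : forall i, exists w, w \in T /\ eqM (tnth s i) w.
    by move=> i; have [Ki Oi] := hs i; have [w] := cT _ Ki Oi; exists w.
  have injw : injective w.
    move=> i j ew; have [Ki Oi] := hs i; have [l [_ hl]] := us _ (hs i).
    have -> : i = l.
      by apply/esym; apply: hl; apply/max_idealP => //; rewrite subrr; split; [apply: subfield0 sK|left].
    apply: hl; apply/max_idealP => //; split; first by apply: (subfieldB sK) => //; have [] := hs j.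
    have [_ h1] := hw i; have [_ h2] := hw j; apply: (eqm_trans MI h1); rewrite ew.
    exact: (eqm_sym MI).
  have /choice[d hd] : forall z, exists i : 'I_q, z \in T -> eqM (c z) (tnth s i).
    move=> z; have [zT|zT] := boolP (z \in T); last first.
      have [i _] := us 0 (conj (subfield0 sK) O0); by exists i.
    have [Kc Oc _] := hc _ zT; have [i [/max_idealP[//|_ h] _]] := us _ (conj Kc Oc).
    by exists i.
  have injd : {in T &, injective d}.
    move=> a b aT bT ed; apply: teich_eq; [exact: hT|exact: hT|].
    have [_ _ ha] := hc _ aT; have [_ _ hb] := hc _ bT.
    apply: (eqm_trans MI ha); apply: (eqm_trans MI (hd _ aT)); rewrite ed.
    apply: (eqm_trans MI (eqm_sym MI (hd _ bT))); exact: (eqm_sym MI).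
  apply/eqP; rewrite eqn_leq -sT; apply/andP; split.
    have um : uniq (map w (enum 'I_q)) by rewrite map_inj_uniq ?enum_uniq.
    have := uniq_leq_size um (_ : {subset _ <= T}); rewrite size_map size_enum_ord; apply.
    by move=> _ /mapP[i _ ->]; have [] := hw i.
  have um : uniq (map d T) by rewrite map_inj_in_uniq.
  have := uniq_leq_size um (_ : {subset _ <= enum 'I_q}); rewrite size_map size_enum_ord; apply.
  by move=> i _; rewrite mem_enum.
have sc : size (map c T) = (p ^ f)%N by rewrite size_map.
have nT (i : 'I_(p ^ f)) : nth 0 T i \in T by rewrite mem_nth // sT.
have tc (i : 'I_(p ^ f)) : tnth (Tuple (introT eqP sc)) i = c (nth 0 T i).
  by rewrite (tnth_nth 0) /= (nth_map 0) // sT.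
exists (Tuple (introT eqP sc)).
  by move=> i; rewrite tc; have [? ? _] := hc _ (nT i).
move=> x [Kx Ox]; have [z zT xz] := cT _ Kx Ox.
have zi : (index z T < p ^ f)%N by rewrite -sT index_mem.
have [Kc Oc zc] := hc _ zT.
exists (Ordinal zi); split.
  rewrite tc /= nth_index //; apply/max_idealP => //; split; first by apply: (subfieldB sK).
  exact: (eqm_trans MI xz).
move=> j /max_idealP[//|_]; rewrite tc => h.
have [_ _ hj] := hc _ (nT j).
apply: val_inj => /=; have -> : z = nth 0 T j.
  apply: teich_eq; [exact: hT|exact: hT|].
  apply: (eqm_trans MI (eqm_sym MI xz)); apply: (eqm_trans MI h); exact: (eqm_sym MI).
by rewrite index_uniq // sT.
Qed.

Lemma zpow_unit pi (a : int) : pi != 0 -> M pi -> U (pi ^ a) -> a = 0.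
Proof.
move=> pi0 Mpi; case: a => [[|a]|a] //.
  by rewrite -exprnP => /U_notM; case; apply: MX.
by rewrite NegzE -exprnN => /UV; rewrite invrK => /U_notM; case; apply: MX.
Qed.

Lemma zpow_int pi (a : int) : pi != 0 -> M pi -> O (pi ^ a) -> 0 <= a.
Proof.
move=> pi0 Mpi; case: a => // a; rewrite NegzE -exprnN => h.
have : M (pi ^+ a.+1) by apply: MX.
by case=> // e; have := expf_neq0 a.+1 pi0; rewrite e eqxx.
Qed.

(** * Totally ramified extensions generated by an Eisenstein element *)

Section Eisenstein.
Variables (K : set C) (pi Pi : C) (m : nat).
Hypotheses (sK : subfield iota K) (upi : unif iota K pi) (m0 : (0 < m)%N)
  (ePi : U (Pi ^+ m / pi)).

Lemma eis_neq0 : Pi != 0.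
Proof. by apply/eqP => e; have := U_neq0 ePi; rewrite e expr0n (gtn_eqF m0) mul0r eqxx. Qed.
Let pi0 : pi != 0. Proof. by case: upi. Qed.

Lemma eis_O : O Pi.
Proof.
have h : O (Pi ^+ m).
  by rewrite -[X in O X](divfK pi0); apply: OM (U_O ePi) _; apply: M_O; case: upi.
apply: (@O_root _ _ _ _ ('X^m - (Pi ^+ m)%:P)).
- by rewrite monicXnsubC.
- move=> i; rewrite coefB coefXn coefC; apply: OB; first exact: OnatR.
  by case: eqP => // _; apply: O0.
- by rewrite rootE !hornerE subrr.
Qed.

Lemma eis_M : M Pi.
Proof.
apply: (M_exp eis_O (n := m)); rewrite -[X in M X](divfK pi0).
by apply: MM; [apply: U_O ePi|case: upi].
Qed.

Lemma eis_term c i : K c -> c != 0 -> exists a : int, U (c * Pi ^+ i / Pi ^ (m%:Z * a + i%:Z)).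
Proof.
move=> Kc c0; have [a ha] := unif_decompz sK upi Kc c0; exists a.
have Pz := eis_neq0; rewrite expfzDr // -exprz_exp -!exprnP.
have -> : c * Pi ^+ i / ((Pi ^+ m) ^ a * Pi ^+ i) = (c / pi ^ a) / (Pi ^+ m / pi) ^ a.
  have n1 : Pi ^+ i != 0 by rewrite expf_neq0.
  have n2 : (Pi ^+ m) ^ a != 0 by rewrite expfz_neq0 // expf_neq0.
  have n3 : pi ^ a != 0 by rewrite expfz_neq0.
  have -> : (Pi ^+ m / pi) ^ a = (Pi ^+ m) ^ a / pi ^ a by rewrite expfzMl exprz_inv -invr_expz.
  by field; rewrite n1 n2 n3.
apply: UM => //; apply: UV; case: a {ha} => a.
  by rewrite -exprnP; apply: UX.
by rewrite NegzE -exprnN; apply: UV; apply: UX.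
Qed.

(** Measured in powers of [Pi], a nonzero term of index [i] has valuation congruent to [i] modulo
    [m]; for [i < m] no two terms tie, and one dominates strictly. *)
Lemma eis_dominant (P : {poly C}) : (forall i, K P`_i) -> (size P <= m)%N -> P != 0 ->
  exists i0, [/\ (i0 < m)%N, P`_i0 != 0, U (P.[Pi] / (P`_i0 * Pi ^+ i0)) &
    forall i, O (P`_i * Pi ^+ i / (P`_i0 * Pi ^+ i0))].
Proof.
move=> KP sP P0; have Pz := eis_neq0; have Mz := eis_M.
pose R := \poly_(i < size P) (P`_i * Pi ^+ i).
have cR i : R`_i = P`_i * Pi ^+ i.
  by rewrite coef_poly; case: ltnP => // h; rewrite nth_default // mul0r.
have R0 : R != 0.
  apply/eqP => e; have := cR (size P).-1; rewrite e coef0 -lead_coefE => /esym/eqP.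
  by rewrite mulf_eq0 lead_coef_eq0 (negPf P0) expf_eq0 (negPf Pz) andbF.
have [i0 [h0 hi]] := dominant_coef R0.
rewrite cR in h0; have P0' : P`_i0 != 0 by apply: contraNneq h0 => ->; rewrite mul0r.
have i0m : (i0 < m)%N.
  by rewrite (leq_trans _ sP) // ltnNge; apply: contraNN P0' => h; rewrite nth_default.
have hi' i : O (P`_i * Pi ^+ i / (P`_i0 * Pi ^+ i0)) by have := hi i; rewrite !cR.
exists i0; split=> //.
have hM i : (i < m)%N -> i != i0 -> M (P`_i * Pi ^+ i / (P`_i0 * Pi ^+ i0)).
  move=> im ni; have [e|Pi0] := eqVneq P`_i 0; first by rewrite e !mul0r; left.
  have [//|Ui] := O_case (hi' i); exfalso.
  have [a ha] := eis_term i (KP i) Pi0; have [b hb] := eis_term i0 (KP i0) P0'.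
  have : U (Pi ^ ((m%:Z * a + i%:Z) - (m%:Z * b + i0%:Z))).
    have -> : Pi ^ ((m%:Z * a + i%:Z) - (m%:Z * b + i0%:Z)) =
      (P`_i * Pi ^+ i / (P`_i0 * Pi ^+ i0)) * (P`_i0 * Pi ^+ i0 / Pi ^ (m%:Z * b + i0%:Z)) /
       (P`_i * Pi ^+ i / Pi ^ (m%:Z * a + i%:Z)).
      rewrite expfzDr // -invr_expz.
      have n1 : Pi ^+ i != 0 by rewrite expf_neq0.
      have n2 : Pi ^+ i0 != 0 by rewrite expf_neq0.
      have n3 : Pi ^ (m%:Z * a + i%:Z) != 0 by rewrite expfz_neq0.
      have n4 : Pi ^ (m%:Z * b + i0%:Z) != 0 by rewrite expfz_neq0.
      by field; rewrite n1 n2 n3 n4 Pi0 P0'.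
    by apply: UM (UV ha); apply: UM.
  move=> /(zpow_unit Pz Mz) e.
  have : (m%:Z * (b - a) = i%:Z - i0%:Z) by lia.
  move: im i0m ni; clear; move=> im i0m /eqP ni e.
  have : b - a = 0 by nia.
  by move=> e2; rewrite e2 mulr0 in e; apply: ni; lia.
have -> : P.[Pi] / (P`_i0 * Pi ^+ i0) = 1 + \sum_(i < m | i != i0 :> nat) (P`_i * Pi ^+ i / (P`_i0 * Pi ^+ i0)).
  rewrite (horner_coef_wide _ sP) (bigD1 (Ordinal i0m)) //= mulrDl divff // mulr_suml.
  by congr (_ + _); apply: eq_bigl => i.
by apply: U_D; [apply: U1|apply: (idl_sum MI) => i ni; apply: hM].
Qed.

Lemma eis_free (P : {poly C}) : (forall i, K P`_i) -> (size P <= m)%N -> P.[Pi] = 0 -> P = 0.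
Proof.
move=> KP sP e; apply/eqP/negPn/negP => P0; have [i0 [_ _ + _]] := eis_dominant KP sP P0.
by rewrite e mul0r => /U_neq0; rewrite eqxx.
Qed.

Lemma eis_M_multiple (P : {poly C}) : (forall i, K P`_i) -> (size P <= m)%N -> M P.[Pi] ->
  mult Pi P.[Pi].
Proof.
move=> KP sP MP; have Pz := eis_neq0; have Mz := eis_M.
have [->|P0] := eqVneq P 0; first by rewrite horner0 /multiple mul0r; apply: O0.
have [i0 [i0m P0' Ud hd]] := eis_dominant KP sP P0.
have [a ha] := eis_term i0 (KP i0) P0'.
set z := (_ * a + _) in ha.
have nz : Pi ^ z != 0 by rewrite expfz_neq0.
have nt : P`_i0 * Pi ^+ i0 != 0 by rewrite mulf_neq0 // expf_neq0.
have Uq : U (P.[Pi] / Pi ^ z).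
  by have := UM Ud ha; rewrite mulrA divfK.
have y0 : P.[Pi] != 0 by apply: contraTneq (U_neq0 Uq) => ->; rewrite mul0r eqxx.
have MPz : M (Pi ^ z).
  rewrite (_ : Pi ^ z = P.[Pi] * (P.[Pi] / Pi ^ z)^-1); first by apply: MMr (U_OV Uq).
  by field; rewrite nz y0.
have z0 : 0 <= z by apply: (zpow_int Pz Mz); apply: M_O.
have zn0 : z != 0 by apply/eqP => e; apply: (@M1 _ _ _ iota); move: MPz; rewrite e expr0z.
have [k ek] := posint_succ z0 zn0.
have n1 : Pi ^+ k != 0 by rewrite expf_neq0.
rewrite ek -exprnP in Uq.
rewrite /multiple (_ : _ / _ = P.[Pi] / Pi ^+ k.+1 * Pi ^+ k).
  by apply: OM (U_O Uq) (OX _ eis_O).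
by rewrite exprS; field; rewrite Pz n1.
Qed.

(** For [0 < i < m] the valuation of the term of index [i] is not a multiple of [m], so once it is
    nonnegative it is positive: the residue field does not grow. *)
Lemma eis_residue (P : {poly C}) : (forall i, K P`_i) -> (size P <= m)%N -> O P.[Pi] ->
  O P`_0 /\ eqM P.[Pi] P`_0.
Proof.
move=> KP sP OP; have Pz := eis_neq0; have Mz := eis_M.
have [->|P0] := eqVneq P 0; first by rewrite horner0 coef0; split; [apply: O0|apply: (eqm_refl MI)].
have [i0 [i0m P0' Ud hd]] := eis_dominant KP sP P0.
have nt : P`_i0 * Pi ^+ i0 != 0 by rewrite mulf_neq0 // expf_neq0.
have Ot : O (P`_i0 * Pi ^+ i0).
  rewrite (_ : _ * _ = P.[Pi] * (P.[Pi] / (P`_i0 * Pi ^+ i0))^-1); first by apply: OM (U_OV Ud).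
  have y0 : P.[Pi] != 0 by apply: contraTneq (U_neq0 Ud) => ->; rewrite mul0r eqxx.
  by field; rewrite expf_neq0 // P0' y0.
have hO i : O (P`_i * Pi ^+ i) by rewrite -[X in O X](divfK nt); apply: OM.
split; first by have := hO 0%N; rewrite expr0 mulr1.
rewrite (horner_coef_wide _ sP) -(prednK m0) big_ord_recl expr0 mulr1 /eqm addrAC subrr add0r.
apply: (idl_sum MI) => i _; rewrite /bump /= ?add1n.
have [e|ci] := eqVneq P`_i.+1 0; first by rewrite e mul0r; left.
have [a ha] := eis_term i.+1 (KP i.+1) ci; set z := (_ * a + _) in ha.
have nz : Pi ^ z != 0 by rewrite expfz_neq0.
have z0 : 0 <= z.
  apply: (zpow_int Pz Mz).
  rewrite (_ : Pi ^ z = (P`_i.+1 * Pi ^+ i.+1) * (P`_i.+1 * Pi ^+ i.+1 / Pi ^ z)^-1).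
    by apply: OM (hO _) (U_OV ha).
  by field; rewrite ?nz ?Pz ?ci ?expf_neq0.
have zn0 : z != 0.
  apply/eqP => e; have im : (i.+1 < m)%N by rewrite -[X in (_ < X)%N](prednK m0) ltnS.
  move: e im; rewrite /z; clear=> e im.
  have [a0|a0] : (0 <= a) \/ (a <= -1) by lia.
    by nia.
  by nia.
have : M (P`_i.+1 * Pi ^+ i.+1 / Pi ^ z * Pi ^ z).
  apply: MM (U_O ha) _; have [k ->] := posint_succ z0 zn0.
  by rewrite -exprnP; apply: MX.
by rewrite divfK.
Qed.

Lemma eisenstein L : subfield iota L -> (forall x, K x -> L x) -> L Pi ->
  (forall y, L y -> exists P : {poly C}, [/\ forall i, K P`_i, (size P <= m)%N & y = P.[Pi]]) ->
  [/\ unif iota L Pi, is_basis K L (\row_(i < m) Pi ^+ i) &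
    forall y, L y -> O y -> exists c, [/\ K c, O c & eqM y c]].
Proof.
move=> sL KL LPi sp; split.
- split; [exact: LPi|exact: eis_neq0|exact: eis_M|].
  by move=> y /sp[P [KP sP ->]]; apply: eis_M_multiple.
- by apply: (power_basis sK) => //; [move=> i; apply: (subfieldX i sL)|apply: eis_free].
- move=> y /sp[P [KP sP ->]] /(eis_residue KP sP)[h1 h2]; by exists P`_0.
Qed.

End Eisenstein.

(* The other roots lie outside the valuation ring: writing the polynomial as
   [f_0 * \prod (1 - X / r)], its linear coefficient [1] would otherwise be in
   the maximal ideal. *)
Lemma hensel_linear K (f : {poly C}) : subfield iota K -> (forall i, K f`_i) ->
  O f`_0 -> f`_1 = 1 -> (forall i, (1 < i)%N -> M f`_i) ->
  exists x, [/\ K x, O x & f.[x] = 0].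
Proof.
move=> sK Kf O0f f1 hM.
have f0 : f != 0 by apply/eqP => e; move: f1; rewrite e coef0 => /esym/eqP; rewrite oner_eq0.
have uni x y : O x -> O y -> f.[x] = 0 -> f.[y] = 0 -> x = y.
  move=> Ox Oy fx fy; apply/eqP/negPn/negP; rewrite -subr_eq0 => n.
  have : f.[x] - f.[y] = 0 by rewrite fx fy subrr.
  rewrite !horner_coef -sumrB (eq_bigr (fun i : 'I_(size f) => (x - y) * (f`_i * \sum_(j < i) x ^+ (i.-1 - j) * y ^+ j))).
    rewrite -mulr_sumr => /eqP; rewrite mulf_eq0 (negPf n) /= => /eqP.
    have s1 : (1 < size f)%N.
      rewrite ltnNge; apply/negP => h; move: f1; rewrite nth_default // => /esym/eqP.
      by rewrite oner_eq0.
    rewrite (bigD1 (Ordinal s1)) //= f1 mul1r big_ord1 subnn !expr0 mulr1 => e.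
    have : U (1 + \sum_(i < size f | i != Ordinal s1) f`_i * \sum_(j < i) x ^+ (i.-1 - j) * y ^+ j).
      apply: U_D; first exact: U1.
      apply: (idl_sum MI) => i ni; have [i0|i0] := eqVneq (i : nat) 0%N.
        by rewrite i0 big_ord0 mulr0; left.
      apply: MMr; first by apply: hM; rewrite ltn_neqAle lt0n i0 andbT eq_sym; apply: contraNneq ni => e1; apply/eqP/val_inj.
      by apply: Osum => j _; apply: OM; apply: OX.
    by move/U_neq0; rewrite e eqxx.
  move=> i _; rewrite -mulrBr mulrCA; congr (_ * _).
  case: (nat_of_ord i) => [|k]; first by rewrite !expr0 subrr big_ord0 mulr0.
  by rewrite subrXX; congr (_ * _); apply: eq_bigr => j _; rewrite mulrC.
have [x Ox fx] : exists2 x, O x & f.[x] = 0.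
  have [e|c0] := eqVneq f`_0 0; first by exists 0; [apply: O0|rewrite horner_coef0].
  have [r er] := closed_field_poly_normal f.
  have l0 : lead_coef f != 0 by rewrite lead_coef_eq0.
  apply: contrapT => nx.
  have hr w : w \in r -> w != 0 /\ M w^-1.
    move=> wr; have fw : f.[w] = 0 by apply/rootP; rewrite er rootZ // root_prod_XsubC.
    have w0 : w != 0 by apply: contraNneq c0 => e; rewrite -horner_coef0 -[X in _.[X]]e fw.
    split=> //; right; rewrite invrK => Ow; apply: nx; by exists w.
  have e0 : f`_0 = lead_coef f * \prod_(w <- r) (- w).
    rewrite -horner_coef0 {1}er hornerZ horner_prod; congr (_ * _).
    by apply: eq_bigr => w _; rewrite hornerXsubC sub0r.
  have ef : f = f`_0 *: \prod_(w <- r) (1 - w^-1 *: 'X).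
    rewrite e0 -scalerA {1}er; congr (_ *: _).
    rewrite -mul_polyC rmorph_prod /= -big_split /=; apply: eq_big_seq => w /hr[w0 _].
    rewrite -mul_polyC polyCN mulNr mulrBr mulr1 mulrA -polyCM divff // mul1r.
    by rewrite opprB.
  have gM (s : seq C) : (forall w, w \in s -> w != 0 /\ M w^-1) ->
      (\prod_(w <- s) (1 - w^-1 *: 'X) : {poly C})`_0 = 1 /\ M (\prod_(w <- s) (1 - w^-1 *: 'X) : {poly C})`_1.
    elim: s => [|a s IH] hs; first by rewrite big_nil !coef1; split=> //; left.
    have [|h0 h1] := IH; first by move=> w ws; apply: hs; rewrite inE ws orbT.
    have [_ Ma] : a != 0 /\ M a^-1 by apply: hs; rewrite inE eqxx.
    rewrite big_cons mulrBl mul1r -scalerAl -commr_polyX !coefB !coefZ !coefMX /= h0 mulr0 subr0 mulr1.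
    by split=> //; apply: MB.
  have [_] := gM r hr; have := f1; rewrite {1}ef coefZ => e1 h.
  by apply: (@M1 _ _ _ iota); rewrite -e1; apply: MM.
exists x; split=> //; apply: (fixed_mem alg p_prime sK) => h hK.
have hi := fixes_iota sK hK.
apply: uni => //; first exact: O_aut.
by rewrite -(horner_fixes _ hK Kf) fx rmorph0.
Qed.

(** Put [v = 1 + z * x] in [v^p = u] and divide by [p * z]: the linear coefficient becomes [1], the
    middle ones are divisible by [z], and the hypothesis on [z^(p-1) / p] controls the top one. *)
Lemma unit_pth_root K z u : subfield iota K -> K z -> z != 0 -> M z ->
  M (z ^+ p.-1 / p%:R) -> K u -> mult (p%:R * z) (u - 1) ->
  exists v, [/\ K v, v ^+ p = u & mult z (v - 1)].
Proof.
move=> sK Kz z0 Mz Mzp Ku hu.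
have p0 : (p%:R : C) != 0 by apply: (p_neq0 (iota := iota)).
have pg0 := prime_gt0 p_prime; have pg1 := prime_gt1 p_prime.
pose f := (p%:R * z)^-1 *: ((1 + z *: 'X) ^+ p - u%:P) : {poly C}.
have cf i : f`_i = (p%:R * z)^-1 * (z ^+ i * ('C(p, i))%:R - (i == 0)%N%:R * u).
  rewrite coefZ coefB coefC; congr (_ * (_ - _)); last by case: eqP; rewrite ?mul1r ?mul0r.
  rewrite exprDn coef_sum; have [iQ|iQ] := ltnP i p.+1.
    rewrite (bigD1 (Ordinal iQ)) //= big1 ?addr0 => [|l nl].
      by rewrite expr1n mul1r coefMn exprZn coefZ coefXn eqxx mulr1 mulr_natr.
    rewrite expr1n mul1r coefMn exprZn coefZ coefXn; case: eqP => [e|]; rewrite ?mulr0 ?mul0rn //.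
    by case/eqP: nl; apply: val_inj.
  rewrite bin_small // mulr0 big1 // => l _; rewrite expr1n mul1r coefMn exprZn coefZ coefXn.
  by case: eqP => [e|]; rewrite ?mulr0 ?mul0rn //; have := ltn_ord l; rewrite -e; lia.
have [|||| x [Kx Ox fx]] := @hensel_linear K f sK.
- move=> i; rewrite cf; apply: (subfieldM sK).
    by apply: (subfieldV sK); apply: (subfieldM sK) => //; apply: subfield_nat sK.
  apply: (subfieldB sK); apply: (subfieldM sK) => //; try exact: subfield_nat sK.
  exact: (subfieldX i sK).
- rewrite cf expr0 bin0 !mul1r mulrC; have := ON hu; rewrite -mulNr opprB.
  by [].
- have pz0 : p%:R * z != 0 by apply: mulf_neq0.
  by rewrite cf expr1 bin1 mul0r subr0 [z * _]mulrC mulVf.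
- move=> i i1; rewrite cf (gtn_eqF (ltnW i1)) mul0r subr0.
  have [ip|ip] := ltnP i p.
    have /dvdnP[k ->] : (p %| 'C(p, i))%N by apply: prime_dvd_bin => //; rewrite ip (ltnW i1).
    have ei : z ^+ i = z * z ^+ i.-1 by rewrite -exprS prednK // ltnW.
    rewrite natrM ei.
    rewrite (_ : (p%:R * z)^-1 * (z * z ^+ i.-1 * (k%:R * p%:R)) = k%:R * z ^+ i.-1); last by field; rewrite p0 z0.
    by apply: MM; [apply: OnatR|apply: MX => //; rewrite -subn1 subn_gt0].
  move: ip; rewrite leq_eqVlt => /orP[/eqP <-|ip].
    have ep : z ^+ p = z * z ^+ p.-1 by rewrite -exprS prednK.
    rewrite binn mulr1 ep.
    by rewrite (_ : (p%:R * z)^-1 * (z * z ^+ p.-1) = z ^+ p.-1 / p%:R) //; field; rewrite p0 z0.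
  by rewrite bin_small // !mulr0; left.
exists (1 + z * x); split.
- by apply: (subfieldD sK); [apply: subfield1 sK|apply: (subfieldM sK)].
- move: fx; rewrite /f !hornerE => /eqP; rewrite mulf_eq0 invr_eq0 mulf_eq0 (negPf p0) (negPf z0) /=.
  by rewrite subr_eq0 => /eqP.
- by rewrite /multiple addrC addKr mulrAC divff // mul1r.
Qed.

(** Each root extracted costs one factor [p]; for odd [p] even [z = p] is small enough in
    [unit_pth_root]. This is the device that turns approximate solutions into exact ones. *)
Lemma unit_ppow_root K i k u : odd p -> subfield iota K -> K u ->
  mult (p%:R ^+ (i + k.+1)) (u - 1) ->
  exists v, [/\ K v, v ^+ (p ^ i)%N = u & mult (p%:R ^+ k.+1) (v - 1)].
Proof.
move=> podd sK; elim: i u => [|i IH] u Ku hu; first by exists u; rewrite expn0 !expr1.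
have p0 : (p%:R : C) != 0 by apply: (p_neq0 (iota := iota)).
have p3 : (2 < p)%N by case: (p) p_prime podd => [|[|[|]]].
have [||||||v [Kv ev hv]] := @unit_pth_root K (p%:R ^+ (i + k.+1)) u sK.
- by apply: (subfieldX _ sK); apply: subfield_nat sK.
- exact: expf_neq0.
- by apply: MX; [rewrite addnS|apply: Mp].
- rewrite addnS -exprM (_ : ((i + k).+1 * p.-1 = ((i + k).+1 * p.-1).-1.+1)%N); last by nia.
  by rewrite exprS mulrAC divff // mul1r; apply: MX; [nia|apply: Mp].
- exact: Ku.
- by rewrite -exprS.
have [w [Kw ew hw]] := IH v Kv hv.
by exists w; split=> //; rewrite expnSr exprM ew.
Qed.

End Residues.

(** * The cyclotomic extension F *)

Section Cyclotomic.
Variables (p : nat) (Qp : padicField p) (C : closedFieldType).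
Variable iota : {rmorphism Qp -> C}.
Context {HC : padic_closure iota}.
Let p_prime : prime p := pc_prime.
Let alg : forall y : C, algebraicOver iota y := pc_alg.
Implicit Types (K L : set C) (x y z : C) (g h : {rmorphism C -> C}).
Local Notation O := (integral iota).
Local Notation M := (nonunit iota).
Local Notation U := (isunit iota).
Local Notation eqM := (eqm M).
Local Notation adj := (adjoin iota).
Local Notation mult := (multiple iota).
Let MI : Oideal iota M := M_ideal.

Lemma conj_orbit K z : subfield iota K -> exists Y : seq C, [/\ uniq Y,
  forall w, w \in Y <-> exists2 h, fixes K h & h z = w &
  forall i, K (\prod_(w <- Y) ('X - w%:P))`_i].
Proof.
move=> sK; have [f f0 fz] := alg z.
have [r er] := closed_field_poly_normal (map_poly iota f).
have l0 : lead_coef (map_poly iota f) != 0 by rewrite lead_coef_eq0 map_poly_eq0.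
have rr w : root (map_poly iota f) w = (w \in r) by rewrite er rootZ // root_prod_XsubC.
pose Y := [seq w <- undup r | `[< exists2 h, fixes K h & h z = w >]].
have YP w : w \in Y <-> exists2 h, fixes K h & h z = w.
  rewrite mem_filter mem_undup; split; first by case/andP => /asboolP.
  move=> [h hK <-]; apply/andP; split; first by apply/asboolP; exists h.
  rewrite -rr; apply/rootP.
  have -> : map_poly iota f = map_poly h (map_poly iota f).
    by apply/polyP => i; rewrite !coef_map /= (fixes_iota sK hK).
  by rewrite horner_map (rootP fz) rmorph0.
exists Y; split=> //; first by rewrite filter_uniq // undup_uniq.
move=> i; apply: (fixed_mem alg p_prime sK) => h hK.
rewrite -coef_map rmorph_prod /=; congr (_`_i).
rewrite (eq_bigr (fun w => 'X - (h w)%:P)); last by move=> w _; rewrite rmorphB /= map_polyX map_polyC.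
rewrite -(big_map h xpredT (fun w => 'X - w%:P)).
have um : uniq (map h Y) by rewrite map_inj_uniq ?filter_uniq ?undup_uniq //; apply: fmorph_inj.
have sub : {subset map h Y <= Y}.
  move=> _ /mapP[w /YP[h' h'K <-] ->]; apply/YP; exists (h \o h') => //.
  by move=> x Kx /=; rewrite h'K // hK.
rewrite (perm_big Y) //; apply: uniq_perm => //; first by rewrite filter_uniq ?undup_uniq.
by have [_ e] := uniq_min_size um sub (eq_leq (esym (size_map h Y))).
Qed.

Lemma poly_lift (k : fieldType) (j : {rmorphism k -> C}) K (G : {poly C}) :
  (forall x, K x <-> exists a, x = j a) -> (forall i, K G`_i) -> exists g : {poly k}, map_poly j g = G.
Proof.
move=> hj KG; have /choice[l hl] : forall i, exists a, G`_i = j a by move=> i; apply/hj.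
exists (\poly_(i < size G) l i).
apply/polyP => i; rewrite coef_map coef_poly; case: ltnP => h /=; first by rewrite -hl.
by rewrite rmorph0 nth_default.
Qed.

Lemma adjoin_poly_size K z (G : {poly C}) m : subfield iota K -> (forall i, K G`_i) ->
  G.[z] = 0 -> size G = m.+1 ->
  forall y, adj K z y -> exists P : {poly C}, [/\ forall i, K P`_i, (size P <= m)%N & y = P.[z]].
Proof.
move=> sK KG Gz sG; have [k [j hj]] := subfield_fieldType sK.
have [g eg] := poly_lift hj KG.
have g0 : g != 0 by rewrite -(map_poly_eq0 j) eg -size_poly_eq0 sG.
move=> y /(adjoin_poly alg sK hj)[P ->].
exists (map_poly j (P %% g)); split.
- by move=> i; rewrite coef_map; apply/hj; eexists.
- by rewrite size_map_poly -ltnS -sG -eg size_map_poly ltn_modp.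
- rewrite {1}(divp_eq P g) rmorphD rmorphM /= hornerD hornerM eg.
  by rewrite Gz mulr0 add0r.
Qed.

Lemma basis_coords K L d (e : 'rV[C]_d) (k : fieldType) (j : {rmorphism k -> C}) :
  is_basis K L e -> (forall x, K x <-> exists a, x = j a) ->
  forall m (f : 'I_m -> C), (forall i, L (f i)) ->
  exists A : 'M[k]_(m, d), forall i, f i = \sum_l j (A i l) * e 0 l.
Proof.
move=> [Le be] hj m f Lf.
have /choice[c hc] : forall i : 'I_m, exists c : 'cV[C]_d, (forall l, K (c l 0)) /\ (e *m c) 0 0 = f i.
  by move=> i; have [c [h _]] := be _ (Lf i); exists c.
have /choice[a ha] : forall il : 'I_m * 'I_d, exists a, c il.1 il.2 0 = j a.
  by move=> il; apply/hj; have [h _] := hc il.1; apply: h.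
exists (\matrix_(i, l) a (i, l)) => i; have [_ <-] := hc i; rewrite mxE; apply: eq_bigr => l _.
by rewrite mxE -(ha (i, l)) mulrC.
Qed.

Lemma basis_span K L d (e : 'rV[C]_d) (f : 'I_d -> C) : subfield iota K ->
  is_basis K L e -> (forall i, L (f i)) ->
  (forall c : 'I_d -> C, (forall i, K (c i)) -> \sum_i c i * f i = 0 -> forall i, c i = 0) ->
  forall y, L y -> exists c : 'I_d -> C, (forall i, K (c i)) /\ y = \sum_i c i * f i.
Proof.
move=> sK be Lf fr y Ly; have [k [j hj]] := subfield_fieldType sK.
have [A hA] := basis_coords be hj Lf.
have [u hu] := basis_coords be hj (fun _ : 'I_1 => Ly).
have comb (v : 'rV[k]_d) : \sum_i j (v 0 i) * f i = \sum_l j ((v *m A) 0 l) * e 0 l.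
  rewrite (eq_bigr (fun i => \sum_l j (v 0 i * A i l) * e 0 l)); last first.
    by move=> i _; rewrite hA mulr_sumr; apply: eq_bigr => l _; rewrite rmorphM mulrA.
  by rewrite exchange_big; apply: eq_bigr => l _; rewrite mxE rmorph_sum mulr_suml.
have rA : row_free A.
  rewrite -kermx_eq0; apply/negPn/negP; rewrite -nz_row_eq0; set v := nz_row _ => v0.
  have vA : v *m A = 0 by apply/sub_kermxP; apply: nz_row_sub.
  move/eqP: v0; apply; apply/rowP => i; rewrite mxE; apply: (fmorph_inj j); rewrite rmorph0.
  apply: (fr (fun i => j (v 0 i))); first by move=> l; apply/hj; eexists.
  by rewrite comb vA big1 // => l _; rewrite mxE rmorph0 mul0r.
have uA : A \in unitmx by rewrite -row_free_unit.
exists (fun i => j ((u *m invmx A) 0 i)); split; first by move=> i; apply/hj; eexists.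
by rewrite comb mulmxKV // (hu 0).
Qed.

Lemma basis_dim K L d d' (e : 'rV[C]_d) (e' : 'rV[C]_d') : subfield iota K -> subfield iota L ->
  is_basis K L e -> is_basis K L e' -> d = d'.
Proof.
move=> sK sL.
suff H m m' (f : 'rV[C]_m) (f' : 'rV[C]_m') : is_basis K L f -> is_basis K L f' -> (m <= m')%N.
  by move=> h h'; apply/eqP; rewrite eqn_leq (H _ _ _ _ h h') (H _ _ _ _ h' h).
move=> h h'; have [k [j hj]] := subfield_fieldType sK.
have Lf i : L (f 0 i) by case: h.
have [A hA] := basis_coords h' hj Lf.
suff rA : row_free A by move: rA => /eqP <-; apply: rank_leq_col.
rewrite -kermx_eq0; apply/negPn/negP; rewrite -nz_row_eq0; set v := nz_row _ => v0.
have vA : v *m A = 0 by apply/sub_kermxP; apply: nz_row_sub.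
have f0 : \sum_i j (v 0 i) * f 0 i = 0.
  rewrite (eq_bigr (fun i => \sum_l j (v 0 i * A i l) * f' 0 l)); last first.
    by move=> i _; rewrite hA mulr_sumr; apply: eq_bigr => l _; rewrite rmorphM mulrA.
  rewrite exchange_big big1 // => l _; rewrite -mulr_suml -rmorph_sum /=.
  by have := congr1 (fun B : 'rV[k]_m' => B 0 l) vA; rewrite !mxE => ->; rewrite rmorph0 mul0r.
have [_ be] := h; have [c [_ uc]] := be 0 (subfield0 sL).
have c0 : c = 0.
  by apply: uc; split=> [i|]; rewrite ?mulmx0 mxE //; apply: subfield0 sK.
have cv : c = \col_i j (v 0 i).
  apply: uc; split=> [i|]; first by rewrite mxE; apply/hj; eexists.
  by rewrite mxE -[RHS]f0; apply: eq_bigr => i _; rewrite mxE mulrC.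
move/eqP: v0; apply; apply/rowP => i; rewrite mxE; apply: (fmorph_inj j); rewrite rmorph0.
have := congr1 (fun B : 'cV[C]_m => B i 0) cv; rewrite c0 !mxE => <-.
by [].
Qed.

(** * The field [E(zeta)] and its automorphisms over [E] *)

Hypothesis p_odd : odd p.
Variables (E : set C) (n : nat) (zeta : C).
Hypotheses (E_unr : unramified iota (range iota) E) (n_gt0 : (0 < n)%N)
  (zeta_prim : (p ^ n)%N.-primitive_root zeta).
Local Notation F := (adj E zeta).
Local Notation pi := (zeta - 1).
Local Notation e := (p ^ n.-1 * p.-1)%N.

Lemma unr_base_subfield : subfield iota E.
Proof. by case: E_unr => -[]. Qed.
Let sE := unr_base_subfield.

(** The uniformizer common to [Qp] and [E] lies in [Qp], where elements of absolute value below [1]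
    are divisible by [p]. *)
Lemma unr_base_unif : unif iota E p%:R.
Proof.
have [_ [pi0 /prime_elementP + /(prime_elementP _ sE)]] := E_unr.
move=> /(_ (subfield_iotaR iota)) [Q0 pi00 Mpi0 hQ] [_ _ _ hE].
have p0 : (p%:R : C) != 0 by apply: (p_neq0 (iota := iota)).
have Mpp : M p%:R := Mp.
split; [exact: subfield_nat sE|exact: p0|exact: Mpp|].
move=> x Ex Mx; apply: (@multiple_trans _ _ _ _ _ pi0) => //; last exact: hE.
case: Q0 Mpi0 pi00 => c _ <-; rewrite /multiple fmorph_eq0 => Mc c0.
rewrite -(rmorph_nat iota) -fmorph_div; apply: O_iotaW; rewrite inE padic_absM padic_absV padic_absp //.
rewrite invrK -ler_pdivlMr ?ltr0n ?prime_gt0 // mul1r -[_^-1]/(_ ^- 1).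
apply: padic_lt1 => //; rewrite ltNge; apply/negP => hc.
case: Mc => [/eqP|]; first by rewrite fmorph_eq0 (negPf c0).
apply; rewrite -fmorphV; apply: O_iotaW; rewrite inE padic_absV invf_le1 //.
by apply: lt_le_trans hc; apply: ltr01.
Qed.

Lemma unr_base_resid : exists f, [/\ (0 < f)%N, resid iota E (p ^ f) & full_resid iota E (p ^ f)].
Proof.
have [[_ _ _ [d [b be]]] _] := E_unr.
have h : resid iota E (p ^ (d.+1)`!).
  have := resid_finite (HC := HC) (subfield_iotaR iota) sE be (f := 1); rewrite expn1; apply.
  exact: resid_iota.
by apply: (residue_full sE (f0 := (d.+1)`!)) => //; apply: fact_gt0.
Qed.

Lemma F_subfield : subfield iota F. Proof. exact: adjoin_subfield. Qed.
Let sF := F_subfield.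

Let m := (p ^ n.-1)%N.
Let mp : (m * p = p ^ n)%N. Proof. by rewrite /m -expnSr prednK. Qed.
(** The cyclotomic polynomial of order [p^n], as the quotient of [X^(p^n) - 1] by [X^m - 1]. *)
Let G : {poly C} := \sum_(j < p) 'X^(m * j).

Let G_mul : ('X^m - 1) * G = 'X^(p ^ n) - 1.
Proof.
rewrite -mp exprM [RHS]subrX1; congr (_ * _); apply: eq_bigr => j _.
by rewrite exprM.
Qed.

Let G_coef i : E G`_i.
Proof.
by rewrite coef_sum; apply: (subfield_sum _ sE) => j _; rewrite coefXn; apply: subfield_nat sE.
Qed.

Let m_gt0 : (0 < m)%N. Proof. by rewrite expn_gt0 prime_gt0. Qed.

Let G_monic : G \is monic.
Proof.
have := monicXnsubC (1 : C) m_gt0; rewrite polyC1 => h.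
by rewrite -(monicMl _ h) G_mul -(polyC1 C) monicXnsubC // expn_gt0 prime_gt0.
Qed.

Let G_size : size G = e.+1.
Proof.
have h : ('X^m - 1 : {poly C}) != 0 by rewrite -size_poly_eq0 -(polyC1 C) size_XnsubC.
have := size_mul h (monic_neq0 G_monic); rewrite G_mul -(polyC1 C) !size_XnsubC //; last first.
  by rewrite expn_gt0 prime_gt0.
rewrite -mp addSn /= => e1.
apply: (@addnI m); rewrite -e1 addnS; congr _.+1.
by rewrite -mulnS prednK // prime_gt0.
Qed.

Lemma coprime_pn a : coprime p a = coprime (p ^ n) a.
Proof. by rewrite coprime_pexpl. Qed.

Let G_root w : G.[w] = 0 <-> exists2 a, coprime p a & w = zeta ^+ a.
Proof.
split.
  move=> Gw; have : (('X^m - 1) * G).[w] = 0 by rewrite hornerM Gw mulr0.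
  rewrite G_mul !hornerE => /eqP; rewrite subr_eq0 => /eqP /(prim_rootP zeta_prim)[i ei].
  exists i => //; rewrite prime_coprime //; apply/negP => /dvdnP[k ek].
  have wm : w ^+ m = 1.
    by rewrite ei ek -exprM -mulnA [(p * m)%N]mulnC mp mulnC exprM (prim_expr_order zeta_prim) expr1n.
  move: Gw; rewrite /G horner_sum (eq_bigr (fun=> 1)); last first.
    by move=> j _; rewrite hornerXn exprM wm expr1n.
  have p0 : (p%:R : C) != 0 by apply: (p_neq0 (iota := iota)).
  by rewrite sumr_const card_ord => /eqP; rewrite (negPf p0).
move=> [a ca ->].
have h : (('X^m - 1) * G).[zeta ^+ a] = 0.
  by rewrite G_mul !hornerE -exprM mulnC exprM (prim_expr_order zeta_prim) expr1n subrr.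
move: h; rewrite hornerM => /eqP; rewrite mulf_eq0 => /orP[|/eqP//].
rewrite !hornerE subr_eq0 -exprM -(prim_order_dvd zeta_prim) => h; exfalso.
move: ca; rewrite prime_coprime // => /negP; apply.
by rewrite -(dvdn_pmul2r m_gt0) mulnC mp.
Qed.

Lemma zeta_neq1 : zeta != 1.
Proof.
apply/eqP => e1; have := prim_order_dvd zeta_prim 1.
by rewrite expr1 e1 eqxx dvdn1 gtn_eqF // -(exp1n n) ltn_exp2r // prime_gt1.
Qed.

(** The quotient is a geometric sum, and so is its inverse, because [zeta] is in turn a power of
    [zeta^a]. *)
Lemma one_sub_zeta_pow a : coprime p a -> U ((zeta ^+ a - 1) / pi).
Proof.
move=> ca.
have hO w k : O w -> w != 1 -> O ((w ^+ k - 1) / (w - 1)).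
  move=> Ow w1; rewrite subrX1 mulrAC divff ?mul1r ?subr_eq0 //.
  by apply: Osum => l _; apply: OX.
have Oz : O zeta.
  apply: U_O; apply: (U_root (n := (p ^ n)%N)); first by rewrite expn_gt0 prime_gt0.
  by rewrite (prim_expr_order zeta_prim); apply: U1.
have q1 : (1 < p ^ n)%N by rewrite -(exp1n n) ltn_exp2r // prime_gt1.
have z1 := zeta_neq1.
have a0 : (0 < a)%N by apply: coprime_gt0 ca.
have [u [v euv]] : exists u v, (u * a = v * p ^ n + 1)%N.
  have [u v e1 _] := egcdnP (p ^ n) a0; exists u, v.
  by rewrite e1; move: ca; rewrite coprime_pn coprime_sym /coprime => /eqP ->.
have zu : (zeta ^+ a) ^+ u = zeta.
  rewrite -exprM mulnC euv exprD expr1 mulnC exprM (prim_expr_order zeta_prim).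
  by rewrite expr1n mul1r.
have za : zeta ^+ a != 1 by apply: contraNneq z1 => e1; rewrite -zu e1 expr1n.
apply/unitP; split; first by rewrite mulf_neq0 ?invr_eq0 ?subr_eq0.
  exact: hO.
by rewrite invf_div -{1}zu; apply: hO => //; apply: OX.
Qed.

(** Evaluating the cyclotomic polynomial at [1] writes [p] as the product of the [1 - zeta^a], each
    a unit times [pi]. *)
Lemma pi_pow_e : U (pi ^+ e / p%:R).
Proof.
have [r er] := closed_field_poly_normal G.
rewrite (monicP G_monic) scale1r in er.
have sr : size r = e by have := G_size; rewrite er size_prod_XsubC => -[].
have hr w : w \in r -> U ((w - 1) / pi).
  rewrite -root_prod_XsubC -er => /rootP/G_root[a ca ->]; exact: one_sub_zeta_pow.
have q1 : (1 < p ^ n)%N by rewrite -(exp1n n) ltn_exp2r // prime_gt1.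
have pi0 : pi != 0 by rewrite subr_eq0 zeta_neq1.
have ep : (p%:R : C) = \prod_(w <- r) (1 - w).
  transitivity G.[1]; last by rewrite er horner_prod; apply: eq_bigr => w _; rewrite !hornerE.
  rewrite /G horner_sum (eq_bigr (fun=> 1)) ?sumr_const ?card_ord //.
  by move=> j _; rewrite hornerXn expr1n.
have eu : \prod_(w <- r) (- ((w - 1) / pi)) * pi ^+ e = p%:R.
  rewrite ep -sr; elim: (r) => [|w s IH]; first by rewrite !big_nil mulr1.
  by rewrite !big_cons /= exprS -IH; field.
have Uu : U (\prod_(w <- r) (- ((w - 1) / pi))).
  by rewrite big_seq; apply: Uprod => w wr; apply: UN; apply: hr.
rewrite -eu (_ : _ / _ = (\prod_(w <- r) (- ((w - 1) / pi)))^-1); first exact: UV.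
have := U_neq0 Uu; set u := \prod_(w <- r) _ => u0.
by field; rewrite u0 expf_neq0.
Qed.

Lemma e_gt0 : (0 < e)%N.
Proof. by rewrite muln_gt0 m_gt0 -subn1 subn_gt0 prime_gt1. Qed.

Let G1 := G \Po ('X + 1).
Let G1_coef i : E G1`_i.
Proof.
rewrite /G1 comp_polyE coef_sum; apply: (subfield_sum _ sE) => l _; rewrite coefZ.
apply: (subfieldM sE) => //; rewrite addrC exprDn coef_sum; apply: (subfield_sum _ sE) => j _.
by rewrite expr1n mul1r coefMn coefXn -mulrnA; apply: subfield_nat sE.
Qed.

Lemma F_span y : F y -> exists P : {poly C}, [/\ forall i, E P`_i, (size P <= e)%N & y = P.[pi]].
Proof.
move=> Fy; apply: (adjoin_poly_size sE G1_coef (z := pi)).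
- by rewrite /G1 horner_comp !hornerE subrK; apply/G_root; exists 1%N; rewrite ?coprimen1 ?expr1.
- by rewrite /G1 size_comp_poly2 ?G_size // -(polyC1 C) size_XaddC.
- move: y Fy; apply: adjoin_min; first exact: adjoin_subfield.
    by move=> x; apply: adjoin_base.
  have h : adj E pi (pi + 1).
    by apply: (subfieldD (adjoin_subfield pi sE)); [apply: adjoin_gen|apply: subfield1 (adjoin_subfield pi sE)].
  by rewrite subrK in h.
Qed.

Lemma pi_F : F pi.
Proof. by apply: (subfieldB sF); [apply: adjoin_gen|apply: subfield1 sF]. Qed.

Lemma F_structure : [/\ unif iota F pi, is_basis E F (\row_(i < e) pi ^+ i) &
    forall y, F y -> O y -> exists c, [/\ E c, O c & eqM y c]].
Proof.
apply: (eisenstein sE unr_base_unif e_gt0 pi_pow_e sF) => //.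
- by move=> x; apply: adjoin_base.
- exact: pi_F.
- exact: F_span.
Qed.

Lemma F_unif : unif iota F pi. Proof. by case: F_structure. Qed.

Lemma F_residue y : F y -> O y -> exists c, [/\ E c, O c & eqM y c].
Proof. by case: F_structure => _ _ h; apply: h. Qed.

(** If the orbit of [zeta] had fewer than [e] elements, its polynomial would relate
    [1, pi, ..., pi^(e-1)] over [E], which are independent by total ramification. So all primitive
    roots are conjugate. *)
Lemma cyclotomic_surj a : coprime p a -> exists2 h, fixes E h & h zeta = zeta ^+ a.
Proof.
move=> ca; have [Y [uY YP EY]] := conj_orbit zeta sE.
apply/YP.
have [r er] := closed_field_poly_normal G.
rewrite (monicP G_monic) scale1r in er.
have sr : size r = e by have := G_size; rewrite er size_prod_XsubC => -[].
have Yr : {subset Y <= r}.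
  move=> w /YP[h hE <-]; rewrite -root_prod_XsubC -er; apply/rootP.
  rewrite -(horner_fixes _ hE G_coef) (_ : G.[zeta] = 0) ?rmorph0 //.
  by apply/G_root; exists 1%N; rewrite ?coprimen1 ?expr1.
have sY : (size r <= size Y)%N.
  rewrite leqNgt sr; apply/negP => lt.
  pose P := \prod_(w <- Y) ('X - w%:P) \Po ('X + 1).
  have EP i : E P`_i.
    rewrite /P comp_polyE coef_sum; apply: (subfield_sum _ sE) => l _; rewrite coefZ.
    apply: (subfieldM sE) => //; rewrite addrC exprDn coef_sum; apply: (subfield_sum _ sE) => j _.
    by rewrite expr1n mul1r coefMn coefXn -mulrnA; apply: subfield_nat sE.
  have sP : size P = (size Y).+1.
    by rewrite /P size_comp_poly2 ?size_prod_XsubC // -(polyC1 C) size_XaddC.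
  have P0 : P = 0.
    apply: (eis_free sE unr_base_unif e_gt0 pi_pow_e EP); first by rewrite sP.
    rewrite /P horner_comp !hornerE subrK; apply/rootP; rewrite root_prod_XsubC.
    by apply/YP; exists idfun.
  by move: sP; rewrite P0 size_poly0.
have [_ eY] := uniq_min_size uY Yr sY.
rewrite eY -root_prod_XsubC -er; apply/rootP/G_root; by exists a.
Qed.

Lemma F_aut h : fixes E h -> exists2 a, coprime p a & h zeta = zeta ^+ a.
Proof.
move=> hE; apply/G_root; rewrite -(horner_fixes _ hE G_coef) (_ : G.[zeta] = 0) ?rmorph0 //.
by apply/G_root; exists 1%N; rewrite ?coprimen1 ?expr1.
Qed.

Lemma F_stable h y : fixes E h -> F y -> F (h y).
Proof.
move=> hE Fy; have [a _ ha] := F_aut hE.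
have : adj E (h zeta) (h y).
  by apply: (adjoin_image sE sE (fixes_iota sE hE)) Fy => x Ex; rewrite hE.
by rewrite ha; apply: adjoin_pow.
Qed.

End Cyclotomic.

(** * Kummer steps *)

Fixpoint rpow (R : nzRingType) (g : {rmorphism R -> R}) (k : nat) : {rmorphism R -> R} :=
  if k is k'.+1 then g \o rpow g k' else idfun.

Lemma rpowS (R : nzRingType) (g : {rmorphism R -> R}) k x : rpow g k.+1 x = g (rpow g k x).
Proof. by []. Qed.

Lemma rpowSr (R : nzRingType) (g : {rmorphism R -> R}) k x : rpow g k.+1 x = rpow g k (g x).
Proof. by elim: k => //= k <-. Qed.

Lemma rpowD (R : nzRingType) (g : {rmorphism R -> R}) k l x :
  rpow g (k + l) x = rpow g k (rpow g l x).
Proof. by elim: k => //= k ->. Qed.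

Lemma rpowM (R : nzRingType) (g : {rmorphism R -> R}) k l x :
  rpow g (k * l) x = rpow (rpow g l) k x.
Proof. by elim: k => //= k IH; rewrite mulSn rpowD IH. Qed.

Lemma rpow_fixes (C : closedFieldType) (K : set C) (g : {rmorphism C -> C}) k :
  fixes K g -> fixes K (rpow g k).
Proof. by move=> h; elim: k => //= k IH x Kx /=; rewrite IH // h. Qed.

Lemma rpow_id (C : closedFieldType) (g : {rmorphism C -> C}) k x : g x = x -> rpow g k x = x.
Proof. by move=> h; elim: k => //= k ->. Qed.

Lemma rpow_stable (C : closedFieldType) (L : set C) (g : {rmorphism C -> C}) k x :
  (forall y, L y -> L (g y)) -> L x -> L (rpow g k x).
Proof. by move=> h Lx; elim: k => //= k IH; apply: h. Qed.

Lemma rpow_eigen (C : closedFieldType) (g : {rmorphism C -> C}) z b k :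
  g z = z -> g b = z * b -> rpow g k b = z ^+ k * b.
Proof.
move=> gz gb; elim: k => [|k IH]; first by rewrite expr0 mul1r.
by rewrite rpowS IH rmorphM rmorphXn gz gb exprSr mulrA.
Qed.

Section Step.
Variables (p : nat) (Qp : padicField p) (C : closedFieldType).
Variable iota : {rmorphism Qp -> C}.
Context {HC : padic_closure iota}.
Let p_prime : prime p := pc_prime.
Let alg : forall y : C, algebraicOver iota y := pc_alg.
Local Notation O := (integral iota).
Local Notation M := (nonunit iota).
Local Notation U := (isunit iota).
Local Notation eqM := (eqm M).
Local Notation adj := (adjoin iota).
Local Notation ur := (ur iota).
Local Notation mult := (multiple iota).
Let MI : Oideal iota M := M_ideal.

Variables (d : nat) (K : set C) (Pi b z : C) (rho : {rmorphism C -> C}).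
Hypotheses (d_gt1 : (1 < d)%N) (sK : subfield iota K) (uPi : unif iota K Pi) (b0 : b != 0)
  (Kbd : K (b ^+ d)) (z_prim : d.-primitive_root z) (Kz : K z)
  (rho_ur : fixes (ur K) rho) (rho_b : rho b = z * b).
Local Notation L := (adj K b).
Let sL : subfield iota L := adjoin_subfield b sK.
Let d0 : (0 < d)%N := ltnW d_gt1.

Let rhoK : fixes K rho.
Proof. by move=> x Kx; apply: rho_ur; apply: ur_base. Qed.
Let rho_iota c : rho (iota c) = iota c.
Proof. exact: (fixes_iota sK rhoK). Qed.
Let rho_ru w : ru p w -> rho w = w.
Proof. by move=> rw; apply: rho_ur; apply: ur_ru. Qed.

Lemma step_pow k : rpow rho k b = z ^+ k * b.
Proof. by apply: rpow_eigen => //; apply: rhoK. Qed.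

Lemma step_stable y : L y -> L (rho y).
Proof.
move=> Ly; have : adj K (rho b) (rho y).
  by apply: (adjoin_image sK sK rho_iota) Ly => x Kx; rewrite rhoK.
apply: adjoin_min => //; first by move=> x; apply: adjoin_base.
by rewrite rho_b; apply: (subfieldM sL); [apply: adjoin_base|apply: adjoin_gen].
Qed.

Lemma step_ur_stable y : ur L y -> ur L (rho y).
Proof. by apply: (ur_image sL sL rho_iota) => x; apply: step_stable. Qed.

Lemma step_aut h : fixes K h -> exists k, h b = rpow rho k b.
Proof.
move=> hK; have : (h b / b) ^+ d = 1.
  by rewrite exprMn exprVn -rmorphXn hK // divff // expf_neq0.
move=> /(prim_rootP z_prim)[k ek]; exists k.
by rewrite step_pow -ek divfK.
Qed.

Lemma step_agree h k : fixes K h -> h b = rpow rho k b -> forall y, L y -> h y = rpow rho k y.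
Proof.
move=> hK e; apply: (fixes_adjoin sK hK) => //.
exact: rpow_fixes.
Qed.

Lemma step_fixed y : L y -> rho y = y -> K y.
Proof.
move=> Ly e; apply: (fixed_mem alg p_prime sK) => h hK.
have [k ek] := step_aut hK; rewrite (step_agree hK ek Ly).
exact: rpow_id.
Qed.

Lemma step_ur_fixed y : ur L y -> rho y = y -> ur K y.
Proof.
move=> Ly e; apply: (fixed_mem alg p_prime (ur_subfield sK)) => h hK.
have hK' : fixes K h by move=> x Kx; apply: hK; apply: ur_base.
have [k ek] := step_aut hK'.
have -> : h y = rpow rho k y.
  apply: (ur_agree sL) Ly; first exact: step_agree.
  by move=> w rw; rewrite hK; [rewrite rpow_id // rho_ru|apply: ur_ru].
exact: rpow_id.
Qed.

Lemma step_order y : ur L y -> rpow rho d y = y.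
Proof.
move=> Ly; have -> : y = (idfun : {rmorphism C -> C}) y by [].
rewrite -[LHS]/(rpow rho d y); apply: (ur_agree sL) Ly => [x Lx|w rw].
  apply: (fixes_adjoin sK _ _ _ Lx) => //; first exact: rpow_fixes.
  by rewrite step_pow (prim_expr_order z_prim) mul1r.
by rewrite rpow_id // rho_ru.
Qed.

Lemma step_basis : is_basis K L (\row_(j < d) b ^+ j).
Proof.
apply: (power_basis sK).
- by move=> j; apply: (subfieldX j sL); apply: adjoin_gen.
- apply: (adjoin_poly_size sK (G := 'X^d - (b ^+ d)%:P)).
  + move=> j; rewrite coefB coefXn coefC; apply: (subfieldB sK); first exact: subfield_nat sK.
    by case: eqP => // _; apply: subfield0 sK.
  + by rewrite !hornerE subrr.
  + by rewrite size_XnsubC.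
- move=> P KP sP Pb; apply/eqP/negPn/negP => P0.
  pose rs := [seq z ^+ (nat_of_ord j) * b | j <- enum 'I_d].
  have urs : uniq rs.
    rewrite map_inj_in_uniq ?enum_uniq // => j l _ _ /(mulIf b0)/eqP.
    rewrite (eq_prim_root_expr z_prim) !modn_small // => /eqP; exact: val_inj.
  have := max_poly_roots P0 (_ : all (root P) rs) urs.
  rewrite size_map size_enum_ord ltnNge sP => H.
  suff: false by []; apply: H; apply/allP => _ /mapP[j _ ->].
  apply/rootP; rewrite -step_pow -(horner_fixes b (rpow_fixes j rhoK) KP) Pb.
  exact: rmorph0.
Qed.

Lemma z_neq1 : z != 1.
Proof.
apply/eqP => e1; have := prim_order_dvd z_prim 1.
by rewrite expr1 e1 eqxx dvdn1 gtn_eqF.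
Qed.

Lemma b_notin_ur : ~ ur K b.
Proof.
move=> h; have := rho_ur h; rewrite rho_b => /eqP.
by rewrite -{2}[b]mul1r (inj_eq (mulIf b0)) (negPf z_neq1).
Qed.

(** The conjugates of [g y / y] over a period of [g] multiply to [1], so neither it nor its inverse
    lies in the maximal ideal. This replaces invariance of the valuation under automorphisms. *)
Lemma conj_unit (g : {rmorphism C -> C}) k y : (forall c, g (iota c) = iota c) ->
  rpow g k y = y -> (0 < k)%N -> y != 0 -> U (g y / y).
Proof.
move=> gi gk k0 y0; set w := g y / y.
have w0 : w != 0 by rewrite mulf_neq0 ?invr_eq0 ?fmorph_eq0.
have pw : \prod_(j < k) rpow g j w = 1.
  suff h l : \prod_(j < l) rpow g j w = rpow g l y / y by rewrite h gk divff.
  elim: l => [|l IH]; first by rewrite big_ord0 divff.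
  rewrite big_ord_recr /= IH /w fmorph_div -rpowSr rpowS.
  have := y0; rewrite -(fmorph_eq0 (rpow g l)) => n1.
  by field; rewrite n1 y0.
have gi' j c : rpow g j (iota c) = iota c by apply: rpow_id.
have noM u : M u -> \prod_(j < k) rpow g j u = 1 -> False.
  move=> Mu; rewrite -(prednK k0) big_ord_recl => e; apply: (@M1 _ _ _ iota); rewrite -e.
  apply: MMr; first exact: Mu.
  by apply: Oprod => j _; apply: O_aut (M_O Mu); apply: gi'.
apply/unitP; split=> //; apply: contrapT => nO.
  have Mw : M w^-1 by right; rewrite invrK.
  apply: (noM _ Mw); rewrite (eq_bigr (fun j : 'I_k => (rpow g j w)^-1)) => [|j _]; last by rewrite fmorphV.
  by rewrite prodfV pw invr1.
by apply: (noM w) => //; right.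
Qed.

Hypotheses (K_resid : exists2 f, (0 < f)%N & resid iota K (p ^ f)) (d_prime : prime d).

(* Otherwise [K(b)] would be unramified over [K], hence contained in [ur K]. *)
Lemma step_ramified : exists y, [/\ L y, M y, y != 0 & ~ mult Pi y].
Proof.
apply: contrapT => nex; apply: b_notin_ur.
have KL x : K x -> L x by apply: adjoin_base.
apply: (unramified_ur sK K_resid (L := L)); last exact: adjoin_gen.
split; first by split=> //; exists d, (\row_(j < d) b ^+ j); apply: step_basis.
have [KPi Pi0 MPi hPi] := uPi.
exists Pi; apply/prime_elementP => //; split=> //; first exact: KL.
move=> y Ly My; apply: contrapT => ny; apply: nex; exists y; split=> //.
by apply/eqP => y0; apply: ny; rewrite y0 /multiple mul0r; apply: O0.
Qed.

Lemma step_norm_mem y : L y -> K (\prod_(j < d) rpow rho j y).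
Proof.
move=> Ly; apply: step_fixed.
  by apply: (subfield_prod _ sL) => j _; apply: (rpow_stable (L := L)) => // w; apply: step_stable.
rewrite rmorph_prod -[in RHS](prednK d0) -[in LHS](prednK d0) big_ord_recr big_ord_recl /= mulrC.
congr (_ * _); rewrite -rpowS prednK //; apply: step_order; exact: ur_base.
Qed.

(** [step_ramified] provides a nonunit [y] not divisible by [Pi]. Comparison with its norm shows
    that [y^d] is a unit times some [Pi^c]; if [d] divided [c], then [y] would be a unit times a
    power of [Pi]. As [d] is prime, a Bezout relation between [c] and [d] yields an element whose
    [d]-th power is a unit times [Pi]. *)
Lemma step_structure : exists Pi', [/\ unif iota L Pi', U (Pi' ^+ d / Pi) &
  forall y, L y -> O y -> exists c, [/\ K c, O c & eqM y c]].
Proof.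
have [y [Ly My y0 ny]] := step_ramified.
have [KPi Pi0 MPi hPi] := uPi.
pose N := \prod_(j < d) rpow rho j y.
have KN : K N := step_norm_mem Ly.
have yord : rpow rho d y = y by apply: step_order; apply: ur_base.
have Uj j : U (rpow rho j y / y).
  elim: j => [|j IH] /=; first by rewrite divff //; apply: U1.
  have h : U (rho (rpow rho j y) / rpow rho j y).
    have := U_aut (fun c => rpow_id j (rho_iota c)) (conj_unit rho_iota yord d0 y0).
    by rewrite fmorph_div /= -rpowSr.
  have n1 : rpow rho j y != 0 by rewrite fmorph_eq0.
  by have := UM h IH; rewrite mulrA divfK.
have UN' : U (N / y ^+ d).
  rewrite /N -[in X in _ / X](card_ord d) -prodr_const -prodf_div.
  by apply: Uprod => j _; apply: Uj.
have ON' : O N by apply: Oprod => j _; apply: O_aut (M_O My) => c; apply: rpow_id.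
have N0 : N != 0 by apply: contraNneq (U_neq0 UN') => ->; rewrite mul0r.
have [c Uc] := unif_decomp sK uPi KN ON' N0.
have Pik k : Pi ^+ k != 0 by rewrite expf_neq0.
have yk k : y ^+ k != 0 by rewrite expf_neq0.
have Uy : U (y ^+ d / Pi ^+ c).
  rewrite (_ : _ / _ = (N / Pi ^+ c) / (N / y ^+ d)); first by apply: UM (UV UN').
  by field; rewrite N0 yk Pik.
have npc : ~~ (d %| c)%N.
  apply/negP => /dvdnP[k ek].
  have Uyk : U (y / Pi ^+ k).
    by apply: (U_root d0); rewrite exprMn exprVn -exprM -ek.
  apply: ny; case: k ek Uyk => [|k] ek Uyk.
    by exfalso; move: Uyk; rewrite expr0 divr1 => /U_notM.
  rewrite /multiple (_ : _ / _ = y / Pi ^+ k.+1 * Pi ^+ k); last first.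
    by rewrite exprS; field; rewrite Pi0 Pik.
  by apply: OM (U_O Uyk) (OX _ (M_O MPi)).
have c0 : (0 < c)%N by rewrite lt0n; apply: contraNneq npc => ->; rewrite dvdn0.
have [u [v euv]] : exists u v, (u * c = v * d + 1)%N.
  have [u v e1 _] := egcdnP d c0; exists u, v.
  by rewrite e1; move: npc; rewrite -prime_coprime // coprime_sym /coprime => /eqP ->.
pose Pi' := y ^+ u / Pi ^+ v.
have ePi' : U (Pi' ^+ d / Pi).
  rewrite (_ : _ / _ = (y ^+ d / Pi ^+ c) ^+ u); first exact: UX.
  rewrite /Pi' !exprMn !exprVn -!exprM [(c * u)%N]mulnC euv exprD expr1 [(d * u)%N]mulnC.
  by field; rewrite Pi0 Pik.
have KL x : K x -> L x by apply: adjoin_base.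
have LPi' : L Pi'.
  by apply: (subfield_div sL); apply: (subfieldX _ sL) => //; apply: KL.
have fr := eis_free sK uPi d0 ePi'.
have [|h1 _ h3] := eisenstein sK uPi d0 ePi' sL KL LPi'; last by exists Pi'.
move=> w Lw.
have [|cc Kc c00|cc [Kcc ecc]] := basis_span sK step_basis (f := fun j => Pi' ^+ j) _ _ Lw.
- by move=> j; apply: (subfieldX j sL).
- move=> l; have P0 : \poly_(j < d) (if insub j is Some j' then cc j' else 0) = 0.
    apply: fr.
    + move=> j; rewrite coef_poly; case: ifP => _; last exact: subfield0 sK.
      by case: insubP => [j' _ _|_]; [apply: Kc|apply: subfield0 sK].
    + exact: size_poly.
    + by rewrite horner_poly -[RHS]c00; apply: eq_bigr => j _; rewrite valK.
  have := congr1 (fun P : {poly C} => P`_l) P0; rewrite coef_poly ltn_ord coef0 valK.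
  by [].
- exists (\poly_(j < d) (if insub j is Some j' then cc j' else 0)); split.
  + move=> j; rewrite coef_poly; case: ifP => _; last exact: subfield0 sK.
    by case: insubP => [j' _ _|_]; [apply: Kcc|apply: subfield0 sK].
  + exact: size_poly.
  + by rewrite ecc horner_poly; apply: eq_bigr => j _; rewrite valK.
Qed.

End Step.

(** * Approximate surjectivity of the norm *)

Lemma deriv_prod (R : comNzRingType) (I : eqType) (r : seq I) (F : I -> {poly R}) : uniq r ->
  (\prod_(j <- r) F j)^`() = \sum_(j <- r) (F j)^`() * \prod_(l <- r | l != j) F l.
Proof.
elim: r => [|a r IH] /=; first by rewrite !big_nil derivC.
move=> /andP[ar ur]; rewrite !big_cons derivM IH // eqxx /=; congr (_ + _).
  congr (_ * _); rewrite big_seq_cond [RHS]big_seq_cond; apply: eq_bigl => l.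
  by case: eqP => [->|]; rewrite ?(negPf ar) ?andbT.
rewrite mulr_sumr; apply: eq_big_seq => j jr.
have aj : a != j by apply: contraNneq ar => ->.
by rewrite big_cons aj mulrCA.
Qed.

Section NormStep.
Variables (p : nat) (Qp : padicField p) (C : closedFieldType).
Variable iota : {rmorphism Qp -> C}.
Context {HC : padic_closure iota}.
Let p_prime : prime p := pc_prime.
Let alg : forall y : C, algebraicOver iota y := pc_alg.
Local Notation O := (integral iota).
Local Notation M := (nonunit iota).
Local Notation U := (isunit iota).
Local Notation eqM := (eqm M).
Local Notation mult := (multiple iota).
Let MI : Oideal iota M := M_ideal.
Let p0 : (0 < p)%N := prime_gt0 p_prime.

(** The coefficients of an integral equation reduce to the prime field, so the residue of [x] is
    periodic under Frobenius. *)
Lemma O_teich x : O x -> exists z, (z = 0 \/ ru p z) /\ eqM x z.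
Proof.
move=> Ox; have [f [mf /polyOverP hf fx]] := Ox.
have [||||| b [/andP[b0 _] hb]] := @residue_period _ _ _ iota _ 1 (map_poly iota f) x.
- by move=> i; rewrite coef_map; apply: O_iotaW.
- move=> i; rewrite coef_map expn1; apply: resid_iota; last by apply: O_iotaW.
  by exists f`_i.
- exists (size f).-1; rewrite coef_map /= -lead_coefE (monicP mf) rmorph1; exact: M1.
- exact: Ox.
- by rewrite (rootP fx); apply: M0.
rewrite expn1 in hb; have [z zq xz] := teich_q Ox hb b0.
exists z; split=> //; have [->|z0] := eqVneq z 0; first by left.
by right; apply: (ru_q (iota := iota) b0).
Qed.

Lemma ideal_prod_coef (I : C -> Prop) (J : Type) (r : seq J) (P : pred J) (y : J -> C) :
  Oideal iota I -> (forall z, I z -> O z) -> (forall j, P j -> I (y j)) ->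
  forall k, (0 < k)%N -> I (\prod_(j <- r | P j) (1 + y j *: 'X) : {poly C})`_k.
Proof.
move=> hI IO hy.
suff H : forall k, O (\prod_(j <- r | P j) (1 + y j *: 'X) : {poly C})`_k /\
    ((0 < k)%N -> I (\prod_(j <- r | P j) (1 + y j *: 'X) : {poly C})`_k).
  by move=> k; have [_] := H k.
elim: r => [|a r IH] k.
  rewrite big_nil coef1; case: k => [|k] /=; split=> //; [exact: O1|exact: O0|].
  by move=> _; apply: (idl0 hI).
rewrite big_cons; case: ifP => // Pa.
rewrite mulrDl mul1r -scalerAl -commr_polyX coefD coefZ coefMX.
have [Ok Ik] := IH k.
case: k Ok Ik => [|k] /= Ok Ik; first by rewrite mulr0 addr0.
have [Ok' _] := IH k.
have h : I (y a * (\prod_(j <- r | P j) (1 + y j *: 'X))`_k) by apply: (idlMr hI) => //; apply: hy.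
by split=> [|_]; [apply: OD => //; apply: IO|apply: (idlD hI) => //; apply: Ik].
Qed.

(** * The norm in a ramified step of degree [p] with algebraically closed residue field *)

Variables (A B : set C) (Pa Pb : C) (rho : {rmorphism C -> C}).
Hypotheses (sA : subfield iota A) (sB : subfield iota B) (AB : forall x, A x -> B x)
  (rhoA : fixes A rho) (rhoB : forall y, B y -> B (rho y))
  (rho_fix : forall y, B y -> rho y = y -> A y) (rho_p : forall y, B y -> rpow rho p y = y)
  (uA : unif iota A Pa) (uB : unif iota B Pb) (Pab : U (Pb ^+ p / Pa))
  (ruA : forall w, ru p w -> A w).

Let rho_iota c : rho (iota c) = iota c. Proof. exact: (fixes_iota sA rhoA). Qed.
Let rpow_iota j c : rpow rho j (iota c) = iota c. Proof. exact: rpow_id. Qed.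
Let Pa0 : Pa != 0. Proof. by case: uA. Qed.
Let Pb0 : Pb != 0. Proof. by case: uB. Qed.
Let MPa : M Pa. Proof. by case: uA. Qed.
Let MPb : M Pb. Proof. by case: uB. Qed.
Let APa : A Pa. Proof. by case: uA. Qed.
Let BPb : B Pb. Proof. by case: uB. Qed.

Definition nrm y := \prod_(j < p) rpow rho j y.
Definition trc y := \sum_(j < p) rpow rho j y.

Let Bpow j y : B y -> B (rpow rho j y).
Proof. by move=> By; apply: (rpow_stable (L := B)). Qed.

Lemma nrmM x y : nrm (x * y) = nrm x * nrm y.
Proof. by rewrite /nrm -big_split; apply: eq_bigr => j _; rewrite rmorphM. Qed.

Lemma nrm_base c : A c -> nrm c = c ^+ p.
Proof.
move=> Ac; rewrite /nrm (eq_bigr (fun=> c)) ?prodr_const ?card_ord // => j _.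
by apply: rpow_id; apply: rhoA.
Qed.

Lemma nrm_A y : B y -> A (nrm y).
Proof.
move=> By; apply: rho_fix; first by apply: (subfield_prod _ sB) => j _; apply: Bpow.
rewrite /nrm rmorph_prod -[in RHS](prednK p0) -[in LHS](prednK p0) big_ord_recr big_ord_recl /= mulrC.
by congr (_ * _); rewrite -rpowS prednK // rho_p.
Qed.

Lemma trc_A y : B y -> A (trc y).
Proof.
move=> By; apply: rho_fix; first by apply: (subfield_sum _ sB) => j _; apply: Bpow.
rewrite /trc rmorph_sum -[in RHS](prednK p0) -[in LHS](prednK p0) big_ord_recr big_ord_recl /= addrC.
by congr (_ + _); rewrite -rpowS prednK // rho_p.
Qed.

Lemma rpow_unit j : U (rpow rho j Pb / Pb).
Proof.
elim: j => [|j IH] /=; first by rewrite divff //; apply: U1.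
have h : U (rho (rpow rho j Pb) / rpow rho j Pb).
  have := U_aut (rpow_iota j) (conj_unit (HC := HC) rho_iota (rho_p BPb) p0 Pb0).
  by rewrite fmorph_div /= -rpowSr.
have n1 : rpow rho j Pb != 0 by rewrite fmorph_eq0.
by have := UM h IH; rewrite mulrA divfK.
Qed.

Lemma mult_rpow j m y : mult (Pb ^+ m) y -> mult (Pb ^+ m) (rpow rho j y).
Proof.
move=> h; have := multiple_aut (rpow_iota j) h.
have -> : rpow rho j (Pb ^+ m) = Pb ^+ m * (rpow rho j Pb / Pb) ^+ m.
  by rewrite rmorphXn -exprMn mulrC divfK.
by move=> h'; apply/(multiple_unit _ _ (UX m (rpow_unit j))).
Qed.

Lemma mult_Pab k y : mult (Pb ^+ (p * k)) y <-> mult (Pa ^+ k) y.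
Proof.
have e : Pb ^+ (p * k) = Pa ^+ k * (Pb ^+ p / Pa) ^+ k.
  by rewrite -exprMn mulrC divfK // exprM.
have [h1 h2] := multiple_unit (Pa ^+ k) y (UX k Pab).
by rewrite e; split.
Qed.

Lemma nrm_unif : U (nrm Pb / Pa).
Proof.
have : U (nrm Pb / Pb ^+ p).
  rewrite /nrm -[in X in _ / X](card_ord p) -prodr_const -prodf_div.
  by apply: Uprod => j _; apply: rpow_unit.
by move=> h; have := UM h Pab; rewrite mulrA divfK // expf_neq0.
Qed.

Lemma nrm_mult m y : mult (Pb ^+ m) y -> mult (Pa ^+ m) (nrm y).
Proof.
move=> h; apply/mult_Pab; rewrite mulnC exprM /multiple /nrm.
rewrite -[in X in _ / X](card_ord p) -prodr_const -prodf_div; apply: Oprod => j _.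
exact: mult_rpow.
Qed.

(* The middle coefficients [s_k] of the norm polynomial are traces up to the
   unit [k]: comparing derivatives, [k s_k] is the trace of an element of
   [B] divisible by [z ^+ 2]. *)
Lemma norm_expansion l m z c : (0 < m)%N -> B z -> mult (Pb ^+ m) z -> A c -> O c ->
  (forall y, B y -> mult (Pb ^+ m.+1) y -> mult (Pa ^+ l.+1) (trc y)) ->
  mult (Pa ^+ l.+1) (nrm (1 + c * z) - (1 + c * trc z + c ^+ p * nrm z)).
Proof.
move=> m0 Bz hz Ac Oc hT.
have Oz : O (Pb ^+ m) by apply: OX; apply: M_O.
have Pm0 : Pb ^+ m != 0 by rewrite expf_neq0.
pose y j := rpow rho j z.
have hy j : mult (Pb ^+ m) (y j) by apply: mult_rpow.
have By j : B (y j) by apply: Bpow.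
pose F (j : nat) : {poly C} := 1 + y j *: 'X.
pose P := \prod_(j < p) F j.
have evP : nrm (1 + c * z) = P.[c].
  rewrite /P horner_prod; apply: eq_bigr => j _.
  by rewrite /F !hornerE rmorphD rmorphM rmorph1 /= (rpow_id j (rhoA Ac)) mulrC.
have mapF k j : map_poly (rpow rho k) (F j) = F (k + j)%N.
  by rewrite /F rmorphD rmorph1 /= map_polyZ map_polyX /= /y rpowD.
have Fp : F p = F 0 by rewrite /F /y rho_p.
have mapP1 : map_poly rho P = P.
  have mapF1 j : map_poly rho (F j) = F j.+1 by have := mapF 1%N j.
  rewrite /P rmorph_prod -[in RHS](prednK p0) -[in LHS](prednK p0) big_ord_recr big_ord_recl /= mulrC.
  by rewrite mapF1 prednK // Fp; congr (_ * _); apply: eq_bigr => j _; rewrite mapF1.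
have mapP k : map_poly (rpow rho k) P = P.
  elim: k => [|k IH]; first by apply/polyP => i; rewrite coef_map.
  by rewrite -[RHS]mapP1 -[in RHS]IH; apply/polyP => i; rewrite !coef_map.
have F0 j : F j != 0.
  apply/eqP => e; have := congr1 (fun Q : {poly C} => Q`_0) e.
  by rewrite coefD coefZ coefX coef1 mulr0 addr0 coef0 => /eqP; rewrite oner_eq0.
pose o0 := Ordinal p0.
pose P0 := \prod_(l < p | l != o0) F l.
have Pj (j : 'I_p) : \prod_(l < p | l != j) F l = map_poly (rpow rho j) P0.
  have sp (k : 'I_p) : F k * \prod_(l' < p | l' != k) F l' = P by rewrite /P [RHS](bigD1 k).
  apply: (mulfI (F0 j)); rewrite sp -(mapP j) -[in LHS](sp o0) rmorphM /=.
  by rewrite mapF addn0.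
have dP : P^`() = \sum_(j < p) y j *: map_poly (rpow rho j) P0.
  rewrite /P deriv_prod ?index_enum_uniq //; apply: eq_bigr => j _.
  by rewrite -Pj /F derivD derivZ derivX (derivC 1) add0r -scalerAl mul1r.
have BP0 k : B P0`_k.
  have H (r : seq 'I_p) (Q : pred 'I_p) : forall k, B (\prod_(l <- r | Q l) F l)`_k.
    elim: r => [|a r IH] k'.
      by rewrite big_nil coef1; apply: subfield_nat sB.
    rewrite big_cons; case: ifP => // _; rewrite coefM; apply: (subfield_sum _ sB) => l' _.
    apply: (subfieldM sB) => //; rewrite coefD coefZ coefX coef1.
    apply: (subfieldD sB); first exact: subfield_nat sB.
    by apply: (subfieldM sB) => //; apply: subfield_nat sB.
  exact: H.
have kP k : (k.+1)%:R * P`_k.+1 = trc (z * P0`_k).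
  have := congr1 (fun Q : {poly C} => Q`_k) dP; rewrite coef_deriv => ek.
  rewrite mulr_natl ek coef_sum; apply: eq_bigr => j _.
  by rewrite coefZ coef_map rmorphM.
have sF j : (size (F j) <= 2)%N.
  rewrite /F (leq_trans (size_polyD _ _)) // size_poly1 geq_max /= (leq_trans (size_scale_leq _ _)) //.
  by rewrite size_polyX.
have sP : (size P <= p.+1)%N.
  have H k : (size (\prod_(j < k) F j)%R <= k.+1)%N.
    elim: k => [|k IH]; first by rewrite big_ord0 size_poly1.
    rewrite big_ord_recr /= (leq_trans (size_polyMleq _ _)) //.
    by rewrite -subn1 leq_subLR; apply: leq_trans (leq_add IH (sF k)) _; lia.
  exact: H.
have Pc0 : P`_0 = 1.
  rewrite -horner_coef0 /P horner_prod big1 // => j _.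
  by rewrite /F !hornerE ?mulr0 ?addr0.
have Pc1 : P`_1 = trc z.
  have := kP 0%N; rewrite mul1r => ->; congr trc.
  rewrite -[RHS]mulr1; congr (_ * _); rewrite -horner_coef0 /P0 horner_prod big1 // => j _.
  by rewrite /F !hornerE ?mulr0 ?addr0.
have Pcp : P`_p = nrm z.
  have H k : (\prod_(j < k) F j)`_k = \prod_(j < k) y j.
    elim: k => [|k IH]; first by rewrite !big_ord0 coef1.
    rewrite !big_ord_recr /= /F mulrDr mulr1 -scalerAr coefD coefZ coefMX /= IH mulrC.
    rewrite nth_default ?add0r //.
    elim: k {IH} => [|k IH]; first by rewrite big_ord0 size_poly1.
    rewrite big_ord_recr /= (leq_trans (size_polyMleq _ _)) //.
    by rewrite -subn1 leq_subLR; apply: leq_trans (leq_add IH (sF k)) _; lia.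
  exact: H.
have sum3 k (f : nat -> C) : \sum_(j < k.+3) f j = f 0%N + f 1%N + f k.+2 + \sum_(j < k) f j.+2.
  by rewrite big_ord_recl big_ord_recr big_ord_recl /=; ring.
have p2 : p = (p - 2).+2 by have := prime_gt1 p_prime; lia.
have e3 : P.[c] = P`_0 + P`_1 * c + P`_p * c ^+ p + \sum_(j < p - 2) P`_j.+2 * c ^+ j.+2.
  rewrite (horner_coef_wide _ sP); have := sum3 (p - 2)%N (fun k => P`_k * c ^+ k).
  by rewrite -p2 expr0 expr1 mulr1.
rewrite evP e3 Pc0 Pc1 Pcp.
rewrite (_ : _ - _ = \sum_(j < p - 2) P`_j.+2 * c ^+ j.+2); last by ring.
apply: (idl_sum (multiple_ideal iota _)) => j _; apply: multiple_mulr; last exact: OX.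
have Uj : U (j.+2)%:R.
  apply: U_coprime; rewrite prime_coprime // gtnNdvd //; have := ltn_ord j; lia.
rewrite -[P`_j.+2](mulKf (U_neq0 Uj)); apply: multiple_mull; last exact: U_OV.
rewrite kP; apply: hT; first exact: (subfieldM sB).
have h2 : mult (Pb ^+ (m + m)) (z * P0`_j.+1).
  rewrite exprD; apply: multiple_mul => //.
  rewrite /P0 /F; apply: (@ideal_prod_coef (mult (Pb ^+ m)) _ _ _ (fun l : 'I_p => y l) (multiple_ideal iota _)) => // w.
  exact: multiple_O.
by apply: multiple_powW h2 => //; [apply: M_O|rewrite -addn1 leq_add2l].
Qed.

Lemma trc_scale a y : A a -> trc (a * y) = a * trc y.
Proof.
move=> Aa; rewrite /trc mulr_sumr; apply: eq_bigr => j _.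
by rewrite rmorphM (rpow_id j (rhoA Aa)).
Qed.

Lemma O_trc y : O y -> O (trc y).
Proof. by move=> Oy; apply: Osum => j _; apply: O_aut Oy; apply: rpow_iota. Qed.

Lemma teich_A x : O x -> exists c, [/\ A c, O c & eqM x c].
Proof.
move=> /O_teich[z [hz xz]]; exists z; split=> //; first by case: hz => [->|]; [apply: subfield0 sA|apply: ruA].
exact: (teich_O hz).
Qed.

Lemma mult_succ l d : A d -> M d -> mult (Pa ^+ l.+1) (d * Pa ^+ l).
Proof.
move=> Ad Md; rewrite exprS; apply: multiple_mul; last by apply: multiple_self; rewrite expf_neq0.
by have [_ _ _ h] := uA; apply: h.
Qed.

(** Let [m] be least such that the trace sends level [m] of [B] into level [l + 1] of [A]. If
    [m <= l], the norm of [1 + c * Pb^l] is governed by [c^p] alone. Otherwise some [z] of level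
    [m - 1] has a trace of exact order [l], and the leading term is [c * a + c^p * b] with [a] a
    unit. Both equations in [c] can be solved since the residue field is algebraically closed. *)
Lemma norm_level l u : (0 < l)%N -> A u -> mult (Pa ^+ l) (u - 1) ->
  exists w, [/\ B w, U w & mult (Pa ^+ l.+1) (nrm w - u)].
Proof.
move=> l0 Au hu.
pose good m := forall y, B y -> mult (Pb ^+ m) y -> mult (Pa ^+ l.+1) (trc y).
have ex : exists m, `[< good m >].
  exists (p * l.+1)%N; apply/asboolP => y By /mult_Pab hy.
  have APl : A (Pa ^+ l.+1) by apply: (subfieldX _ sA).
  rewrite -[y](mulKf (expf_neq0 l.+1 Pa0)) mulrCA trc_scale // /multiple mulrAC divff ?mul1r ?expf_neq0 //.
  by apply: O_trc; rewrite mulrC.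
case: (ex_minnP ex) => m /asboolP gm mmin.
have Pal : Pa ^+ l != 0 by rewrite expf_neq0.
pose d := (u - 1) / Pa ^+ l.
have Od : O d by [].
have Ad : A d by apply: (subfield_div sA); [apply: (subfieldB sA) => //; apply: subfield1 sA|apply: (subfieldX _ sA)].
have eu : u = 1 + d * Pa ^+ l by rewrite divfK // addrC subrK.
have APl : A (Pa ^+ l) by apply: (subfieldX _ sA).
have fin z c k : (0 < k)%N -> B z -> mult (Pb ^+ k) z -> A c -> O c -> good k.+1 ->
    M (c * (trc z / Pa ^+ l) + c ^+ p * (nrm z / Pa ^+ l) - d) ->
    exists w, [/\ B w, U w & mult (Pa ^+ l.+1) (nrm w - u)].
  move=> k0 Bz hz Ac Oc gk hM; exists (1 + c * z).
  have Pk : Pb ^+ k != 0 by rewrite expf_neq0.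
  have Mz : M z by apply: multiple_M hz => //; apply: MX.
  split.
  - by apply: (subfieldD sB); [apply: subfield1 sB|apply: (subfieldM sB) => //; apply: AB].
  - by apply: U_D; [apply: U1|apply: MM].
  - have h := norm_expansion k0 Bz hz Ac Oc gk.
    rewrite -[nrm _](subrK (1 + c * trc z + c ^+ p * nrm z)) -addrA.
    apply: (idlD (multiple_ideal iota _)) => //.
    rewrite eu (_ : _ - _ = (c * (trc z / Pa ^+ l) + c ^+ p * (nrm z / Pa ^+ l) - d) * Pa ^+ l); last by field.
    apply: mult_succ => //; apply: (subfieldB sA) => //.
    apply: (subfieldD sA); apply: (subfieldM sA) => //; try exact: (subfieldX _ sA).
      by apply: (subfield_div sA) => //; apply: trc_A.
    by apply: (subfield_div sA) => //; apply: nrm_A.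
have [lm|lm] := leqP m l.
  pose eta := nrm Pb / Pa.
  have Ueta := nrm_unif; rewrite -/eta in Ueta.
  have [c0 ec0] : exists c0, c0 ^+ p = d / eta ^+ l.
    have [c0] : exists c0, root ('X^p - (d / eta ^+ l)%:P) c0.
      by apply/closed_rootP; rewrite size_XnsubC // eqSS gtn_eqF.
    by rewrite rootE !hornerE subr_eq0 => /eqP <-; exists c0.
  have Oc0 : O c0.
    apply: (@O_root _ _ _ _ ('X^p - (d / eta ^+ l)%:P)); first by rewrite monicXnsubC.
      move=> i; rewrite coefB coefXn coefC; apply: OB; first exact: OnatR.
      case: eqP => _; last exact: O0.
      by apply: OM => //; apply: U_OV; apply: UX.
    by rewrite rootE !hornerE ec0 subrr.
  have [c [Ac Oc cc]] := teich_A Oc0.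
  apply: (fin (Pb ^+ l) c l) => //.
  - exact: (subfieldX _ sB).
  - by apply: multiple_self; rewrite expf_neq0.
  - move=> y By hy; apply: gm => //; apply: multiple_powW hy => //; first exact: M_O.
    by apply: leqW.
  - have -> : nrm (Pb ^+ l) / Pa ^+ l = eta ^+ l.
      rewrite /eta exprMn exprVn; congr (_ / _); rewrite /nrm -prodrXl.
      by apply: eq_bigr => j _; rewrite rmorphXn.
    have h1 : M (trc (Pb ^+ l) / Pa ^+ l).
      have h := gm (Pb ^+ l) (subfieldX l sB BPb) _.
      have /h : mult (Pb ^+ m) (Pb ^+ l).
        apply: (@multiple_powW _ _ _ iota Pb l m) => //; first exact: M_O.
        by apply: multiple_self; rewrite expf_neq0.
      move=> h2; rewrite (_ : trc (Pb ^+ l) / Pa ^+ l = Pa * (trc (Pb ^+ l) / Pa ^+ l.+1)); first exact: MMr.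
      by rewrite exprS; field; rewrite Pa0 Pal.
    rewrite -addrA; apply: MD; first exact: MM.
    rewrite (_ : _ - _ = (c ^+ p - c0 ^+ p) * eta ^+ l); last first.
      by rewrite ec0 mulrBl divfK // expf_neq0 // (U_neq0 Ueta).
    apply: MMr; last by apply: OX; apply: U_O.
    by apply: (eqm_sym MI); apply: (eqmX MI).
case: m gm mmin lm => // m gm mmin lm.
have m0 : (0 < m)%N by apply: leq_trans l0 _.
have ng : ~ good m by move=> g; have := mmin m (asboolT g); rewrite ltnn.
have [z [Bz hz nz]] : exists z, [/\ B z, mult (Pb ^+ m) z & ~ mult (Pa ^+ l.+1) (trc z)].
  apply: contrapT => nex; apply: ng => y By hy; apply: contrapT => ny; apply: nex.
  by exists y.
have tA := trc_A Bz.
have t0 : trc z != 0 by apply/eqP => e; apply: nz; rewrite e /multiple mul0r; apply: O0.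
have Oz : O z by apply: multiple_O hz; [rewrite expf_neq0|apply: OX; apply: M_O].
have [l' Ul'] := unif_decomp sA uA tA (O_trc Oz) t0.
have Pal' : Pa ^+ l' != 0 by rewrite expf_neq0.
have l'l : (l' <= l)%N.
  rewrite leqNgt; apply/negP => h; apply: nz.
  by apply: multiple_powW h (U_O Ul') => //; apply: M_O.
(* If [l' < l], multiplying [z] by [Pa^(l - l')] would bring it to level [m + 1] or more while
   giving its trace the exact order [l], against [gm]. *)
have el : l' = l.
  apply/eqP; rewrite eqn_leq l'l leqNgt; apply/negP => h.
  have Aa : A (Pa ^+ (l - l')) by apply: (subfieldX _ sA).
  have : mult (Pa ^+ l.+1) (trc (Pa ^+ (l - l') * z)).
    apply: gm; first by apply: (subfieldM sB) => //; apply: AB.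
    apply: (@multiple_powW _ _ _ _ _ (p * (l - l') + m)) => //; first exact: M_O.
      by rewrite -ltnS -addnS -[X in (X < _)%N]add0n ltn_add2r muln_gt0 p0 subn_gt0.
    rewrite exprD; apply: multiple_mul => //; apply/mult_Pab.
    by apply: multiple_self; rewrite expf_neq0.
  rewrite trc_scale // => h2.
  have : O Pa^-1.
    rewrite (_ : Pa^-1 = Pa ^+ (l - l') * trc z / Pa ^+ l.+1 / (trc z / Pa ^+ l')).
      by apply: OM => //; apply: U_OV.
    rewrite -[in X in _ / X / _](subnK l'l) -addSn exprD exprS.
    by field; rewrite ?t0 ?Pa0 ?Pal' ?expf_neq0.
  by case: MPa => // e _; have := Pa0; rewrite e eqxx.
rewrite el in Ul'; set a := trc z / Pa ^+ l in Ul'.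
set b := nrm z / Pa ^+ l.
have Ob : O b.
  by apply: (multiple_powW Pa0 (M_O MPa) _ (nrm_mult hz)); rewrite -ltnS.
have [c [Ac Oc hc]] : exists c, [/\ A c, O c & M (c * a + c ^+ p * b - d)].
  have [Mb|Ub] := O_case Ob.
    have [c [Ac Oc hc]] := teich_A (OM Od (U_OV Ul')).
    exists c; split=> //; rewrite addrAC; apply: MD; last by apply: MM => //; apply: OX.
    have -> : c * a - d = - ((d / a - c) * a) by field; apply: U_neq0 Ul'.
    by apply: MN; apply: MMr => //; apply: U_O.
  pose f := 'X^p + (a / b) *: 'X - (d / b)%:P : {poly C}.
  have b0 := U_neq0 Ub.
  have szf : size ('X^p + (a / b) *: 'X : {poly C}) = p.+1.
    rewrite size_polyDl size_polyXn // (leq_ltn_trans (size_scale_leq _ _)) // size_polyX.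
    by rewrite ltnS prime_gt1.
  have mof : f \is monic.
    rewrite monicE /f lead_coefDl; last by rewrite szf size_polyN (leq_ltn_trans (size_polyC_leq1 _)).
    rewrite lead_coefDl ?lead_coefXn // size_polyXn (leq_ltn_trans (size_scale_leq _ _)) // size_polyX.
    by rewrite ltnS prime_gt1.
  have szff : size f = p.+1.
    by rewrite /f size_polyDl // szf size_polyN (leq_ltn_trans (size_polyC_leq1 _)).
  have [c0 rc0] : exists c0, root f c0 by apply/closed_rootP; rewrite szff eqSS gtn_eqF.
  have Oc0 : O c0.
    apply: O_root mof _ rc0 => i; rewrite /f coefB coefD coefXn coefZ coefX coefC.
    apply: OB; last by case: eqP => _; [apply: OM => //; apply: U_OV|apply: O0].
    apply: OD; first exact: OnatR.
    by apply: OM; [apply: OM (U_O Ul') (U_OV Ub)|apply: OnatR].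
  have [c [Ac Oc hc]] := teich_A Oc0.
  exists c; split=> //.
  have ed : d = c0 * a + c0 ^+ p * b.
    have aux (X Y a' b' c' : C) : b' != 0 -> X + a' / b' * c' = Y / b' -> Y = c' * a' + X * b'.
      by move=> nb h; rewrite -[Y](divfK nb) -h; field.
    apply: (aux _ _ _ _ _ b0); apply/eqP; rewrite -subr_eq0; move: rc0.
    by rewrite rootE /f hornerD hornerN hornerC hornerD hornerXn hornerZ hornerX.
  rewrite ed (_ : _ - _ = (c - c0) * a + (c ^+ p - c0 ^+ p) * b); last by ring.
  have hc' : eqM c c0 by apply: (eqm_sym MI).
  apply: MD; apply: MMr => //; [exact: U_O|].
  exact: (eqmX MI).
exact: (fin z c m).
Qed.

(** The norm of an element of [A] is its [p]-th power, and the residue field is perfect. *)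
Lemma norm_level0 u : A u -> U u -> exists w, [/\ B w, U w & mult Pa (nrm w - u)].
Proof.
move=> Au Uu.
have [c0 ec0] : exists c0, c0 ^+ p = u.
  have [c0] : exists c0, root ('X^p - u%:P) c0.
    by apply/closed_rootP; rewrite size_XnsubC // eqSS gtn_eqF.
  by rewrite rootE !hornerE subr_eq0 => /eqP <-; exists c0.
have Uc0 : U c0 by apply: (U_root p0); rewrite ec0.
have [c [Ac Oc cc]] := teich_A (U_O Uc0).
have [_ _ _ hA] := uA.
exists c; split; first exact: AB.
  rewrite -[c](subrK c0) addrC; apply: U_D => //; exact: (eqm_sym MI).
rewrite nrm_base //; apply: hA.
  by apply: (subfieldB sA) => //; apply: (subfieldX _ sA).
by rewrite -ec0; apply: (eqm_sym MI); apply: (eqmX MI) => //; apply: U_O.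
Qed.

(** By multiplicativity the quotient [u / nrm w] is pushed one level further at each step; the
    precision is finite because the steps have no limit in [B]. *)
Lemma norm_approx l u : A u -> U u -> exists w, [/\ B w, U w & mult (Pa ^+ l) (u / nrm w - 1)].
Proof.
move=> Au Uu.
have U_nrm w : U w -> U (nrm w) by move=> Uw; apply: Uprod => j _; apply: U_aut Uw; apply: rpow_iota.
elim: l => [|l [w [Bw Uw hw]]].
  exists 1; split; [exact: subfield1 sB|exact: U1|].
  rewrite expr0 /multiple divr1 nrm_base ?expr1n ?divr1; last exact: subfield1 sA.
  by apply: OB; [apply: U_O|apply: O1].
have Uv : U (u / nrm w) by apply: UM => //; apply: UV; apply: U_nrm.
have Av : A (u / nrm w) by apply: (subfield_div sA) => //; apply: nrm_A.
have [w' [Bw' Uw' hw']] : exists w', [/\ B w', U w' & mult (Pa ^+ l.+1) (nrm w' - u / nrm w)].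
  case: l hw => [|l] hw; first by rewrite expr1; apply: norm_level0.
  exact: norm_level.
exists (w * w'); split; [exact: (subfieldM sB)|exact: UM|].
have n1 := U_neq0 (U_nrm _ Uw); have n2 := U_neq0 (U_nrm _ Uw').
rewrite nrmM (_ : _ - 1 = - (nrm w' - u / nrm w) / nrm w'); last by field; rewrite n1 n2.
by apply: multiple_mulr; [apply: (idlN (multiple_ideal iota _))|apply: U_OV; apply: U_nrm].
Qed.

End NormStep.

(** * The Kummer tower *)

Lemma prod_ord_mul (R : comNzRingType) (a b : nat) (f : nat -> R) :
  \prod_(j < a * b) f j = \prod_(j < a) \prod_(l < b) f (j + a * l)%N.
Proof.
elim: b => [|b IH].
  by rewrite muln0 big_ord0 big1 // => j _; rewrite big_ord0.
rewrite mulnSr big_split_ord /= IH -big_split /=; apply: eq_bigr => j _.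
by rewrite big_ord_recr /= addnC.
Qed.

Lemma eqn_mod_cancel d b a m : coprime d b -> b * a == b * m %[mod d] -> a == m %[mod d].
Proof.
wlog le : a m / (m <= a)%N => [H cb e|cb].
  by case/orP: (leq_total m a) => le; [apply: H|rewrite eq_sym; apply: H; rewrite // eq_sym].
by rewrite !eqn_mod_dvd ?leq_mul2l ?le ?orbT // -mulnBr Gauss_dvdr.
Qed.

Section Kummer.
Variables (p : nat) (Qp : padicField p) (C : closedFieldType).
Variable iota : {rmorphism Qp -> C}.
Context {HC : padic_closure iota}.
Let p_prime : prime p := pc_prime.
Let alg : forall y : C, algebraicOver iota y := pc_alg.
Implicit Types (K L : set C) (x y z : C) (g h : {rmorphism C -> C}).
Local Notation O := (integral iota).
Local Notation M := (nonunit iota).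
Local Notation U := (isunit iota).
Local Notation eqM := (eqm M).
Local Notation adj := (adjoin iota).
Local Notation ur := (ur iota).
Local Notation mult := (multiple iota).
Let MI : Oideal iota M := M_ideal.

Lemma ru_pow h z : ru p z -> exists s, h z = z ^+ s.
Proof.
move=> [N cN zN]; have [d pd _] := prim_order_exists (coprime_gt0 (HC := HC) cN) zN.
have : (h z) ^+ d = 1 by rewrite -rmorphXn (prim_expr_order pd) rmorph1.
by move=> /(prim_rootP pd)[s ->]; exists s.
Qed.

Variables (E : set C) (n : nat) (zeta : C).
Hypotheses (E_unr : unramified iota (range iota) E) (n_gt0 : (0 < n)%N)
  (zeta_prim : (p ^ n)%N.-primitive_root zeta).
Local Notation F := (adj E zeta).
Local Notation pi := (zeta - 1).
Let sE : subfield iota E := unr_base_subfield E_unr.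
Let sF : subfield iota F := F_subfield zeta E_unr.
Let uF : unif iota F pi := F_unif E_unr n_gt0 zeta_prim.

(** Automorphisms raise each root of unity to a power, hence commute on roots of unity of order
    prime to [p]; on [F], which [g] preserves, [h] is trivial. *)
Lemma ur_commute g h y : fixes E g -> fixes F h -> ur F y -> h (g y) = g (h y).
Proof.
move=> gE hF; apply: (ur_agree sF (g := h \o g) (h := g \o h)) => [x Fx|z rz] /=.
  by rewrite (hF x Fx) hF //; apply: (F_stable E_unr n_gt0 zeta_prim).
have [s es] := ru_pow g rz; have [s' es'] := ru_pow h rz.
by rewrite es es' !rmorphXn es es' -!exprM mulnC.
Qed.

Variables (i : nat) (alpha : C).
Hypotheses (i_gt0 : (0 < i)%N) (i_len : (i <= n)%N) (alpha0 : alpha != 0)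
  (alphaF : F (alpha ^+ (p ^ i)%N))
  (alpha_notpow : forall y, F y -> y ^+ p != alpha ^+ (p ^ i)%N)
  (alpha_twist : exists g a m w, [/\ fixes E g, g zeta = zeta ^+ a, F w /\ w != 0,
     g alpha = alpha ^+ m * w & ~~ (a == m %[mod p])]).

Definition kzeta := zeta ^+ (p ^ (n - i))%N.
Local Notation zi := kzeta.

Lemma kzeta_prim : (p ^ i)%N.-primitive_root zi.
Proof.
have d : (p ^ i %| p ^ n)%N by rewrite dvdn_exp2l.
have := dvdn_prim_root zeta_prim d.
by rewrite -expnB // prime_gt0.
Qed.

Lemma kzeta_F : F zi.
Proof. by apply: (subfieldX _ sF); apply: adjoin_gen. Qed.

Definition zetap := zi ^+ (p ^ i.-1)%N.

Lemma zetap_prim : p.-primitive_root zetap.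
Proof.
have d : (p %| p ^ i)%N by rewrite dvdn_exp.
have e : (p ^ i %/ p = p ^ i.-1)%N by rewrite -[in LHS](prednK i_gt0) expnS mulKn ?prime_gt0.
by have := dvdn_prim_root kzeta_prim d; rewrite e.
Qed.

(** A [p^k]-th root of [alpha^(p^i)]: the tower goes from [kroot 0], in [F], to [kroot i], which is
    [alpha]. *)
Definition kroot k := alpha ^+ (p ^ (i - k))%N.

Lemma krootS k : (k < i)%N -> kroot k.+1 ^+ p = kroot k.
Proof. by move=> ki; rewrite /kroot -exprM -expnSr subnSK. Qed.

Lemma kroot_neq0 k : kroot k != 0. Proof. by rewrite expf_neq0. Qed.

Lemma kroot_eigen g k : g zi = zi -> g alpha = zi * alpha ->
  forall j, rpow g j (kroot k) = zi ^+ (j * p ^ (i - k))%N * kroot k.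
Proof.
move=> gz ga j; rewrite /kroot rmorphXn (rpow_eigen j gz ga) exprMn.
by rewrite -exprM.
Qed.

Lemma kummer_aut h : fixes F h -> exists a, h alpha = zi ^+ a * alpha.
Proof.
move=> hF; have : (h alpha / alpha) ^+ (p ^ i)%N = 1.
  by rewrite exprMn exprVn -rmorphXn hF // divff // expf_neq0.
by move=> /(prim_rootP kzeta_prim)[a ea]; exists a; rewrite -ea divfK.
Qed.

(* Otherwise [kroot 1] would generate an extension of [F] abelian over [E]:
   comparing both orders of [g] and an automorphism moving [kroot 1]
   contradicts [alpha_twist]. *)
Lemma kroot1_notur : ~ ur F (kroot 1).
Proof.
move=> uk.
have ek : kroot 1 ^+ p = alpha ^+ (p ^ i)%N by rewrite krootS // /kroot subn0.
have nF : ~ F (kroot 1) by move=> Fk; have := alpha_notpow Fk; rewrite ek eqxx.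
have [h hF nh] : exists2 h, fixes F h & h (kroot 1) != kroot 1.
  apply: contrapT => nex; apply: nF; apply: (fixed_mem alg p_prime sF) => h hF.
  by apply/eqP/negPn/negP => nh; apply: nex; exists h.
have [b eb] := kummer_aut hF.
have ehk : h (kroot 1) = zetap ^+ b * kroot 1.
  by rewrite /kroot subn1 rmorphXn eb exprMn /zetap -!exprM [(b * _)%N]mulnC.
have pb : ~~ (p %| b)%N.
  by rewrite (prim_order_dvd zetap_prim); apply: contraNneq nh => e; rewrite ehk e mul1r.
have [g [a [m [w [gE gz [Fw w0] ga nam]]]]] := alpha_twist.
have gk : g (kroot 1) = kroot 1 ^+ m * w ^+ (p ^ i.-1)%N.
  by rewrite /kroot subn1 rmorphXn ga exprMn -!exprM mulnC.
have hw : h w = w by apply: hF.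
have gzp : g zetap = zetap ^+ a.
  by rewrite /zetap /zi !rmorphXn gz -!exprM; congr (_ ^+ _); lia.
have e1 : h (g (kroot 1)) = (zetap ^+ b * kroot 1) ^+ m * w ^+ (p ^ i.-1)%N.
  by rewrite gk rmorphM [h (_ ^+ m)]rmorphXn ehk [h (_ ^+ _)]rmorphXn hw.
have e2 : g (h (kroot 1)) = zetap ^+ (a * b)%N * (kroot 1 ^+ m * w ^+ (p ^ i.-1)%N).
  by rewrite ehk rmorphM gk [g (_ ^+ b)]rmorphXn gzp -exprM.
have := ur_commute gE hF uk; rewrite e1 e2 exprMn -exprM -mulrA => e.
have n0 : kroot 1 ^+ m * w ^+ (p ^ i.-1)%N != 0 by rewrite mulf_neq0 ?expf_neq0 // kroot_neq0.
move: e => /(mulIf n0) /eqP; rewrite (eq_prim_root_expr zetap_prim).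
have cb : coprime p b by rewrite prime_coprime.
rewrite [(a * b)%N]mulnC => /(eqn_mod_cancel cb) e.
by move/negP: nam; apply; rewrite eq_sym.
Qed.

(** An automorphism over [ur F] that moves [kroot 1] multiplies [alpha] by [zi^b] with [b] prime to
    [p]; inverting [b] modulo [p^i] gives the power to take. *)
Lemma tau_exists : exists2 tau, fixes (ur F) tau & tau alpha = zi * alpha.
Proof.
have [h hF nh] : exists2 h, fixes (ur F) h & h (kroot 1) != kroot 1.
  apply: contrapT => nex; apply: kroot1_notur; apply: (fixed_mem alg p_prime (ur_subfield sF)) => h hF.
  by apply/eqP/negPn/negP => nh; apply: nex; exists h.
have hF' : fixes F h by move=> x Fx; apply: hF; apply: ur_base.
have [b eb] := kummer_aut hF'.
have cb : coprime b (p ^ i).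
  rewrite coprime_sym coprime_pexpl // prime_coprime //; apply: contraNN nh => /dvdnP[k ek].
  rewrite /kroot rmorphXn eb exprMn -exprM ek -mulnA -expnS subn1 prednK // mulnC exprM.
  by rewrite (prim_expr_order kzeta_prim) expr1n mul1r.
have b0 : (0 < b)%N.
  rewrite lt0n; apply: contraTneq cb => ->; rewrite /coprime gcd0n.
  by rewrite gtn_eqF // -(exp1n i) ltn_exp2r // prime_gt1.
have [u [v euv]] : exists u v, (u * b = v * p ^ i + 1)%N.
  have [u v e1 _] := egcdnP (p ^ i) b0; exists u, v.
  by rewrite e1; move: cb; rewrite /coprime => /eqP ->.
exists (rpow h u); first exact: rpow_fixes.
rewrite (@rpow_eigen C h (zi ^+ b) alpha u) //; last by rewrite hF' //; apply: (subfieldX _ sF); apply: kzeta_F.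
by rewrite -exprM mulnC euv exprD expr1 mulnC exprM (prim_expr_order kzeta_prim) expr1n mul1r.
Qed.

Variable tau : {rmorphism C -> C}.
Hypotheses (tau_ur : fixes (ur F) tau) (tau_alpha : tau alpha = zi * alpha).
Let tauF : fixes F tau. Proof. by move=> x Fx; apply: tau_ur; apply: ur_base. Qed.
Let tau_zi : tau zi = zi. Proof. by apply: tauF; apply: kzeta_F. Qed.
Let tau_ru w : ru p w -> tau w = w. Proof. by move=> rw; apply: tau_ur; apply: ur_ru. Qed.

Fixpoint Mt (k : nat) : set C := if k is k'.+1 then adj (Mt k') (kroot k) else F.

Lemma Mt_subfield k : subfield iota (Mt k).
Proof. by elim: k => [|k IH] //=; apply: adjoin_subfield. Qed.

Lemma Mt_F k x : F x -> Mt k x.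
Proof. by move=> Fx; elim: k => //= k IH; apply: adjoin_base. Qed.

Lemma Mt_kroot k : Mt k (kroot k).
Proof. by case: k => [|k] /=; [rewrite /kroot subn0|apply: adjoin_gen]. Qed.

Lemma Mt_rho k : (k <= i)%N -> fixes (Mt k) (rpow tau (p ^ k)).
Proof.
move=> ki; suff H k' : (k' <= k)%N -> fixes (Mt k') (rpow tau (p ^ k)) by apply: H.
elim: k' => [_|k' IH k'k] /=; first exact: rpow_fixes.
move=> x Mx; have -> : x = (idfun : {rmorphism C -> C}) x by [].
rewrite -[LHS]/(rpow tau (p ^ k) x); apply: (fixes_adjoin (Mt_subfield k')) Mx => //.
  exact: IH (ltnW k'k).
rewrite (kroot_eigen _ tau_zi tau_alpha) -expnD (_ : (k + (i - k'.+1) = i + (k - k'.+1))%N); last by lia.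
by rewrite expnD exprM (prim_expr_order kzeta_prim) expr1n mul1r.
Qed.

Lemma Mt_rho_ur k : (k <= i)%N -> fixes (ur (Mt k)) (rpow tau (p ^ k)).
Proof.
move=> ki x ux; have -> : x = (idfun : {rmorphism C -> C}) x by [].
rewrite -[LHS]/(rpow tau (p ^ k) x); apply: (ur_agree (Mt_subfield k)) ux; first exact: Mt_rho.
by move=> w rw; apply: rpow_id; apply: tau_ru.
Qed.

Lemma Mt_rho_eigen k : (k < i)%N -> rpow tau (p ^ k) (kroot k.+1) = zetap * kroot k.+1.
Proof.
move=> ki; rewrite (kroot_eigen _ tau_zi tau_alpha) /zetap -expnD.
by congr (_ ^+ (_ ^ _)%N * _); lia.
Qed.

Lemma resid_sub K f : (forall y, K y -> O y -> exists c, [/\ E c, O c & eqM y c]) ->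
  resid iota E (p ^ f) -> resid iota K (p ^ f).
Proof.
move=> hK rE y Ky Oy; have [c [Ec Oc yc]] := hK _ Ky Oy.
apply: (eqm_trans MI); first by apply: (eqmX MI) yc.
exact: (eqm_trans MI (rE _ Ec Oc) (eqm_sym MI yc)).
Qed.

Let p_gt1 : (1 < p)%N := prime_gt1 p_prime.
Let zetap_F : F zetap. Proof. by apply: (subfieldX _ sF); apply: kzeta_F. Qed.
Let kpow k : (k < i)%N -> Mt k (kroot k.+1 ^+ p).
Proof. by move=> ki; rewrite krootS //; apply: Mt_kroot. Qed.

(** Each floor is a Kummer step of degree [p] for [tau^(p^k)], which fixes [ur (Mt k)] and
    multiplies [kroot k.+1] by [zetap]. *)
Lemma Mt_structure k : (k <= i)%N -> exists P, [/\ unif iota (Mt k) P, U (P ^+ (p ^ k)%N / pi) &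
  forall y, Mt k y -> O y -> exists c, [/\ E c, O c & eqM y c]].
Proof.
elim: k => [_|k IH ki].
  exists pi; split; [exact: uF| |exact: (F_residue E_unr n_gt0 zeta_prim)].
  rewrite expn0 expr1 divff; first exact: U1.
  by case: uF.
have [P [uP UP rP]] := IH (ltnW ki).
have [f [f0 rE _]] := unr_base_resid E_unr.
have rM : resid iota (Mt k) (p ^ f) := resid_sub rP rE.
have [P' [uP' UP' rP']] := step_structure p_gt1 (Mt_subfield k) uP (kroot_neq0 k.+1) (kpow ki)
  zetap_prim (Mt_F k zetap_F) (Mt_rho_ur (ltnW ki)) (Mt_rho_eigen ki) (ex_intro2 _ _ f f0 rM) p_prime.
exists P'; split=> //.
  have [_ pi0 _ _] := uF; have [_ P0 _ _] := uP.
  rewrite (_ : _ / _ = (P' ^+ p / P) ^+ (p ^ k)%N * (P ^+ (p ^ k)%N / pi)).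
    by apply: UM => //; apply: UX.
  rewrite exprMn exprVn -exprM -expnS.
  have n1 : P ^+ (p ^ k)%N != 0 by rewrite expf_neq0.
  by field; rewrite pi0 n1.
move=> y My Oy; have [c [Mc Oc yc]] := rP' _ My Oy; have [c' [Ec' Oc' cc']] := rP _ Mc Oc.
by exists c'; split=> //; apply: (eqm_trans MI yc).
Qed.

Definition Nt k w := \prod_(j < p ^ k) rpow tau j w.

Lemma NtM k x y : Nt k (x * y) = Nt k x * Nt k y.
Proof. by rewrite /Nt -big_split; apply: eq_bigr => j _; rewrite rmorphM. Qed.

Lemma NtV k x : Nt k x^-1 = (Nt k x)^-1.
Proof. by rewrite /Nt -prodfV; apply: eq_bigr => j _; rewrite fmorphV. Qed.

Let tau_iota c : tau (iota c) = iota c. Proof. exact: (fixes_iota sF tauF). Qed.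
Let rtau_iota j c : rpow tau j (iota c) = iota c. Proof. exact: rpow_id. Qed.

Lemma Nt_unit k w : U w -> U (Nt k w).
Proof. by move=> Uw; apply: Uprod => j _; apply: U_aut Uw; apply: rtau_iota. Qed.

Lemma Nt_1mod k l w : mult (pi ^+ l) (w - 1) -> mult (pi ^+ l) (Nt k w - 1).
Proof.
move=> hw; have [Fpi pi0 Mpi _] := uF.
have hI := multiple_ideal iota (pi ^+ l).
have pl0 : pi ^+ l != 0 by rewrite expf_neq0.
have Opl : O (pi ^+ l) by apply: OX; apply: M_O.
have hj j : mult (pi ^+ l) (rpow tau j w - 1).
  have := multiple_aut (rtau_iota j) hw.
  by rewrite rmorphB rmorph1 rmorphXn (rpow_id j (tauF Fpi)).
have Oj j : O (rpow tau j w).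
  by rewrite -(subrK 1 (rpow tau j w)); apply: OD (O1); apply: multiple_O (hj j).
have h : eqm (mult (pi ^+ l)) (Nt k w) (\prod_(j < p ^ k) 1).
  by apply: (eqm_prod hI) => j _; [apply: Oj|apply: O1|apply: hj].
by move: h; rewrite /eqm big1.
Qed.

(** Transitivity of the norm: the exponents below [p^(k+1)] are the [j + p^k * l]. *)
Lemma Nt_step k w : Nt k.+1 w = Nt k (nrm p (rpow tau (p ^ k)) w).
Proof.
rewrite /Nt expnSr (prod_ord_mul _ _ (fun j => rpow tau j w)); apply: eq_bigr => j _.
rewrite /nrm rmorph_prod; apply: eq_bigr => l _.
by rewrite rpowD mulnC rpowM.
Qed.

(** One floor is climbed at a time. Precision [pi^l] at the bottom requires [P^(p^k * l)] in [Mt k],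
    since [pi] is a unit times [P^(p^k)]. *)
Lemma Nt_approx k : (k <= i)%N -> forall l u, ur F u -> U u ->
  exists w, [/\ ur (Mt k) w, U w & mult (pi ^+ l) (u / Nt k w - 1)].
Proof.
elim: k => [_ l u Fu Uu|k IH ki l u Fu Uu].
  exists u; split=> //; rewrite /Nt expn0 big_ord1 /= divff ?(U_neq0 Uu) // subrr.
  exact: (idl0 (multiple_ideal iota _)).
have [w [Mw Uw hw]] := IH (ltnW ki) l u Fu Uu.
have [P [uP UP rP]] := Mt_structure (ltnW ki); have [P' [uP' UP' rP']] := Mt_structure ki.
have [_ pi0 _ _] := uF; have [_ P0 _ _] := uP.
have UPP : U (P' ^+ p / P).
  apply: (U_root (n := (p ^ k)%N)); first by rewrite expn_gt0 prime_gt0.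
  rewrite (_ : _ ^+ _ = (P' ^+ (p ^ k.+1)%N / pi) / (P ^+ (p ^ k)%N / pi)); first by apply: UM (UV UP).
  rewrite exprMn exprVn -exprM -expnS.
  have n1 : P ^+ (p ^ k)%N != 0 by rewrite expf_neq0.
  by field; rewrite pi0 n1.
have sM := Mt_subfield k; have sM' := Mt_subfield k.+1.
have Mst := Mt_rho_ur (ltnW ki); have Mei := Mt_rho_eigen ki.
have [w' [Mw' Uw' hw']] := norm_approx (ur_subfield sM) (ur_subfield sM')
  (ur_mono sM' (fun x => @adjoin_base _ _ _ iota (Mt k) (kroot k.+1) x)) Mst
  (fun y => step_ur_stable sM (Mt_F k zetap_F) Mst Mei (y := y))
  (fun y => step_ur_fixed sM (kroot_neq0 k.+1) (kpow ki) zetap_prim (Mt_F k zetap_F) Mst Mei (y := y))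
  (fun y => step_order sM zetap_prim (Mt_F k zetap_F) Mst Mei (y := y))
  (ur_unif sM uP) (ur_unif sM' uP') UPP (fun w rw => ur_ru iota (Mt k) rw) (p ^ k * l)%N Mw Uw.
exists w'; split=> //.
have hw2 : mult (pi ^+ l) (w / nrm p (rpow tau (p ^ k)) w' - 1).
  have e : P ^+ (p ^ k * l)%N = pi ^+ l * (P ^+ (p ^ k)%N / pi) ^+ l.
    by rewrite -exprMn mulrC divfK // exprM.
  by rewrite e in hw'; apply/(multiple_unit _ _ (UX l UP)).
have h3 := Nt_1mod k hw2.
rewrite Nt_step; set nw := nrm _ _ _ in h3 *.
have n1 : Nt k w != 0 := U_neq0 (Nt_unit k Uw).
rewrite NtM NtV in h3.
have -> : u / Nt k nw - 1 = (u / Nt k w) * (Nt k w / Nt k nw - 1) + (u / Nt k w - 1).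
  have Unw : U nw by apply: Uprod => j _; apply: U_aut Uw' => c; apply: rpow_id.
  by have n2 := U_neq0 (Nt_unit k Unw); field; rewrite n1 n2.
apply: (idlD (multiple_ideal iota _)) => //.
apply: multiple_mull => //; apply: U_O; apply: UM => //; apply: UV; exact: Nt_unit.
Qed.

Local Notation L := (adj F alpha).

Lemma Mt_L y : Mt i y <-> L y.
Proof.
have ei : kroot i = alpha by rewrite /kroot subnn expn0 expr1.
have sL := adjoin_subfield alpha sF.
split; last first.
  apply: adjoin_min; first exact: Mt_subfield.
    by move=> x; apply: Mt_F.
  by rewrite -ei; apply: Mt_kroot.
suff H k : forall y, Mt k y -> L y by apply: H.
elim: k => [|k IH] /=; first by move=> x; apply: adjoin_base.
apply: adjoin_min => //; apply: (subfieldX _ sL); exact: adjoin_gen.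
Qed.

End Kummer.

(** * The reciprocity map on units *)

Section Reciprocity.
Variables (p : nat) (Qp : padicField p) (C : closedFieldType).
Variable iota : {rmorphism Qp -> C}.
Context {HC : padic_closure iota}.
Let p_prime : prime p := pc_prime.
Let alg : forall y : C, algebraicOver iota y := pc_alg.
Local Notation O := (integral iota).
Local Notation M := (nonunit iota).
Local Notation U := (isunit iota).
Local Notation eqM := (eqm M).
Local Notation ur := (ur iota).
Local Notation mult := (multiple iota).
Let MI : Oideal iota M := M_ideal.

Lemma U_zpow u (a : int) : U u -> U (u ^ a).
Proof.
case: a => a Uu; first by rewrite -exprnP; apply: UX.
by rewrite NegzE -exprnN; apply: UV; apply: UX.
Qed.

(** The first digit of [b] is a Teichmuller representative fixed by [phi], hence a residue of [K];
    subtract it, divide by [Pi] and repeat. *)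
Lemma frob_descent (K : set C) Pi phi f : subfield iota K -> unif iota K Pi -> (0 < f)%N ->
  full_resid iota K (p ^ f) -> fixes K phi -> (forall z, ru p z -> phi z = z ^+ (p ^ f)%N) ->
  forall l b, ur K b -> O b -> mult (Pi ^+ l) (phi b - b) ->
  exists b0, [/\ K b0, O b0 & mult (Pi ^+ l) (b - b0)].
Proof.
move=> sK uK f0 fK phiK phir; have sU : subfield iota (ur K) by exact: ur_subfield sK.
have [KPi Pi0 MPi _] := uK; have [_ _ _ hU] := ur_unif sK uK.
elim=> [|l IH] b Ub Ob hb.
  exists 0; split; [exact: subfield0 sK|exact: O0|].
  by rewrite subr0 expr0 /multiple divr1.
have [z [hz bz]] := O_teich Ob.
have phii := fixes_iota sK phiK.
have phz : phi z = z ^+ (p ^ f)%N.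
  case: hz => [->|]; last exact: phir.
  by rewrite rmorph0 expr0n expn_eq0 (gtn_eqF (prime_gt0 p_prime)).
have zz : z ^+ (p ^ f)%N = z.
  apply: (teich_eq (iota := iota)) => //.
    by case: hz => [->|rz]; [left; rewrite expr0n expn_eq0 (gtn_eqF (prime_gt0 p_prime))|right; apply: ruX].
  rewrite -phz; apply: (eqm_trans MI (y := phi b)).
    by apply: (eqm_sym MI); rewrite /eqm -rmorphB; apply: M_aut.
  apply: (eqm_trans MI (y := b)) => //.
  by apply: (multiple_M _ _ hb); [rewrite expf_neq0|apply: MX].
have [c [Kc Oc zc]] := fK _ zz.
have bc : M (b - c) := eqm_trans MI bz zc.
have UKc : ur K c by apply: ur_base.
have UPi : ur K Pi by apply: ur_base.
pose b1 := (b - c) / Pi.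
have Ub1 : ur K b1 by apply: (subfield_div sU) => //; apply: (subfieldB sU).
have Ob1 : O b1 by apply: hU => //; apply: (subfieldB sU).
have eb : b = c + Pi * b1 by rewrite /b1 mulrC divfK // addrC subrK.
have Pl : Pi ^+ l != 0 by rewrite expf_neq0.
have [|b2 [Kb2 Ob2 hb2]] := IH b1 Ub1 Ob1.
  move: hb; rewrite {1 2}eb rmorphD rmorphM (phiK c Kc) (phiK Pi KPi) /multiple.
  by rewrite (_ : _ / _ = (phi b1 - b1) / Pi ^+ l) //; rewrite exprS; field; rewrite Pi0 Pl.
exists (c + Pi * b2); split.
- by apply: (subfieldD sK) => //; apply: (subfieldM sK).
- by apply: OD => //; apply: OM => //; apply: M_O.
- move: hb2; rewrite eb /multiple.
  by rewrite (_ : (c + Pi * b1 - (c + Pi * b2)) / Pi ^+ l.+1 = (b1 - b2) / Pi ^+ l) //; rewrite exprS; field; rewrite Pi0 Pl.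
Qed.

(** Every unit is approximately of the form [phi s / s]. With [q = p^f], one solves [c^(q-1) = r] on
    residues and the Artin-Schreier equation [c^q - c = d] at the higher levels. *)
Lemma lang (K : set C) Pi phi f : subfield iota K -> unif iota K Pi -> (0 < f)%N ->
  fixes K phi -> (forall z, ru p z -> phi z = z ^+ (p ^ f)%N) ->
  forall l y, ur K y -> U y -> exists s, [/\ ur K s, U s & mult (Pi ^+ l) (y * s / phi s - 1)].
Proof.
move=> sK uK f0 phiK phir l y Uy UUy; have sU : subfield iota (ur K) by exact: ur_subfield sK.
have [KPi Pi0 MPi _] := uK; have [_ _ _ hU] := ur_unif sK uK.
have phii := fixes_iota sK phiK.
have q1 : (1 < p ^ f)%N by rewrite -(exp1n f) ltn_exp2r // prime_gt1.
have phU z : ur K z -> ur K (phi z) by apply: (ur_image sK sK phii) => x Kx; rewrite phiK.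
have phz z : (z = 0 \/ ru p z) -> phi z = z ^+ (p ^ f)%N.
  case=> [->|]; last exact: phir.
  by rewrite rmorph0 expr0n expn_eq0 (gtn_eqF (prime_gt0 p_prime)).
have UKz z : (z = 0 \/ ru p z) -> ur K z.
  by case=> [->|]; [apply: subfield0 sU|apply: ur_ru].
elim: l => [|l [s [Us UUs hs]]].
  exists 1; split; [exact: subfield1 sU|exact: U1|].
  rewrite rmorph1 mulr1 divr1 expr0 /multiple divr1; apply: OB O1; exact: U_O.
pose r := y * s / phi s.
have Uphs : U (phi s) by apply: U_aut.
have Ur : U r by apply: UM; [apply: UM|apply: UV].
have UKr : ur K r by apply: (subfield_div sU); [apply: (subfieldM sU)|apply: phU].
suff [s' [Us' UUs' hs']] : exists s', [/\ ur K s', U s' & mult (Pi ^+ l.+1) (r - phi s' / s')].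
  exists (s * s'); split; [exact: (subfieldM sU)|exact: UM|].
  have n1 := U_neq0 UUs'; have n2 : phi s' != 0 by rewrite fmorph_eq0.
  have n3 := U_neq0 Uphs.
  rewrite rmorphM (_ : _ - 1 = (r - phi s' / s') * (s' / phi s')); last first.
    by rewrite /r; field; rewrite n1 n2 n3.
  by apply: multiple_mulr => //; apply: OM; [apply: U_O|apply: U_OV; apply: U_aut].
case: l hs => [|l] hs.
  have [c0 ec0] : exists c0, c0 ^+ (p ^ f).-1 = r.
    have q2 : (0 < (p ^ f).-1)%N by rewrite -subn1 subn_gt0.
    have [c0] : exists c0, root ('X^((p ^ f).-1) - r%:P) c0.
      by apply/closed_rootP; rewrite size_XnsubC // eqSS gtn_eqF.
    by rewrite rootE !hornerE subr_eq0 => /eqP <-; exists c0.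
  have Uc0 : U c0.
    by apply: (U_root (n := (p ^ f).-1)); rewrite ?ec0 // -subn1 subn_gt0.
  have [z [hz cz]] := O_teich (U_O Uc0).
  have Uz : U z by rewrite -[z](subrK c0) addrC; apply: U_D => //; apply: (eqm_sym MI).
  exists z; split=> //; first exact: UKz.
  rewrite expr1; apply: hU.
    by apply: (subfieldB sU) => //; apply: (subfield_div sU); [apply: phU|]; apply: UKz.
  rewrite phz // -(prednK (ltnW q1)) exprS mulrAC divff ?mul1r ?(U_neq0 Uz) // -ec0.
  by apply: (eqmX MI) => //; apply: U_O.
have Pl : Pi ^+ l.+1 != 0 by rewrite expf_neq0.
pose d := (r - 1) / Pi ^+ l.+1.
have er : r = 1 + d * Pi ^+ l.+1 by rewrite divfK // addrC subrK.
have Od : O d by [].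
have UKd : ur K d.
  apply: (subfield_div sU); first by apply: (subfieldB sU) => //; apply: subfield1 sU.
  by apply: (subfieldX _ sU); apply: ur_base.
pose g := 'X^(p ^ f) - 'X - d%:P : {poly C}.
have szg' : size ('X^(p ^ f) - 'X : {poly C}) = (p ^ f).+1.
  by rewrite size_polyDl size_polyXn // size_polyN size_polyX ltnS.
have szg : size g = (p ^ f).+1.
  by rewrite /g size_polyDl // szg' size_polyN (leq_ltn_trans (size_polyC_leq1 _)) // ltnW.
have mog : g \is monic.
  rewrite monicE /g lead_coefDl; last by rewrite szg' size_polyN (leq_ltn_trans (size_polyC_leq1 _)) // ltnW.
  by rewrite lead_coefDl ?lead_coefXn // size_polyN size_polyX size_polyXn ltnS.
have [c0 rc0] : exists c0, root g c0 by apply/closed_rootP; rewrite szg eqSS gtn_eqF // ltnW.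
have Oc0 : O c0.
  apply: O_root mog _ rc0 => j; rewrite /g !coefB coefXn coefX coefC.
  apply: OB; last by case: eqP => _; [|apply: O0].
  by apply: OB; apply: OnatR.
have ed : d = c0 ^+ (p ^ f)%N - c0.
  by move: rc0; rewrite rootE /g !hornerE subr_eq0 => /eqP ->.
have [c [hc cc]] := O_teich Oc0.
have Oc : O c by exact: teich_O hc.
have UKc := UKz _ hc.
have Ml : M (Pi ^+ l.+1) by apply: MX.
have Us' : U (1 + c * Pi ^+ l.+1) by apply: U_D; [apply: U1|apply: MM].
exists (1 + c * Pi ^+ l.+1); split=> //.
  apply: (subfieldD sU); first exact: subfield1 sU.
  by apply: (subfieldM sU) => //; apply: (subfieldX _ sU); apply: ur_base.
have n1 := U_neq0 Us'.
rewrite rmorphD rmorphM rmorph1 rmorphXn (phiK Pi KPi) (phz c hc) er.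
rewrite (_ : _ - _ = ((d - (c ^+ (p ^ f)%N - c)) * Pi ^+ l.+1 + d * c * (Pi ^+ l.+1 * Pi ^+ l.+1)) / (1 + c * Pi ^+ l.+1)); last first.
  by field.
apply: multiple_mulr; last exact: U_OV.
have hI := multiple_ideal iota (Pi ^+ l.+2).
apply: (idlD hI).
  rewrite exprS; apply: multiple_mul; last exact: multiple_self.
  apply: hU.
    by apply: (subfieldB sU) => //; apply: (subfieldB sU) => //; apply: (subfieldX _ sU).
  rewrite ed; apply: (eqmB MI) => //; exact: (eqmX MI).
apply: multiple_mull; last exact: OM.
rewrite -exprD; apply: (@multiple_powW _ _ _ iota Pi (l.+1 + l.+1)) => //; first exact: M_O.
  by lia.
by apply: multiple_self; rewrite expf_neq0.
Qed.

(** * The reciprocity exponent for a totally ramified cyclic extension with generator [tau] and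
    Frobenius [phi] *)

Variables (F L : set C) (pi Pi zi alpha : C) (i f : nat) (tau phi : {rmorphism C -> C}).
Local Notation q := (p ^ i)%N.
Local Notation A := (ur F).
Local Notation B := (ur L).
Definition rnorm w := \prod_(j < q) rpow tau j w.
Local Notation N := rnorm.

Hypotheses (p_odd : odd p) (sF : subfield iota F) (sL : subfield iota L)
  (FL : forall x, F x -> L x) (uF : unif iota F pi) (uL : unif iota L Pi)
  (UPi : U (Pi ^+ q / pi)) (f_gt0 : (0 < f)%N)
  (fullF : full_resid iota F (p ^ f))
  (tau_A : fixes A tau) (tau_L : forall y, L y -> L (tau y))
  (tau_fixL : forall y, L y -> tau y = y -> F y)
  (tau_fixB : forall y, B y -> tau y = y -> A y)
  (tau_q : forall y, B y -> rpow tau q y = y)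
  (phi_L : fixes L phi) (phi_ru : forall z, ru p z -> phi z = z ^+ (p ^ f)%N)
  (zi_prim : q.-primitive_root zi) (zi_F : F zi) (alpha_L : L alpha) (alpha0 : alpha != 0)
  (tau_alpha : tau alpha = zi * alpha)
  (N_approx : forall l u, A u -> U u -> exists w, [/\ B w, U w & mult (pi ^+ l) (u / N w - 1)]).

Let sA : subfield iota A := ur_subfield sF.
Let sB : subfield iota B := ur_subfield sL.
Let AB x : A x -> B x. Proof. exact: (ur_mono sL FL). Qed.
Let tauF : fixes F tau. Proof. by move=> x Fx; apply: tau_A; apply: ur_base. Qed.
Let phiF : fixes F phi. Proof. by move=> x /FL; apply: phi_L. Qed.
Let tau_iota c : tau (iota c) = iota c. Proof. exact: (fixes_iota sF tauF). Qed.
Let phi_iota c : phi (iota c) = iota c. Proof. exact: (fixes_iota sL phi_L). Qed.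
Let rtau_iota j c : rpow tau j (iota c) = iota c. Proof. exact: rpow_id. Qed.
Let tau_B y : B y -> B (tau y). Proof. exact: (ur_image sL sL tau_iota). Qed.
Let phi_B y : B y -> B (phi y).
Proof. by apply: (ur_image sL sL phi_iota) => x Lx; rewrite phi_L. Qed.
Let phi_A y : A y -> A (phi y).
Proof. by apply: (ur_image sF sF phi_iota) => x Fx; rewrite phiF. Qed.
Let rtau_B j y : B y -> B (rpow tau j y).
Proof. by apply: (rpow_stable (L := B)). Qed.
Let q_gt0 : (0 < q)%N. Proof. by rewrite expn_gt0 prime_gt0. Qed.
Let uA := ur_unif sF uF.
Let uB := ur_unif sL uL.
Let pi0 : pi != 0. Proof. by case: uF. Qed.
Let Pi0 : Pi != 0. Proof. by case: uL. Qed.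
Let MPi : M Pi. Proof. by case: uL. Qed.
Let Mpi : M pi. Proof. by case: uF. Qed.
Let LPi : L Pi. Proof. by case: uL. Qed.
Let BPi : B Pi. Proof. exact: ur_base. Qed.

Lemma phi_tau y : B y -> phi (tau y) = tau (phi y).
Proof.
apply: (ur_agree sL (g := phi \o tau) (h := tau \o phi)) => [x Lx|z rz] /=.
  by rewrite (phi_L Lx) phi_L //; apply: tau_L.
have tz w : ru p w -> tau w = w by move=> rw; apply: tau_A; apply: ur_ru.
by rewrite tz // phi_ru // tz //; apply: ruX.
Qed.

Lemma phi_rtau j y : B y -> phi (rpow tau j y) = rpow tau j (phi y).
Proof.
by move=> By; elim: j => //= j IH; rewrite phi_tau ?IH //; apply: rtau_B.
Qed.

Lemma rnormM x y : N (x * y) = N x * N y.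
Proof. by rewrite /N -big_split; apply: eq_bigr => j _; rewrite rmorphM. Qed.
Lemma rnormV x : N x^-1 = (N x)^-1.
Proof. by rewrite /N -prodfV; apply: eq_bigr => j _; rewrite fmorphV. Qed.
Lemma rnorm_base c : A c -> N c = c ^+ q.
Proof.
move=> Ac; rewrite /N (eq_bigr (fun=> c)) ?prodr_const ?card_ord // => j _.
by apply: rpow_id; apply: tau_A.
Qed.
Lemma rnorm_phi y : B y -> phi (N y) = N (phi y).
Proof. by move=> By; rewrite /N rmorph_prod; apply: eq_bigr => j _; apply: phi_rtau. Qed.
Lemma tau_rnorm y : B y -> tau (N y) = N y.
Proof.
move=> By; rewrite /N rmorph_prod -[in RHS](prednK q_gt0) -[in LHS](prednK q_gt0).
rewrite big_ord_recr big_ord_recl /= mulrC.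
by congr (_ * _); rewrite -rpowS prednK // tau_q.
Qed.
Lemma rnorm_tau y : B y -> N (tau y) = N y.
Proof.
move=> By; rewrite -[RHS]tau_rnorm // /N rmorph_prod; apply: eq_bigr => j _.
by rewrite -rpowSr.
Qed.
Lemma rnorm_A y : B y -> A (N y).
Proof.
move=> By; apply: tau_fixB; last exact: tau_rnorm.
by apply: (subfield_prod _ sB) => j _; apply: rtau_B.
Qed.
Lemma rnorm_F y : L y -> F (N y).
Proof.
move=> Ly; apply: tau_fixL; last by apply: tau_rnorm; apply: ur_base.
by apply: (subfield_prod _ sL) => j _; apply: (rpow_stable (L := L)).
Qed.
Lemma rnorm_U y : U y -> U (N y).
Proof. by move=> Uy; apply: Uprod => j _; apply: U_aut Uy; apply: rtau_iota. Qed.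
Lemma rnorm_neq0 y : y != 0 -> N y != 0.
Proof. by move=> y0; apply/prodf_neq0 => j _; rewrite fmorph_eq0. Qed.

Lemma tauPi_U : U (tau Pi / Pi).
Proof. by apply: (conj_unit tau_iota _ q_gt0 Pi0); apply: tau_q. Qed.

Lemma rtauPi_U j : U (rpow tau j Pi / Pi).
Proof.
elim: j => [|j IH] /=; first by rewrite divff //; apply: U1.
have h : U (tau (rpow tau j Pi) / rpow tau j Pi).
  by have := U_aut (rtau_iota j) tauPi_U; rewrite fmorph_div /= -rpowSr.
have n1 : rpow tau j Pi != 0 by rewrite fmorph_eq0.
by have := UM h IH; rewrite mulrA divfK.
Qed.

Lemma mult_rtau j m y : mult (Pi ^+ m) y -> mult (Pi ^+ m) (rpow tau j y).
Proof.
move=> h; have := multiple_aut (rtau_iota j) h.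
have -> : rpow tau j (Pi ^+ m) = Pi ^+ m * (rpow tau j Pi / Pi) ^+ m.
  by rewrite rmorphXn -exprMn mulrC divfK.
by move=> h'; apply/(multiple_unit _ _ (UX m (rtauPi_U j))).
Qed.

Lemma rnorm_1mod m y : mult (Pi ^+ m) (y - 1) -> mult (Pi ^+ m) (N y - 1).
Proof.
move=> hy; have hI := multiple_ideal iota (Pi ^+ m).
have hj j : mult (Pi ^+ m) (rpow tau j y - 1).
  by have := mult_rtau j hy; rewrite rmorphB rmorph1.
have Oj j : O (rpow tau j y).
  rewrite -(subrK 1 (rpow tau j y)); apply: OD O1; apply: multiple_O (hj j).
    by rewrite expf_neq0.
  by apply: OX; apply: M_O.
have h : eqm (mult (Pi ^+ m)) (N y) (\prod_(j < q) 1).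
  by apply: (eqm_prod hI) => j _; [apply: Oj|apply: O1|apply: hj].
by move: h; rewrite /eqm big1.
Qed.

Lemma mult_Pipi k y : mult (Pi ^+ (q * k)) y <-> mult (pi ^+ k) y.
Proof.
have e : Pi ^+ (q * k) = pi ^+ k * (Pi ^+ q / pi) ^+ k.
  by rewrite -exprMn mulrC divfK // exprM.
have [h1 h2] := multiple_unit (pi ^+ k) y (UX k UPi).
by rewrite e; split.
Qed.

(** A Lagrange resolvent: applying [tau] and multiplying by [w] shifts the terms, and the cycle
    closes because [N w = 1]. *)
Lemma hilbert90_sum w th : B w -> U w -> N w = 1 -> B th ->
  let Y := \sum_(j < q) (\prod_(k < j) rpow tau k w) * rpow tau j th in
  B Y /\ w * tau Y = Y.
Proof.
move=> Bw Uw Nw Bth Y; split.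
  apply: (subfield_sum _ sB) => j _; apply: (subfieldM sB); last exact: rtau_B.
  by apply: (subfield_prod _ sB) => k _; apply: rtau_B.
pose T j := (\prod_(k < j) rpow tau k w) * rpow tau j th.
have step j : w * tau (T j) = T j.+1.
  rewrite /T rmorphM rmorph_prod mulrA -rpowS; congr (_ * _).
  by rewrite big_ord_recl.
have Tq : T q = T 0%N.
  by rewrite /T -/(N w) Nw big_ord0 mul1r tau_q //= mul1r.
rewrite /Y rmorph_sum mulr_sumr (eq_bigr (fun j : 'I_q => T j.+1)); last by move=> j _; apply: step.
rewrite -[in LHS](prednK q_gt0) -[in RHS](prednK q_gt0) big_ord_recr big_ord_recl /=.
by rewrite -/(T 0%N) addrC prednK // Tq.
Qed.

(** One of the resolvents of [1, alpha, ..., alpha^(q-1)] is nonzero: divided by [alpha^k] and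
    summed over [k] they give [q], by orthogonality of the powers of [zi]. *)
Lemma hilbert90 w : B w -> U w -> N w = 1 -> exists y, [/\ B y, y != 0 & tau y = w * y].
Proof.
move=> Bw Uw Nw.
pose Y k := \sum_(j < q) (\prod_(l < j) rpow tau l w) * rpow tau j (alpha ^+ k).
have [k Yk] : exists k : 'I_q, Y k != 0.
  apply: contrapT => nex.
  have Y0 (k : 'I_q) : Y k = 0 by apply/eqP/negPn/negP => h; apply: nex; exists k.
  have : \sum_(k < q) Y k / alpha ^+ k = 0 by rewrite big1 // => k _; rewrite Y0 mul0r.
  rewrite (eq_bigr (fun k : 'I_q => \sum_(j < q) (\prod_(l < j) rpow tau l w) * (zi ^+ j) ^+ k)); last first.
    move=> k _; rewrite /Y mulr_suml; apply: eq_bigr => j _; rewrite -mulrA; congr (_ * _).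
    rewrite rmorphXn (rpow_eigen j (tauF zi_F) tau_alpha) exprMn mulfK // expf_neq0 //.
  rewrite exchange_big /= (bigD1 (Ordinal q_gt0)) //= [X in _ + X]big1 => [|j nj].
    rewrite addr0 (eq_bigr (fun=> 1)) => [|k _]; last by rewrite big_ord0 expr0 expr1n mul1r.
    rewrite sumr_const card_ord => /eqP.
    by rewrite (negPf (charC0 (iota := iota) q_gt0)).
  rewrite -mulr_sumr; suff -> : \sum_(k < q) (zi ^+ j) ^+ k = 0 by rewrite mulr0.
  have nz : zi ^+ j - 1 != 0.
    rewrite subr_eq0 -(prim_order_dvd zi_prim); apply/negP => /dvdn_leq.
    have j0 : (0 < j)%N by rewrite lt0n; apply: contraNneq nj => e; apply/eqP/val_inj.
    by move=> /(_ j0); rewrite leqNgt ltn_ord.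
  apply: (mulfI nz); rewrite mulr0 -subrX1 -exprM mulnC exprM (prim_expr_order zi_prim).
  by rewrite expr1n subrr.
have Ba : B (alpha ^+ k) by apply: (subfieldX _ sB); apply: ur_base.
have [BY eY] := hilbert90_sum Bw Uw Nw Ba.
exists (Y k)^-1; split; [exact: (subfieldV sB)|by rewrite invr_eq0|].
have eY' : w * tau (Y k) = Y k := eY.
by rewrite fmorphV -[in RHS]eY' invfM mulrA divff ?mul1r // (U_neq0 Uw).
Qed.

Lemma B_decomp y : B y -> y != 0 -> exists a : int, U (y / Pi ^ a).
Proof. exact: (unif_decompz sB uB). Qed.

Lemma phi_unit y : B y -> y != 0 -> U (phi y / y).
Proof.
move=> By y0; have [a Ua] := B_decomp By y0.
have nz : Pi ^ a != 0 by rewrite expfz_neq0.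
have Uy : U (phi (y / Pi ^ a)) by apply: U_aut.
have ph : phi (Pi ^ a) = Pi ^ a by rewrite fmorphXz phi_L.
move: Uy; rewrite fmorph_div ph => Uy.
have -> : phi y / y = (phi y / Pi ^ a) / (y / Pi ^ a) by field; rewrite y0 nz.
by apply: UM => //; apply: UV.
Qed.

Lemma precision m : exists l, forall x, mult (pi ^+ l) x -> mult (p%:R ^+ m) x.
Proof.
have p0 : (p%:R : C) ^+ m != 0 by rewrite expf_neq0 // (p_neq0 (iota := iota)).
have [l hl] := archimedean Mpi p0; exists l => x; apply: multiple_trans hl.
by rewrite expf_neq0.
Qed.

Lemma U_mult_p k v : mult (p%:R ^+ k.+1) (v - 1) -> U v.
Proof.
move=> h; rewrite -(subrK 1 v) addrC; apply: U_D; first exact: U1.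
apply: multiple_M h; first by rewrite expf_neq0 // (p_neq0 (iota := iota)).
by apply: MX => //; apply: Mp.
Qed.

(** Dwork's description of the reciprocity map on units, in which [a] is the exponent of [tau] up to
    the choice of sign: [N w = u], [phi w / w = tau y / y] and [y] has valuation [a]. It is a
    relation because [w] and [y] are choices; [rec_one] gives uniqueness modulo [q]. *)
Definition rec u (a : int) := exists w y, [/\ B w, U w, B y, y != 0 & N w = u] /\
  phi w * y = w * tau y /\ U (y / Pi ^ a).

(** After an approximate norm, the remaining quotient is close to [1], hence the [q]-th power, that
    is the norm, of an element of [ur F]. Hilbert 90 applies to [phi w / w], of norm [1] because
    [phi] fixes [u]. *)
Lemma rec_exists u : F u -> U u -> exists a, rec u a.
Proof.
move=> Fu Uu; have [l hl] := precision (i + 1).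
have Au : A u by apply: ur_base.
have [w0 [Bw0 Uw0 hw0]] := N_approx l Au Uu.
have Aw : A (u / N w0) by apply: (subfield_div sA) => //; apply: rnorm_A.
have [v [Av ev hv]] := unit_ppow_root p_odd sA Aw (hl _ hw0).
have Uv := U_mult_p hv.
have Nw : N (w0 * v) = u.
  by rewrite rnormM (rnorm_base Av) ev mulrC divfK // rnorm_neq0 // (U_neq0 Uw0).
have Uw : U (w0 * v) by apply: UM.
have Bw : B (w0 * v) by apply: (subfieldM sB) => //; apply: AB.
set w := w0 * v in Nw Uw Bw.
have Uph : U (phi w) by apply: U_aut.
have [||| y [By y0 ty]] := @hilbert90 (phi w / w).
- by apply: (subfield_div sB) => //; apply: phi_B.
- by apply: UM => //; apply: UV.
- by rewrite rnormM rnormV -rnorm_phi // Nw (phiF Fu) divff // (U_neq0 Uu).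
have [a Ua] := B_decomp By y0.
exists a, w, y; split=> //; split=> //.
by rewrite ty mulrA [w * _]mulrC divfK // (U_neq0 Uw).
Qed.

Lemma rec_div u v a b : rec u a -> rec v b -> rec (u / v) (a - b).
Proof.
move=> [w [y [[Bw Uw By y0 Nw] [e Uy]]]] [w' [y' [[Bw' Uw' By' y0' Nw'] [e' Uy']]]].
have nw' := U_neq0 Uw'; have nw := U_neq0 Uw.
have npw' : phi w' != 0 by rewrite fmorph_eq0.
exists (w / w'), (y / y'); split; first split.
- exact: (subfield_div sB).
- by apply: UM => //; apply: UV.
- exact: (subfield_div sB).
- by rewrite mulf_neq0 ?invr_eq0.
- by rewrite rnormM rnormV Nw Nw'.
have t1 : tau y' != 0 by rewrite fmorph_eq0.
have np : Pi ^ b != 0 by rewrite expfz_neq0.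
have na : Pi ^ a != 0 by rewrite expfz_neq0.
split; last first.
  rewrite (expfzDr _ _ Pi0) -invr_expz.
  rewrite (_ : _ / _ = (y / Pi ^ a) / (y' / Pi ^ b)); last by field; rewrite np na y0'.
  by apply: UM => //; apply: UV.
rewrite !fmorph_div.
rewrite (_ : phi w / phi w' * (y / y') = (phi w * y) / (phi w' * y')); last by field; rewrite npw' y0'.
by rewrite e e'; field; rewrite t1 nw'.
Qed.

Lemma zpow_piPi b : U (pi ^ b / Pi ^ (q%:Z * b)).
Proof.
rewrite -exprz_exp -exprnP -[_ / _]invrK; apply: UV.
rewrite invf_div (_ : _ / _ = (Pi ^+ q / pi) ^ b); first exact: U_zpow.
by rewrite expfzMl exprz_inv -invr_expz.
Qed.

(** If [N w = 1], then [w = tau s / s], and the relation says that [tau] fixes [y * s / phi s]. This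
    element lies in [ur F], where valuations are multiples of [q], and [s / phi s] is a unit. *)
Lemma rec_one a : rec 1 a -> (q%:Z %| a)%Z.
Proof.
move=> [w [y [[Bw Uw By y0 Nw] [e Uy]]]].
have [s [Bs s0 ts]] := hilbert90 Bw Uw Nw.
have ps0 : phi s != 0 by rewrite fmorph_eq0.
have tps0 : tau (phi s) != 0 by rewrite !fmorph_eq0.
have Bps := phi_B Bs.
have nw := U_neq0 Uw.
have npw : phi w != 0 by rewrite fmorph_eq0.
have Ac : A (y * s / phi s).
  apply: tau_fixB; first by apply: (subfield_div sB) => //; apply: (subfieldM sB).
  rewrite fmorph_div rmorphM -(phi_tau Bs) ts rmorphM mulrA [tau y * w]mulrC -e.
  by field; rewrite npw ps0.
have c0 : y * s / phi s != 0 by rewrite !mulf_neq0 ?invr_eq0.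
have [b Ub] := unif_decompz sA uA Ac c0.
have Ups := UV (phi_unit Bs s0).
have na : Pi ^ a != 0 by rewrite expfz_neq0.
have nb : pi ^ b != 0 by rewrite expfz_neq0.
have nqb : Pi ^ (q%:Z * b) != 0 by rewrite expfz_neq0.
have H : U (Pi ^ (a - q%:Z * b)).
  rewrite (expfzDr _ _ Pi0) -invr_expz.
  rewrite (_ : _ / _ = (y * s / phi s / pi ^ b) * (pi ^ b / Pi ^ (q%:Z * b)) * (phi s / s) / (y / Pi ^ a)).
    apply: UM; last exact: UV.
    by apply: UM; [apply: UM => //; apply: zpow_piPi|apply: phi_unit].
  by field; rewrite na nb nqb y0 s0 ps0.
have /eqP : a - q%:Z * b = 0 by exact: (zpow_unit Pi0 MPi H).
rewrite subr_eq0 => /eqP ->.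
exact: dvdz_mulr.
Qed.

Lemma rec_norm w : L w -> U w -> rec (N w) 0.
Proof.
move=> Lw Uw; have Bw : B w by apply: ur_base.
exists w, 1; split; first by split=> //; [apply: subfield1 sB|apply: oner_neq0].
by rewrite phi_L // rmorph1 expr0z divr1; split=> //; apply: U1.
Qed.

Let fullL : full_resid iota L (p ^ f).
Proof. by move=> z /fullF [c [Fc Oc zc]]; exists c; split=> //; apply: FL. Qed.

(** As [q] divides [a], a power of [pi] makes [y] a unit, approximately [phi s / s]. Then
    [w * s / tau s] has the norm of [w] and is almost fixed by [phi], so it is close to some [w0] in
    [L], and the defect [u / N w0] is a [q]-th power in [F]. *)
Lemma rec_ker u a : F u -> U u -> rec u a -> (q%:Z %| a)%Z -> exists w, [/\ L w, w != 0 & N w = u].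
Proof.
move=> Fu Uu [w [y [[Bw Uw By y0 Nw] [e Uy]]]] /dvdzP [b eb].
rewrite mulrC in eb.
have na : Pi ^ a != 0 by rewrite expfz_neq0.
have nb : pi ^ b != 0 by rewrite expfz_neq0.
pose y' := y / pi ^ b.
have Uy' : U y'.
  rewrite /y' (_ : _ / _ = (y / Pi ^ a) / (pi ^ b / Pi ^ a)); last by field; rewrite na nb.
  by apply: UM => //; apply: UV; rewrite eb; apply: zpow_piPi.
have Fpib : F (pi ^ b).
  have [Fpi _ _ _] := uF.
  case: (b) => k; first by rewrite -exprnP; apply: (subfieldX _ sF).
  by rewrite NegzE -exprnN; apply: (subfieldV sF); apply: (subfieldX _ sF).
have By' : B y' by apply: (subfield_div sB) => //; apply: AB; apply: ur_base.
have [l0 hl0] := precision (i + 1).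
have [s [Bs Us hs]] := lang sL uL f_gt0 phi_L phi_ru (q * l0) By' Uy'.
set r := y' * s / phi s in hs.
have nPl : Pi ^+ (q * l0) != 0 by rewrite expf_neq0.
have ns := U_neq0 Us; have nps : phi s != 0 by rewrite fmorph_eq0.
have nts : tau s != 0 by rewrite fmorph_eq0.
have ny' := U_neq0 Uy'.
have r0 : r != 0 by rewrite !mulf_neq0 ?invr_eq0.
have Ur : U r by apply: UM; [apply: UM|apply: UV; apply: U_aut].
have Uts : U (tau s) by apply: U_aut.
pose w' := w * s / tau s.
have Bw' : B w' by apply: (subfield_div sB); [apply: (subfieldM sB)|apply: tau_B].
have Uw' : U w' by apply: UM; [apply: UM|apply: UV].
have Nw' : N w' = u.
  rewrite /w' !rnormM rnormV rnorm_tau // -mulrA divff ?mulr1 //.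
  by rewrite rnorm_neq0.
have nw := U_neq0 Uw.
have ephi : phi w' * r = w' * tau r.
  have tpb : tau (pi ^ b) = pi ^ b by apply: tauF.
  rewrite /w' /r /y' !(rmorphM, fmorphV) /= tpb -(phi_tau Bs).
  have npts : phi (tau s) != 0 by rewrite !fmorph_eq0.
  rewrite (_ : phi w * phi s / phi (tau s) * (y / pi ^ b * s / phi s) = (phi w * y) * s / phi (tau s) / pi ^ b); last first.
    by field; rewrite nb nps npts.
  by rewrite e; field; rewrite nb nts npts.
have hmod : mult (Pi ^+ (q * l0)) (phi w' - w').
  rewrite (_ : _ - _ = w' * ((tau r - 1) - (r - 1)) / r); last first.
    by apply: (mulIf r0); rewrite divfK // mulrBl ephi; ring.
  have hI := multiple_ideal iota (Pi ^+ (q * l0)).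
  apply: multiple_mulr; last exact: U_OV.
  apply: multiple_mull; last exact: U_O.
  apply: (idlB hI) => //.
  by have := mult_rtau 1 hs; rewrite /= rmorphB rmorph1.
have [w0 [Lw0 Ow0 hw0]] := frob_descent sL uL f_gt0 fullL phi_L phi_ru Bw' (U_O Uw') hmod.
have Uw0 : U w0.
  (* Nothing prevents [precision] from returning [0] except that [1] would then be divisible by
     [p]. *)
  have [l00|l0p] := posnP l0; last first.
    have ql : (0 < q * l0)%N by rewrite muln_gt0 q_gt0.
    rewrite (_ : w0 = w' - (w' - w0)); last by ring.
    by apply: U_D => //; apply: MN; apply: multiple_M hw0 => //; apply: MX.
  have : mult (p%:R ^+ 1) 1.
    apply: (@multiple_powW _ _ _ iota p%:R (i + 1)); [exact: (p_neq0 (iota := iota))|exact: OnatR|by rewrite addn1|].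
    by apply: hl0; rewrite l00 expr0 /multiple divr1; apply: O1.
  rewrite expr1 => /(multiple_M (p_neq0 (iota := iota)) Mp) h.
  by case: (M1 h).
have n0 := U_neq0 Uw0.
have h1 : mult (pi ^+ l0) (u / N w0 - 1).
  apply/mult_Pipi; rewrite -Nw' -rnormV -rnormM; apply: rnorm_1mod.
  rewrite (_ : _ - 1 = (w' - w0) / w0); last by field.
  by apply: multiple_mulr => //; apply: U_OV.
have Fq : F (u / N w0) by apply: (subfield_div sF) => //; apply: rnorm_F.
have [v [Fv ev hv]] := unit_ppow_root p_odd sF Fq (hl0 _ h1).
exists (w0 * v); split; first by apply: (subfieldM sL) => //; apply: FL.
  by rewrite mulf_neq0 // (U_neq0 (U_mult_p hv)).
rewrite rnormM [N v]rnorm_base ?ev; last exact: ur_base.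
by rewrite mulrC divfK // rnorm_neq0.
Qed.

(** The target is [y = Pi]. Solving [phi s / s = tau Pi / Pi] approximately makes [N s] nearly fixed
    by [phi], hence close to a unit [u0] of [F], and [w = s * v] has norm exactly [u0]. The error
    [rho] has norm [1], and Hilbert 90 turns it into a correction [Y] with the valuation of [q]; so
    [Pi / Y] has valuation [1] modulo [q]. *)
Lemma rec_surj : (0 < i)%N -> exists u a, [/\ F u, U u, rec u a & ~~ (p%:Z %| a)%Z].
Proof.
move=> i0; have [l0 hl0] := precision (i + i.+1).
have BtPi : B (tau Pi / Pi) by apply: (subfield_div sB) => //; apply: tau_B.
have [s [Bs Us hs]] := lang sL uL f_gt0 phi_L phi_ru (q * l0) BtPi tauPi_U.
have ntp : tau Pi != 0 by rewrite fmorph_eq0.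
have ns := U_neq0 Us; have nps : phi s != 0 by rewrite fmorph_eq0.
have NtP : N (tau Pi / Pi) = 1 by rewrite rnormM rnormV rnorm_tau // divff // rnorm_neq0.
have h1 : mult (pi ^+ l0) (phi (N s) - N s).
  have := rnorm_1mod hs; rewrite -[tau Pi / Pi * s / phi s]mulrA rnormM NtP mul1r rnormM rnormV -rnorm_phi // => /mult_Pipi h.
  have n1 : N s != 0 by rewrite rnorm_neq0.
  have n2 : phi (N s) != 0 by rewrite fmorph_eq0.
  rewrite (_ : _ - _ = - (phi (N s)) * (N s / phi (N s) - 1)); last by field.
  apply: multiple_mull => //; apply: ON; apply: O_aut => //; exact: U_O (rnorm_U Us).
have [u0 [Fu0 Ou0 hu0]] := frob_descent sF uF f_gt0 fullF phiF phi_ru (rnorm_A Bs) (U_O (rnorm_U Us)) h1.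
have UN := rnorm_U Us; have nN := U_neq0 UN.
have h2 : mult (pi ^+ l0) (u0 / N s - 1).
  rewrite (_ : _ - 1 = - ((N s - u0) / N s)); last by field.
  by have hI := multiple_ideal iota (pi ^+ l0); apply: (idlN hI); apply: multiple_mulr => //; apply: U_OV.
have Aq : A (u0 / N s) by apply: (subfield_div sA); [apply: ur_base|apply: rnorm_A].
have [v [Av ev hv]] := unit_ppow_root p_odd sA Aq (hl0 _ h2).
have Uv := U_mult_p hv; have nv := U_neq0 Uv.
have npv : phi v != 0 by rewrite fmorph_eq0.
pose w := s * v.
have Bw : B w by apply: (subfieldM sB) => //; apply: AB.
have Uw : U w by apply: UM.
have Nw : N w = u0 by rewrite rnormM (rnorm_base Av) ev mulrC divfK.
have Uu0 : U u0 by rewrite -Nw; apply: rnorm_U.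
have Upw : U (phi w) by apply: U_aut.
have nw := U_neq0 Uw; have npw := U_neq0 Upw.
pose rho := phi w / w / (tau Pi / Pi).
have Brho : B rho by apply: (subfield_div sB) => //; apply: (subfield_div sB) => //; apply: phi_B.
have Urho : U rho by apply: UM; [apply: UM => //; apply: UV|apply: UV; apply: tauPi_U].
have Nrho : N rho = 1.
  by rewrite /rho rnormM rnormV NtP invr1 mulr1 rnormM rnormV -rnorm_phi // Nw (phiF Fu0) divff // (U_neq0 Uu0).
have pi0' : (p%:R : C) != 0 by exact: (p_neq0 (iota := iota)).
have hI := multiple_ideal iota (p%:R ^+ i.+1 : C).
have hrho : mult (p%:R ^+ i.+1) (rho - 1).
  have a1 : mult (p%:R ^+ i.+1) (tau Pi / Pi * s / phi s - 1).
    apply: (@multiple_powW _ _ _ iota p%:R (i + i.+1)) => //; first exact: OnatR.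
      by rewrite leq_addl.
    by apply: hl0; apply/mult_Pipi.
  have a2 : mult (p%:R ^+ i.+1) (phi v - 1).
    by have := multiple_aut phi_iota hv; rewrite rmorphB rmorph1 rmorphXn rmorph_nat.
  have er : rho = (phi v / v) / (tau Pi / Pi * s / phi s).
    by rewrite /rho /w rmorphM; field; rewrite ns nps nv ntp Pi0.
  set z := tau Pi / Pi * s / phi s in a1 er.
  have Uz : U z by apply: UM; [apply: UM => //; apply: tauPi_U|apply: UV; apply: U_aut].
  have nz := U_neq0 Uz.
  rewrite (_ : rho - 1 = ((phi v - 1) - (v - 1) - v * (z - 1)) / (v * z)); last by rewrite er; field; rewrite nz nv.
  apply: multiple_mulr; last by apply: U_OV; apply: UM.
  apply: (idlB hI); first exact: (idlB hI).
  by apply: multiple_mull => //; apply: U_O.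
have B1 : B 1 := subfield1 sB.
have [BY eY] := hilbert90_sum Brho Urho Nrho B1.
set Y := \sum_(j < q) _ in BY eY.
(* For the resolvent of [1] every term is congruent to [1] modulo [p^(i+1)]; this precision, one
   power of [p] beyond [q], is what makes [Y / q] a unit. *)
have hY : mult (p%:R ^+ i.+1) (Y - q%:R).
  have -> : q%:R = \sum_(j < q) (1 : C) by rewrite sumr_const card_ord.
  apply: (eqm_sum hI) => j _; rewrite rmorph1 mulr1.
  have h : eqm (mult (p%:R ^+ i.+1)) (\prod_(k < j) rpow tau k rho) (\prod_(k < j) 1).
    apply: (eqm_prod hI) => k _; [|exact: O1|].
      by apply: U_O; apply: U_aut Urho; apply: rtau_iota.
    have := multiple_aut (rtau_iota k) hrho.
    by rewrite rmorphB rmorph1 rmorphXn rmorph_nat.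
  by move: h; rewrite big1_eq.
have q0' : (q%:R : C) != 0 by rewrite natrX expf_neq0.
have UY : U (Y / q%:R).
  rewrite (_ : _ / _ = 1 + (Y - q%:R) / q%:R); last by field.
  apply: U_D; first exact: U1.
  rewrite (_ : _ / _ = p%:R * ((Y - q%:R) / p%:R ^+ i.+1)); last first.
    by rewrite natrX exprS; field; rewrite pi0' expf_neq0.
  by apply: MMr => //; apply: Mp.
have nY : Y != 0.
  by apply: contraTneq isT => Y0; move: (U_neq0 UY); rewrite Y0 mul0r eqxx.
have Fq : F q%:R := subfield_nat _ sF.
have [b Ub] := unif_decompz sF uF Fq q0'.
exists u0, (1 - q%:Z * b); split=> //; last first.
  rewrite dvdzE; apply/negP => h.
  have : (p%:Z %| (1 - q%:Z * b) + q%:Z * b)%Z.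
    apply: rpredD; first by rewrite dvdzE.
    by apply: dvdz_mulr; rewrite dvdzE /=; apply: dvdn_exp.
  rewrite subrK.
  by rewrite dvdzE /= dvdn1 => /eqP p1; move: p_prime; rewrite p1.
exists w, (Pi / Y); split; first by split=> //; [apply: (subfield_div sB)|rewrite mulf_neq0 // invr_eq0].
have nPiY : tau Y != 0 by rewrite fmorph_eq0.
have nr := U_neq0 Urho.
split.
  have -> : phi w = rho * w * (tau Pi / Pi) by rewrite /rho; field; rewrite nw ntp Pi0.
  by rewrite fmorph_div -{1}eY; field; rewrite nr nPiY Pi0.
have nb : pi ^ b != 0 by rewrite expfz_neq0.
have nqb : Pi ^ (q%:Z * b) != 0 by rewrite expfz_neq0.
rewrite (expfzDr _ _ Pi0) expr1z -invr_expz.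
rewrite (_ : _ / _ = ((pi ^ b / Pi ^ (q%:Z * b)) * (q%:R / pi ^ b) * (Y / q%:R))^-1); last first.
  by field; rewrite nb nqb nY q0' Pi0.
by apply: UV; apply: UM => //; apply: UM => //; apply: zpow_piPi.
Qed.

Lemma rtau_mod j y : B y -> rpow tau (j %% q) y = rpow tau j y.
Proof.
move=> By; rewrite {2}(divn_eq j q) rpowD rpowM.
by rewrite [RHS]rpow_id // tau_q //; apply: rtau_B.
Qed.

(** Applying [sigma] turns [tau y / y] into [tau^c (sigma y) / sigma y], which is [tau Y / Y] for
    the product [Y] of the [tau^j (sigma y)] with [j < c]; each factor has the valuation of [y]. The
    norm commutes with [sigma] because [c] is prime to [q]. *)
Lemma rec_aut (sigma : {rmorphism C -> C}) c u a : (0 < c)%N -> coprime c q ->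
  (forall z, sigma (iota z) = iota z) ->
  (forall y, L y -> L (sigma y)) ->
  (forall y, B y -> sigma (tau y) = rpow tau c (sigma y)) ->
  (forall y, B y -> sigma (phi y) = phi (sigma y)) -> U (sigma Pi / Pi) ->
  rec u a -> rec (sigma u) (c%:Z * a).
Proof.
move=> c0 cq si sL' st sp UsP [w [y [[Bw Uw By y0 Nw] [e Uy]]]].
have sB' z : B z -> B (sigma z) by apply: (ur_image sL sL si).
have Bsw := sB' _ Bw; have Bsy := sB' _ By.
have str j z : B z -> sigma (rpow tau j z) = rpow tau (c * j) (sigma z).
  move=> Bz; elim: j => [|j IH]; first by rewrite muln0.
  by rewrite /= st ?IH ?mulnS ?rpowD //; apply: rtau_B.
have sy0 : sigma y != 0 by rewrite fmorph_eq0.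
pose Y := \prod_(j < c) rpow tau j (sigma y).
exists (sigma w), Y; split; first split => //.
- exact: U_aut.
- by apply: (subfield_prod _ sB) => j _; apply: rtau_B.
- by apply/prodf_neq0 => j _; rewrite fmorph_eq0.
- rewrite -Nw /N rmorph_prod.
  have qinj : injective (fun j : 'I_q => Ordinal (ltn_pmod (c * j) q_gt0)).
    move=> j k [/eqP h]; have cq' : coprime q c by rewrite coprime_sym.
    have := eqn_mod_cancel cq' h; rewrite !modn_small ?ltn_ord // => /eqP; exact: val_inj.
  rewrite (reindex_inj qinj) /=; apply: eq_bigr => j _.
  by rewrite rtau_mod // str.
split.
  have tY : tau Y * sigma y = Y * rpow tau c (sigma y).
    rewrite /Y rmorph_prod; case: (c) => [|d]; first by rewrite !big_ord0.
    rewrite -[RHS](big_ord_recr d.+1 (fun j => rpow tau j (sigma y))) /= [RHS]big_ord_recl /= mulrC.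
    by congr (_ * _).
  have := congr1 sigma e; rewrite !rmorphM sp // st // => e'.
  apply: (mulIf sy0); rewrite -[RHS]mulrA tY mulrAC e'.
  by ring.
have nP : Pi ^ a != 0 by rewrite expfz_neq0.
have Usy : U (sigma y / Pi ^ a).
  have := U_aut si Uy; rewrite fmorph_div fmorphXz => h.
  have nsP : sigma Pi ^ a != 0 by rewrite expfz_neq0 // fmorph_eq0.
  rewrite (_ : _ / _ = sigma y / sigma Pi ^ a * (sigma Pi / Pi) ^ a); first by apply: UM => //; apply: U_zpow.
  by rewrite expfzMl exprz_inv -invr_expz; field; rewrite nP nsP.
rewrite [c%:Z * a]mulrC -exprz_exp (_ : Y / _ = \prod_(j < c) (rpow tau j (sigma y) / Pi ^ a)); last first.
  by rewrite big_split prodfV prodr_const card_ord.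
apply: Uprod => j _.
have := U_aut (rtau_iota j) Usy; rewrite fmorph_div fmorphXz => h.
have ntP : rpow tau j Pi ^ a != 0 by rewrite expfz_neq0 // fmorph_eq0.
rewrite (_ : _ / _ = rpow tau j (sigma y) / rpow tau j Pi ^ a * (rpow tau j Pi / Pi) ^ a).
  by apply: UM => //; apply: U_zpow; apply: rtauPi_U.
by rewrite expfzMl exprz_inv -invr_expz; field; rewrite nP ntP.
Qed.

End Reciprocity.

(** * The unit filtration *)

Lemma expr1D_prime (R : comNzRingType) p (y : R) : prime p ->
  (1 + y) ^+ p = 1 + y ^+ p + p%:R * y * \sum_(i < p.-1) y ^+ i * ('C(p, i.+1) %/ p)%:R.
Proof.
move=> pp; have p0 := prime_gt0 pp.
have aux m : (1 + y) ^+ m.+1 = 1 + y ^+ m.+1 + \sum_(i < m) y ^+ i.+1 *+ 'C(m.+1, i.+1).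
  rewrite exprDn big_ord_recl big_ord_recr /= subn0 bin0 expr0 mulr1 mulr1n expr1n.
  rewrite /bump /= add1n binn subnn expr0 mul1r mulr1n addrA addrAC; congr (_ + _).
  by apply: eq_bigr => i _; rewrite expr1n mul1r.
have := aux p.-1; rewrite prednK // => ->; congr (_ + _); rewrite mulr_sumr.
apply: eq_bigr => i _; rewrite exprS -mulr_natr.
have dv : (p %| 'C(p, i.+1))%N.
  by apply: prime_dvd_bin => //; have := ltn_ord i; lia.
rewrite -{1}(divnK dv) natrM; ring.
Qed.

(** Exponents of the logarithmic construction: [w] has level [s], [v^p] has level [p * i0], and the
    level reached is [j = s + 2 * (p - 1)]. *)
Lemma lam_exponents p i0 s j : (2 < p)%N -> (1 < i0)%N -> (s + p.-1 = p * i0)%N ->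
  j = (p * i0 + p.-1)%N ->
  [/\ (p < s)%N, j.+1 = (s.-1 + 2 * p)%N, j.+1 = (s + (2 * p).-1)%N, (s.-1 + p = p * i0)%N
    & (s.-1 + (2 * p).-1 = j)%N] /\
  [/\ (j.+1 <= s + p * i0)%N, s.-1 = (p * i0.-1)%N, (0 < s)%N, ((2 * p).-1 <= p.-1 * p)%N
    & (0 < j)%N].
Proof.
move=> p2 i2 es ej.
have ps : (p < s)%N by nia.
have h : s.-1 = (p * i0.-1)%N by nia.
have h2 : ((2 * p).-1 <= p.-1 * p)%N by nia.
by split; split=> //; lia.
Qed.

Lemma lam_exponent_bound p i0 j P : (2 < p)%N -> (i0 + 2 <= P)%N ->
  j = (p * i0 + p.-1)%N -> (j.+1 <= P * p.-1 + i0)%N.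
Proof.
move=> p2 h ->; have : ((i0 + 2) * p.-1 <= P * p.-1)%N by rewrite leq_mul2r h orbT.
have -> : ((i0 + 2) * p.-1 = p * i0 + 2 * p.-1 - i0)%N by nia.
by lia.
Qed.

Lemma lower_exponents p T : (2 < p)%N -> (2 < T)%N ->
  [/\ ((p * T - p).+1 <= (p * T).-1)%N, (p * T - p = p * T.-1)%N,
    (p * T - p - p.-1 = p * T.-2 + 1)%N, (T <= p * T - p - p.-1)%N
    & (p * T - p = p * T - p - p.-1 + p.-1)%N].
Proof.
move=> p2 T2; have [T' ->] : exists T', T = T'.+3 by exists (T - 3)%N; lia.
have e : (p * T'.+3 = p * T' + 3 * p)%N by lia.
have b : (3 * T' <= p * T')%N by rewrite leq_mul2r p2 orbT.
have e1 : (p * T'.+3.-1 = p * T' + 2 * p)%N by rewrite /=; lia.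
have e2 : (p * T'.+3.-2 = p * T' + p)%N by rewrite /=; lia.
by rewrite e1 e2 e; move: b; set x := (p * T')%N => b; split; lia.
Qed.

Lemma addn_pred_mul p T : (0 < p)%N -> (0 < T)%N -> (T + p.-1 <= p * T)%N.
Proof. by case: p T => [|p] [|T] //= _ _; rewrite mulSn mulnS; lia. Qed.

Lemma lower_between p x j : (2 < p)%N -> (p <= x)%N -> ((x - p).+1 <= j)%N -> (j < x.-1)%N ->
  [/\ (0 < j)%N, (x - p <= j)%N & (0 < j - (x - p) < p.-1)%N].
Proof. by move=> *; split; lia. Qed.

Section Levels.
Variables (p : nat) (Qp : padicField p) (C : closedFieldType).
Variable iota : {rmorphism Qp -> C}.
Context {HC : padic_closure iota}.
Let p_prime : prime p := pc_prime.
Let alg : forall y : C, algebraicOver iota y := pc_alg.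
Local Notation O := (integral iota).
Local Notation M := (nonunit iota).
Local Notation U := (isunit iota).
Local Notation eqM := (eqm M).
Local Notation adj := (adjoin iota).
Local Notation mult := (multiple iota).
Let MI : Oideal iota M := M_ideal.

Lemma exprD_taylor x d m : O x -> O d ->
  exists2 s, O s & (x + d) ^+ m.+1 = x ^+ m.+1 + m.+1%:R * x ^+ m * d + d ^+ 2 * s.
Proof.
move=> Ox Od; elim: m => [|m [s Os es]].
  by exists 0; [exact: O0|rewrite !expr1 expr0; ring].
exists (m.+1%:R * x ^+ m + s * x + s * d).
  by apply: OD; [apply: OD|]; apply: OM => //; [apply: OnatR|apply: OX].
rewrite exprS es !exprS -!natr1; ring.
Qed.

Lemma expr1D_taylor d m : O d -> exists2 s, O s & (1 + d) ^+ m = 1 + m%:R * d + d ^+ 2 * s.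
Proof.
move=> Od; case: m => [|m]; first by exists 0; [exact: O0|rewrite expr0; ring].
by have [s Os es] := exprD_taylor m O1 Od; exists s => //; rewrite es !expr1n; ring.
Qed.

Lemma expr1D_p y : O y -> exists2 s, O s & (1 + y) ^+ p = 1 + y ^+ p + p%:R * y * s.
Proof.
move=> Oy; rewrite expr1D_prime //; eexists; last by [].
by apply: Osum => i _; apply: OM; [apply: OX|apply: OnatR].
Qed.

Variables (E : set C) (n : nat) (zeta pi : C).
Hypotheses (E_unr : unramified iota (range iota) E) (n_gt0 : (0 < n)%N)
  (zeta_prim : (p ^ n)%N.-primitive_root zeta) (pi_def : pi = zeta - 1).
Local Notation F := (adj E zeta).
Local Notation e := (p ^ n.-1 * p.-1)%N.
Local Notation I j := (mult (pi ^+ j)).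

Let sE : subfield iota E. Proof. exact: unr_base_subfield E_unr. Qed.
Let sF : subfield iota F. Proof. exact: F_subfield E_unr. Qed.
Let uF : unif iota F pi. Proof. rewrite pi_def; exact: F_unif E_unr n_gt0 zeta_prim. Qed.
Let pi0 : pi != 0. Proof. by case: uF. Qed.
Let Mpi : M pi. Proof. by case: uF. Qed.
Let Opi : O pi. Proof. exact: M_O. Qed.
Let Fpi : F pi. Proof. by case: uF. Qed.
Let EF x : E x -> F x. Proof. exact: adjoin_base. Qed.
Let II j : Oideal iota (I j). Proof. exact: multiple_ideal. Qed.
Let pj0 j : pi ^+ j != 0. Proof. by rewrite expf_neq0. Qed.
Let p0 : (p%:R : C) != 0. Proof. exact: (p_neq0 (iota := iota)). Qed.

(** For [j > 0] this is [U_j]; for [j = 0] it only asks that [u] be integral. *)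
Definition level j u := F u /\ I j (u - 1).

Lemma levW j k x : (j <= k)%N -> I k x -> I j x.
Proof. by move=> jk; apply: multiple_powW. Qed.
Lemma lev_M j x : (0 < j)%N -> I j x -> M x.
Proof. by move=> j0; apply: multiple_M => //; apply: MX. Qed.
Lemma lev_O j x : I j x -> O x.
Proof. by apply: multiple_O => //; apply: OX. Qed.
Lemma lev_pi j : I j (pi ^+ j).
Proof. exact: multiple_self. Qed.
Lemma lev_mul j k x y : I j x -> I k y -> I (j + k)%N (x * y).
Proof. by rewrite exprD; apply: multiple_mul. Qed.
Lemma lev_exp j k x : I j x -> I (j * k)%N (x ^+ k).
Proof. by rewrite exprM; apply: multiple_exp. Qed.
Lemma lev1 x : F x -> M x -> I 1 x.
Proof. by case: uF => _ _ _ h Fx Mx; rewrite expr1; apply: h. Qed.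
Lemma lev_p j m x : (j <= e + m)%N -> I m x -> I j (p%:R * x).
Proof.
move=> je hx; apply: levW je _; apply: lev_mul => //.
have Uu : U (pi ^+ e / p%:R) by rewrite pi_def; exact: pi_pow_e n_gt0 zeta_prim.
rewrite /multiple -[_ / _]invrK invf_div; apply: U_OV; exact: Uu.
Qed.

Lemma level_unit j u : (0 < j)%N -> level j u -> U u.
Proof.
move=> j0 [_ h]; rewrite -(subrK 1 u) addrC; apply: U_D; first exact: U1.
exact: lev_M h.
Qed.

Lemma levelW j k u : (j <= k)%N -> level k u -> level j u.
Proof. by move=> jk [Fu h]; split=> //; apply: levW h. Qed.

(** [F] is totally ramified over [E], so the leading coefficient can be taken in [E], where the
    automorphisms act trivially. *)
Lemma level_decomp j u : level j u -> exists a, [/\ E a, O a & I j.+1 (u - (1 + a * pi ^+ j))].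
Proof.
move=> [Fu h].
have Fq : F ((u - 1) / pi ^+ j).
  apply: (subfield_div sF); last exact: (subfieldX _ sF).
  by apply: (subfieldB sF) => //; apply: subfield1 sF.
have [a [Ea Oa ha]] := F_residue E_unr n_gt0 zeta_prim Fq h.
exists a; split=> //.
have h1 : I 1 ((u - 1) / pi ^+ j - a) by apply: lev1 => //; apply: (subfieldB sF) => //; apply: EF.
have := lev_mul h1 (lev_pi j); rewrite add1n.
by rewrite mulrBl divfK // opprD addrA.
Qed.

Lemma level_quot j u v : F u -> F v -> U v -> I j (u - v) -> level j (u / v).
Proof.
move=> Fu Fv Uv h; split; first exact: (subfield_div sF).
have nv := U_neq0 Uv.
rewrite (_ : u / v - 1 = (u - v) / v); last by field.
by apply: multiple_mulr => //; apply: U_OV.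
Qed.

Let zeta_pi : zeta = 1 + pi. Proof. by rewrite pi_def addrC subrK. Qed.

Lemma conj_pi (h : {rmorphism C -> C}) a : h zeta = zeta ^+ a -> I 2 (h pi - a%:R * pi).
Proof.
move=> hz; have [s Os es] := expr1D_taylor a Opi.
have -> : h pi - a%:R * pi = pi ^+ 2 * s.
  by rewrite {1}pi_def rmorphB rmorph1 hz zeta_pi es; ring.
by apply: multiple_mulr => //; apply: lev_pi.
Qed.

Lemma conj_level (h : {rmorphism C -> C}) a j : h zeta = zeta ^+ a -> I j.+1 ((h pi) ^+ j - (a ^ j)%:R * pi ^+ j).
Proof.
move=> hz; have h1 := conj_pi hz.
have h2 : I 1 (h pi / pi - a%:R).
  rewrite /multiple (_ : _ / _ = (h pi - a%:R * pi) / pi ^+ 2) //.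
  by rewrite expr1; field.
have Oh : O (h pi / pi).
  by rewrite -(subrK a%:R (_ / _)); apply: OD; [apply: lev_O h2|apply: OnatR].
have h3 : eqm (I 1) ((h pi / pi) ^+ j) (a%:R ^+ j) by apply: (eqmX (II 1)) => //; apply: OnatR.
have := lev_mul h3 (lev_pi j); rewrite add1n mulrBl -exprMn divfK // natrX.
by [].
Qed.

Let Fpij j : F (pi ^+ j). Proof. exact: (subfieldX _ sF). Qed.
Let F1 : F 1. Proof. exact: subfield1 sF. Qed.
Let level1a j a : F a -> O a -> level j (1 + a * pi ^+ j).
Proof.
move=> Fa Oa; split; first by apply: (subfieldD sF) => //; apply: (subfieldM sF).
by rewrite [1 + _]addrC addrK; apply: multiple_mull => //; apply: lev_pi.
Qed.

Variables (i : nat) (X : C -> int).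
Definition V k u := (p%:Z ^+ k %| X u)%Z.
(** [X] vanishes modulo [p^k] on [U_j]. For the reciprocity exponent [X] and [k = i], the conductor
    is the least such [j]. *)
Definition null k j := forall u, level j u -> V k u.
Hypothesis X_div : forall u v, F u -> U u -> F v -> U v ->
  (p%:Z ^+ i %| X (u / v) - (X u - X v))%Z.

Lemma dvdz_cong k (a b : int) : (k <= i)%N -> (p%:Z ^+ i %| a - b)%Z ->
  (p%:Z ^+ k %| a)%Z = (p%:Z ^+ k %| b)%Z.
Proof.
move=> ki h; have h' : (p%:Z ^+ k %| a - b)%Z by apply: dvdz_trans h; apply: dvdz_exp2l.
by rewrite -[in LHS](subrK b a) rpredDl.
Qed.

Lemma X_one : (p%:Z ^+ i %| X 1)%Z.
Proof. by have := X_div F1 (U1 : U 1) F1 (U1 : U 1); rewrite subrr subr0 divr1. Qed.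

Lemma X_inv u : F u -> U u -> (p%:Z ^+ i %| X u^-1 + X u)%Z.
Proof.
move=> Fu Uu; have := X_div F1 (U1 : U 1) Fu Uu; rewrite div1r => h.
have := rpredD h X_one; rewrite (_ : _ + X 1 = X u^-1 + X u) //; ring.
Qed.

Lemma X_mul u v : F u -> U u -> F v -> U v -> (p%:Z ^+ i %| X (u * v) - (X u + X v))%Z.
Proof.
move=> Fu Uu Fv Uv.
have := X_div Fu Uu (subfieldV sF Fv) (UV Uv); rewrite invrK => h.
have := rpredB h (X_inv Fv Uv); rewrite (_ : _ - _ - _ = X (u * v) - (X u + X v)) //; ring.
Qed.

Lemma X_exp u m : F u -> U u -> (p%:Z ^+ i %| X (u ^+ m) - m%:Z * X u)%Z.
Proof.
move=> Fu Uu; elim: m => [|m IH]; first by rewrite expr0 mul0r subr0; exact: X_one.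
have h := rpredD (X_mul Fu Uu (subfieldX m sF Fu) (UX m Uu)) IH; rewrite -exprS in h.
suff -> : X (u ^+ m.+1) - m.+1%:Z * X u =
  X (u ^+ m.+1) - (X u + X (u ^+ m)) + (X (u ^+ m) - m%:Z * X u) by [].
have -> : m.+1%:Z = m%:Z + 1 by rewrite -addn1 PoszD.
by ring.
Qed.

Lemma V_mul k u v : (k <= i)%N -> F u -> U u -> F v -> U v -> V k u -> V k v -> V k (u * v).
Proof.
move=> ki Fu Uu Fv Uv hu hv; rewrite /V (dvdz_cong ki (X_mul Fu Uu Fv Uv)).
exact: rpredD.
Qed.

Lemma V_div k u v : (k <= i)%N -> F u -> U u -> F v -> U v -> V k u -> V k v -> V k (u / v).
Proof.
move=> ki Fu Uu Fv Uv hu hv; rewrite /V (dvdz_cong ki (X_div Fu Uu Fv Uv)).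
exact: rpredB.
Qed.

Let pz0 : p%:Z != 0. Proof. by rewrite eqz_nat -lt0n prime_gt0. Qed.

Lemma V_expp k u : (k < i)%N -> F u -> U u -> V k.+1 (u ^+ p) = V k u.
Proof.
move=> ki Fu Uu; rewrite /V (dvdz_cong ki (X_exp p Fu Uu)) exprS.
by rewrite dvdz_mul2l.
Qed.

Lemma pz_Gauss k (a b : int) : ~~ (p%:Z %| a)%Z -> (p%:Z ^+ k %| a * b)%Z -> (p%:Z ^+ k %| b)%Z.
Proof.
move=> na; rewrite Gauss_dvdzr //; apply: coprimezXl.
by rewrite /coprimez /gcdz /= ; move: na; rewrite dvdzE /= => na; rewrite eqz_nat -/(coprime _ _) prime_coprime.
Qed.

(** A unit of level [j] is the prescribed representative [v] of its class times a unit of level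
    [j + 1]. *)
Lemma null_step k j : (k <= i)%N -> (0 < j)%N -> null k j.+1 ->
  (forall a, E a -> O a -> exists v, [/\ F v, I j.+1 (v - (1 + a * pi ^+ j)) & V k v]) ->
  null k j.
Proof.
move=> ki j0 hn h u hu; have [Fu _] := hu.
have [a [Ea Oa ha]] := level_decomp hu.
have [v [Fv hv Vv]] := h a Ea Oa.
have lv : level j v.
  split=> //; rewrite (_ : v - 1 = (v - (1 + a * pi ^+ j)) + a * pi ^+ j); last by ring.
  by apply: (idlD (II j)); [apply: levW hv; apply: leqnSn|apply: multiple_mull => //; apply: lev_pi].
have Uv := level_unit j0 lv; have Uu := level_unit j0 hu; have nv := U_neq0 Uv.
have huv : I j.+1 (u - v).
  rewrite (_ : u - v = (u - (1 + a * pi ^+ j)) - (v - (1 + a * pi ^+ j))); last by ring.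
  exact: (idlB (II _)).
have l' := level_quot Fu Fv Uv huv.
have -> : u = (u / v) * v by rewrite divfK.
have [Fq _] := l'.
by apply: V_mul => //; [apply: UM => //; apply: UV|apply: hn].
Qed.

Lemma null_descend k lo hi : (lo <= hi)%N -> null k hi ->
  (forall j, (lo <= j < hi)%N -> null k j.+1 -> null k j) -> null k lo.
Proof.
move=> lh nh hs; suff h d : (d <= hi - lo)%N -> null k (hi - d).
  by have := h _ (leqnn _); rewrite subKn.
elim: d => [|d IH] hd; first by rewrite subn0.
apply: hs; first lia.
by rewrite -subSn ?subSS; [apply: IH; lia|lia].
Qed.

(** In [U_j / U_(j+1)] the elements [sigma u] and [u^(g^j)] agree, so [p^k] divides
    [(c - g^j) * X u], whose first factor is prime to [p]. *)
Lemma null_char (sigma : {rmorphism C -> C}) (g : nat) (c : int) k j :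
  fixes E sigma -> sigma zeta = zeta ^+ g ->
  (forall u, F u -> U u -> (p%:Z ^+ i %| X (sigma u) - c * X u)%Z) ->
  (k <= i)%N -> (0 < j)%N -> ~~ (p%:Z %| c - (g ^ j)%N%:Z)%Z ->
  null k j.+1 -> null k j.
Proof.
move=> sgE sz Xs ki j0 nc hn; apply: null_step => // a Ea Oa.
set m := (g ^ j)%N in nc.
have lu := level1a j (EF Ea) Oa.
set u := 1 + a * pi ^+ j in lu *.
exists u; split; [by case: lu|by rewrite subrr; apply: (idl0 (II _))|].
have [Fu _] := lu; have Uu := level_unit j0 lu.
have Fsu : F (sigma u) by exact: (F_stable E_unr n_gt0 zeta_prim sgE Fu).
have Usu : U (sigma u) by apply: U_aut Uu => d; apply: (fixes_iota sE sgE).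
have Fum := subfieldX m sF Fu; have Uum := UX m Uu.
have hs : I j.+1 (sigma u - u ^+ m).
  have Oaj : O (a * pi ^+ j) by apply: OM => //; apply: OX.
  have [s Os es] := expr1D_taylor m Oaj.
  rewrite es /u rmorphD rmorph1 rmorphM (sgE _ Ea) rmorphXn.
  rewrite (_ : _ - _ = a * ((sigma pi) ^+ j - m%:R * pi ^+ j) - (a * pi ^+ j) ^+ 2 * s); last by ring.
  apply: (idlB (II _)).
    apply: multiple_mull => //; exact: (conj_level j sz).
  apply: multiple_mulr => //; rewrite exprMn -exprM; apply: multiple_mull; last exact: OX.
  by apply: levW (lev_pi _); lia.
have lq := level_quot Fsu Fum Uum hs.
have Vq : V k (sigma u / u ^+ m) by apply: hn.
move: Vq; rewrite /V (dvdz_cong ki (X_div Fsu Usu Fum Uum)).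
have -> : (p%:Z ^+ k %| X (sigma u) - X (u ^+ m))%Z = (p%:Z ^+ k %| (c - m%:Z) * X u)%Z.
  apply: dvdz_cong => //.
  have := rpredB (Xs _ Fu Uu) (X_exp m Fu Uu).
  by rewrite (_ : _ - _ - _ = X (sigma u) - X (u ^+ m) - (c - m%:Z) * X u) //; ring.
exact: pz_Gauss.
Qed.

(** * An automorphism with cyclotomic character [1 + p] *)

Section Gamma.
Variables (gam : {rmorphism C -> C}) (cg : int).
Hypotheses (p_odd : odd p) (p_gt2 : (2 < p)%N) (n_gt1 : (1 < n)%N) (gamE : fixes E gam) (gam_zeta : gam zeta = zeta ^+ p.+1)
  (cg1 : (p%:Z %| cg - 1)%Z)
  (X_gam : forall u, F u -> U u -> (p%:Z ^+ i %| X (gam u) - cg * X u)%Z).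

Let e_big : (2 * p <= e)%N.
Proof.
have : (p ^ 1 <= p ^ n.-1)%N by rewrite leq_exp2l; lia.
by rewrite expn1 => h; apply: (@leq_trans (p * p.-1)%N); [rewrite mulnC leq_mul2l; lia|rewrite leq_mul2r h orbT].
Qed.

Let gam_iota c : gam (iota c) = iota c. Proof. exact: (fixes_iota sE gamE). Qed.
Let gam_F u : F u -> F (gam u). Proof. exact: (F_stable E_unr n_gt0 zeta_prim gamE). Qed.
Let gam_U u : U u -> U (gam u). Proof. exact: U_aut. Qed.

Lemma V_gam k u : (k < i)%N -> F u -> U u -> V k u -> V k.+1 (gam u / u).
Proof.
move=> ki Fu Uu hu; rewrite /V (dvdz_cong ki (X_div (gam_F Fu) (gam_U Uu) Fu Uu)).
have -> : (p%:Z ^+ k.+1 %| X (gam u) - X u)%Z = (p%:Z ^+ k.+1 %| (cg - 1) * X u)%Z.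
  apply: dvdz_cong => //; have := X_gam Fu Uu.
  by rewrite (_ : _ - _ - (_ * _) = X (gam u) - cg * X u) //; ring.
by rewrite exprS; apply: dvdz_mul.
Qed.

(** The other terms of [(1 + pi)^(p+1)] carry the factor [p * pi], of order [e + 1], and [n > 1]
    gives [e >= 2 * p]. *)
Lemma gam_pi : I (2 * p) (gam pi - (pi + pi ^+ p + pi ^+ p.+1)).
Proof.
have [s Os es] := expr1D_p Opi.
have eg : gam pi = (1 + pi) * (1 + pi) ^+ p - 1.
  by rewrite {1}pi_def rmorphB rmorph1 gam_zeta exprS zeta_pi.
rewrite eg es (_ : _ - _ = p%:R * (pi * (s * (1 + pi)))); last by rewrite exprS; ring.
have Oz : O (1 + pi) by apply: OD O1 _.
by apply: (lev_p (m := 1)); [lia|rewrite expr1; apply: multiple_mulr; [apply: multiple_self|apply: OM]].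
Qed.

(** [gam] multiplies [pi] by [1 + pi^(p-1)] up to higher order, so for [w = 1 + b * pi^m] the
    leading term of [gam w / w - 1] is [m * b * pi^(m+p-1)]; with [m] prime to [p], every class at
    level [j] is reached. *)
Lemma null_gam k j m : (k < i)%N -> (0 < m)%N -> coprime p m -> j = (m + p.-1)%N ->
  null k m -> null k.+1 j.+1 -> null k.+1 j.
Proof.
move=> ki m0 cpm ej nm hn; apply: null_step => //; first by lia.
move=> a Ea Oa.
have Um : U m%:R by exact: U_coprime.
pose b := a / m%:R.
have Eb : E b by apply: (subfield_div sE) => //; apply: (subfield_nat _ sE).
have Ob : O b by apply: OM => //; apply: U_OV.
have lw := level1a m (EF Eb) Ob.
set w := 1 + b * pi ^+ m in lw.
have [Fw _] := lw; have Uw := level_unit m0 lw; have nw := U_neq0 Uw.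
exists (gam w / w); split; [by apply: (subfield_div sF) => //; apply: gam_F| |by apply: V_gam => //; apply: nm].
pose eps := gam pi / pi - 1.
have he : I p (eps - pi ^+ p.-1).
  have h : I p.+1 (gam pi - (pi + pi ^+ p)).
    rewrite (_ : _ - _ = (gam pi - (pi + pi ^+ p + pi ^+ p.+1)) + pi ^+ p.+1); last by ring.
    by apply: (idlD (II _)); [apply: levW _ gam_pi; lia|apply: lev_pi].
  move: h; rewrite /multiple exprS (_ : _ / _ = (eps - pi ^+ p.-1) / pi ^+ p) //.
  by rewrite /eps -{1 3}(prednK (prime_gt0 p_prime)) exprS; field; rewrite pi0 pj0.
have he1 : I p.-1 eps.
  rewrite -(subrK (pi ^+ p.-1) eps); apply: (idlD (II _)); last exact: lev_pi.
  by apply: levW _ he; lia.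
have Oe := lev_O he1.
have [s Os es] := expr1D_taylor m Oe.
have eg : gam pi = pi * (1 + eps) by rewrite /eps; field.
have hgw : I j.+1 (gam w - w - a * pi ^+ j).
  rewrite /w rmorphD rmorph1 rmorphM (gamE Eb) rmorphXn eg exprMn es.
  have ea : a = b * m%:R by rewrite /b divfK // (U_neq0 Um).
  rewrite ej exprD ea.
  rewrite (_ : _ - _ = b * pi ^+ m * (m%:R * (eps - pi ^+ p.-1) + eps ^+ 2 * s)); last by ring.
  have -> : (m + p.-1).+1 = (m + p)%N by have := prime_gt0 p_prime; lia.
  apply: lev_mul; first by apply: multiple_mull => //; apply: lev_pi.
  apply: (idlD (II _)); first by apply: multiple_mull => //; apply: OnatR.
  apply: multiple_mulr => //; have := lev_exp 2 he1; apply: levW; lia.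
have Ow : O w^-1 := U_OV Uw.
rewrite (_ : _ - _ = (gam w - w - a * pi ^+ j) / w - a * pi ^+ j * (w - 1) / w); last by field.
apply: (idlB (II _)); apply: multiple_mulr => //.
have := @lev_mul j m (a * pi ^+ j) (w - 1).
move=> hl; apply: levW (hl _ _); [lia|by apply: multiple_mull => //; apply: lev_pi|by case: lw].
Qed.

Let lam := \sum_(k < p.-1) (-1) ^+ k * pi ^+ k.+1 / k.+1%:R.

Let Uk (k : 'I_p.-1) : U (k.+1%:R).
Proof.
apply: U_coprime; rewrite prime_coprime //; apply/negP => /dvdn_leq h.
by have := h isT; have := ltn_ord k; lia.
Qed.

Let Osign k : O ((-1) ^+ k). Proof. by apply: OX; apply: ON; apply: O1. Qed.

Let p_gt0 : (0 < p)%N. Proof. exact: prime_gt0. Qed.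

Let p1S : p.-1 = (p.-2).+1. Proof. by lia. Qed.

Lemma trunc_log_F : F lam.
Proof.
apply: (subfield_sum _ sF) => k _; apply: (subfield_div sF); last exact: (subfield_nat _ sF).
by apply: (subfieldM sF) => //; apply: (subfieldX _ sF); apply: (subfieldN sF).
Qed.

Lemma trunc_log_pi : I 2 (lam - pi).
Proof.
rewrite /lam p1S big_ord_recl /= expr0 mul1r expr1 divr1 addrC addKr.
apply: (idl_sum (II 2)) => k _.
have kk : (k.+1 < p.-1)%N by have := ltn_ord k; lia.
apply: multiple_mulr; last by apply: U_OV; apply: (Uk (Ordinal kk)).
apply: multiple_mull => //; apply: levW _ (lev_pi _); rewrite /bump /=; lia.
Qed.

(* Modulo [p], the derivative of [lam] with respect to [pi] is [(1 - pi^(p-1)) / (1 + pi)],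
   while [gam] moves [pi] by [pi^p (1 + pi)]. *)
Lemma gam_trunc_log : I (2 * p) (gam lam - (lam + pi ^+ p - pi ^+ (2 * p).-1)).
Proof.
pose d := pi ^+ p + pi ^+ p.+1.
have Od : O d by apply: OD; apply: OX.
have hg : eqm (I (2 * p)) (gam pi) (pi + d) by have := gam_pi; rewrite /eqm /d addrA.
have Og : O (gam pi) by apply: O_aut.
have d2 : I (2 * p) (d ^+ 2).
  have hd : I p d by apply: (idlD (II _)); [apply: lev_pi|apply: levW _ (lev_pi _); lia].
  by have := lev_exp 2 hd; rewrite mulnC.
have egl : gam lam = \sum_(k < p.-1) (-1) ^+ k * (gam pi) ^+ k.+1 / k.+1%:R.
  rewrite /lam rmorph_sum; apply: eq_bigr => k _.
  by rewrite fmorph_div rmorphM !rmorphXn rmorphN1 rmorph_nat.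
have h1 : eqm (I (2 * p)) (gam lam) (\sum_(k < p.-1) ((-1) ^+ k * pi ^+ k.+1 / k.+1%:R + (-1) ^+ k * pi ^+ k * d)).
  rewrite egl; apply: (eqm_sum (II _)) => k _.
  have [s Os es] := exprD_taylor k Opi Od.
  have hk : eqm (I (2 * p)) ((gam pi) ^+ k.+1) (pi ^+ k.+1 + k.+1%:R * pi ^+ k * d).
    apply: (eqm_trans (II _)) (_ : eqm _ ((pi + d) ^+ k.+1) _).
      by apply: (eqmX (II _)) => //; apply: OD.
    rewrite /eqm es (_ : _ - _ = d ^+ 2 * s); last by ring.
    exact: multiple_mulr.
  have nk := U_neq0 (Uk k).
  rewrite /eqm (_ : _ - _ = (-1) ^+ k / k.+1%:R * (gam pi ^+ k.+1 - (pi ^+ k.+1 + k.+1%:R * pi ^+ k * d))); last first.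
    by move: nk; move: (k.+1%:R : C) => m nk; field.
  by apply: multiple_mull => //; apply: OM => //; apply: U_OV; apply: Uk.
rewrite big_split /= -/lam in h1.
have geo : \sum_(k < p.-1) (-1) ^+ k * pi ^+ k * d = pi ^+ p - pi ^+ (2 * p).-1.
  rewrite -mulr_suml (eq_bigr (fun k : 'I_p.-1 => (- pi) ^+ k)); last by move=> k _; rewrite -exprMn mulN1r.
  have -> : d = (1 + pi) * pi ^+ p by rewrite /d exprS; ring.
  have hs : (\sum_(k < p.-1) (- pi) ^+ k) * (1 + pi) = 1 - pi ^+ p.-1.
    have := subrX1 (- pi) p.-1.
    have ev : ~~ odd p.-1 by case: (p) p_prime p_gt2 p_odd => //= k _ _; rewrite negbK.
    rewrite exprNn -signr_odd (negPf ev) expr0 mul1r => h.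
    by rewrite -[1 - _]opprB h; ring.
  rewrite mulrA hs mulrBl mul1r -exprD; congr (_ - pi ^+ _); lia.
by rewrite geo addrA in h1.
Qed.

(** Since [s = 1] modulo [p], [gam w - w] equals [B * lam^(s-1) * (gam lam - lam)], that is
    [B * lam^(p * i0) - B * pi^j], up to order [j + 1]. Division by [v^p], which begins with
    [1 + B * lam^(p * i0)], removes the first term; the second is the desired class when [B] is
    congruent to [- a]. *)
Lemma null_lam k j s i0 : (k < i)%N -> (1 < i0)%N -> (i0 + 2 <= p ^ n.-1)%N ->
  (s + p.-1 = p * i0)%N -> j = (p * i0 + p.-1)%N ->
  null k s -> null k i0 -> null k.+1 j.+1 -> null k.+1 j.
Proof.
move=> ki i01 i0n es ej ns ni hn.
have [[ps ej2 ej1 ea1 ea2] [ea3 ea4 s0 ea5 j_gt0]] := lam_exponents p_gt2 i01 es ej.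
have ea6 : (j.+1 <= e + i0)%N by exact: lam_exponent_bound.
apply: null_step => //.
move=> a Ea Oa.
have [f [f0 Ef _]] := unr_base_resid E_unr.
(* A [p]-th root of [- a] modulo the maximal ideal, because [(- a)^(p^f)] is congruent to [- a]. *)
pose b := (- a) ^+ (p ^ f.-1).
have Eb : E b by apply: (subfieldX _ sE); apply: (subfieldN sE).
have ONa : O (- a) by exact: ON.
have Ob : O b by exact: OX.
pose B := b ^+ p.
have EB : E B by exact: (subfieldX _ sE).
have OB' : O B by exact: OX.
have hB : I 1 (B + a).
  apply: lev1; first by apply: (subfieldD sF); apply: EF.
  have := Ef _ (subfieldN sE Ea) ONa.
  by rewrite /eqm opprK /B /b -exprM -expnSr prednK.
have Fl := trunc_log_F; have hl := trunc_log_pi.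
have hl1 : I 1 lam.
  rewrite -(subrK pi lam); apply: (idlD (II _)); first by apply: levW _ hl.
  by rewrite expr1; apply: multiple_self.
have Ol := lev_O hl1.
have hlr : I 1 (lam / pi - 1).
  rewrite /multiple (_ : _ / _ = (lam - pi) / pi ^+ 2) //.
  by rewrite expr1; field.
have Ulr : U (lam / pi).
  rewrite -(subrK 1 (_ / _)) addrC; apply: U_D; first exact: U1.
  exact: lev_M hlr.
have l0 : lam != 0.
  by apply: contraTneq isT => z0; move: (U_neq0 Ulr); rewrite z0 mul0r eqxx.
have Ulr' : O (pi / lam) by rewrite -invf_div; apply: U_OV.
have hlk m : I m (lam ^+ m) by have := lev_exp m hl1; rewrite mul1n.
have Olr : O (lam / pi) := U_O Ulr.
have hlpi m : I m.+1 (lam ^+ m - pi ^+ m).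
  have h3 : eqm (I 1) ((lam / pi) ^+ m) (1 ^+ m) by apply: (eqmX (II 1)) => //; apply: O1.
  have := lev_mul h3 (lev_pi m); rewrite add1n mulrBl -exprMn divfK // expr1n mul1r.
  by [].
have hlp : I (2 * p) (lam ^+ p - pi ^+ p).
  pose mu := (lam - pi) / pi ^+ 2.
  have Omu : O mu := hl.
  have el : lam = pi * (1 + pi * mu) by rewrite /mu; field.
  have Opm : O (pi * mu) by exact: OM.
  have [r Or er] := expr1D_p Opm.
  rewrite el exprMn er exprMn.
  rewrite (_ : _ - _ = pi ^+ p * pi ^+ p * mu ^+ p + p%:R * (pi ^+ p * (pi * mu) * r)); last by ring.
  apply: (idlD (II _)).
    apply: multiple_mulr; last exact: OX.
    by rewrite -exprD addnn -mul2n; apply: lev_pi.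
  apply: (lev_p (m := p)); first by lia.
  by apply: multiple_mulr => //; apply: multiple_mulr => //; apply: lev_pi.
pose eps := gam lam / lam - 1.
have hgl := gam_trunc_log.
have he : I p.-1 eps.
  have h : I p (gam lam - lam).
    rewrite (_ : _ - _ = (gam lam - (lam + pi ^+ p - pi ^+ (2 * p).-1)) + (pi ^+ p - pi ^+ (2 * p).-1)); last by ring.
    apply: (idlD (II _)); first by apply: levW _ hgl; lia.
    by apply: (idlB (II _)); [apply: lev_pi|apply: levW _ (lev_pi _); lia].
  have -> : eps = (gam lam - lam) / pi * (pi / lam) by rewrite /eps; field; rewrite pi0 l0.
  apply: multiple_mulr => //.
  have epp : pi ^+ p = pi * pi ^+ p.-1 by rewrite -exprS prednK.
  by move: h; rewrite /multiple epp invfM mulrA.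
have Oe := lev_O he.
have h1p : I (2 * p).-1 ((1 + eps) ^+ p - 1).
  have [r Or er] := expr1D_p Oe.
  rewrite er (_ : _ - _ = eps ^+ p + p%:R * (eps * r)); last by ring.
  apply: (idlD (II _)).
    by have := lev_exp p he; apply: levW.
  by apply: (lev_p (m := p.-1)); [lia|apply: multiple_mulr].
(* As [s - 1 = p * (i0 - 1)], this is a power of [(1 + eps)^p], already congruent to [1] to order
   [2p - 1]. *)
have hpow : I (2 * p).-1 ((1 + eps) ^+ s.-1 - 1).
  rewrite ea4.
  have : eqm (I (2 * p).-1) (((1 + eps) ^+ p) ^+ i0.-1) (1 ^+ i0.-1).
    by apply: (eqmX (II _)) => //; [apply: OX; apply: OD O1 _|apply: O1].
  by rewrite expr1n exprM.
have egl : gam lam = lam * (1 + eps) by rewrite /eps; field.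
have Ogl : O (gam lam) by rewrite egl; apply: OM => //; apply: OD O1 _.
have hgs : I j.+1 ((gam lam) ^+ s - lam ^+ s.-1 * gam lam).
  have -> : (gam lam) ^+ s - lam ^+ s.-1 * gam lam = lam ^+ s * ((1 + eps) ^+ s.-1 - 1) * (1 + eps).
    rewrite egl -{1 3}(prednK s0).
    by rewrite !exprS exprMn; ring.
  rewrite ej1; apply: multiple_mulr; last by apply: OD O1 _.
  exact: lev_mul.
pose w := 1 + B * lam ^+ s.
pose v := 1 + b * lam ^+ i0.
have lw : level s w.
  split; last by rewrite /w [1 + _]addrC addrK; apply: multiple_mull.
  apply: (subfieldD sF) => //; apply: (subfieldM sF); first exact: EF.
  exact: (subfieldX _ sF).
have lv : level i0 v.
  split; last by rewrite /v [1 + _]addrC addrK; apply: multiple_mull.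
  apply: (subfieldD sF) => //; apply: (subfieldM sF); first exact: EF.
  exact: (subfieldX _ sF).
have [Fw _] := lw; have [Fv _] := lv.
have Uw := level_unit s0 lw; have Uv := level_unit (ltnW i01) lv.
have Ow := U_O Uw.
have Uvp := UX p Uv; have Fvp := subfieldX p sF Fv.
have hvp : I j.+1 (v ^+ p - (1 + B * lam ^+ (p * i0))).
  have Obl : O (b * lam ^+ i0) by apply: OM => //; apply: OX.
  have [r Or er] := expr1D_p Obl.
  have elp : (lam ^+ i0) ^+ p = lam ^+ (p * i0) by rewrite -exprM mulnC.
  rewrite er exprMn elp (_ : _ - _ = p%:R * (b * lam ^+ i0 * r)); last by rewrite /B; ring.
  apply: (lev_p (m := i0)); last by apply: multiple_mulr => //; apply: multiple_mull.
  exact: ea6.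
have Fgw := gam_F Fw; have Ugw := gam_U Uw.
exists (gam w / w / v ^+ p); split.
- by apply: (subfield_div sF) => //; apply: (subfield_div sF).
- have Uwv : U (w * v ^+ p) by apply: UM.
  have nwv := U_neq0 Uwv; have nw := U_neq0 Uw; have nv := U_neq0 Uvp.
  suff key : I j.+1 (gam w - w * v ^+ p * (1 + a * pi ^+ j)).
    rewrite (_ : _ - _ = (gam w - w * v ^+ p * (1 + a * pi ^+ j)) / (w * v ^+ p)); last by field; rewrite ?nw ?nv ?(U_neq0 Uv).
    by apply: multiple_mulr => //; apply: U_OV.
  have k1 : I j.+1 (gam w - (w + B * lam ^+ s.-1 * (pi ^+ p - pi ^+ (2 * p).-1))).
    have egw : gam w = 1 + B * (gam lam) ^+ s by rewrite /w rmorphD rmorph1 rmorphM (gamE EB) rmorphXn.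
    have els : lam ^+ s = lam ^+ s.-1 * lam by rewrite -exprSr prednK.
    rewrite egw /w els.
    rewrite (_ : _ - _ = B * ((gam lam) ^+ s - lam ^+ s.-1 * gam lam)
      + B * (lam ^+ s.-1 * (gam lam - (lam + pi ^+ p - pi ^+ (2 * p).-1)))); last by ring.
    apply: (idlD (II _)); apply: multiple_mull => //.
    rewrite ej2.
    exact: lev_mul.
  have k2 : I j.+1 (B * lam ^+ s.-1 * (pi ^+ p - lam ^+ p)).
    rewrite ej2.
    apply: lev_mul; first exact: multiple_mull.
    by rewrite -opprB; apply: (idlN (II _)).
  have ep : lam ^+ s.-1 * lam ^+ p = lam ^+ (p * i0) by rewrite -exprD ea1.
  have k3 : I j.+1 (B * (lam ^+ s.-1 - pi ^+ s.-1) * pi ^+ (2 * p).-1).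
    rewrite ej1.
    apply: lev_mul; last exact: lev_pi.
    by apply: multiple_mull => //; have := hlpi s.-1; rewrite prednK.
  have ep2 : pi ^+ s.-1 * pi ^+ (2 * p).-1 = pi ^+ j by rewrite -exprD ea2.
  have k4 : I j.+1 ((B + a) * pi ^+ j).
    by rewrite -[j.+1]add1n; apply: lev_mul => //; apply: lev_pi.
  have k5 : I j.+1 (w * (v ^+ p - (1 + B * lam ^+ (p * i0)))) by apply: multiple_mull.
  have k6 : I j.+1 ((w - 1) * (B * lam ^+ (p * i0))).
    apply: levW ea3 _.
    by apply: lev_mul; [case: lw|apply: multiple_mull].
  have k7 : I j.+1 ((w * v ^+ p - 1) * (a * pi ^+ j)).
    rewrite -[j.+1]add1n; apply: lev_mul; last by apply: multiple_mull => //; apply: lev_pi.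
    apply: lev1.
      by apply: (subfieldB sF) => //; apply: (subfieldM sF).
    have Mv : M (v - 1) by apply: lev_M (ltnW i01) _; case: lv.
    have Mw : M (w - 1) by apply: lev_M s0 _; case: lw.
    have : eqM (w * v ^+ p) (1 * 1 ^+ p).
      apply: (eqmM MI) => //; first by apply: OX; apply: O1.
      by apply: (eqmX MI) => //; [apply: U_O|apply: O1].
    by rewrite expr1n mulr1.
  (* The estimates [k1] to [k7] are the pieces of a telescoping decomposition of
     [gam w - w * v^p * (1 + a * pi^j)]. *)
  have := idlB (II _) (idlB (II _) (idlB (II _) (idlB (II _) (idlD (II _) k1 k2) k3) k4) (idlD (II _) k5 k6)) k7.
  congr (I j.+1 _); rewrite -ep -ep2; ring.
- apply: V_div => //; first by apply: (subfield_div sF).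
  + by apply: UM => //; apply: UV.
  + by apply: V_gam => //; apply: ns.
  + by rewrite V_expp //; apply: ni.
Qed.

End Gamma.

(** * The exact level at which the reciprocity exponent vanishes *)

Hypotheses (p_odd : odd p) (i_n : (i <= n)%N).
Let p_gt2 : (2 < p)%N.
Proof. by case: (p) p_prime p_odd => [|[|[|k]]]. Qed.

Lemma null0 j : null 0 j.
Proof. by move=> u _; rewrite /V expr0 dvd1z. Qed.

(** Above level [e / (p - 1) = p^(n-1)] raising to the power [p] shifts levels by [e], and
    [e + p^(n-1) = p^n]; so the units of level [p^n + 1] are [p]-th powers of units of level
    [p^(n-1) + 1]. *)
Lemma null_large k : (k < i)%N -> null k (p ^ n.-1).+1 -> null k.+1 (p ^ n).+1.
Proof.
move=> ki hk u hu; have [Fu hu1] := hu.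
have pn : (e + (p ^ n.-1).+1 = (p ^ n).+1)%N.
  rewrite addnS; congr _.+1; rewrite -{3}(prednK n_gt0) expnS; nia.
have Uu : U (pi ^+ e / p%:R) by rewrite pi_def; exact: pi_pow_e n_gt0 zeta_prim.
pose z := pi ^+ (p ^ n.-1).+1.
have h1 : M (z ^+ p.-1 / p%:R).
  have -> : z ^+ p.-1 / p%:R = pi ^+ e / p%:R * pi ^+ p.-1.
    by rewrite /z -exprM mulSn exprD; ring.
  by apply: MM; [apply: U_O|apply: MX => //; lia].
have h2 : mult (p%:R * z) (u - 1).
  move: hu1; rewrite -pn exprD => hu1; apply/(multiple_unit _ _ Uu).
  by rewrite (_ : p%:R * z * _ = pi ^+ e * z) //; field.
have [v [Fv ev hv]] := unit_pth_root sF (Fpij _) (pj0 _) (MX (ltn0Sn _) Mpi) h1 Fu h2.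
have lv : level (p ^ n.-1).+1 v by [].
by rewrite -ev V_expp //; [apply: hk|apply: level_unit lv].
Qed.

Lemma pexp_mod a b : (p ^ a * b = b %[mod p.-1])%N.
Proof.
have h : (p = 1 %[mod p.-1])%N by rewrite -{1}(prednK (prime_gt0 p_prime)) -[p.-1.+1]addn1 modnDl.
by rewrite -modnMml -modnXm h modnXm exp1n modnMml mul1n.
Qed.

Variables (t g : nat) (sigma : {rmorphism C -> C}) (c : int).
Hypotheses (t_gt2 : (2 < t)%N) (t_ltp : (t < p)%N)
  (sigE : fixes E sigma) (sig_zeta : sigma zeta = zeta ^+ g)
  (X_sig : forall u, F u -> U u -> (p%:Z ^+ i %| X (sigma u) - c * X u)%Z)
  (sig_c : forall j, (p%:Z %| c - (g ^ j)%N%:Z)%Z -> j = t.-1 %[mod p.-1])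
  (gamP : (1 < n)%N -> exists (gam : {rmorphism C -> C}) (cg : int),
    [/\ fixes E gam, gam zeta = zeta ^+ p.+1, (p%:Z %| cg - 1)%Z
      & forall u, F u -> U u -> (p%:Z ^+ i %| X (gam u) - cg * X u)%Z])
  (X_surj : exists u, [/\ F u, U u & ~~ (p%:Z %| X u)%Z]).

Lemma null_char_t k j : (k <= i)%N -> (0 < j)%N -> j <> t.-1 %[mod p.-1] -> null k j.+1 -> null k j.
Proof.
move=> ki j0 nj; apply: (null_char sigE sig_zeta X_sig) => //.
by apply/negP => /sig_c.
Qed.

Lemma t_mod : (t.-1 %% p.-1 = t.-1)%N. Proof. by rewrite modn_small //; lia. Qed.

Lemma eq_mod_cases j : j = t.-1 %[mod p.-1] -> exists a, j = (t.-1 + a * p.-1)%N.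
Proof.
rewrite t_mod => h; exists (j %/ p.-1)%N; rewrite {1}(divn_eq j p.-1) h; lia.
Qed.

(** The descent common to all values of [k]. Levels not congruent to [t - 1] are passed with
    [sigma]; the others with [gam], by [null_gam] if [p] does not divide [j + 1] and by [null_lam]
    if it does. The last two hypotheses keep the auxiliary levels [j - (p - 1)], [s] and [i0] at [T]
    or above, where [X] is already known to vanish modulo [p^k]. *)
Lemma null_upper k lo T : (k < i)%N -> (0 < T)%N -> null k T -> (T <= lo)%N ->
  (T <= (p ^ n.-1))%N ->
  (forall j, (lo <= j <= p ^ n)%N -> j = t.-1 %[mod p.-1] ->
    (1 < n)%N /\ (T + p.-1 <= j)%N) ->
  (forall i0, (lo <= p * i0 + p.-1 <= p ^ n)%N -> (p * i0 + p.-1)%N = t.-1 %[mod p.-1] ->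
    [/\ T <= i0, T + p.-1 <= p * i0 & 1 < i0]%N) ->
  null k.+1 lo.
Proof.
move=> ki T0 nT Tlo Tn hj hi.
have nW a : (T <= a)%N -> null k a by move=> Ta u lu; apply: nT; apply: levelW lu.
have [lh|lh] := leqP lo (p ^ n).+1; last first.
  have h : null k.+1 (p ^ n).+1 by apply: null_large => //; apply: nW; lia.
  by move=> u lu; apply: h; apply: levelW lu; lia.
apply: (null_descend lh) => [|j /andP[lj jh] nj].
  by apply: null_large => //; apply: nW; lia.
have j0 : (0 < j)%N by lia.
have [/eqP jt|/eqP jt] := boolP (j == t.-1 %[mod p.-1]); last exact: null_char_t.
have jr : (lo <= j <= p ^ n)%N by lia.
have [n1 Tj] := hj j jr jt.
have [gam [cg [gamE gz cg1 Xg]]] := gamP n1.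
have [cp|ncp] := boolP (coprime p j.+1).
  apply: (null_gam p_odd p_gt2 n1 gamE gz cg1 Xg (m := (j - p.-1)%N)) => //; [lia| |lia|apply: nW; lia].
  have e1 : j.+1 = (p + (j - p.-1))%N by lia.
  by move: cp; rewrite e1 !prime_coprime // dvdn_addr.
rewrite prime_coprime // negbK in ncp; have /dvdnP [d ed] := ncp.
have d0 : (0 < d)%N by case: (d) ed.
have p1 : (0 < p)%N by exact: prime_gt0.
have ej : j = (p * d.-1 + p.-1)%N.
  by apply: succn_inj; rewrite ed -{1}(prednK d0) mulSn -addnS prednK // mulnC addnC.
rewrite ej in jr jt.
have [a1 a2 a3] := hi _ jr jt.
have b1 : (p.-1 <= p * d.-1)%N by apply: leq_trans a2; apply: leq_addl.
apply: (null_lam p_odd p_gt2 n1 gamE gz cg1 Xg (s := (p * d.-1 - p.-1)%N) (i0 := d.-1)) => //.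
(* The bound on [i0 = d - 1] could only fail for [d = p^(n-1)], where [j + 1 = p^n] is [1] modulo
   [p - 1]; but [j + 1] is congruent to [t], and [2 < t < p]. *)
- have h1 : (d <= p ^ n.-1)%N.
    rewrite leqNgt; apply/negP => Pd.
    have : (p * (p ^ n.-1).+1 <= p * d)%N by rewrite leq_mul2l Pd orbT.
    rewrite mulnS -expnS prednK // [(p * d)%N]mulnC -ed => /leq_trans /(_ jh).
    by rewrite -addn1 addnC leq_add2l leqNgt ltnW.
  have [h2|h2] := leqP d.+1 (p ^ n.-1); first by rewrite addn2 prednK.
  have de : d = (p ^ n.-1 * 1)%N by apply/eqP; rewrite muln1 eqn_leq h1 -ltnS.
  have e1 : j.+1 = 1 %[mod p.-1].
    by rewrite ed de mulnC; have := pexp_mod 1 (p ^ n.-1 * 1); rewrite expn1 pexp_mod => ->.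
  have [a ea] := eq_mod_cases jt; rewrite -ej in ea.
  have t0 : (0 < t)%N by apply: leq_trans t_gt2.
  have tp1 : (t <= p.-1)%N by rewrite -ltnS prednK.
  have p11 : (1 < p.-1)%N by apply: leq_trans (ltnW t_gt2) tp1.
  move: e1; rewrite ea -addSn prednK // addnC modnMDl => e1.
  have [tl|tl] := ltnP t p.-1.
    by rewrite !modn_small // in e1; move: t_gt2; rewrite e1.
  have tp : t = p.-1 by apply/eqP; rewrite eqn_leq tl tp1.
  by rewrite tp modnn modn_small in e1.
- by rewrite subnK.
- by apply: nW; rewrite -(leq_add2r p.-1) subnK.
- exact: nW.
Qed.

(** The factor [p] between successive levels is imposed by [null_lam]: it needs vanishing at level
    [i0], where [j = p * i0 + p - 1], and [j >= p * T] is what ensures [i0 >= T]. In the base case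
    [T = 1], vanishing modulo [p^0] being free. *)
Lemma conductor_upper k : (k < i)%N -> null k.+1 (p ^ k * t).
Proof.
elim: k => [|k IH] ki.
  rewrite expn0 mul1n.
  have pn : (1 <= p ^ n.-1)%N by rewrite expn_gt0 prime_gt0.
  apply: (null_upper ki (T := 1%N)) => //; [exact: null0|lia| |].
    move=> j /andP[tj jp] /eq_mod_cases [a ea].
    have a0 : (0 < a)%N by case: (a) ea => [|a'] //; lia.
    have ap : (p.-1 <= a * p.-1)%N by rewrite -{1}[p.-1]mul1n leq_mul2r a0 orbT.
    split; last by lia.
    (* For [n = 1] the range stops at [p], below the first critical level [t + p - 2]. *)
    rewrite ltnNge; apply/negP => n1; have en : n = 1%N by lia.
    by move: jp; rewrite en expn1; lia.
  move=> i0 /andP[tj jp] h.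
  have [a ea] := eq_mod_cases h.
  (* [i0 = 0] gives [j = p - 1] and [i0 = 1] gives [j = 2 * p - 1], congruent to [0] and [1] modulo
     [p - 1]; neither is congruent to [t - 1] when [2 < t < p]. *)
  have i02 : (1 < i0)%N.
    case: i0 tj ea {h jp} => [|[|i0]] //.
      rewrite muln0 add0n => tj ea; have a0 : (0 < a)%N by case: (a) ea => [|a'] //; lia.
      have ap : (p.-1 <= a * p.-1)%N by rewrite -{1}[p.-1]mul1n leq_mul2r a0 orbT.
      by lia.
    rewrite muln1 => tj ea.
    by case: a ea => [|[|[|a]]] ea; lia.
  have : (p * 2 <= p * i0)%N by rewrite leq_mul2l i02 orbT.
  by split=> //; lia.
have ki' : (k < i)%N by lia.
have nT := IH ki'.
set T := (p ^ k * t)%N in nT.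
have -> : (p ^ k.+1 * t)%N = (p * T)%N by rewrite expnS mulnA.
have pk : (0 < p ^ k)%N by rewrite expn_gt0 prime_gt0.
have T3 : (2 < T)%N by rewrite /T; apply: (leq_trans t_gt2); rewrite leq_pmull.
have Tn : (T < p ^ n.-1)%N.
  have a1 : (T < p ^ k.+1)%N by rewrite /T expnSr ltn_mul2l pk.
  by apply: (leq_trans a1); rewrite leq_exp2l; lia.
have cT : (T + p.-1 <= p * T)%N by apply: addn_pred_mul; [apply: prime_gt0|apply: ltnW (ltnW T3)].
apply: (null_upper ki (T := T)) => //; [lia|by rewrite leq_pmull ?prime_gt0|exact: ltnW| |].
  by move=> j /andP[pTj _] _; split; [lia|apply: (leq_trans cT)].
move=> i0 /andP[tj jp] h.
have Ti : (T <= i0)%N.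
  rewrite leqNgt; apply/negP => iT; have : (p * i0.+1 <= p * T)%N by rewrite leq_mul2l iT orbT.
  by lia.
split=> //; [|lia].
by apply: (leq_trans cT); rewrite leq_mul2l Ti orbT.
Qed.

(** Base case: vanishing on [U_(t-1)] would spread by [sigma] to [U_1], hence to all units, whose
    powers of exponent [p^f - 1] lie in [U_1]; this contradicts surjectivity. Inductive step, with
    [T = p^k * t]: vanishing at level [p * T - 1] spreads down to [p * T - p], which contains the
    [p]-th powers of [U_(T-1)], so [X] would vanish on [U_(T-1)] modulo one power of [p] less. *)
Lemma conductor_lower k : (k < i)%N -> ~ null k.+1 (p ^ k * t).-1.
Proof.
elim: k => [|k IH] ki.
  rewrite expn0 mul1n => nt.
  have n1 : null 1 1.
    apply: (null_descend (hi := t.-1)) nt _; first by lia.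
    move=> j /andP[j1 jt]; apply: null_char_t => //.
    by rewrite t_mod modn_small; lia.
  have [u [Fu Uu nu]] := X_surj; move/negP: nu; apply.
  have [f [f0 Ef _]] := unr_base_resid E_unr.
  have [a [Ea Oa ha]] := F_residue E_unr n_gt0 zeta_prim Fu (U_O Uu).
  have q1 : (1 < p ^ f)%N by rewrite -(exp1n f) ltn_exp2r // prime_gt1.
  have hu : eqM (u ^+ (p ^ f)) u.
    apply: (eqm_trans MI) (eqm_sym MI ha).
    by apply: (eqm_trans MI) (Ef _ Ea Oa); apply: (eqmX MI) => //; apply: U_O.
  have nu0 := U_neq0 Uu.
  have lu : level 1 (u ^+ (p ^ f).-1).
    have Fp : F (u ^+ (p ^ f).-1) by exact: (subfieldX _ sF).
    split=> //; apply: lev1; first exact: (subfieldB sF).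
    rewrite (_ : _ - 1 = (u ^+ (p ^ f) - u) / u); first by apply: MMr => //; apply: U_OV.
    by rewrite -{2}(prednK (ltnW q1)) exprS; field.
  have := n1 _ lu; rewrite /V expr1.
  have ki1 : (1 <= i)%N by [].
  have := dvdz_cong ki1 (X_exp (p ^ f).-1 Fu Uu); rewrite expr1 => -> h.
  have := @pz_Gauss 1 (p ^ f).-1%:Z (X u); rewrite expr1; apply => //.
  rewrite dvdzE /=; apply/negP => hp.
  have := dvdn_sub (dvdn_exp f0 (dvdnn p)) hp.
  have -> : (p ^ f - (p ^ f).-1 = 1)%N by lia.
  by rewrite dvdn1 => /eqP p1; move: p_gt2; rewrite p1.
move=> nt; have ki' : (k < i)%N by lia.
have nT := conductor_upper ki'; have hT := IH ki'; clear IH.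
have eT : (p ^ k.+1 * t)%N = (p * (p ^ k * t))%N by rewrite expnS mulnA.
rewrite eT in nt.
have Tmod := pexp_mod k t.
set T := (p ^ k * t)%N in nT hT nt Tmod.
have pk : (0 < p ^ k)%N by rewrite expn_gt0 prime_gt0.
have T3 : (2 < T)%N by rewrite /T; apply: (leq_trans t_gt2); rewrite leq_pmull.
have Tn : (T < p ^ n.-1)%N.
  have a1 : (T < p ^ k.+1)%N by rewrite /T expnSr ltn_mul2l pk.
  by apply: (leq_trans a1); rewrite leq_exp2l; lia.
have [b1 b2 b3 b4 b5] := lower_exponents p_gt2 T3.
have n1 : (1 < n)%N by apply: leq_trans i_n; apply: leq_trans ki.
have T0 : (0 < T)%N by apply: leq_trans T3.
have j0mod : (p * T - p)%N = t.-1 %[mod p.-1].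
  rewrite b2; have := pexp_mod 1 T.-1; rewrite expn1 => ->; apply/eqP.
  by rewrite -(eqn_modDr 1) !addn1 !prednK ?Tmod //; apply: leq_trans t_gt2.
have pT : (p <= p * T)%N by rewrite leq_pmulr.
have n2 : null k.+2 (p * T - p).+1.
  apply: (null_descend (hi := (p * T).-1)) nt _ => //.
  move=> j /andP[j1 jt]; have [j0 jx /andP[c1 c2]] := lower_between p_gt2 pT j1 jt.
  apply: null_char_t => //; rewrite -j0mod => /eqP; rewrite eqn_mod_dvd //.
  by apply/negP; rewrite gtnNdvd.
(* This level is congruent to [t - 1], where [sigma] gives nothing; [null_gam] applies from
   [p * (T - 2) + 1], which is prime to [p] and at least [T]. *)
have n3 : null k.+2 (p * T - p).
  have [gam [cg [gamE gz cg1 Xg]]] := gamP n1.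
  apply: (null_gam p_odd p_gt2 n1 gamE gz cg1 Xg (m := (p * T - p - p.-1)%N)) => //.
  - exact: leq_trans b4.
  - by rewrite b3 prime_coprime // dvdn_addr ?dvdn_mulr // dvdn1 gtn_eqF // ltnW.
  - by move=> u lu; apply: nT; apply: levelW lu.
apply: hT => w lw; have [Fw hw] := lw.
have T1 : (0 < T.-1)%N by rewrite -ltnS prednK // ltnW.
have Uw := level_unit T1 lw.
rewrite -V_expp //; apply: n3; split; first exact: (subfieldX _ sF).
have Ox : O (w - 1) := lev_O hw.
have [s Os es] := expr1D_p Ox.
have -> : w ^+ p - 1 = (w - 1) ^+ p + p%:R * ((w - 1) * s).
  by rewrite -{1}(subrK 1 w) [w - 1 + 1]addrC es; ring.
have eTp : (p * T - p)%N = (T.-1 * p)%N by rewrite b2 mulnC.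
rewrite eTp; apply: (idlD (II _)); first exact: lev_exp.
apply: (lev_p (m := T.-1)); last exact: multiple_mulr.
rewrite -{1}(prednK (prime_gt0 p_prime)) mulnS addnC leq_add2r leq_mul2r.
by rewrite (leq_trans (leq_pred T)) ?orbT // ltnW.
Qed.

End Levels.

(** * Norms and the Hilbert symbol *)

Section Norms.
Variable C : closedFieldType.
Variables (K L : set C) (d : nat) (th : C) (s : 'I_d -> {rmorphism C -> C}).
Hypotheses (sK : forall k, fixes K (s k)) (Lth : forall m : nat, L (th ^+ m))
  (s_inj : injective (fun k => s k th)).

(** Tested on the powers of [th], the relation becomes a Vandermonde system with distinct nodes. *)
Lemma conj_independent (v : 'rV[C]_d) :
  (forall y, L y -> \sum_k v 0 k * s k y = 0) -> v = 0.
Proof.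
move=> h; pose a := \row_k s k th : 'rV[C]_d.
have dV : \det (Vandermonde d a) != 0.
  rewrite det_Vandermonde; apply/prodf_neq0 => i _; apply/prodf_neq0 => j ij.
  rewrite !mxE subr_eq0; apply/eqP => /s_inj e.
  by move: ij; rewrite e ltnn.
have uV : (Vandermonde d a)^T \in unitmx by rewrite unitmx_tr unitmxE unitfE.
have e0 : v *m (Vandermonde d a)^T = 0.
  apply/rowP => m; rewrite !mxE -[RHS](h _ (Lth m)); apply: eq_bigr => k _.
  by rewrite !mxE rmorphXn.
by rewrite -(mulmxK uV v) e0 mul0mx.
Qed.

(** The matrix [W] of conjugates of the basis intertwines multiplication by [y] with the diagonal
    matrix of the [s k y], and is invertible by independence of the embeddings. *)
Lemma det_conj (e : 'rV[C]_d) (A : 'M[C]_d) y : is_basis K L e ->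
  (forall i j, K (A i j)) -> e *m A = y *: e -> \det A = \prod_k s k y.
Proof.
move=> [Le be] KA eA.
pose W := \matrix_(k, j) s k (e 0 j) : 'M[C]_d.
have WA : W *m A = diag_mx (\row_k s k y) *m W.
  apply/matrixP => k l; rewrite mul_diag_mx !mxE -rmorphM.
  have := congr1 (fun B : 'rV[C]_d => B 0 l) eA; rewrite !mxE => <-.
  rewrite rmorph_sum; apply: eq_bigr => j _.
  by rewrite mxE rmorphM (sK k (KA j l)).
have dW : \det W != 0.
  apply/negP => /det0P [v v0 vW]; move/negP: v0; apply; apply/eqP.
  apply: conj_independent => x Lx.
  have [c [[Kc ex] _]] := be _ Lx.
  rewrite -ex mxE.
  have -> : \sum_k v 0 k * s k (\sum_j e 0 j * c j 0) = \sum_j (v *m W) 0 j * c j 0.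
    under eq_bigr => k _ do rewrite rmorph_sum mulr_sumr.
    rewrite exchange_big; apply: eq_bigr => j _; rewrite mxE mulr_suml.
    by apply: eq_bigr => k _; rewrite mxE rmorphM (sK k (Kc j)) mulrA.
  by rewrite vW big1 // => j _; rewrite mxE mul0r.
have := congr1 determinant WA; rewrite !det_mulmx det_diag mulrC => /(mulIf dW) ->.
by apply: eq_bigr => k _; rewrite mxE.
Qed.

End Norms.

Section Symbol.
Variables (p : nat) (Qp : padicField p) (C : closedFieldType).
Variable iota : {rmorphism Qp -> C}.
Context {HC : padic_closure iota}.
Let p_prime : prime p := pc_prime.
Let alg : forall y : C, algebraicOver iota y := pc_alg.
Local Notation O := (integral iota).
Local Notation M := (nonunit iota).
Local Notation U := (isunit iota).
Local Notation eqM := (eqm M).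
Local Notation adj := (adjoin iota).
Local Notation ur := (ur iota).
Local Notation mult := (multiple iota).
Let MI : Oideal iota M := M_ideal.

Lemma subfieldXz (K : set C) x (a : int) : subfield iota K -> K x -> K (x ^ a).
Proof.
move=> sK Kx; case: a => k; first by rewrite -exprnP; apply: (subfieldX _ sK).
by rewrite NegzE -exprnN; apply: (subfieldV sK); apply: (subfieldX _ sK).
Qed.

(** Divided by a power of [Pi] the element is a unit, approximated by [K] to every order; an
    automorphism over [K] then fixes it by separatedness. *)
Lemma ur_frob_fixed (K : set C) Pi phi f : subfield iota K -> unif iota K Pi -> (0 < f)%N ->
  full_resid iota K (p ^ f) -> fixes K phi -> (forall z, ru p z -> phi z = z ^+ (p ^ f)%N) ->
  forall y, ur K y -> phi y = y -> K y.
Proof.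
move=> sK uK f0 fK phiK phir y Uy phy.
have [->|y0] := eqVneq y 0; first exact: subfield0 sK.
have sU : subfield iota (ur K) by exact: ur_subfield sK.
have [KPi Pi0 MPi _] := uK.
have uU : unif iota (ur K) Pi by exact: ur_unif.
have [a Ua] := unif_decompz sU uU Uy y0.
have na : Pi ^ a != 0 by rewrite expfz_neq0.
have KPa : K (Pi ^ a) by exact: subfieldXz.
suff Kb : K (y / Pi ^ a) by rewrite -(divfK na y); apply: (subfieldM sK).
set b := y / Pi ^ a in Ua *.
have Ub : ur K b by apply: (subfield_div sU) => //; apply: ur_base.
have phb : phi b = b by rewrite /b fmorph_div phy (phiK _ KPa).
apply: (fixed_mem alg p_prime sK) => h hK; apply/eqP; rewrite -subr_eq0; apply/eqP.
apply: (multiple_pow_eq0 MPi Pi0) => l.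
have hl : mult (Pi ^+ l) (phi b - b) by rewrite phb subrr; apply: (idl0 (multiple_ideal iota _)).
have [c [Kc Oc hc]] := frob_descent sK uK f0 fK phiK phir Ub (U_O Ua) hl.
have := multiple_aut (fixes_iota sK hK) hc; rewrite rmorphXn (hK _ KPi) rmorphB (hK _ Kc) => h2.
have := idlB (multiple_ideal iota _) h2 hc.
by rewrite opprB addrA subrK.
Qed.

Lemma basis_mul (K L : set C) d (e : 'rV[C]_d) y : subfield iota L -> is_basis K L e -> L y ->
  exists A : 'M[C]_d, (forall i j, K (A i j)) /\ e *m A = y *: e.
Proof.
move=> sL [Le be] Ly.
have h j : exists c : 'cV[C]_d, (forall i, K (c i 0)) /\ (e *m c) 0 0 = y * e 0 j.
  by have [|c [hc _]] := be (y * e 0 j); [apply: (subfieldM sL)|exists c].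
have [F hF] := choice h.
exists (\matrix_(i, j) F j i 0); split=> [i j|]; first by rewrite mxE; case: (hF j).
apply/rowP => j; rewrite !mxE; have [_] := hF j; rewrite mxE => <-.
by apply: eq_bigr => i _; rewrite mxE.
Qed.

Lemma is_norm_conj (K L : set C) d (e : 'rV[C]_d) th (s : 'I_d -> {rmorphism C -> C}) :
  subfield iota K -> subfield iota L -> is_basis K L e -> (forall k, fixes K (s k)) -> L th ->
  injective (fun k => s k th) -> forall y z, L y -> is_norm K L y z <-> z = \prod_k s k y.
Proof.
move=> sK sL be fs Lth si y z Ly.
have Lm (m : nat) : L (th ^+ m) by exact: (subfieldX _ sL).
split=> [[d' [e' [A [be' KA eA ->]]]]|->].
  have dd : d' = d by exact: (basis_dim sK sL be' be).
  by subst d'; apply: (det_conj fs Lm si be' KA eA).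
have [A [KA eA]] := basis_mul sL be Ly.
by exists d, e, A; split=> //; rewrite (det_conj fs Lm si be KA eA).
Qed.

Variables (E : set C) (n : nat) (zeta : C).
Hypotheses (E_unr : unramified iota (range iota) E) (n_gt0 : (0 < n)%N)
  (zeta_prim : (p ^ n)%N.-primitive_root zeta).
Local Notation F := (adj E zeta).
Variables (i : nat) (alpha : C).
Local Notation q := (p ^ i)%N.
Local Notation L := (adj F alpha).
Local Notation zi := (kzeta p n zeta i).
Hypotheses (i_gt0 : (0 < i)%N) (i_len : (i <= n)%N) (alpha0 : alpha != 0)
  (alphaF : F (alpha ^+ q)).
Variables (Pi : C) (f : nat) (tau phi : {rmorphism C -> C}).
Hypotheses (tau_ur : fixes (ur F) tau) (tau_alpha : tau alpha = zi * alpha)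
  (uL : unif iota L Pi) (UPi : U (Pi ^+ q / (zeta - 1))) (f_gt0 : (0 < f)%N)
  (resF : resid iota F (p ^ f)) (fullF : full_resid iota F (p ^ f))
  (resL : resid iota L (p ^ f))
  (phi_L : fixes L phi) (phi_ru : forall z, ru p z -> phi z = z ^+ (p ^ f)%N).
Local Notation N := (rnorm p i tau).

Let sF : subfield iota F. Proof. exact: F_subfield E_unr. Qed.
Let uF : unif iota F (zeta - 1). Proof. exact: F_unif E_unr n_gt0 zeta_prim. Qed.
Let sL : subfield iota L. Proof. exact: adjoin_subfield. Qed.
Let FL x : F x -> L x. Proof. exact: adjoin_base. Qed.
Let La : L alpha. Proof. exact: adjoin_gen. Qed.
Let zi_prim : q.-primitive_root zi. Proof. exact: (kzeta_prim (HC := HC) zeta_prim i_len). Qed.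
Let zi_F : F zi. Proof. exact: (kzeta_F n E_unr i). Qed.
Let tauF : fixes F tau. Proof. by move=> x Fx; apply: tau_ur; apply: ur_base. Qed.
Let phiF : fixes F phi. Proof. by move=> x /FL; apply: phi_L. Qed.
Let q_gt1 : (1 < q)%N. Proof. by rewrite -(exp1n i) ltn_exp2r // prime_gt1. Qed.
Let sB : subfield iota (ur L). Proof. exact: ur_subfield. Qed.
Let fullL : full_resid iota L (p ^ f).
Proof. by move=> z /fullF [c [Fc Oc zc]]; exists c; split=> //; apply: FL. Qed.
Let tau_L y : L y -> L (tau y). Proof. exact: (step_stable sF zi_F tau_ur tau_alpha). Qed.

Lemma rtau_alpha k : rpow tau k alpha = zi ^+ k * alpha.
Proof. exact: (rpow_eigen k (tauF zi_F) tau_alpha). Qed.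

Lemma is_norm_L y z : L y -> is_norm F L y z <-> z = N y.
Proof.
move=> Ly; have be : is_basis F L (\row_(j < q) alpha ^+ j).
  exact: (step_basis q_gt1 sF alpha0 alphaF zi_prim zi_F tau_ur tau_alpha).
have fs (k : 'I_q) : fixes F (rpow tau k) by apply: rpow_fixes.
have si : injective (fun k : 'I_q => rpow tau k alpha).
  move=> k l; rewrite !rtau_alpha => /(mulIf alpha0) /eqP.
  by rewrite (eq_prim_root_expr zi_prim) !modn_small ?ltn_ord // => /eqP /val_inj.
rewrite /rnorm; exact: (is_norm_conj (s := fun k : 'I_q => rpow tau k) sF sL be fs La si z Ly).
Qed.

Lemma frob_degree1 : frobenius_degree iota F 1 phi.
Proof.
exists (p ^ f)%N; first by apply/(residue_card sF f_gt0 resF fullF).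
have -> : max_unramified iota F = ur F.
  by apply: (max_unramifiedE sF uF); exists f.
have sA : subfield iota (ur F) by exact: ur_subfield.
have phi_iota := fixes_iota sF phiF.
move=> x [Ax Ox]; apply/(max_idealP _ sA); split.
  apply: (subfieldB sA); last exact: (subfieldX _ sA).
  by apply: (ur_image sF sF phi_iota) Ax => y Fy; rewrite phiF.
have [z [hz xz]] := O_teich Ox.
have Oz : O z by exact: teich_O hz.
have phz : phi z = z ^+ (p ^ f)%N.
  case: hz => [->|]; last exact: phi_ru.
  by rewrite rmorph0 expr0n expn_eq0 (gtn_eqF (prime_gt0 p_prime)).
rewrite expn1; apply: (eqm_trans MI (y := phi z)).
  by rewrite /eqm -rmorphB; apply: M_aut.
by rewrite phz; apply: (eqmX MI) => //; apply: (eqm_sym MI).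
Qed.

Lemma max_ur_L : max_unramified iota L = ur L.
Proof. by apply: (max_unramifiedE sL uL); exists f. Qed.

(** The lift chosen is [phi], of degree [1] and trivial on [L], so its fixed field is [L]; splitting
    [w] as [Pi] times [w / Pi] supplies the two norms. *)
Lemma symbol_of_norm w : L w -> w != 0 -> hilbert_symbol iota i F (alpha ^+ q) (N w) 1.
Proof.
move=> Lw w0; exists alpha, phi; split=> //; last by rewrite mul1r phi_L.
  by apply/(in_galoisP alg _ sF).
exists phi, 1%N; split=> //; first by apply/(in_galoisP alg _ sF).
  exact: frob_degree1.
have -> : [set y | max_unramified iota L y /\ phi y = y] = L.
  rewrite max_ur_L; apply/seteqP; split=> [y [By py]|y Ly].
    exact: (ur_frob_fixed sL uL f_gt0 fullL phi_L phi_ru By py).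
  by split; [apply: ur_base|apply: phi_L].
have [LPi Pi0 _ _] := uL.
have Lw' : L (w / Pi) by exact: (subfield_div sL).
exists Pi, (w / Pi), (N Pi), (N (w / Pi)); split.
- by apply/prime_elementP.
- by apply/is_norm_L.
- by split=> //; rewrite mulf_neq0 ?invr_eq0.
- by apply/is_norm_L.
- by rewrite -rnormM mulrC divfK.
Qed.

Lemma adjoin_other_root b : b ^+ q = alpha ^+ q -> adj F b = L.
Proof.
move=> eb; have : (b / alpha) ^+ q = 1 by rewrite exprMn exprVn eb divff // expf_neq0.
move=> /(prim_rootP zi_prim)[a ea].
have Fz : F (zi ^+ a) by exact: (subfieldX _ sF).
have z0 : zi ^+ a != 0.
  rewrite -ea mulf_neq0 ?invr_eq0 //; apply: contra_eq_neq eb => ->.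
  by rewrite expr0n (gtn_eqF (ltnW q_gt1)) eq_sym expf_neq0.
have eb' : b = zi ^+ a * alpha by rewrite -ea divfK.
apply/seteqP; split => y.
  by apply: adjoin_min => //; rewrite eb'; apply: (subfieldM sL) => //; apply: FL.
have sb : subfield iota (adj F b) by exact: adjoin_subfield.
have Fb x : F x -> adj F b x by exact: adjoin_base.
apply: adjoin_min => //; have -> : alpha = b / zi ^+ a by rewrite eb' mulrC mulKf.
by apply: (subfield_div sb); [exact: adjoin_gen|apply: Fb].
Qed.

Lemma phi_rtau_comm k l y : ur L y -> rpow phi k (rpow tau l y) = rpow tau l (rpow phi k y).
Proof.
have phi_iota := fixes_iota sF phiF.
have phB z : ur L z -> ur L (phi z).
  by apply: (ur_image sL sL phi_iota) => x Lx; rewrite phi_L.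
move=> By; elim: k => //= k IH; rewrite IH.
by rewrite (phi_rtau sF sL tau_ur tau_L phi_L phi_ru) //; apply: (rpow_stable (L := ur L)).
Qed.

(** * Lifts of arbitrary positive degree: their fixed fields and norms *)

Section FixedField.
Variables (h : {rmorphism C -> C}) (d : nat).
Hypotheses (d_gt0 : (0 < d)%N) (hL : fixes L h)
  (h_ru : forall z, ru p z -> h z = z ^+ ((p ^ f) ^ d)%N).
Local Notation Q := (p ^ f)%N.
Let Q_gt1 : (1 < Q)%N. Proof. by rewrite -(exp1n f) ltn_exp2r // prime_gt1. Qed.
Let Qd_gt1 : (1 < Q ^ d)%N. Proof. by rewrite -(exp1n d) ltn_exp2r. Qed.
Let N0 := (Q ^ d).-1.
Let N0_gt0 : (0 < N0)%N. Proof. by rewrite /N0 -subn1 subn_gt0. Qed.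
Let cpN0 : coprime p N0.
Proof.
rewrite prime_coprime //; apply/negP => hp.
have pQ : (p %| Q ^ d)%N by rewrite -expnM dvdn_exp // muln_gt0 f_gt0.
have := dvdn_sub pQ hp; have -> : (Q ^ d - N0 = 1)%N by rewrite /N0; lia.
by rewrite dvdn1 => /eqP p1; move: p_prime; rewrite p1.
Qed.

Variable xi : C.
Hypothesis xi_prim : N0.-primitive_root xi.
Let xi_ru : ru p xi. Proof. exact: prim_ru cpN0 xi_prim. Qed.
Let xi_Q : xi ^+ (Q ^ d) = xi.
Proof. by rewrite -(prednK (ltnW Qd_gt1)) exprS (prim_expr_order xi_prim) mulr1. Qed.
Local Notation T := (adj L xi).
Let sT : subfield iota T. Proof. exact: adjoin_subfield. Qed.
Let LT x : L x -> T x. Proof. exact: adjoin_base. Qed.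
Let Txi : T xi. Proof. exact: adjoin_gen. Qed.
Let xi0 : xi != 0. Proof. exact: U_neq0 (ru_U xi_ru). Qed.

Lemma T_ur y : T y -> ur L y.
Proof. by move=> Ty; exists xi. Qed.

Lemma phi_d y : ur L y -> rpow phi d y = h y.
Proof.
apply: (ur_agree sL) => [x Lx|z rz]; first by rewrite rpow_id ?hL ?phi_L.
rewrite h_ru //; elim: (d) => [|k IH]; first by rewrite expn0 expr1.
by rewrite rpowS IH rmorphXn phi_ru // -exprM mulnC -expnSr.
Qed.

(** [h] fixes [xi], of order [Q^d - 1], and acts on roots of unity as the Frobenius over [T]; so
    [ur_frob_fixed] applies to [T]. *)
Lemma fixed_field : [set y | ur L y /\ h y = y] = T.
Proof.
have hT : fixes T h.
  move=> y Ty; have -> : y = (idfun : {rmorphism C -> C}) y by [].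
  rewrite -[LHS]/(h y); apply: (fixes_adjoin sL) Ty => //=.
  by rewrite h_ru.
apply/seteqP; split=> [y [By hy]|y Ty]; last by split; [apply: T_ur|apply: hT].
have uT : unif iota T Pi.
  have [LPi Pi0 MPi _] := uL; have [_ _ _ hU] := ur_unif sL uL.
  by split=> // [|x Tx Mx]; [apply: LT|apply: hU => //; apply: T_ur].
have fullT : full_resid iota T (p ^ (f * d)).
  move=> z; rewrite expnM => ez; exists z.
  have [->|z0] := eqVneq z 0.
    by split; [apply: subfield0 sT|apply: O0|apply: (eqm_refl MI)].
  have z1 : z ^+ N0 = 1.
    by apply: (mulfI z0); rewrite mulr1 -exprS prednK // ltnW.
  have rz : ru p z by exists N0.
  have /(prim_rootP xi_prim)[a ->] := z1.
  by split; [apply: (subfieldX _ sT)|apply: OX; apply: U_O; apply: ru_U|apply: (eqm_refl MI)].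
apply: (ur_frob_fixed sT uT _ fullT hT) hy; first by rewrite muln_gt0 f_gt0.
  by move=> z rz; rewrite h_ru // expnM.
exact: (ur_mono sT LT).
Qed.

(** A primitive element of [T] over [F], product of the unramified generator and the Kummer
    generator. *)
Let th := xi * alpha.
(** The [d * q] embeddings [phi^a tau^b], enumerated by division of [k] by [d]. *)
Let s (k : 'I_(d * q)) : {rmorphism C -> C} := rpow phi (k %% d) \o rpow tau (k %/ d).

Let q0 : (0 < q)%N. Proof. exact: ltnW. Qed.

Lemma rphi_xi k : rpow phi k xi = xi ^+ (Q ^ k).
Proof.
elim: k => [|k IH]; first by rewrite expn0 expr1.
by rewrite rpowS IH rmorphXn phi_ru // -exprM mulnC -expnSr.
Qed.

Lemma s_theta k : s k th = xi ^+ (Q ^ (k %% d)) * (zi ^+ (k %/ d) * alpha).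
Proof.
have tx l : rpow tau l xi = xi by apply: rpow_id; apply: tau_ur; apply: ur_ru.
rewrite /s /th /= !rmorphM tx rphi_xi rtau_alpha; congr (_ * _).
by rewrite rpow_id // phi_L //; apply: (subfieldM sL) => //; apply: FL; apply: (subfieldX _ sF).
Qed.

(** Raising to the power [q] kills the powers of [zi] and is injective on those of [xi], whose order
    is prime to [p]; this separates the two exponents. *)
Lemma s_theta_inj : injective (fun k => s k th).
Proof.
move=> k l; rewrite !s_theta !mulrA => /(mulIf alpha0) e.
have e1 : xi ^+ (Q ^ (k %% d)) = xi ^+ (Q ^ (l %% d)) /\ zi ^+ (k %/ d) = zi ^+ (l %/ d).
  have h1 : xi ^+ (Q ^ (k %% d) * q) = xi ^+ (Q ^ (l %% d) * q).
    have := congr1 (fun x => x ^+ q) e.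
    rewrite !exprMn -![zi ^+ _ ^+ _]exprM ![(_ %/ _ * q)%N]mulnC !exprM (prim_expr_order zi_prim).
    by rewrite !expr1n !mulr1.
  have h2 : xi ^+ (Q ^ (k %% d)) = xi ^+ (Q ^ (l %% d)).
    apply/eqP; rewrite (eq_prim_root_expr xi_prim).
    apply: (@eqn_mod_cancel _ q); first by rewrite coprime_sym coprime_pexpl.
    by rewrite -(eq_prim_root_expr xi_prim) ![(q * _)%N]mulnC h1.
  split=> //; move: e; rewrite h2 => /mulfI; apply.
  by rewrite expf_neq0.
have [e2 e3] := e1.
have hb : (k %/ d = l %/ d)%N.
  have kb (m : 'I_(d * q)) : (m %/ d < q)%N by have := ltn_ord m; rewrite ltn_divLR // [(q * d)%N]mulnC.
  by move/eqP: e3; rewrite (eq_prim_root_expr zi_prim) !modn_small ?kb // => /eqP.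
have Qle m : (m < d)%N -> (Q ^ m <= N0)%N.
  move=> md; rewrite /N0 -ltnS prednK; last exact: ltnW.
  by rewrite ltn_exp2l.
have inj a b : (0 < a <= N0)%N -> (0 < b <= N0)%N -> a = b %[mod N0] -> a = b.
  move=> /andP[a0 aN] /andP[b0 bN].
  have -> : a = (a.-1 + 1)%N by lia.
  have -> : b = (b.-1 + 1)%N by lia.
  by move/eqP; rewrite eqn_modDr !modn_small; [move/eqP->|lia|lia].
have ha : (k %% d = l %% d)%N.
  move/eqP: e2; rewrite (eq_prim_root_expr xi_prim) => /eqP hm.
  have Qb m : (0 < Q ^ (m %% d) <= N0)%N by rewrite Qle ?ltn_pmod // expn_gt0 (ltnW Q_gt1).
  have /eqP := inj _ _ (Qb _) (Qb _) hm.
  by rewrite eqn_exp2l // => /eqP.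
by apply: ord_inj; rewrite (divn_eq k d) (divn_eq l d) ha hb.
Qed.

Lemma T_theta : adj F th = T.
Proof.
have sTh : subfield iota (adj F th) by exact: adjoin_subfield.
have Fth x : F x -> adj F th x by exact: adjoin_base.
have Tth : adj F th th by exact: adjoin_gen.
have Ta : adj F th alpha.
  have [u [v euv]] : exists u v, (u * N0 = v * q + 1)%N.
    have [u v e1 _] := egcdnP q N0_gt0; exists u, v.
    have : coprime N0 q by rewrite coprime_sym coprime_pexpl.
    by rewrite e1 /coprime => /eqP ->.
  have e : th ^+ (N0 * u) = alpha * (alpha ^+ q) ^+ v.
    rewrite exprM /th exprMn (prim_expr_order xi_prim) mul1r -!exprM mulnC euv addn1 exprS.
    by rewrite mulnC.
  have nv : (alpha ^+ q) ^+ v != 0 by rewrite !expf_neq0.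
  have -> : alpha = th ^+ (N0 * u) / (alpha ^+ q) ^+ v by rewrite e mulfK.
  by apply: (subfield_div sTh); apply: (subfieldX _ sTh) => //; apply: Fth.
apply/seteqP; split => y.
  apply: adjoin_min => [//|x Fx|]; first by apply: LT; apply: FL.
  by apply: (subfieldM sT) => //; apply: LT.
apply: adjoin_min => //; first by apply: adjoin_min.
have -> : xi = th / alpha by rewrite /th mulfK.
exact: (subfield_div sTh).
Qed.

(** A monic polynomial of degree [d * q] with root [th]; [phi] permutes its factors cyclically,
    which puts its coefficients in [F]. *)
Let G := \prod_(a < d) ('X^q - (xi ^+ (Q ^ a * q) * alpha ^+ q)%:P) : {poly C}.

Lemma G_F m : F G`_m.
Proof.
have sA : subfield iota (ur F) by exact: ur_subfield.
have mapG (g : {rmorphism C -> C}) : fixes F g ->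
    map_poly g G = \prod_(a < d) ('X^q - (g xi ^+ (Q ^ a * q) * alpha ^+ q)%:P).
  move=> gF; rewrite rmorph_prod; apply: eq_bigr => a _ /=.
  by rewrite rmorphB /= map_polyXn map_polyC /= rmorphM /= (gF _ alphaF) rmorphXn.
apply: (ur_frob_fixed sF uF f_gt0 fullF phiF phi_ru).
  apply: (fixed_mem alg p_prime sA) => g gA.
  have gF : fixes F g by move=> x Fx; apply: gA; apply: ur_base.
  have := congr1 (fun P : {poly C} => P`_m) (mapG g gF).
  by rewrite coef_map /= => ->; rewrite gA //; apply: ur_ru.
have := congr1 (fun P : {poly C} => P`_m) (mapG phi phiF).
rewrite coef_map /= => ->; congr (nth 0 (polyseq _) m).
pose H a := 'X^q - (xi ^+ (Q ^ a * q) * alpha ^+ q)%:P : {poly C}.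
rewrite (eq_bigr (fun a : 'I_d => H a.+1)) => [|a _]; last first.
  by rewrite phi_ru // -exprM mulnA -expnS.
rewrite /G -[in LHS](prednK d_gt0) -[in RHS](prednK d_gt0) big_ord_recr big_ord_recl /=.
rewrite [LHS]mulrC; congr (_ * _); rewrite /H prednK // exprM xi_Q expn0 mul1n.
by [].
Qed.

Lemma size_G : size G = (d * q).+1.
Proof.
have hs (c : C) : size ('X^q - c%:P : {poly C}) = q.+1 by rewrite size_XnsubC.
rewrite /G size_prod => [|a _]; last by rewrite -size_poly_eq0 hs.
rewrite (eq_bigr (fun=> q.+1)) // sum_nat_const card_ord /= mulnS.
by rewrite subSn ?addKn // leq_addr.
Qed.

Lemma T_basis : is_basis F T (\row_(k < d * q) th ^+ k).
Proof.
rewrite -T_theta; have sTh : subfield iota (adj F th) by exact: adjoin_subfield.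
apply: (power_basis sF) => [m|y Ty|P KP sP Pth].
- by apply: (subfieldX _ sTh); apply: adjoin_gen.
- apply: (adjoin_poly_size sF G_F _ size_G Ty).
  rewrite /G horner_prod; apply/eqP/prodf_eq0; exists (Ordinal d_gt0) => //=.
  by rewrite !hornerE /th exprMn ?expn0 ?mul1n subrr.
- apply: (@roots_geq_poly_eq0 _ P [seq s k th | k <- enum 'I_(d * q)]).
  + apply/allP => _ /mapP[k _ ->]; apply/rootP.
    have fk : fixes F (s k) by move=> x Fx /=; rewrite !rpow_id ?phiF ?tauF.
    have eP : P = map_poly (s k) P by apply/polyP => m; rewrite coef_map -[RHS]/(s k P`_m) fk.
    by rewrite eP horner_map Pth rmorph0.
  + by rewrite map_inj_uniq ?enum_uniq //; apply: s_theta_inj.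
  + by rewrite size_map size_enum_ord.
Qed.

(** The product over all embeddings is [N] applied to the product of the [phi^a y], the norm from
    [T] to [L]. *)
Lemma norm_T y z : T y -> y != 0 -> is_norm F T y z -> exists w, [/\ L w, w != 0 & z = N w].
Proof.
move=> Ty y0.
have fs k : fixes F (s k) by move=> x Fx /=; rewrite !rpow_id ?phiF ?tauF.
have Tth : T th by apply: (subfieldM sT) => //; apply: LT.
move/(is_norm_conj sF sT T_basis fs Tth s_theta_inj z Ty) => ->.
have By := T_ur Ty.
have phi_iota := fixes_iota sF phiF.
have phB k : ur L (rpow phi k y).
  apply: (rpow_stable (L := ur L)) => // x.
  by apply: (ur_image sL sL phi_iota) => x' Lx'; rewrite phi_L.
have hy : rpow phi d y = y.
  by rewrite phi_d //; have := Ty; rewrite -fixed_field => -[].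
exists (\prod_(a < d) rpow phi a y); split.
- apply: (ur_frob_fixed sL uL f_gt0 fullL phi_L phi_ru).
    by apply: (subfield_prod _ sB) => a _; apply: phB.
  rewrite rmorph_prod -[in LHS](prednK d_gt0) -[in RHS](prednK d_gt0) big_ord_recr big_ord_recl /=.
  by rewrite mulrC -rpowS prednK // hy.
- by apply/prodf_neq0 => a _; rewrite fmorph_eq0.
rewrite /s /= (prod_ord_mul _ _ (fun k => rpow phi (k %% d) (rpow tau (k %/ d) y))).
rewrite /rnorm exchange_big /=; apply: eq_bigr => l _; rewrite rmorph_prod; apply: eq_bigr => a _.
rewrite mulnC addnC modnMDl modn_small // divnMDl // divn_small // addn0.
exact: phi_rtau_comm.
Qed.

End FixedField.

(** As the symbol is [1], [g] and its lift [h] are trivial on [L]. So [h] is a power of Frobenius on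
    [ur L], its fixed field is some [L(xi)], and both factors of [u] are norms from [L]. *)
Lemma norm_of_symbol u : hilbert_symbol iota i F (alpha ^+ q) u 1 ->
  exists w, [/\ L w, w != 0 & N w = u].
Proof.
move=> [b [g [eb gG]]]; rewrite (adjoin_other_root eb) mul1r.
move=> [h [d [hG hg d0 [q' rq hfr]]]] + gb.
have gF : fixes F g by apply/(in_galoisP alg _ sF).
have hF : fixes F h by apply/(in_galoisP alg _ sF).
have gL : fixes L g.
  move=> y; rewrite -(adjoin_other_root eb) => Ly.
  have -> : y = (idfun : {rmorphism C -> C}) y by [].
  by rewrite -[LHS]/(g y); apply: (fixes_adjoin sF) Ly.
have hL : fixes L h by move=> y Ly; rewrite hg // gL.
have eq' : q' = (p ^ f)%N by apply/(residue_card sF f_gt0 resF fullF).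
rewrite {}eq' in hfr rq.
have h_ru z : ru p z -> h z = z ^+ ((p ^ f) ^ d)%N.
  move=> rz; have sA : subfield iota (ur F) by exact: ur_subfield.
  have eA : max_unramified iota F = ur F by apply: (max_unramifiedE sF uF); exists f.
  have : max_ideal iota (ur F) (h z - z ^+ ((p ^ f) ^ d)%N).
    by rewrite -eA; apply: hfr; rewrite eA; split; [apply: ur_ru|apply: U_O; apply: ru_U].
  move=> /(max_idealP _ sA)[_ Mz].
  by apply: (ru_inj (iota := iota)) Mz; [apply: ru_aut|apply: ruX].
have Qd1 : (1 < (p ^ f) ^ d)%N.
  by rewrite -expnM -(exp1n (f * d)) ltn_exp2r ?prime_gt1 // muln_gt0 f_gt0.
have N0 : (0 < ((p ^ f) ^ d).-1)%N by rewrite -subn1 subn_gt0.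
have [xi xiP] := exists_prim_root (iota := iota) N0.
rewrite max_ur_L (fixed_field d0 hL h_ru xiP) /=.
move=> [pi [y [Npi [Ny [ppi npi [Ly y0] ny ->]]]]].
have sT : subfield iota (adj L xi) by exact: adjoin_subfield.
have [Tpi pi0 _ _] := (prime_elementP pi sT).1 ppi.
have [w [Lw w0 ->]] := norm_T d0 hL h_ru xiP Tpi pi0 npi.
have -> : Ny = N y by apply/is_norm_L.
by exists (w * y); split; [apply: (subfieldM sL)|rewrite mulf_neq0|rewrite rnormM].
Qed.

End Symbol.

(** * Conductors *)

Lemma prime_generator p : prime p -> exists2 g, coprime p g &
  forall j k, g ^ j = g ^ k %[mod p] -> j = k %[mod p.-1].
Proof.
move=> pp; pose rs := enum (predC1 (0 : 'F_p)).
have p1 : (0 < p.-1)%N by rewrite -subn1 subn_gt0 prime_gt1.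
have sz : size rs = p.-1 by rewrite -cardE cardC1 card_Fp.
have /hasP [z zrs zP] : has p.-1.-primitive_root rs.
  apply: has_prim_root => //; [|exact: enum_uniq|by rewrite sz].
  apply/allP => x; rewrite mem_enum inE => x0; rewrite unity_rootE; apply/eqP.
  apply: (mulfI x0); rewrite mulr1 -exprS prednK ?prime_gt0 //.
  by have := expf_card x; rewrite card_Fp.
have z0 : z != 0 by move: zrs; rewrite mem_enum inE.
have ez : z = (z : nat)%:R by rewrite natr_Zp.
exists (z : nat).
  rewrite prime_coprime //; apply/negP => hd; move/negP: z0; apply.
  by rewrite ez -(dvdn_pcharf (pchar_Fp pp)).
move=> j k e; apply/eqP; rewrite -(eq_prim_root_expr zP) ez -!natrX.
apply/eqP/val_inj; rewrite /= !val_Fp_nat //.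
Qed.

(** The exponent [r] may be negative; it is traded for a natural number congruent to it modulo
    [p - 1], only the value modulo [p] being used later. *)
Lemma cyclotomic_character_pow p (C : closedFieldType) n (zeta : C) (g : {rmorphism C -> C}) a (r : int) :
  prime p -> (0 < n)%N -> (p ^ n)%N.-primitive_root zeta -> coprime p a -> g zeta = zeta ^+ a ->
  exists2 k : nat, (k%:Z = r %[mod p.-1])%Z &
    ((cyclotomic_character p n zeta g ^ r)%R : nat) = (a ^ k)%N %[mod p].
Proof.
move=> pp n0 zP cpa gz; set P := (p ^ n)%N.
have P1 : (1 < P)%N by rewrite -(exp1n n) ltn_exp2r // prime_gt1.
have pP : (p %| P)%N by rewrite dvdn_exp.
have ec : cyclotomic_character p n zeta g = a%:R.
  rewrite /cyclotomic_character; case: pickP => [u /eqP eu|/(_ (a%:R : 'Z_P))].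
    apply/val_inj; rewrite /= val_Zp_nat //.
    move: eu; rewrite gz => /eqP; rewrite (eq_prim_root_expr zP) => /eqP ->.
    by rewrite modn_small //; apply: (leq_trans (ltn_ord u)); rewrite Zp_cast.
  by rewrite val_Zp_nat // gz (eq_prim_root_expr zP) modn_mod eqxx.
rewrite ec; case: r => k.
  exists k => //; rewrite -exprnP -natrX val_Zp_nat //.
  by rewrite modn_dvdm.
have ca : (a%:R : 'Z_P) \is a GRing.unit by rewrite unitZpE // coprime_pexpl.
rewrite NegzE -exprnN; set m := nat_of_ord _.
have em : (m%:R : 'Z_P) = (a%:R) ^- k.+1 by rewrite natr_Zp.
have e1 : (m * a ^ k.+1)%N = 1 %[mod p].
  have : ((m * a ^ k.+1)%N%:R : 'Z_P) = 1%N%:R by rewrite natrM em natrX mulVr // unitrX.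
  move/(congr1 (@nat_of_ord _)); rewrite !val_Zp_nat // => e.
  by rewrite -(modn_dvdm _ pP) e modn_dvdm.
(* [p - 2] is congruent to [-1] modulo [p - 1]. *)
exists (k.+1 * p.-2)%N.
  apply/eqP; rewrite eqz_mod_dvd opprK -PoszD -mulnSr.
  by rewrite prednK ?PoszM ?dvdz_mull //; have := prime_gt1 pp; lia.
apply/eqP; apply: (@eqn_mod_cancel _ (a ^ k.+1)); first by rewrite coprimeXr.
rewrite mulnC e1 -expnD addnC -mulnSr prednK; last by have := prime_gt1 pp; lia.
rewrite mulnC expnM -modnXm.
have := Euler_exp_totient (n := p) (a := a); rewrite totient_prime // coprime_sym cpa => /(_ isT) ->.
by rewrite modnXm exp1n.
Qed.

Section Conductor.
Variables (p : nat) (Qp : padicField p) (C : closedFieldType).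
Variable iota : {rmorphism Qp -> C}.
Context {HC : padic_closure iota}.
Let p_prime : prime p := pc_prime.
Let alg : forall y : C, algebraicOver iota y := pc_alg.
Local Notation O := (integral iota).
Local Notation M := (nonunit iota).
Local Notation U := (isunit iota).
Local Notation eqM := (eqm M).
Local Notation adj := (adjoin iota).
Local Notation ur := (ur iota).
Local Notation mult := (multiple iota).
Let MI : Oideal iota M := M_ideal.

Lemma max_ideal_powerP (K : set C) pi j x : subfield iota K -> unif iota K pi ->
  max_ideal_power iota K j x <-> K x /\ mult (pi ^+ j) x.
Proof.
move=> sK uK; have [Kpi pi0 Mpi hpi] := uK.
elim: j x => [|j IH] x /=; first by rewrite expr0 /multiple divr1.
split=> [[s hs ->]|[Kx hx]].
  split; rewrite big_seq.
    apply: (subfield_sum _ sK) => ab abs; have [/(max_idealP _ sK)[K1 _] /IH[K2 _]] := hs _ abs.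
    exact: (subfieldM sK).
  apply: (idl_sum (multiple_ideal iota _)) => ab abs.
  have [/(max_idealP _ sK)[K1 M1] /IH[_ h2]] := hs _ abs.
  by rewrite exprS; apply: multiple_mul => //; apply: hpi.
exists [:: (pi, x / pi)]; last by rewrite big_seq1 /= mulrC divfK.
move=> ab; rewrite inE => /eqP -> /=; split; first by apply/(max_idealP _ sK).
apply/IH; split; first exact: (subfield_div sK).
by move: hx; rewrite /multiple exprS invfM mulrA.
Qed.

Variables (E : set C) (n : nat) (zeta : C).
Hypotheses (E_unr : unramified iota (range iota) E) (n_gt0 : (0 < n)%N)
  (zeta_prim : (p ^ n)%N.-primitive_root zeta).
Local Notation F := (adj E zeta).
Let sF : subfield iota F. Proof. exact: F_subfield E_unr. Qed.
Let sE : subfield iota E. Proof. exact: unr_base_subfield E_unr. Qed.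
Let uF : unif iota F (zeta - 1). Proof. exact: F_unif E_unr n_gt0 zeta_prim. Qed.

Variables (r : int) (x : C).
Hypothesis x_eigen : twisted_eigenspace p n zeta E F r x.

(** Extract a [p^i]-th root of the eigenspace relation: the [p^n]-th power in it has one in [F], and
    the ambiguity is a [p^i]-th root of unity, also in [F]. *)
Lemma eigen_root_aut i alpha a : (i <= n)%N -> alpha ^+ (p ^ i)%N = x -> coprime p a ->
  exists (h : {rmorphism C -> C}) (m k : nat) (w : C),
    [/\ fixes E h, h zeta = zeta ^+ a, F w /\ w != 0, h alpha = alpha ^+ m * w
      & (k%:Z = r %[mod p.-1])%Z /\ m = (a ^ k)%N %[mod p]].
Proof.
move=> i_n ea cpa; have [Fx x0 hx] := x_eigen.
have [h hE hz] := cyclotomic_surj E_unr n_gt0 zeta_prim cpa.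
have hG : in_galois E h by apply/(in_galoisP alg _ sE).
have [k ek em] := cyclotomic_character_pow r p_prime n_gt0 zeta_prim cpa hz.
have [z [Fz z0] ez] := hx h hG.
set m := nat_of_ord _ in em ez.
have a0 : alpha != 0.
  apply: contraNneq x0 => a0; rewrite -ea a0 expr0n expn_eq0.
  by rewrite (gtn_eqF (prime_gt0 p_prime)).
have xm0 : x ^+ m != 0 by rewrite expf_neq0.
have hxe : h x = x ^+ m * z ^+ (p ^ n)%N by rewrite -ez mulrC divfK.
pose w0 := z ^+ (p ^ (n - i))%N.
have w00 : w0 != 0 by rewrite expf_neq0.
have am0 : alpha ^+ m * w0 != 0 by rewrite mulf_neq0 // expf_neq0.
have : (h alpha / (alpha ^+ m * w0)) ^+ (p ^ i)%N = 1.
  rewrite exprMn exprVn -rmorphXn ea hxe exprMn -exprM mulnC exprM ea.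
  by rewrite /w0 -[(z ^+ _) ^+ _]exprM -expnD subnK // divff // mulf_neq0 ?expf_neq0.
have ziP : (p ^ i)%N.-primitive_root (kzeta p n zeta i) by exact: (kzeta_prim (HC := HC) zeta_prim i_n).
move=> /(prim_rootP ziP)[b eb].
exists h, m, k, (w0 * kzeta p n zeta i ^+ b); split=> //.
  have Fzi : F (kzeta p n zeta i ^+ b) by apply: (subfieldX _ sF); exact: (kzeta_F n E_unr i).
  split; first by apply: (subfieldM sF) => //; apply: (subfieldX _ sF).
  rewrite mulf_neq0 // expf_neq0 //; apply/eqP => z0'.
  move: (prim_expr_order ziP); rewrite z0' expr0n expn_eq0 (gtn_eqF (prime_gt0 p_prime)) => /eqP.
  by rewrite eq_sym oner_eq0.
by rewrite mulrA -eb mulrC divfK.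
Qed.

Hypotheses (p_odd : odd p) (r_neq0 : (r != 0 %[mod p.-1])%Z) (r_neq1 : (r != 1 %[mod p.-1])%Z)
  (x_notpow : ~ unit_powers F p x).
Variable t : nat.
Hypotheses (t_gt0 : (0 < t)%N) (t_mod : (t%:Z = 2 - r %[mod p.-1])%Z)
    (t_min : forall s : nat, (0 < s)%N -> (s%:Z = 2 - r %[mod p.-1])%Z -> (t <= s)%N).
Let p_gt2 : (2 < p)%N.
Proof. by case: (p) p_prime p_odd => [|[|[|k]]]. Qed.

(** [t = 1] and [t = 2] correspond to [r = 1] and [r = 0] modulo [p - 1], the two excluded cases. *)
Lemma t_bounds : (2 < t < p)%N.
Proof.
have tp : (t < p)%N.
  rewrite ltnNge; apply/negP => pt.
  have pt' : (p.-1 < t)%N by apply: leq_trans pt; rewrite ltn_predL prime_gt0.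
  have e : ((t - p.-1)%N%:Z = 2 - r %[mod p.-1])%Z.
    rewrite -t_mod -subzn ?(ltnW pt') //; apply/eqP; rewrite eqz_mod_dvd.
    by rewrite (_ : _ - _ = - p.-1%:Z); [rewrite rpredN /=|ring].
  have := t_min _ e; rewrite subn_gt0 => /(_ pt').
  by rewrite leqNgt ltn_subrL t_gt0 -subn1 subn_gt0 prime_gt1.
rewrite tp andbT.
have tr : (p.-1%:Z %| t%:Z - 2 + r)%Z.
  by move/eqP: t_mod; rewrite eqz_mod_dvd opprB [X in (_ %| X)%Z](_ : _ = t%:Z - 2 + r) //; ring.
case: (t) t_gt0 tr => [|[|[|s]]] //= _ tr.
  move/negP: r_neq1; case; rewrite eqz_mod_dvd.
  by move: tr; rewrite (_ : 1%:Z - 2 + r = r - 1) //; ring.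
move/negP: r_neq0; case; rewrite eqz_mod_dvd subr0.
by move: tr; rewrite subrr add0r.
Qed.

Lemma eigen_conductor i : (1 <= i <= n)%N -> is_conductor iota i F x (p ^ i.-1 * t)%N.
Proof.
move=> /andP[i0 i_n]; have [Fx x0 _] := x_eigen.
have /andP [t2 tp] := t_bounds.
have q1 : (1 < p ^ i)%N by rewrite -(exp1n i) ltn_exp2r // prime_gt1.
have [alpha ea] : exists alpha, alpha ^+ (p ^ i)%N = x.
  have [c0] : exists c0, root ('X^(p ^ i) - x%:P) c0.
    by apply/closed_rootP; rewrite size_XnsubC ?(ltnW q1) // eqSS gtn_eqF // ltnW.
  by rewrite rootE !hornerE subr_eq0 => /eqP <-; exists c0.
have a0 : alpha != 0.
  apply: contraNneq x0 => a0; rewrite -ea a0 expr0n expn_eq0.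
  by rewrite (gtn_eqF (prime_gt0 p_prime)).
have aF : F (alpha ^+ (p ^ i)%N) by rewrite ea.
have [g cpg gP] := prime_generator p_prime.
have r1 (k : nat) : (k%:Z = r %[mod p.-1])%Z -> k <> 1 %[mod p.-1].
  move=> ek e1; move/negP: r_neq1; apply; rewrite -ek.
  by rewrite !modz_nat; apply/eqP; congr Posz.
have a_twist : exists (h : {rmorphism C -> C}) a m w, [/\ fixes E h, h zeta = zeta ^+ a, F w /\ w != 0,
     h alpha = alpha ^+ m * w & ~~ (a == m %[mod p])].
  have [h [m [k [w [hE hz hw ha [ek em]]]]]] := eigen_root_aut i_n ea cpg.
  exists h, g, m, w; split=> //; apply/negP => /eqP gm.
  by apply: (r1 k ek); apply: gP; rewrite -em -gm expn1.
have a_notpow y : F y -> y ^+ p != alpha ^+ (p ^ i)%N.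
  move=> Fy; apply/eqP => ey; apply: x_notpow; exists y; last by rewrite ey ea.
  split=> //; apply/eqP => y0; move/eqP: x0; apply; rewrite -ea -ey y0 expr0n.
  by rewrite (gtn_eqF (prime_gt0 p_prime)).
have [tau tauA taua] := tau_exists E_unr n_gt0 zeta_prim i0 i_n a0 aF a_notpow a_twist.
have [Pi] := Mt_structure E_unr n_gt0 zeta_prim i0 i_n a0 aF tauA taua (leqnn i).
have eL : Mt iota E zeta i alpha i = adj F alpha.
  by apply/seteqP; split=> y /(Mt_L E_unr aF).
rewrite eL => -[uL UPi rL].
set L := adj F alpha in eL uL rL.
have sL : subfield iota L by exact: adjoin_subfield.
have FL y : F y -> L y by exact: adjoin_base.
have La : L alpha by exact: adjoin_gen.
have [f [f0 rE fE]] := unr_base_resid E_unr.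
have resF : resid iota F (p ^ f).
  by apply: (resid_sub _ rE) => y; apply: (F_residue E_unr n_gt0 zeta_prim).
have resL : resid iota L (p ^ f) by exact: (resid_sub rL rE).
have fullF : full_resid iota F (p ^ f).
  by move=> z /fE [c [Ec Oc zc]]; exists c; split=> //; apply: adjoin_base.
have [phi phiL phir] := frobenius_exists sL resL.
have ziP : (p ^ i)%N.-primitive_root (kzeta p n zeta i) by exact: (kzeta_prim (HC := HC) zeta_prim i_n).
have ziF : F (kzeta p n zeta i) by exact: (kzeta_F n E_unr i).
have tauF : fixes F tau by move=> y Fy; apply: tauA; apply: ur_base.
have tauL y : L y -> L (tau y) by exact: (step_stable sF ziF tauA taua).
have tfL y : L y -> tau y = y -> F y by exact: (step_fixed sF a0 aF ziP ziF tauA taua).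
have tfB y : ur L y -> tau y = y -> ur F y by exact: (step_ur_fixed sF a0 aF ziP ziF tauA taua).
have tq y : ur L y -> rpow tau (p ^ i) y = y by exact: (step_order sF ziP ziF tauA taua).
have Nap l u : ur F u -> U u -> exists w, [/\ ur L w, U w & mult ((zeta - 1) ^+ l) (u / rnorm p i tau w - 1)].
  move=> Au Uu; have := Nt_approx E_unr n_gt0 zeta_prim i0 i_n a0 aF tauA taua (leqnn i) l Au Uu.
  by rewrite eL => -[w hw]; exists w.
pose R u a := rec iota L Pi i tau phi u a.
have Rex u : F u -> U u -> exists a, R u a.
  exact: (rec_exists p_odd sF sL FL uF uL tauA tauL tfB tq phiL phir ziP ziF La a0 taua Nap).
have qz : (p ^ i)%N%:Z = p%:Z ^+ i by rewrite -!natz natrX.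
have R1 a : R 1 a -> (p%:Z ^+ i %| a)%Z.
  by rewrite -qz; exact: (rec_one sF sL uF uL UPi tauA tauL tfB tq phiL phir ziP ziF La a0 taua).
have Rd u v a b : R u a -> R v b -> R (u / v) (a - b) by exact: (rec_div sL uL).
(* A choice of exponent, meaningful for units of [F] and modulo [p^i] only; where no exponent exists
   it is [0]. *)
pose X u := xget 0 [set a | R u a].
have XR u : F u -> U u -> R u (X u).
  by move=> Fu Uu; have [a ha] := Rex u Fu Uu; apply: (@xgetPex _ 0 [set a | R u a]); exists a.
have Xu u a : F u -> U u -> R u a -> (p%:Z ^+ i %| X u - a)%Z.
  move=> Fu Uu hR; apply: R1; have := Rd _ _ _ _ (XR u Fu Uu) hR.
  by rewrite divff // (U_neq0 Uu).
have Xdiv u v : F u -> U u -> F v -> U v -> (p%:Z ^+ i %| X (u / v) - (X u - X v))%Z.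
  move=> Fu Uu Fv Uv; apply: Xu; [exact: (subfield_div sF)|by apply: UM => //; apply: UV|].
  by apply: Rd; apply: XR.
have zi_neq0 : kzeta p n zeta i != 0.
  apply/eqP => z0'; move: (prim_expr_order ziP).
  rewrite z0' expr0n expn_eq0 (gtn_eqF (prime_gt0 p_prime)) => /eqP.
  by rewrite eq_sym oner_eq0.
(* [c] is chosen with [c * m = a] modulo [p^i]: as [h] raises [zi] to the power [a] and sends
   [alpha] to [alpha^m * w], this is what [h tau = tau^c h] requires on [alpha]. *)
have Xaut a : coprime p a -> exists (h : {rmorphism C -> C}) (c m k : nat),
    [/\ fixes E h, h zeta = zeta ^+ a,
      forall u, F u -> U u -> (p%:Z ^+ i %| X (h u) - c%:Z * X u)%Z,
      (c * m = a %[mod p])%N & (k%:Z = r %[mod p.-1])%Z /\ m = (a ^ k)%N %[mod p]].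
  move=> cpa; have [h [m [k [w [hE hz [Fw w0] ha [ek em]]]]]] := eigen_root_aut i_n ea cpa.
  have cpm : coprime p m by rewrite -coprime_modr em coprime_modr coprimeXr.
  have m0 : (0 < m)%N by exact: (coprime_gt0 cpm).
  have [c [c0 cpc cm]] : exists c, [/\ (0 < c)%N, coprime c (p ^ i) & (c * m = a %[mod p ^ i])%N].
    have [u v e1 _] := egcdnP (p ^ i) m0.
    have cg : gcdn m (p ^ i) = 1%N by apply/eqP; rewrite -/(coprime _ _) coprime_sym coprime_pexpl.
    rewrite cg in e1.
    have em' : (u * a * m = a %[mod p ^ i])%N.
      by rewrite mulnAC e1 mulnDl mul1n [(v * _ * a)%N]mulnAC modnMDl.
    have cpq : coprime (p ^ i) (u * a * m).
      by rewrite -coprime_modr em' coprime_modr coprime_pexpl.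
    exists (u * a)%N; split=> //.
      by rewrite lt0n; apply/eqP => z; move: cpq; rewrite z mul0n /coprime gcdn0 gtn_eqF.
    by move: cpq; rewrite coprimeMr coprime_sym => /andP[].
  exists h, c, m, k; split=> //; last first.
    by rewrite -(@modn_dvdm (p ^ i)) ?dvdn_exp // cm modn_dvdm // dvdn_exp.
  move=> u Fu Uu.
  have hi := fixes_iota sE hE.
  have hF y : F y -> F (h y) by exact: (F_stable E_unr n_gt0 zeta_prim hE).
  have ha_L : L (h alpha).
    by rewrite ha; apply: (subfieldM sL); [apply: (subfieldX _ sL)|apply: FL].
  have hL y : L y -> L (h y).
    move=> Ly; have := adjoin_image sF sL hi (fun y Fy => FL _ (hF y Fy)) Ly.
    by apply: adjoin_min.
  have hur y : ru p y -> exists s, h y = y ^+ s by exact: ru_pow.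
  have tr z : ru p z -> tau z = z by move=> rz; apply: tauA; apply: ur_ru.
  apply: Xu; [exact: hF|exact: U_aut|].
  apply: (rec_aut sF sL uL tauA tauL tq c0 cpc hi hL) (XR u Fu Uu).
  - move=> y By; apply: (ur_agree sL (g := h \o tau) (h := rpow tau c \o h)) By => [z Lz|z rz] /=; last first.
      by rewrite (tr _ rz) rpow_id // tr //; apply: ru_aut.
    have sAg : subfield iota [set y | (h \o tau : {rmorphism C -> C}) y = (rpow tau c \o h : {rmorphism C -> C}) y].
      apply: agree_subfield => d /=; rewrite hi (fixes_iota sF tauF) hi rpow_id //.
      exact: (fixes_iota sF tauF).
    apply: (adjoin_min sAg _ _ Lz) => [y' Fy|] /=.
      by rewrite (tauF _ Fy) rpow_id //; apply: tauF; apply: hF.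
    have hzi : h (kzeta p n zeta i) = kzeta p n zeta i ^+ (c * m).
      rewrite /kzeta rmorphXn hz -exprM mulnC exprM -/(kzeta p n zeta i).
      by apply/eqP; rewrite (eq_prim_root_expr ziP); apply/eqP.
    rewrite taua rmorphM hzi ha rmorphM rmorphXn (rpow_eigen c (tauF _ ziF) taua) exprMn exprM.
    by rewrite [rpow tau c w]rpow_id ?mulrA //; apply: tauF.
  - move=> y By; apply: (ur_agree sL (g := h \o phi) (h := phi \o h)) By => [z Lz|z rz] /=.
      by rewrite (phiL _ Lz) phiL //; apply: hL.
    have [s es] := hur z rz.
    by rewrite es phir // !rmorphXn es phir // -!exprM mulnC.
  (* [h Pi / Pi] is a unit because its [p^i]-th power is, up to units, the quotient of
     [h (zeta - 1)] by [zeta - 1]. *)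
  - have [_ Pi0 _ _] := uL; have [_ pi0 _ _] := uF.
    apply: (U_root (n := (p ^ i)%N)); first exact: ltnW.
    have hp : U (h (zeta - 1) / (zeta - 1)).
      by rewrite rmorphB rmorph1 hz; exact: (one_sub_zeta_pow n_gt0 zeta_prim cpa).
    have := U_aut hi UPi; rewrite fmorph_div rmorphXn => h1.
    have n1 : Pi ^+ (p ^ i) != 0 by rewrite expf_neq0.
    have n2 : h (zeta - 1) != 0 by rewrite fmorph_eq0.
    rewrite exprMn exprVn (_ : _ / _ = (h Pi ^+ (p ^ i) / h (zeta - 1)) * (h (zeta - 1) / (zeta - 1)) / (Pi ^+ (p ^ i) / (zeta - 1))).
      by apply: UM; [apply: UM|apply: UV].
    have n2' : h zeta - 1 != 0 by move: n2; rewrite rmorphB rmorph1.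
    by field; rewrite ?n1 ?n2' ?pi0 ?Pi0.
have [sg [c [m [k [sgE sgz Xs cm [ek em]]]]]] := Xaut g cpg.
(* Modulo [p], [c * m = g] and [m = g^k] with [k = r] modulo [p - 1]; so [c = g^j] means
   [j + r = 1], that is [j = t - 1], modulo [p - 1]. *)
have sgc j : (p%:Z %| c%:Z - (g ^ j)%N%:Z)%Z -> j = t.-1 %[mod p.-1].
  rewrite -eqz_mod_dvd !modz_nat eqz_nat => /eqP ec.
  have e1 : (g ^ (j + k))%N = (g ^ 1)%N %[mod p].
    by rewrite expnD expn1 -modnMml -ec modnMml -modnMmr -em modnMmr cm.
  have e2 := gP _ _ e1.
  apply/eqP; rewrite -(eqn_modDr k) e2 -(eqn_modDr 1).
  apply/eqP; have h1 : (t.-1 + k + 1)%N%:Z = t%:Z + k%:Z by rewrite -PoszD addn1 -addSn prednK.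
  suff : ((t.-1 + k + 1)%N%:Z = 2 %[mod p.-1])%Z.
    by rewrite !modz_nat => -[] ->.
  rewrite h1 -modzDm t_mod ek modzDm; congr (modz _ _); ring.
have gamP : (1 < n)%N -> exists (gam : {rmorphism C -> C}) (cg : int),
    [/\ fixes E gam, gam zeta = zeta ^+ p.+1, (p%:Z %| cg - 1)%Z
      & forall u, F u -> U u -> (p%:Z ^+ i %| X (gam u) - cg * X u)%Z].
  move=> _; have cp1 : coprime p p.+1 by rewrite coprimenS.
  have [gam [c' [m' [k' [gE gz Xg cm' [ek' em']]]]]] := Xaut p.+1 cp1.
  exists gam, c'%:Z; split=> //; rewrite -eqz_mod_dvd modz_nat.
  have p1 : (p.+1 = 1 %[mod p])%N by rewrite -addn1 modnDl.
  have m1 : (m' = 1 %[mod p])%N by rewrite em' -modnXm p1 modnXm exp1n.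
  have : (c' = 1 %[mod p])%N by rewrite -p1 -cm' -modnMmr m1 modnMmr muln1.
  by move=> ->; rewrite modz_nat.
have Xsurj : exists u, [/\ F u, U u & ~~ (p%:Z %| X u)%Z].
  have [u [a [Fu Uu Ra na]]] := rec_surj p_odd sF sL FL uF uL UPi f0 fullF tauA tauL tfB tq phiL phir i0.
  exists u; split=> //; apply: contraNN na => pX.
  have pd : (p%:Z %| X u - a)%Z.
    by apply: dvdz_trans (Xu _ _ Fu Uu Ra); rewrite -(prednK i0) exprS dvdz_mulr.
  have := rpredB pX pd; by rewrite opprB addrC subrK.
have i1 : (i.-1 < i)%N by rewrite prednK.
have up : null iota E zeta (zeta - 1) X i.-1.+1 (p ^ i.-1 * t).
  exact: (conductor_upper E_unr n_gt0 zeta_prim erefl Xdiv p_odd i_n t2 tp sgE sgz Xs sgc gamP i1).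
have lo : ~ null iota E zeta (zeta - 1) X i.-1.+1 (p ^ i.-1 * t).-1.
  exact: (conductor_lower E_unr n_gt0 zeta_prim erefl Xdiv p_odd i_n t2 tp sgE sgz Xs sgc gamP Xsurj i1).
rewrite prednK // in up lo.
have T2 : (2 < p ^ i.-1 * t)%N.
  by apply: (leq_trans t2); rewrite leq_pmull // expn_gt0 prime_gt0.
set T := (p ^ i.-1 * t)%N in up lo T2 *.
have hu j u : (0 < j)%N -> higher_units iota F j u <-> level iota E zeta (zeta - 1) j u.
  move=> j0; have -> : higher_units iota F j u = max_ideal_power iota F j (u - 1) by case: (j) j0.
  rewrite (max_ideal_powerP _ _ sF uF); split=> [[Fu1 hu1]|[Fu hu1]]; split=> //.
    by rewrite -(subrK 1 u); apply: (subfieldD sF) => //; apply: subfield1 sF.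
  by apply: (subfieldB sF) => //; apply: subfield1 sF.
have lU j u : (0 < j)%N -> level iota E zeta (zeta - 1) j u -> U u.
  by move=> j0; apply: (level_unit E_unr n_gt0 zeta_prim erefl).
split=> [u /hu|f' hf'].
  move=> /(_ (ltn_trans (isT : 0 < 2)%N T2)) lu; have Vu := up _ lu.
  have Uu := lU _ _ (ltn_trans (isT : 0 < 2)%N T2) lu; have [Fu _] := lu.
  have qX : ((p ^ i)%N%:Z %| X u)%Z by rewrite qz.
  have [w [Lw w0 <-]] := rec_ker p_odd sF sL FL uF uL UPi f0 fullF tauA tauL tfL tq phiL phir Fu Uu (XR u Fu Uu) qX.
  by rewrite -ea; apply: (symbol_of_norm E_unr n_gt0 zeta_prim i0 i_n a0 aF tauA taua uL f0 resF fullF resL phiL phir Lw w0).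
(* If [f' < T], the symbol would be trivial on [U_(T-1)], whose elements would be norms, and [X]
   would vanish there, against [lo]. *)
rewrite leqNgt; apply/negP => fT; apply: lo => u lu.
have T1 : (0 < T.-1)%N by rewrite -ltnS prednK // ?(ltnW T2) // (ltn_trans _ T2).
have Uu := lU _ _ T1 lu; have [Fu _] := lu.
have hfu : higher_units iota F f' u.
  (* [U_0] is the full unit group, which is not [level] at [0]. *)
  case: (posnP f') => [->|f'0]; first by apply/(unitsP _ sF).
  have fT1 : (f' <= T.-1)%N by rewrite -ltnS prednK // (ltn_trans _ T2).
  by apply/hu => //; exact: (levelW E_unr n_gt0 zeta_prim erefl fT1 lu).
have := hf' u hfu; rewrite -ea => hs.
have [w [Lw w0 Nw]] := norm_of_symbol E_unr n_gt0 zeta_prim i0 i_n a0 aF tauA taua uL f0 resF fullF resL phiL phir hs.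
have tauI := fixes_iota sF tauF.
(* [w] is only known to be nonzero; it is a unit because [w^(p^i)] differs from [u] by the unit
   product of the [tau^j w / w]. *)
have Uw : U w.
  have Bw : ur L w by apply: ur_base.
  apply: (U_root (n := (p ^ i)%N)); first exact: ltnW.
  have Uj (j : 'I_(p ^ i)) : U (rpow tau j w / w).
    apply: (conj_unit (k := (p ^ i)%N)) => //; [by move=> d; apply: rpow_id| |exact: ltnW].
    by rewrite -rpowM mulnC rpowM rpow_id // tq.
  have UN : U (\prod_(j < p ^ i) (rpow tau j w / w)) by apply: Uprod => j _; apply: Uj.
  rewrite big_split /= prodfV prodr_const card_ord in UN.
  have nq : w ^+ (p ^ i) != 0 by rewrite expf_neq0.
  have -> : w ^+ (p ^ i) = u / (u / w ^+ (p ^ i)).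
    by have nu := U_neq0 Uu; field; rewrite nu nq.
  by apply: UM => //; apply: UV; rewrite -{1}Nw.
have := Xu _ _ Fu Uu (_ : R u 0); rewrite subr0; apply.
by rewrite -Nw; apply: rec_norm.
Qed.

End Conductor.

Theorem theorem4p3 (p : nat) (Qp : padicField p) (Qpbar : closedFieldType)
    (iota : {rmorphism Qp -> Qpbar}) (E : set Qpbar) (n : nat) (zeta : Qpbar)
    (r : int) (t : nat) (x : Qpbar)
    (p_prime : prime p) (p_odd : odd p)
    (Qpbar_algebraic : forall y : Qpbar, algebraicOver iota y)
    (E_unramified : unramified iota (range iota) E)
    (n_gt0 : (0 < n)%N)
    (zeta_prim : (p ^ n)%N.-primitive_root zeta)
    (r_neq0 : (r != 0 %[mod p.-1])%Z)
    (r_neq1 : (r != 1 %[mod p.-1])%Z)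
    (t_gt0 : (0 < t)%N)
    (t_mod : (t%:Z = 2 - r %[mod p.-1])%Z)
    (t_min : forall s : nat,
       (0 < s)%N -> (s%:Z = 2 - r %[mod p.-1])%Z -> (t <= s)%N)
    (x_eigen : twisted_eigenspace p n zeta E (adjoin iota E zeta) r x)
    (x_notpow : ~ unit_powers (adjoin iota E zeta) p x) :
  forall i : nat, (1 <= i <= n)%N ->
    is_conductor iota i (adjoin iota E zeta) x (p ^ i.-1 * t)%N.
Proof.
have HC : padic_closure iota by exact: PadicClosure p_prime Qpbar_algebraic.
move=> i hi.
exact: (eigen_conductor E_unramified n_gt0 zeta_prim x_eigen p_odd r_neq0 r_neq1
  x_notpow t_gt0 t_mod t_min hi).
Qed.
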